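(* Let $M$ be a compact connected $C^2$ Riemannian manifold and let $G,H:T^*M\to\mathbb{R}$ be two Tonelli Hamiltonians which Poisson commute, with critical values $\alpha_G[0]=\alpha_H[0]=0$. Let $u^-$ be a negative weak KAM solution for $G$ and $u^+$ a positive weak KAM solution for $G$. If $u^-\sim_Gu^+$, then $u^-\sim_Hu^+$.
   Context: A Hamiltonian $H:T^*M\to\mathbb{R}$ is Tonelli if it is $C^2$ and: (1) for every $K>0$ there is $C^*(K)\in\mathbb{R}$ with $H(x,p)\geqslant K\|p\|-C^*(K)$ for all $(x,p)\in T^*M$; (2) for every $R\geqslant 0$, $\sup\{H(x,p):\|p\|\leqslant R\}<+\infty$; (3) for every $(x,p)\in T^*M$ the second fiber derivative $\partial^2H/\partial p^2(x,p)$ is positive definite. $T^*M$ carries the symplectic form $\Omega=-d\lambda$, $\lambda$ the canonical Liouville form; the Hamiltonian vector field $X_H$ is defined by $\Omega(X_H(x,p),\cdot)=d_{(x,p)}H$, with flow $\Phi_H$. $G$ and $H$ Poisson commute if $\Omega(X_G,X_H)$ vanishes everywhere. The following is stated for $G$, and is the same for $H$. The Lagrangian is $L_G(x,v)=\max_{p\in T_x^*M}\big(p(v)-G(x,p)\big)$. For a function $u$ on $M$ and $s>0$, $T_G^{-s}u(x)=\inf_{\gamma}\big(u(\gamma(0))+\int_0^sL_G(\gamma,\dot\gamma)\,d\sigma\big)$, infimum over absolutely continuous $\gamma:[0,s]\to M$ with $\gamma(s)=x$; $T_G^{+s}u=-T_{\widehat G}^{-s}(-u)$, where $\widehat G(x,p)=G(x,-p)$;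 $T_G^{\pm0}$ is the identity. A function $u:M\to\mathbb{R}$ is an $(\alpha,G)$-subsolution if $u(y)-u(x)\leqslant\inf_\gamma\int_0^tL_G(\gamma,\dot\gamma)\,d\sigma+t\alpha$ for all $x,y\in M$, $t\geqslant0$, infimum over absolutely continuous $\gamma:[0,t]\to M$ from $x$ to $y$. The critical value $\alpha_G[0]$ is the smallest $\alpha$ for which $(\alpha,G)$-subsolutions exist; an $(\alpha_G[0],G)$-subsolution is called a critical subsolution for $G$. When $\alpha_G[0]=0$, a negative (resp. positive) weak KAM solution for $G$ is a function $u:M\to\mathbb{R}$ with $u=T_G^{-t}u$ (resp. $u=T_G^{+t}u$) for all $t\geqslant0$. The Mather set $\widehat{\mathcal M}_G\subset T^*M$ is the closure of the union of the supports of all minimizing $\Phi_G$-invariant Borel probability measures on $T^*M$ (those minimizing $\int L_G\circ\mathcal L_G^{-1}\,d\mu$ among $\Phi_G$-invariant probability measures, where $\mathcal L_G:TM\to T^*M$, $(x,v)\mapsto(x,\partial L_G/\partial v(x,v))$, is the Legendre transform); $\mathcal M_G$ is its projection on $M$. For every critical subsolution $u_G$ for $G$ there exist (Fathi) a unique negative weak KAM solution $u_G^-$ and a unique positive weak KAM solution $u_G^+$ for $G$ which both coincide with $u_G$ on $\mathcal M_G$; the relation $u_G^-\sim_Gu_G^+$ means that $(u_G^-,u_G^+)$ is a pair arising in this way from some critical subsolution. The relation $\sim_H$ is defined in the same way from $H$. *)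

(* Defs.v *)
From HB Require Import structures.
From mathcomp Require Import all_boot all_order all_algebra.
From mathcomp Require Import all_classical all_reals all_analysis.

Set Implicit Arguments.
Unset Strict Implicit.
Unset Printing Implicit Defensive.

Import Order.TTheory GRing.Theory Num.Theory.
Import numFieldNormedType.Exports.

Local Open Scope classical_set_scope.
Local Open Scope ring_scope.

(* Meant for an open set D in finite dimension, where continuity of all the
   directional derivatives is continuity of the differential. *)
Definition C1_on (R : realType) (V W : normedModType R) (D : set V)
    (f : V -> W) : Prop :=
  forall z, D z ->
    differentiable f z /\ forall w, {for z, continuous (fun y => 'D_w f y)}.

Definition C2_on (R : realType) (V W : normedModType R) (D : set V)
    (f : V -> W) : Prop :=
  C1_on D f /\ forall w, C1_on D (fun y => 'D_w f y).

(* A C^2 atlas, not assumed to be maximal, on a nonempty space (the base point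
   plays no other role). chart and chartV are total functions, significant only
   on dom i and on its image. chart_at selects a chart around each point; it
   only serves to represent tangent vectors and covectors. *)
Record C2atlas (R : realType) (n : nat) (M : ptopologicalType) := C2Atlas {
  chart_index : Type;
  dom : chart_index -> set M;
  chart : chart_index -> M -> 'rV[R]_n;
  chartV : chart_index -> 'rV[R]_n -> M;
  open_dom : forall i, open (dom i);
  open_codom : forall i, open (chart i @` dom i);
  chartK : forall i x, dom i x -> chartV i (chart i x) = x;
  chart_continuous : forall i x, dom i x -> {for x, continuous (chart i)};
  chartV_continuous : forall i x, dom i x ->
    {for chart i x, continuous (chartV i)};
  transition_C2 : forall i j,
    C2_on (chart i @` (dom i `&` dom j)) (chart j \o chartV i);
  chart_at : M -> chart_index;
  chart_atP : forall x, dom (chart_at x) x }.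

(* (x, v) and (x, p) stand for the tangent vector, resp. the covector, at x
   whose coordinates in the chart chart_at x are v, resp. p. *)
Definition tangent (R : realType) (n : nat) (M : ptopologicalType)
  (A : C2atlas R n M) : Type := (M * 'rV[R]_n)%type.
Definition cotangent (R : realType) (n : nat) (M : ptopologicalType)
  (A : C2atlas R n M) : Type := (M * 'rV[R]_n)%type.

HB.instance Definition _ (R : realType) (n : nat) (M : ptopologicalType)
  (A : C2atlas R n M) := Pointed.on (cotangent A).

Section Bundles.
Variables (R : realType) (n : nat) (M : ptopologicalType) (A : C2atlas R n M).

Definition codom_chart (i : chart_index A) : set 'rV[R]_n := chart i @` dom i.

(* Vectors are rows: if v and w represent one tangent vector at x in the charts
   i and j, then w = v *m tjac i j x. *)
Definition tjac (i j : chart_index A) (x : M) : 'M[R]_n :=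
  jacobian (chart j \o chartV i) (chart i x).

Definition pairing (p v : 'rV[R]_n) : R := (p *m v^T) 0 0.

(* The canonical chart of the cotangent bundle induced by the chart i; the
   components of a covector change contragrediently to those of a vector. *)
Definition cot_coord (i : chart_index A) (z : cotangent A) :
    'rV[R]_n * 'rV[R]_n :=
  (chart i z.1, z.2 *m (tjac i (chart_at A z.1) z.1)^T).

Definition cot_coordV (i : chart_index A) (a : 'rV[R]_n * 'rV[R]_n) :
    cotangent A :=
  let x := chartV i a.1 in (x, a.2 *m (tjac (chart_at A x) i x)^T).

Definition cot_codom (i : chart_index A) : set ('rV[R]_n * 'rV[R]_n) :=
  [set a | codom_chart i a.1].

(* The manifold topology of the cotangent bundle. It is not the product
   topology, since chart_at need not be locally constant. *)
Definition cot_open : set_system (cotangent A) :=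
  [set W | forall i : chart_index A, open (cot_codom i `&` cot_coordV i @^-1` W)].

Lemma open_cot_codom i : open (cot_codom i).
Proof.
apply: (@open_comp _ _ fst (codom_chart i)); last exact: open_codom.
by move=> x _; exact: cvg_fst.
Qed.

Lemma cot_openT : cot_open [set: cotangent A].
Proof. by move=> i; rewrite preimage_setT setIT; exact: open_cot_codom. Qed.

Lemma cot_openI : setI_closed cot_open.
Proof.
by move=> U V oU oV i; rewrite preimage_setI setIIr; exact: openI.
Qed.

Lemma cot_open_bigU (I : Type) (f : I -> set (cotangent A)) :
  (forall k, cot_open (f k)) -> cot_open (\bigcup_k f k).
Proof.
move=> of_ i; rewrite preimage_bigcup setI_bigcupr.
by apply: bigcup_open => k _; exact: of_.
Qed.

HB.instance Definition _ := isOpenTopological.Build (cotangent A)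
  cot_openT cot_openI cot_open_bigU.

(* metric x is the matrix of the inner product at x in the chart chart_at x.
   The tensor is only required to be continuous: it is used through its norm on
   covectors, up to equivalence of norms. *)
Record riemannian := Riemannian {
  metric : M -> 'M[R]_n;
  metric_sym : forall x, (metric x)^T = metric x;
  metric_posdef : forall x (v : 'rV[R]_n), v != 0 -> 0 < (v *m metric x *m v^T) 0 0;
  metric_continuous : forall (i : chart_index A) x, dom i x ->
    {for x, continuous (fun y => tjac i (chart_at A y) y *m metric y
                                 *m (tjac i (chart_at A y) y)^T)} }.

Definition tnorm (g : riemannian) (x : M) (v : 'rV[R]_n) : R :=
  Num.sqrt ((v *m metric g x *m v^T) 0 0).

Definition conorm (g : riemannian) (x : M) (p : 'rV[R]_n) : R :=
  sup [set pairing p v | v in [set v | tnorm g x v <= 1]].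

End Bundles.


Notation cot_borel A := (g_sigma_algebraType (@open (cotangent A))).

Section Symplectic.
Variables (R : realType) (n : nat).
Let E := ('rV[R]_n * 'rV[R]_n)%type.

Definition liouville (z v : E) : R := pairing z.2 v.1.

Definition ext_der (theta : E -> E -> R) (z v w : E) : R :=
  'D_v (fun y => theta y w) z - 'D_w (fun y => theta y v) z.

(* The expression of the symplectic form in any canonical chart. *)
Definition Omega (z v w : E) : R := - ext_der liouville z v w.

Definition ham_vf (h : E -> R) (z : E) : E :=
  xget 0 [set X | forall w, Omega z X w = 'd h z w].

End Symplectic.

Section Hamiltonian.
Variables (R : realType) (n : nat) (M : ptopologicalType) (A : C2atlas R n M).
Implicit Types (G H : cotangent A -> R) (u : M -> R) (gamma : R -> M).

Definition local_rep H (i : chart_index A) (a : 'rV[R]_n * 'rV[R]_n) : R :=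
  H (cot_coordV i a).

(* The canonical charts are only C^1 related, hence being C^2 refers to the
   given atlas. *)
Definition tonelli (g : riemannian A) H : Prop :=
  [/\ forall i, C2_on (cot_codom i) (local_rep H i),
      forall K : R, 0 < K -> exists C : R, forall x p,
        K * conorm g x p - C <= H (x, p),
      forall r : R, 0 <= r ->
        (ereal_sup [set (H z)%:E | z in [set z | (conorm g z.1 z.2 <= r)%R]]
           < +oo)%E
    & forall x p w, w != 0 ->
        0 < 'D_w (fun q => 'D_w (fun q' : 'rV[R]_n => H (x, q')) q) p].

Definition poisson_commute G H : Prop :=
  forall i a, cot_codom i a ->
    Omega a (ham_vf (local_rep G i) a) (ham_vf (local_rep H i) a) = 0.

Definition integral_curve H (c : R -> cotangent A) : Prop :=
  continuous c /\
  forall t i, dom i (c t).1 ->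
    is_derive t 1 (fun s => cot_coord i (c s))
                  (ham_vf (local_rep H i) (cot_coord i (c t))).

Definition is_flow H (Phi : R -> cotangent A -> cotangent A) : Prop :=
  (forall z, Phi 0 z = z) /\ forall z, integral_curve H (Phi^~ z).

Definition ham_flow H : R -> cotangent A -> cotangent A :=
  xget ((fun _ z => z) : R -> cotangent A -> cotangent A)
    [set Phi | is_flow H Phi].

Definition lagrangian H (w : tangent A) : R :=
  sup [set pairing p w.2 - H (w.1, p) | p in [set: 'rV[R]_n]].

Definition legendre H (w : tangent A) : cotangent A :=
  (w.1, \row_j 'D_(delta_mx 0 j) (fun v => lagrangian H (w.1, v)) w.2).

Definition legendreV H (z : cotangent A) : tangent A :=
  xget ((z.1, 0) : M * 'rV[R]_n) [set w | legendre H w = z].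

Definition abs_continuous_on (f : R -> 'rV[R]_n) (a b : R) : Prop :=
  forall e : R, 0 < e -> exists2 d : R, 0 < d &
    forall (m : nat) (x y : 'I_m -> R),
      (forall k, [/\ a <= x k, x k <= y k & y k <= b]) ->
      trivIset [set: 'I_m] (fun k => `]x k, y k[%classic) ->
      \sum_(k < m) (y k - x k) < d ->
      \sum_(k < m) `|f (y k) - f (x k)| < e.

Definition abs_continuous_curve (s : R) gamma : Prop :=
  {within `[0, s], continuous gamma} /\
  forall (i : chart_index A) (a b : R), 0 <= a -> a <= b -> b <= s ->
    gamma @` `[a, b]%classic `<=` dom i ->
    abs_continuous_on (chart i \o gamma) a b.

(* Arbitrary where gamma is not differentiable, which for an absolutely
   continuous curve is a null set. *)
Definition velocity gamma (t : R) : tangent A :=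
  (gamma t, derive1 (chart (chart_at A (gamma t)) \o gamma) t).

Definition action H (s : R) gamma : \bar R :=
  (\int[lebesgue_measure]_(t in `[0%R, s])
     (lagrangian H (velocity gamma t))%:E)%E.

Definition lax_oleinik_neg H (s : R) u (x : M) : \bar R :=
  if s == 0 then (u x)%:E else
  ereal_inf [set ((u (gamma 0))%:E + action H s gamma)%E | gamma in
    [set gamma | abs_continuous_curve s gamma /\ gamma s = x]].

Definition reversed H (z : cotangent A) : R := H (z.1, - z.2).

Definition lax_oleinik_pos H (s : R) u (x : M) : \bar R :=
  (- lax_oleinik_neg (reversed H) s (fun y => - u y)%R x)%E.

Definition subsolution H (alpha : R) u : Prop :=
  forall (x y : M) (t : R), 0 <= t ->
    ((u y - u x)%:E <=
     ereal_inf [set action H t gamma | gamma in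
       [set gamma | [/\ abs_continuous_curve t gamma,
                        gamma 0%R = x & gamma t = y]]]
     + (t * alpha)%:E)%E.

Definition is_critical_value H (alpha : R) : Prop :=
  (exists u, subsolution H alpha u) /\
  forall beta, (exists u, subsolution H beta u) -> alpha <= beta.

Definition critical_subsolution H u : Prop :=
  exists2 alpha, is_critical_value H alpha & subsolution H alpha u.

(* These two are the right notions for critical value 0 only. *)
Definition neg_weak_KAM H u : Prop :=
  forall (t : R) x, 0 <= t -> (u x)%:E = lax_oleinik_neg H t u x.

Definition pos_weak_KAM H u : Prop :=
  forall (t : R) x, 0 <= t -> (u x)%:E = lax_oleinik_pos H t u x.

Definition invariant_measure H (mu : probability (cot_borel A) R) : Prop :=
  forall (t : R) (B : set (cot_borel A)), measurable B ->
    mu (ham_flow H t @^-1` B) = mu B.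

Definition cot_action H (mu : probability (cot_borel A) R) : \bar R :=
  (\int[mu]_z (lagrangian H (legendreV H z))%:E)%E.

Definition minimizing_measure H (mu : probability (cot_borel A) R) : Prop :=
  invariant_measure H mu /\
  forall nu : probability (cot_borel A) R, invariant_measure H nu ->
    (cot_action H mu <= cot_action H nu)%E.

Definition cot_support (mu : probability (cot_borel A) R) : set (cotangent A) :=
  [set z | forall W : set (cotangent A), open W -> W z -> (0 < mu W)%E].

Definition mather_set H : set (cotangent A) :=
  closure (\bigcup_(mu in minimizing_measure H) cot_support mu).

Definition projected_mather_set H : set M := fst @` mather_set H.

Definition weak_KAM_pair H (um up : M -> R) : Prop :=
  exists u, [/\ critical_subsolution H u,
    neg_weak_KAM H um /\ (forall x, projected_mather_set H x -> um x = u x)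
  & pos_weak_KAM H up /\ (forall x, projected_mather_set H x -> up x = u x)].

End Hamiltonian.

(* Main.v *)
(** A short step of the Lax-Oleinik semigroup of H is realized by an orbit of H
    joining a subdifferential of u to a superdifferential of its image. As G is
    constant on this orbit, the step preserves the subsolutions of G. On the
    Aubry set of G, where H vanishes because its critical value is 0, it follows
    that every subsolution of G is calibrated along the backward orbits of H.
    Since the backward calibrated curves of um accumulate on that set, um is a
    weak KAM solution for H; reversing time gives the same for up.
    The Mather set of H lies in its Aubry set, so, exchanging G and H, both um
    and up are calibrated by G along the backward orbit of G issued from one of
    its points z, and um - up is constant on this orbit. A limit of averages
    along the orbit (Krylov-Bogoliubov) is a minimizing measure of G, so um - up
    takes its value at z on the Mather set of G too, where it vanishes. Hence
    um = up on the Mather set of H, and um itself is the subsolution sought. *)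
From HB Require Import structures.
Require Import Defs.
From mathcomp Require Import all_boot all_order all_algebra.
From mathcomp Require Import all_classical all_reals all_analysis.
From mathcomp Require Import measurable_realfun ring lra.
Set Implicit Arguments.
Unset Strict Implicit.
Unset Printing Implicit Defensive.
Import Order.TTheory GRing.Theory Num.Theory.
Import numFieldNormedType.Exports.
Local Open Scope classical_set_scope.
Local Open Scope ring_scope.

(** No existence theorem for minimizing curves is used. For a short time t the flow has a twist
    property: over a fixed base point the end of the orbit is strongly monotone in the covector.
    Hence two points at distance O(t) are joined by an orbit (shooting), and an exact first
    variation shows that its action is at most that of any curve with the same ends staying in the
    chart box. The infimum over curves becomes a minimum over a compact ball of covectors. H
    vanishes on the Aubry set of G for the following reason. At such a point z a step of time s
    lowers every subsolution of G by s H(z). The images remain subsolutions of G, whose oscillation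
    is uniformly bounded, so H has a single value c there. Comparison with a subsolution of H gives
    c <= 0. Conversely H = c at the covectors of the backward orbits of um, so um is a subsolution
    of H at level c, and criticality gives c >= 0. Curves are only absolutely continuous, and the
    Lagrangian along them is not known to be measurable; their actions are bounded below through
    measurable minorants. *)

Section Pairing.
Variables (R : realType) (n : nat).
Implicit Types (p q v w : 'rV[R]_n).

Lemma pairingE p v : pairing p v = \sum_j p 0 j * v 0 j.
Proof. by rewrite /pairing mxE; apply: eq_bigr => j _; rewrite mxE. Qed.

Lemma pairingC p v : pairing p v = pairing v p.
Proof. by rewrite !pairingE; apply: eq_bigr => j _; rewrite mulrC. Qed.

Lemma pairingDl p q v : pairing (p + q) v = pairing p v + pairing q v.
Proof. by rewrite /pairing mulmxDl mxE. Qed.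

Lemma pairingDr p v w : pairing p (v + w) = pairing p v + pairing p w.
Proof. by rewrite pairingC pairingDl !(pairingC p). Qed.

Lemma pairingZl k p v : pairing (k *: p) v = k * pairing p v.
Proof. by rewrite /pairing -scalemxAl mxE. Qed.

Lemma pairingZr k p v : pairing p (k *: v) = k * pairing p v.
Proof. by rewrite pairingC pairingZl pairingC. Qed.

Lemma pairingNl p v : pairing (- p) v = - pairing p v.
Proof. by rewrite -scaleN1r pairingZl mulN1r. Qed.

Lemma pairingNr p v : pairing p (- v) = - pairing p v.
Proof. by rewrite pairingC pairingNl pairingC. Qed.

Lemma pairingBl p q v : pairing (p - q) v = pairing p v - pairing q v.
Proof. by rewrite pairingDl pairingNl. Qed.

Lemma pairingBr p v w : pairing p (v - w) = pairing p v - pairing p w.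
Proof. by rewrite pairingDr pairingNr. Qed.

Lemma pairing0l v : pairing 0 v = 0.
Proof. by rewrite /pairing mul0mx mxE. Qed.

Lemma pairing0r p : pairing p 0 = 0.
Proof. by rewrite pairingC pairing0l. Qed.

Lemma pairing_deltar p j : pairing p (delta_mx 0 j) = p 0 j.
Proof.
rewrite pairingE (bigD1 j) //= big1 ?addr0 => [|k kj]; first by rewrite mxE !eqxx mulr1.
by rewrite mxE (negPf kj) andbF mulr0.
Qed.

Lemma pairing_inj p q : (forall v, pairing p v = pairing q v) -> p = q.
Proof. by move=> pq; apply/rowP => j; rewrite -!pairing_deltar. Qed.

Lemma pairing_trmx m (A : 'M[R]_(m, n)) p (v : 'rV[R]_m) :
  pairing (p *m A^T) v = pairing p (v *m A).
Proof. by rewrite /pairing trmx_mul mulmxA. Qed.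

Lemma row_norm_ge v j : `|v 0 j| <= `|v|.
Proof.
rewrite [leRHS]/Num.Def.normr/= mx_normrE.
exact: (le_bigmax _ (fun i : 'I_1 * 'I_n => `|v i.1 i.2|) (0, j)).
Qed.

Lemma row_norm_le v e : 0 <= e -> (forall j, `|v 0 j| <= e) -> `|v| <= e.
Proof.
move=> e0 ve; rewrite [leLHS]/Num.Def.normr/= mx_normrE.
by apply: bigmax_le => //= -[i j] _; rewrite (ord1 i).
Qed.

(** Rows carry the maximum norm, whence the factor n. *)
Lemma pairing_bound p v : `|pairing p v| <= n%:R * (`|p| * `|v|).
Proof.
rewrite pairingE (le_trans (ler_norm_sum _ _ _))//.
have -> : n%:R * (`|p| * `|v|) = \sum_(j < n) (`|p| * `|v|).
  by rewrite sumr_const card_ord mulr_natl.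
by apply: ler_sum => j _; rewrite normrM ler_pM// row_norm_ge.
Qed.

(** The maximum norm is not differentiable. This inequality, with its converse [pairing_vv_le], lets
    the smooth quantity [pairing v v] stand for the squared norm along curves. *)
Lemma pairing_vv_ge v : `|v| ^+ 2 <= pairing v v.
Proof.
have s0 : 0 <= pairing v v.
  by rewrite pairingE sumr_ge0// => j _; rewrite -expr2 sqr_ge0.
suff : `|v| <= Num.sqrt (pairing v v).
  by move=> h; rewrite -(sqr_sqrtr s0) ler_sqr ?nnegrE ?sqrtr_ge0.
apply: row_norm_le; rewrite ?sqrtr_ge0// => j.
rewrite -sqrtr_sqr ler_sqrt// pairingE (bigD1 j)//= -expr2 lerDl sumr_ge0// => k _.
by rewrite -expr2 sqr_ge0.
Qed.

Lemma pairing_vv_ge0 v : 0 <= pairing v v.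
Proof. by apply: le_trans (pairing_vv_ge v); rewrite exprn_ge0. Qed.

Lemma pairing_vv_le v : pairing v v <= n%:R * `|v| ^+ 2.
Proof. by rewrite expr2 (le_trans (ler_norm _))// pairing_bound. Qed.

Lemma is_derive_coord (c : R -> 'rV[R]_n) t dc j :
  is_derive t (1 : R) c dc -> is_derive t (1 : R) (fun s => c s 0 j) (dc 0 j).
Proof.
move=> [cd <-]; have cdj := (derivable_mxP c t 1).1 cd.
by rewrite derive_mx// mxE; apply: DeriveDef.
Qed.

Lemma is_derive_row (c : R -> 'rV[R]_n) (t : R) (dc : 'rV[R]_n) :
  (forall j, is_derive t (1 : R) (fun s => c s 0 j) (dc 0 j)) -> is_derive t (1 : R) c dc.
Proof.
move=> H; have cd : derivable c t 1.
  by apply/derivable_mxP => i j; rewrite (ord1 i); case: (H j).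
apply: DeriveDef => //; rewrite derive_mx//; apply/rowP => j; rewrite mxE.
by case: (H j).
Qed.

Lemma is_derive_pairing (c d : R -> 'rV[R]_n) t dc dd :
  is_derive t (1 : R) c dc -> is_derive t (1 : R) d dd ->
  is_derive t (1 : R) (fun s => pairing (c s) (d s)) (pairing dc (d t) + pairing (c t) dd).
Proof.
move=> hc hd.
have -> : (fun s => pairing (c s) (d s)) = \sum_j ((fun s => c s 0 j) \* (fun s => d s 0 j)).
  by apply/funext => s; rewrite pairingE fct_sumE.
apply: (@is_derive_eq _ _ _ _ _ _ _ (\sum_j (c t 0 j *: dd 0 j + d t 0 j *: dc 0 j))).
  apply: is_derive_sum => j.
  exact: (is_deriveM (is_derive_coord j hc) (is_derive_coord j hd)).
rewrite !pairingE -big_split/=; apply: eq_bigr => j _.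
by rewrite addrC [d t 0 j *: _]mulrC.
Qed.

Lemma cvg_pairing (T : Type) (F : set_system T) {FF : Filter F} (c d : T -> 'rV[R]_n) p v :
  c x @[x --> F] --> p -> d x @[x --> F] --> v ->
  pairing (c x) (d x) @[x --> F] --> pairing p v.
Proof.
move=> cp dv; rewrite pairingE.
under eq_fun do rewrite pairingE.
apply: cvg_big => [|j _]; first exact: add_continuous. apply: cvgM.
  exact: (cvg_comp _ _ cp (@coord_continuous _ _ _ 0 j p)).
exact: (cvg_comp _ _ dv (@coord_continuous _ _ _ 0 j v)).
Qed.

End Pairing.

(** * Differentiation and mean value estimates for curves *)

Section Curves.
Variable R : realType.

Lemma is_derive_comp_diff (V W : normedModType R) (f : V -> W) (c : R -> V) t dc :
  differentiable f (c t) -> is_derive t (1 : R) c dc ->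
  is_derive t (1 : R) (f \o c) ('d f (c t) dc).
Proof.
move=> df [dct <-]; have cd : differentiable c t by apply/derivable1_diffP.
have fcd : differentiable (f \o c) t by apply: differentiable_comp.
apply: DeriveDef; first exact/derivable1_diffP.
by rewrite deriveE// diff_comp//= deriveE.
Qed.

Lemma is_derive_line (V W : normedModType R) (f : V -> W) (a w : V) (s : R) :
  derivable f (a + s *: w) w ->
  is_derive s (1 : R) (fun r => f (a + r *: w)) ('D_w f (a + s *: w)).
Proof.
have E : (fun h : R => h^-1 *: (f (h *: w + (a + s *: w)) - f (a + s *: w))) =
    (fun h : R => h^-1 *: (f (a + (h *: 1 + s) *: w) - f (a + s *: w))).
  apply/funext => h; congr (_ *: (f _ - _)).
  by rewrite [h *: 1]mulr1 scalerDl addrCA.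
move=> df; apply: DeriveDef; first by move: df; rewrite /derivable E.
by rewrite /derive E.
Qed.

Lemma derive_continuous (V : normedModType R) (c : R -> V) t dc :
  is_derive t (1 : R) c dc -> {for t, continuous c}.
Proof.
by move=> [h _]; apply: differentiable_continuous; apply/derivable1_diffP.
Qed.

Lemma mean_value (f df : R -> R) (a b : R) : a <= b ->
  (forall x, a <= x <= b -> is_derive x (1 : R) f (df x)) ->
  exists2 c, a <= c <= b & f b - f a = df c * (b - a).
Proof.
move=> ab Hd.
have [] := @MVT_segment R f df a b ab.
- by move=> x; rewrite in_itv/= => /andP[/ltW ax /ltW xb]; apply: Hd; rewrite ax.
- apply: derivable_within_continuous => x; rewrite in_itv/= => xab.
  by case: (Hd x xab).
by move=> c; rewrite in_itv/= => cab E; exists c.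
Qed.

Lemma derive_ge_increment (f df : R -> R) (a b B : R) : a <= b ->
  (forall x, a <= x <= b -> is_derive x (1 : R) f (df x)) ->
  (forall x, a <= x <= b -> B <= df x) -> B * (b - a) <= f b - f a.
Proof.
move=> ab Hd HB; have [c cab ->] := mean_value ab Hd.
by rewrite ler_wpM2r ?subr_ge0// HB.
Qed.

Lemma row_increment n (c dc : R -> 'rV[R]_n) (a b B : R) : a <= b ->
  (forall x, a <= x <= b -> is_derive x (1 : R) c (dc x)) ->
  (forall x, a <= x <= b -> `|dc x| <= B) -> `|c b - c a| <= B * (b - a).
Proof.
move=> ab Hd HB.
have B0 : 0 <= B by apply: (le_trans _ (HB a _)); rewrite ?lexx.
apply: row_norm_le => [|j]; first by rewrite mulr_ge0// subr_ge0.
have [] := @mean_value (fun s => c s 0 j) (fun s => dc s 0 j) a b ab.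
  by move=> x xab; apply: is_derive_coord; exact: Hd.
move=> z zab E; rewrite mxE [X in _ + X]mxE E normrM (ger0_norm (_ : 0 <= b - a)) ?subr_ge0//.
by rewrite ler_wpM2r ?subr_ge0// (le_trans (row_norm_ge _ _))// HB.
Qed.

End Curves.

(** * Gradients, Taylor estimates and the symplectic form in coordinates *)

Section Gradient.
Variables (R : realType) (n : nat).
Let V := 'rV[R]_n.
Let E := (V * V)%type.
Implicit Types (h f : E -> R) (a b w : E) (D K : set E).

(** Gradients in position and in momentum: Hamilton's equations read x' = gp, p' = - gx
    ([ham_vfE]). *)
Definition gx h a : V := \row_j 'D_((delta_mx 0 j, 0) : E) h a.
Definition gp h a : V := \row_j 'D_((0, delta_mx 0 j) : E) h a.

Lemma norm_fst a : `|a.1| <= `|a|.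
Proof. by rewrite prod_normE le_max lexx. Qed.

Lemma norm_snd a : `|a.2| <= `|a|.
Proof. by rewrite prod_normE le_max lexx orbT. Qed.

Lemma norm_pair_le a (e : R) : `|a.1| <= e -> `|a.2| <= e -> `|a| <= e.
Proof. by move=> h1 h2; rewrite prod_normE ge_max h1. Qed.

Lemma diff_grad h a : differentiable h a -> forall w,
  'd h a w = pairing (gx h a) w.1 + pairing (gp h a) w.2.
Proof.
move=> dh w.
have w1E : ((w.1, 0) : E) = \sum_j w.1 0 j *: ((delta_mx 0 j, 0) : E).
  apply: injective_projections.
    by rewrite (raddf_sum fst)/= {1}[w.1]row_sum_delta.
  by rewrite (raddf_sum snd)/= big1// => j _; rewrite scaler0.
have w2E : ((0, w.2) : E) = \sum_j w.2 0 j *: ((0, delta_mx 0 j) : E).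
  apply: injective_projections.
    by rewrite (raddf_sum fst)/= big1// => j _; rewrite scaler0.
  by rewrite (raddf_sum snd)/= {1}[w.2]row_sum_delta.
have wE : w = ((w.1, 0) : E) + ((0, w.2) : E).
  by apply: injective_projections; rewrite /= ?addr0 ?add0r.
rewrite {1}wE linearD w1E w2E !linear_sum/= !pairingE; congr (_ + _);
  by apply: eq_bigr => j _; rewrite linearZ/= mxE deriveE// mulrC.
Qed.

End Gradient.

Section RealHelpers.
Variable R : realType.

Lemma ler_pM3 (k a b A B : R) : 0 <= k -> 0 <= a -> 0 <= b -> a <= A -> b <= B ->
  k * (a * b) <= k * (A * B).
Proof. by move=> k0 a0 b0 aA bB; rewrite ler_wpM2l// ler_pM. Qed.

Lemma near_pinfty_ex (P : R -> Prop) : (\forall C \near +oo, P C) -> exists2 C, 0 <= C & P C.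
Proof.
move=> [B [_ HB]]; exists (Num.max 0 (B + 1)); first by rewrite le_max lexx.
by apply: HB; rewrite lt_max ltrDl ltr01 orbT.
Qed.

Lemma near_norm_lt (r t : R) : `|t| < r -> \forall s \near t, `|s| < r.
Proof.
move=> tr; have : nbhs t (`]- r, r[%classic : set R).
  by apply: open_nbhs_nbhs; split; [exact: interval_open|rewrite /= in_itv/= -ltr_norml].
by apply: filterS => s; rewrite /= in_itv/= -ltr_norml.
Qed.

Lemma pairing_bound_le n (p v : 'rV[R]_n) (a b : R) : `|p| <= a -> `|v| <= b ->
  `|pairing p v| <= n%:R * (a * b).
Proof.
by move=> pa vb; apply: (le_trans (pairing_bound p v)); exact: ler_pM3.
Qed.

End RealHelpers.

Section SecondOrder.
Variables (R : realType) (n : nat).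
Let V := 'rV[R]_n.
Let E := (V * V)%type.
Implicit Types (h f : E -> R) (D K : set E).

Definition seg_closed K := forall (a b : E) (s : R), K a -> K b -> 0 <= s <= 1 ->
  K (a + s *: (b - a)).

Definition box (x : V) (r q : R) : set E := [set a | `|a.1 - x| <= r /\ `|a.2| <= q].

Lemma seg_closed_box x r q : seg_closed (box x r q).
Proof.
move=> a b s [a1 a2] [b1 b2] /andP[s0 s1].
have cvx (u v : V) (e : R) : `|u| <= e -> `|v| <= e -> `|u + s *: (v - u)| <= e.
  move=> ue ve; have -> : u + s *: (v - u) = (1 - s) *: u + s *: v.
    by rewrite scalerBr scalerBl scale1r addrCA -addrA addrC addrA.
  rewrite (le_trans (ler_normD _ _))// !normrZ (ger0_norm s0) (ger0_norm (_ : 0 <= 1 - s)) ?subr_ge0//.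
  by have := ler_wpM2l s0 ve; have := ler_wpM2l (_ : 0 <= 1 - s) ue; rewrite subr_ge0 s1; lra.
split; last exact: cvx.
have -> : (a + s *: (b - a)).1 - x = (a.1 - x) + s *: ((b.1 - x) - (a.1 - x)).
  rewrite /=; have -> : b.1 - x - (a.1 - x) = b.1 - a.1 by rewrite opprB addrA subrK.
  by rewrite addrAC.
exact: cvx.
Qed.

Lemma compact_row_ball (x : V) (r : R) : compact [set y : V | `|y - x| <= r].
Proof.
apply: bounded_closed_compact.
  exists (r + `|x|); split; first by rewrite num_real.
  move=> m rm y /= yx; apply: ltW; apply: le_lt_trans rm.
  by rewrite -(subrK x y) (le_trans (ler_normD _ _))// lerD2r.
have -> : [set y : V | `|y - x| <= r] = (fun y : V => `|y - x|) @^-1` [set t | t <= r] by [].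
apply: closed_comp; last exact: closed_le.
move=> y _; apply: (@continuous_comp _ _ _ (fun y : V => y - x) (fun y : V => `|y|)).
  by apply: (@cvgB _ _ _ (nbhs y) _ id (cst x)); [exact: cvg_id|exact: cvg_cst].
exact: norm_continuous.
Qed.

Lemma compact_box x r q : compact (box x r q).
Proof.
have -> : box x r q = [set y : V | `|y - x| <= r] `*` [set y : V | `|y - 0| <= q].
  by apply/seteqP; split => [] [a1 a2] [/= h1 h2]; split; rewrite /= ?subr0//; rewrite subr0 in h2.
by apply: compact_setX; exact: compact_row_ball.
Qed.

(** The bound is stated for C near +oo so that the bounds of finitely many functions, such as the
    partial derivatives, can be merged by intersecting filters. *)
Lemma continuous_near_bounded (T : topologicalType) (f : T -> R) (K : set T) :
  compact K -> (forall a, K a -> {for a, continuous f}) ->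
  \forall C \near +oo, forall a, K a -> `|f a| <= C.
Proof.
move=> cK cf.
have : bounded_set (f @` K).
  apply: compact_bounded; apply: continuous_compact => //.
  by apply: continuous_in_subspaceT => x /set_mem; exact: cf.
move=> [B [Br HB]]; exists B; split=> // C BC a Ka; apply: (HB C BC); exists a => //.
Qed.

Lemma continuous_bounded (T : topologicalType) (K : set T) (f : T -> R) : compact K ->
  (forall x, K x -> {for x, continuous f}) -> exists2 C, 0 <= C & forall x, K x -> `|f x| <= C.
Proof. by move=> cK cf; apply: near_pinfty_ex; exact: continuous_near_bounded. Qed.

Lemma grad_bounded f D K : C1_on D f -> compact K -> K `<=` D ->
  exists2 C : R, 0 <= C & forall a : E, K a -> `|gx f a| <= C /\ `|gp f a| <= C.
Proof.
move=> Cf cK KD.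
have H (e : E) : \forall C \near +oo, forall a, K a -> `|'D_e f a| <= C.
  by apply: continuous_near_bounded => // a /KD /Cf [_]; apply.
have /filter_forall H1 := fun j : 'I_n => H (delta_mx 0 j, 0).
have /filter_forall H2 := fun j : 'I_n => H (0, delta_mx 0 j).
have [C C0 [H3 H4]] := near_pinfty_ex (filterI H1 H2).
by exists C => // a Ka; split; apply: row_norm_le => // j; rewrite mxE; [exact: H3|exact: H4].
Qed.

Lemma segment_mean_value f D K (a b : E) :
  C1_on D f -> K `<=` D -> seg_closed K -> K a -> K b ->
  exists2 c : E, K c /\ (exists2 s : R, 0 <= s <= 1 & c = a + s *: (b - a)) &
    f b - f a = pairing (gx f c) (b.1 - a.1) + pairing (gp f c) (b.2 - a.2).
Proof.
move=> Cf KD cvx Ka Kb; pose w : E := b - a.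
have Ks (s : R) : 0 <= s <= 1 -> K (a + s *: w) by move=> s01; exact: cvx.
have [] := @mean_value _ (fun s => f (a + s *: w)) (fun s => 'D_w f (a + s *: w)) 0 1 ler01.
  move=> s s01; apply: is_derive_line; apply: diff_derivable.
  by case: (Cf _ (KD _ (Ks s s01))).
move=> s s01; rewrite scale0r addr0 scale1r subr0 mulr1 => E0.
exists (a + s *: w); first by split; [exact: Ks|exists s].
have df : differentiable f (a + s *: w) by case: (Cf _ (KD _ (Ks s s01))).
have aw : a + w = b by rewrite addrC subrK.
by move: E0; rewrite aw deriveE// diff_grad.
Qed.

Lemma C1_lipschitz_ex f D K : C1_on D f -> compact K -> K `<=` D -> seg_closed K ->
  exists2 C : R, 0 <= C & forall a b : E, K a -> K b -> `|f b - f a| <= C * `|b - a|.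
Proof.
move=> Cf cK KD cvx; have [B B0 HB] := grad_bounded Cf cK KD.
exists (n%:R * B + n%:R * B); first by rewrite addr_ge0// mulr_ge0.
move=> a b Ka Kb; have [c [Kc _] ->] := segment_mean_value Cf KD cvx Ka Kb.
have [h1 h2] := HB c Kc.
apply: le_trans (ler_normD _ _) _.
rewrite mulrDl -!mulrA; apply: lerD.
  exact: pairing_bound_le h1 (norm_fst (b - a)).
exact: pairing_bound_le h2 (norm_snd (b - a)).
Qed.

Lemma C1_lipschitz f D K : C1_on D f -> compact K -> K `<=` D -> seg_closed K ->
  \forall C \near +oo, forall a b : E, K a -> K b -> `|f b - f a| <= C * `|b - a|.
Proof.
move=> Cf cK KD cvx; have [B B0 HB] := C1_lipschitz_ex Cf cK KD cvx.
apply: filterS (nbhs_pinfty_ge (num_real B)) => C BC a b Ka Kb.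
by apply: le_trans (HB a b Ka Kb) _; exact: ler_wpM2r.
Qed.

Lemma grad_lipschitz h D K : C2_on D h -> compact K -> K `<=` D -> seg_closed K ->
  exists2 C : R, 0 <= C & forall a b : E, K a -> K b ->
    `|gx h b - gx h a| <= C * `|b - a| /\ `|gp h b - gp h a| <= C * `|b - a|.
Proof.
move=> [_ C2] cK KD cvx.
have H (e : E) := C1_lipschitz (C2 e) cK KD cvx.
have /filter_forall H1 := fun j : 'I_n => H (delta_mx 0 j, 0).
have /filter_forall H2 := fun j : 'I_n => H (0, delta_mx 0 j).
have [C C0 [H3 H4]] := near_pinfty_ex (filterI H1 H2).
exists C => // a b Ka Kb; have Cab : 0 <= C * `|b - a| by exact: mulr_ge0.
by split; apply: row_norm_le => // j; rewrite !mxE; [exact: H3|exact: H4].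
Qed.

(** The mean value theorem evaluates the gradient at a point c of the segment; replacing c by a
    costs a Lipschitz error, so the remainder is quadratic. *)
Lemma taylor2 h D K : C2_on D h -> compact K -> K `<=` D -> seg_closed K ->
  exists2 C : R, 0 <= C & forall a b : E, K a -> K b ->
    `|h b - h a - pairing (gx h a) (b.1 - a.1) - pairing (gp h a) (b.2 - a.2)|
      <= C * `|b - a| ^+ 2.
Proof.
move=> Ch cK KD cvx; have [B B0 HB] := grad_lipschitz Ch cK KD cvx.
exists (n%:R * B + n%:R * B); first by rewrite addr_ge0// mulr_ge0.
move=> a b Ka Kb.
have [c [Kc [s /andP[s0 s1] cE]] ->] := segment_mean_value Ch.1 KD cvx Ka Kb.
have [h1 h2] := HB a c Ka Kc.
have ca : `|c - a| <= `|b - a|.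
  by rewrite cE addrAC subrr add0r normrZ (ger0_norm s0) ler_piMl.
have h3 := le_trans h1 (ler_wpM2l B0 ca); have h4 := le_trans h2 (ler_wpM2l B0 ca).
have -> : forall x y z t : R, x + y - z - t = (x - z) + (y - t) by move=> *; ring.
rewrite -!pairingBl; apply: le_trans (ler_normD _ _) _.
rewrite expr2 mulrDl; apply: lerD.
  have := pairing_bound_le h3 (norm_fst (b - a)); by rewrite !mulrA.
have := pairing_bound_le h4 (norm_snd (b - a)); by rewrite !mulrA.
Qed.

Lemma OmegaE (a v w : E) : Omega a v w = pairing w.2 v.1 - pairing v.2 w.1.
Proof.
have dl (u x : E) : 'D_u (fun y : E => liouville y x) a = pairing u.2 x.1.
  have -> : (fun y : E => liouville y x) = (fun y : 'rV[R]_n => pairing y x.1) \o snd by [].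
  rewrite /derive; apply: cvg_lim => //.
  have E0 : forall r : R, r != 0 ->
      r^-1 *: (((fun y => pairing y x.1) \o snd) (r *: u + a) - ((fun y => pairing y x.1) \o snd) a)
        = pairing u.2 x.1.
    by move=> r r0; rewrite /= pairingDl pairingZl addrK scalerA mulVf// scale1r.
  apply: cvg_near_cst; apply: filterS (nbhs_dnbhs_neq _) => r r0.
  by rewrite E0.
by rewrite /Omega /ext_der !dl opprB.
Qed.

Lemma ham_vfE h (a : E) : differentiable h a -> ham_vf h a = (gp h a, - gx h a).
Proof.
move=> dh; apply: xget_subset1.
  by move=> w; rewrite OmegaE diff_grad//= pairingNl opprK addrC pairingC (pairingC w.2) pairingC.
(* Nondegeneracy: testing on (0, v) and on (v, 0) recovers both components of the vector. *)
move=> X Y hX hY; apply: injective_projections; apply: pairing_inj => v.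
  by have := hX (0, v); rewrite -(hY (0, v)) !OmegaE/= !pairing0r !subr0 !(pairingC v).
have := hX (v, 0); rewrite -(hY (v, 0)) !OmegaE/= !pairing0l !sub0r.
by move/oppr_inj.
Qed.

End SecondOrder.

Lemma derive_comp (R : realType) (U V W : normedModType R) (f : U -> V) (g : V -> W) a b v :
  f a = b -> differentiable f a -> differentiable g b ->
  'D_v (g \o f) a = 'D_('D_v f a) g b.
Proof.
move=> <- df dg.
have E2 : 'd (g \o f) a v = 'd g (f a) ('d f a v) :=
  f_equal (fun h : U -> W => h v) (diff_comp df dg).
apply: (eq_trans (deriveE v (differentiable_comp df dg))); apply: (eq_trans E2).
by apply: esym; apply: (eq_trans (deriveE _ dg)); rewrite (deriveE _ df).
Qed.

(** * Charts and topology of the cotangent bundle *)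

Section CotangentCharts.
Variables (R : realType) (n : nat) (M : ptopologicalType) (A : C2atlas R n M).
Let V := 'rV[R]_n.
Let E := (V * V)%type.
Implicit Types (i j k : chart_index A) (x : M) (z : cotangent A).

Definition overlap i j : set V := chart i @` (dom i `&` dom j).
Definition transition i j : V -> V := chart j \o chartV i.

Lemma codom_chartP i (y : V) : codom_chart i y -> dom i (chartV i y) /\ chart i (chartV i y) = y.
Proof. by case=> x dx <-; rewrite chartK. Qed.

Lemma codom_chart_chart i x : dom i x -> codom_chart i (chart i x).
Proof. by exists x. Qed.

Lemma overlapP i j (y : V) : overlap i j y <-> codom_chart i y /\ dom j (chartV i y).
Proof.
split=> [[x [ix jx] <-]|[cy dj]]; first by rewrite chartK//; split=> //; exists x.
by have [dy yE] := codom_chartP cy; exists (chartV i y).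
Qed.

Lemma overlap_chart i j x : dom i x -> dom j x -> overlap i j (chart i x).
Proof. by exists x. Qed.

Lemma chartV_nbhs i (y : V) (U : set M) : codom_chart i y -> nbhs (chartV i y) U ->
  nbhs y (chartV i @^-1` U).
Proof.
move=> cy; have [dy yE] := codom_chartP cy.
by have := chartV_continuous dy; rewrite /continuous_at yE; apply.
Qed.

Lemma open_overlap i j : open (overlap i j).
Proof.
rewrite openE => y /overlapP [cy dj].
have N1 : nbhs y (codom_chart i) by apply: open_nbhs_nbhs; split => //; exact: open_codom.
have N2 : nbhs y (chartV i @^-1` dom j).
  by apply: chartV_nbhs => //; apply: open_nbhs_nbhs; split => //; exact: open_dom.
by apply: filterS (filterI N1 N2) => u [h1 h2]; apply/overlapP.
Qed.

Lemma near_overlap i j x : dom i x -> dom j x -> \forall y \near chart i x, overlap i j y.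
Proof.
move=> di dj; apply: open_nbhs_nbhs; split; [exact: open_overlap|exact: overlap_chart].
Qed.

Lemma transition_differentiable i j x : dom i x -> dom j x ->
  differentiable (transition i j) (chart i x).
Proof. by move=> di dj; have [/(_ _ (overlap_chart di dj)) []] := transition_C2 (c:=A) i j. Qed.

Lemma transition_derive i j x (v : V) : dom i x -> dom j x ->
  'D_v (transition i j) (chart i x) = v *m tjac i j x.
Proof. by move=> di dj; rewrite deriveEjacobian//; exact: transition_differentiable. Qed.

Lemma transition_derive_C1 i j (v : V) : C1_on (overlap i j) ('D_v (transition i j)).
Proof. by have [_] := transition_C2 (c:=A) i j; apply. Qed.

Lemma mx_ext (B C : 'M[R]_n) : (forall v : V, v *m B = v *m C) -> B = C.
Proof. by move=> BC; apply/row_matrixP => l; rewrite !rowE BC. Qed.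

Lemma tjac_id i x : dom i x -> tjac i i x = 1%:M.
Proof.
move=> di; apply: mx_ext => v; rewrite mulmx1 -(transition_derive v di di).
have -> : 'D_v (transition i i) (chart i x) = 'D_v id (chart i x).
  apply: near_eq_derive; apply: filterS (near_overlap di di) => y /overlapP[cy _].
  by rewrite /transition/= (codom_chartP cy).2.
by rewrite derive_id.
Qed.

(** The chain rule for transition maps. This cocycle relation makes the change of covectors between
    two charts independent of the reference chart [chart_at]. *)
Lemma tjac_mul i j k x : dom i x -> dom j x -> dom k x ->
  tjac i j x *m tjac j k x = tjac i k x.
Proof.
move=> di dj dk; apply: mx_ext => v; rewrite mulmxA.
transitivity ('D_v (transition i j) (chart i x) *m tjac j k x).
  by rewrite (transition_derive v di dj).
transitivity ('D_('D_v (transition i j) (chart i x)) (transition j k) (chart j x)).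
  exact: (esym (transition_derive _ dj dk)).
apply: (@eq_trans _ _ _ _ _ (transition_derive v di dk)).
have jE : transition i j (chart i x) = chart j x by rewrite /transition/= chartK.
have E1 : 'D_v (transition i k) (chart i x) =
          'D_v (transition j k \o transition i j) (chart i x).
  apply: near_eq_derive; apply: filterS (near_overlap di dj) => y /overlapP[cy djy].
  by rewrite /transition/= (chartK djy).
have E2 := derive_comp v jE (transition_differentiable di dj) (transition_differentiable dj dk).
exact: (eq_trans (esym E2) (esym E1)).
Qed.

Lemma tjacK i j x : dom i x -> dom j x -> tjac i j x *m tjac j i x = 1%:M.
Proof. by move=> di dj; rewrite tjac_mul// tjac_id. Qed.

Lemma cot_codom_coord i z : dom i z.1 -> cot_codom i (cot_coord i z).
Proof. by exists z.1. Qed.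

Lemma cot_coordK i z : dom i z.1 -> cot_coordV i (cot_coord i z) = z.
Proof.
case: z => x p /= di; rewrite /cot_coordV /cot_coord /= chartK//; congr pair.
rewrite -mulmxA -trmx_mul tjacK ?trmx1 ?mulmx1//; exact: chart_atP.
Qed.

Lemma cot_coordVK i (a : E) : cot_codom i a -> cot_coord i (cot_coordV i a) = a.
Proof.
case: a => y p ca; have [dy yE] := codom_chartP ca.
rewrite /cot_coordV /cot_coord /= yE; congr pair.
rewrite -mulmxA -trmx_mul tjacK ?trmx1 ?mulmx1//; exact: chart_atP.
Qed.

Lemma cot_coordV_dom i (a : E) : cot_codom i a -> dom i (cot_coordV i a).1.
Proof. by move=> ca; exact: (codom_chartP ca).1. Qed.

Lemma cot_coord_trans i j z : dom i z.1 -> dom j z.1 ->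
  cot_coord j z = (transition i j (cot_coord i z).1, (cot_coord i z).2 *m (tjac j i z.1)^T).
Proof.
move=> di dj; apply: injective_projections; first by rewrite /transition/= chartK.
rewrite /cot_coord/=; apply: esym.
apply: (@eq_trans _ _ (z.2 *m ((tjac i (chart_at A z.1) z.1)^T *m (tjac j i z.1)^T))).
  by rewrite mulmxA.
congr (z.2 *m _); apply: (@eq_trans _ _ (tjac j i z.1 *m tjac i (chart_at A z.1) z.1)^T).
  by rewrite trmx_mul.
by congr (_^T); apply: tjac_mul => //; exact: chart_atP.
Qed.

Lemma pairing_tjac i j x (p v : V) : dom i x -> dom j x ->
  pairing (p *m (tjac j i x)^T) (v *m tjac i j x) = pairing p v.
Proof. by move=> di dj; rewrite pairing_trmx -mulmxA tjacK// mulmx1. Qed.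

Lemma cot_coordV_continuous i (a : E) : cot_codom i a -> {for a, continuous (cot_coordV i)}.
Proof.
move=> ca U /=; rewrite nbhsE => -[W [oW Wa] WU].
apply: filterS (_ : nbhs a (cot_codom i `&` cot_coordV i @^-1` W)).
  by move=> b [_ /WU].
by apply: open_nbhs_nbhs; split=> //; exact: oW.
Qed.

Lemma cot_fst_continuous : continuous (fst : cotangent A -> M).
Proof.
move=> z U /=; rewrite nbhsE => -[W [oW Wz] WU].
apply: (@filterS _ (nbhs z) (nbhs_filter z) (fst @^-1` W)) => [w /WU//|].
apply: open_nbhs_nbhs; split=> //.
suff : cot_open (fst @^-1` W : set (cotangent A)) by [].
move=> i; rewrite openE => a [ca Wa].
have N1 : nbhs a (cot_codom i) by apply: open_nbhs_nbhs; split => //; exact: open_cot_codom.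
have N2 : nbhs a.1 (chartV i @^-1` W).
  by apply: chartV_nbhs => //; apply: open_nbhs_nbhs.
have N3 : nbhs a (fst @^-1` (chartV i @^-1` W)) by exact: (@cvg_fst _ _ (nbhs a.1) (nbhs a.2) _ _ N2).
by apply: filterS (filterI N1 N3) => b [].
Qed.

Lemma near_dom i z : dom i z.1 -> \forall w \near z, dom i w.1.
Proof.
move=> di; apply: (cot_fst_continuous (_ : nbhs z.1 (dom i))).
by apply: open_nbhs_nbhs; split=> //; exact: open_dom.
Qed.

Lemma transition_derive_continuous i j x (v : V) : dom i x -> dom j x ->
  {for chart i x, continuous ('D_v (transition i j))}.
Proof.
move=> di dj; have [/(_ _ (overlap_chart di dj)) [_]] := transition_C2 (c:=A) i j; exact.
Qed.

Lemma cvg_row (T : Type) (F : set_system T) {FF : Filter F} (f : T -> V) (v : V) :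
  (forall l, f t 0 l @[t --> F] --> v 0 l) -> f t @[t --> F] --> v.
Proof.
move=> fv; apply/cvgrPdist_le => e e0.
have H (l : 'I_n) : \forall t \near F, `|v 0 l - f t 0 l| <= e.
  by have /cvgrPdist_le := fv l; apply.
move/filter_forall: H; apply: filterS => t Ht.
by apply: row_norm_le => [|l]; [exact: ltW|rewrite !mxE].
Qed.

(** The fibre component of the change of chart is written with the derivatives of the inverse
    transition [transition i j], taken at the image point; their continuity is part of the C^2
    compatibility of the atlas. *)
Lemma cot_trans_continuous i j (a : E) : cot_codom j a -> dom i (chartV j a.1) ->
  {for a, continuous (fun b : E => cot_coord i (cot_coordV j b))}.
Proof.
move=> ca di; have [dj yE] := codom_chartP ca.
pose F (b : E) : E := (transition j i b.1,
  \row_l pairing b.2 ('D_(delta_mx 0 l) (transition i j) (transition j i b.1))).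
have EF (b : E) : overlap j i b.1 -> cot_coord i (cot_coordV j b) = F b.
  move=> /overlapP [cb dib]; have [djb bE] := codom_chartP cb.
  have b2E : cot_coord j (cot_coordV j b) = b by rewrite cot_coordVK.
  rewrite (@cot_coord_trans j i) ?b2E//= /F; congr pair.
  apply/rowP => l; rewrite [RHS]mxE -pairing_deltar pairing_trmx; congr (pairing _ _).
  rewrite /transition/= -(transition_derive _ dib djb)//.
have near_F : \forall b \near a, F b = cot_coord i (cot_coordV j b).
  have N : nbhs a.1 (overlap j i).
    by apply: open_nbhs_nbhs; split; [exact: open_overlap|apply/overlapP].
  have N' : nbhs a (fst @^-1` overlap j i) by exact: (@cvg_fst _ _ (nbhs a.1) (nbhs a.2) _ _ N).
  by apply: filterS N' => b /EF ->.
have Ea : cot_coord i (cot_coordV j a) = F a by apply: EF; apply/overlapP.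
suff h : (cot_coord i (cot_coordV j b)) @[b --> a] --> F a by move: h; rewrite -Ea.
apply: cvg_trans (near_eq_cvg near_F) _.
have c1 : transition j i b.1 @[b --> a] --> transition j i a.1.
  apply: (@cvg_comp _ _ _ fst (transition j i) _ (nbhs a.1)); first exact: cvg_fst.
  by rewrite -yE; apply: differentiable_continuous; exact: transition_differentiable.
suff c2 : (F b).2 @[b --> a] --> (F a).2 by exact: (cvg_pair c1 c2).
apply: cvg_row => l; rewrite [X in _ --> X]mxE.
under eq_fun do rewrite mxE.
apply: cvg_pairing; first exact: cvg_snd.
have c3 : {for chart i (chartV j a.1), continuous ('D_(delta_mx 0 l) (transition i j))}.
  exact: transition_derive_continuous.
exact: (@cvg_comp _ _ _ (fun b : E => transition j i b.1) _ (nbhs a) _ _ c1 c3).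
Qed.

Lemma cot_coord_continuous i z : dom i z.1 -> {for z, continuous (cot_coord i)}.
Proof.
move=> di U /=; rewrite nbhsE => -[W [oW Wz] WU].
pose W' : set (cotangent A) := [set w | dom i w.1 /\ W (cot_coord i w)].
apply: (@filterS _ (nbhs z) (nbhs_filter z) W') => [w [_ /WU//]|].
apply: open_nbhs_nbhs; split=> //.
suff : cot_open W' by [].
move=> j; rewrite openE => a [ca [da Wa]].
have N1 : nbhs a (cot_codom j) by apply: open_nbhs_nbhs; split => //; exact: open_cot_codom.
have N2 : nbhs a (cot_coordV j @^-1` [set w | dom i w.1]).
  by apply: cot_coordV_continuous => //; exact: near_dom.
have N3 : nbhs a [set b | W (cot_coord i (cot_coordV j b))].
  by apply: (cot_trans_continuous ca da); apply: open_nbhs_nbhs.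
by apply: filterS (filterI N1 (filterI N2 N3)) => b [h1 [h2 h3]].
Qed.

Lemma cluster_continuous (S T : topologicalType) (f : S -> T) (p q : S) :
  {for p, continuous f} -> {for q, continuous f} ->
  cluster (nbhs p) q -> cluster (nbhs (f p)) (f q).
Proof.
move=> fp fq pq U W /fp Up /fq Wq.
by have [t [Ut Wt]] := pq _ _ Up Wq; exists (f t).
Qed.

(** Points that cannot be separated have the same base, because M is Hausdorff; they are then
    compared in one chart. *)
Lemma cot_hausdorff : hausdorff_space M -> hausdorff_space (cotangent A).
Proof.
move=> hM p q pq.
have E1 : p.1 = q.1.
  by apply: hM; apply: (@cluster_continuous (cotangent A) M fst p q) => //; apply: cot_fst_continuous.
have dp : dom (chart_at A p.1) p.1 := chart_atP A p.1.
have dq : dom (chart_at A p.1) q.1 by rewrite -E1.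
apply: (@eq_trans _ _ _ _ (esym (cot_coordK dp))); apply: (@eq_trans _ _ _ _ _ (cot_coordK dq)).
apply: (f_equal (cot_coordV _)).
apply: norm_hausdorff; apply: cluster_continuous => //; exact: cot_coord_continuous.
Qed.

End CotangentCharts.

(** Limits along ultrafilters replace the extraction of subsequences. *)
Lemma ultra_fmap (S T : Type) (f : S -> T) (U : set_system S) :
  UltraFilter U -> UltraFilter (f @ U).
Proof.
move=> UU; have PU : ProperFilter U by exact: ultra_proper.
split; first exact: fmap_proper_filter.
move=> G PG UG; apply/seteqP; split=> // A GA.
have [//|UnA] := in_ultra_setVsetC (f @^-1` A) UU.
have GnA : G (~` A) by apply: UG.
have : G set0 by rewrite -(setICr A); exact: filterI.
by move/filter_not_empty.
Qed.

(** The limit of the Euler scheme is known only through quadratic bounds; these suffice to identify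
    its derivative. *)
Lemma quad_derive (R : realType) (W : normedModType R) (c : R -> W) (t : R) (v : W) (K : R) :
  (\forall s \near t, `|c s - c t - (s - t) *: v| <= K * (s - t) ^+ 2) ->
  is_derive t (1 : R) c v.
Proof.
move=> Hc; pose K' := Num.max K 1.
have K'0 : 0 < K' by rewrite lt_max ltr01 orbT.
suff C : h^-1 *: (c (h *: 1 + t) - c t) @[h --> (0 : R)^'] --> v.
  by apply: DeriveDef; [apply/cvg_ex; exists v|exact: cvg_lim C].
apply/cvgrPdist_le => e e0.
have N1 : \forall h \near (0 : R), `|c (h *: 1 + t) - c t - h *: v| <= K * h ^+ 2.
  move/nbhs_normP : Hc => [d /= d0 Hd]; apply/nbhs_normP; exists d => // h /=.
  rewrite sub0r normrN => hd; have := Hd (h + t).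
  by rewrite /= opprD addrCA subrr addr0 normrN [h *: 1]mulr1 addrK; apply.
have N2 : \forall h \near (0 : R), `|h| <= e / K'.
  by apply/nbhs_normP; exists (e / K') => /=; rewrite ?divr_gt0// => h /=; rewrite sub0r normrN => /ltW.
near=> h; have h0 : h != 0 by near: h; exact: nbhs_dnbhs_neq.
have -> : v - h^-1 *: (c (h *: 1 + t) - c t) = - (h^-1 *: (c (h *: 1 + t) - c t - h *: v)).
  by rewrite [in RHS]scalerBr scalerA mulVf// scale1r opprB.
have h1 : `|c (h *: 1 + t) - c t - h *: v| <= K * h ^+ 2 by near: h; exact: cvg_within N1.
have h2 : `|h| <= e / K' by near: h; exact: cvg_within N2.
have hp : 0 < `|h| by rewrite normr_gt0.
rewrite normrN normrZ normfV ler_pdivrMl//; apply: (le_trans h1).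
rewrite -(real_normK (num_real h)) expr2 mulrA [leRHS]mulrC ler_wpM2r//.
apply: (@le_trans _ _ (K' * `|h|)); first by rewrite ler_wpM2r// le_max lexx.
by rewrite mulrC -ler_pdivlMr.
Unshelve. all: by end_near. Qed.

(** * Local existence for ordinary differential equations *)

Section EulerScheme.
Variables (R : realType) (W : normedModType R) (X : W -> W) (a0 a : W) (rho B L T : R).
Let Q := [set b : W | `|b - a0| <= rho].
Hypothesis cptQ : compact Q.
Hypothesis XB : forall b, Q b -> `|X b| <= B.
Hypothesis XL : forall b c, Q b -> Q c -> `|X b - X c| <= L * `|b - c|.
Hypotheses (B0 : 0 <= B) (L0 : 0 <= L) (T0 : 0 < T).
Hypothesis aT : `|a - a0| + T * B <= rho.

Definition euler (h : R) (k : nat) : W := iter k (fun b => b + h *: X b) a.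

Lemma euler_dist h k : 0 <= h -> k%:R * h <= T -> `|euler h k - a| <= k%:R * h * B /\ Q (euler h k).
Proof.
move=> h0; suff H : k%:R * h <= T -> `|euler h k - a| <= k%:R * h * B.
  move=> kT; split; first exact: H.
  rewrite /Q/= -(subrK a (euler h k)) -addrA (le_trans (ler_normD _ _))//.
  apply: (le_trans _ aT); rewrite [leRHS]addrC; apply: lerD => //.
  by apply: (le_trans (H kT)); rewrite ler_wpM2r.
elim: k => [_|k IH kT]; first by rewrite mul0r mul0r subrr normr0.
have kT' : k%:R * h <= T by apply: le_trans kT; rewrite ler_wpM2r// ler_nat.
have Qk : Q (euler h k).
  rewrite /Q/= -(subrK a (euler h k)) -addrA (le_trans (ler_normD _ _))//.
  apply: (le_trans _ aT); rewrite [leRHS]addrC; apply: lerD => //.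
  by apply: (le_trans (IH kT')); rewrite ler_wpM2r.
rewrite /= addrAC (le_trans (ler_normD _ _))// -natr1 mulrDl mul1r mulrDl lerD//; first exact: IH.
by rewrite normrZ ger0_norm// ler_wpM2l// XB.
Qed.

Lemma euler_increment h k d : 0 <= h -> (k + d)%:R * h <= T ->
  `|euler h (k + d) - euler h k| <= d%:R * h * B.
Proof.
move=> h0; elim: d => [_|d IH kT]; first by rewrite addn0 subrr normr0 !mul0r.
have kT' : (k + d)%:R * h <= T by apply: le_trans kT; rewrite ler_wpM2r// ler_nat addnS.
rewrite addnS /= addrAC (le_trans (ler_normD _ _))// -natr1 mulrDl mul1r mulrDl lerD//; first exact: IH.
by rewrite normrZ ger0_norm// ler_wpM2l// XB//; case: (euler_dist h0 kT').
Qed.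

(** The bound depends on the elapsed time d h and not on the mesh, so it passes to the limit, where
    it determines the derivative. *)
Lemma euler_quad h k d : 0 <= h -> (k + d)%:R * h <= T ->
  `|euler h (k + d) - euler h k - (d%:R * h) *: X (euler h k)| <= L * B * (d%:R * h) ^+ 2.
Proof.
move=> h0; elim: d => [_|d IH kT].
  by rewrite addn0 subrr mul0r scale0r subr0 normr0 expr0n/= mulr0.
have kT' : (k + d)%:R * h <= T by apply: le_trans kT; rewrite ler_wpM2r// ler_nat addnS.
have kT'' : k%:R * h <= T by apply: le_trans kT; rewrite ler_wpM2r// ler_nat leq_addr.
have Q1 := (euler_dist h0 kT').2; have Q2 := (euler_dist h0 kT'').2.
rewrite addnS /= -natr1 mulrDl mul1r scalerDl.
have -> : forall p q r s t : W, p + q - r - (s + t) = (p - r - s) + (q - t).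
  by move=> p q r s t; rewrite opprD !addrA; congr (_ + _); rewrite -!addrA; congr (_ + _); rewrite addrC -!addrA.
rewrite -scalerBr (le_trans (ler_normD _ _))//.
have e1 := IH kT'; have e2 := XL Q1 Q2; have e3 := euler_increment h0 kT'.
have e4 : L * `|euler h (k + d) - euler h k| <= L * (d%:R * h * B) by rewrite ler_wpM2l.
have e5 := le_trans e2 e4.
rewrite normrZ (ger0_norm h0).
have e6 : h * `|X (euler h (k + d)) - X (euler h k)| <= h * (L * (d%:R * h * B)) by rewrite ler_wpM2l.
apply: le_trans (lerD e1 e6) _.
have LB0 : 0 <= L * B by exact: mulr_ge0.
have dd0 : 0 <= (d%:R : R) by [].
have -> : h * (L * (d%:R * h * B)) = L * B * (h * (d%:R * h)) by ring.
move: (L * B) (d%:R : R) LB0 dd0 => LB dd LB0 dd0.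
rewrite -mulrDr ler_wpM2l//; have : 0 <= h * (dd * h) by rewrite !mulr_ge0.
by have := sqr_ge0 h; rewrite !expr2; lra.
Qed.

(** At each time the polygons of mesh 1/(N+1) stay in the compact set Q, hence converge along one
    ultrafilter chosen once for all times; no equicontinuity is involved. *)
Lemma euler_limit : exists c : R -> W, c 0 = a /\
  forall s t, 0 <= s <= t -> t <= T ->
   [/\ Q (c s), `|c t - c s - (t - s) *: X (c s)| <= L * B * (t - s) ^+ 2
     & `|c t - c s| <= (t - s) * B].
Proof.
pose h (N : nat) : R := N.+1%:R^-1; have h0 N : 0 < h N by rewrite invr_gt0.
pose k (N : nat) (t : R) := Num.truncn (t / h N).
pose e N t := euler (h N) (k N t).
have kh N t : 0 <= t -> (k N t)%:R * h N <= t /\ t - h N <= (k N t)%:R * h N.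
  move=> t0; have t0' : 0 <= t / h N by rewrite divr_ge0// ltW.
  have /andP[h1 h2] := truncn_itv t0'; split; first by rewrite -ler_pdivlMr.
  by move/ltW: h2; rewrite ler_pdivrMr// -natr1 mulrDl mul1r lerBlDr.
have [U [UU UN]] := @ultraFilterLemma nat \oo _.
have cvU (t : R) : 0 <= t <= T -> exists b, Q b /\ e^~ t @ U --> b.
  move=> /andP[t0 tT].
  have UI : UltraFilter (e^~ t @ U) by exact: ultra_fmap.
  move: cptQ; rewrite compact_ultra => /(_ _ UI) []; last by move=> b [Qb cb]; exists b.
  apply: (@filterE _ U) => N; have [h1 _] := kh N t t0.
  exact: (euler_dist (ltW (h0 N)) (le_trans h1 tT)).2.
pose c t := xget a [set b | Q b /\ e^~ t @ U --> b].
have cP t : 0 <= t <= T -> Q (c t) /\ e^~ t @ U --> c t.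
  move=> tT; rewrite /c; case: xgetP => [b -> //|nob].
  by have [b hb] := cvU t tT; case: (nob b hb).
have FU : ProperFilter U by exact: ultra_proper.
have h_cvg : h @ U --> 0.
  by apply: cvg_trans (@cvg_harmonic R); exact: cvg_app.
exists c; split.
  have [|_ c0] := cP 0; first by rewrite lexx ltW.
  apply: (@cvg_unique _ (@norm_hausdorff _ W) (e^~ 0 @ U)) => //.
  have -> : e^~ 0 = (fun=> a) by apply/funext => N; rewrite /e /k mul0r truncn0.
  exact: cvg_cst.
move=> s t /andP[s0 st] tT.
have t0 := le_trans s0 st; have sT := le_trans st tT.
have [|Qs cs] := cP s; first by rewrite s0.
have [|Qt ct] := cP t; first by rewrite t0.
pose dt N := (k N t - k N s)%:R * h N.
have kst N : (k N s <= k N t)%N by apply: le_truncn; rewrite ler_wpM2r// invr_ge0 ltW.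
have dtE N : dt N = (k N t)%:R * h N - (k N s)%:R * h N by rewrite /dt natrB// mulrBl.
have dt_cvg : dt @ U --> t - s.
  have d1 (r : R) : 0 <= r -> (fun N => (k N r)%:R * h N) @ U --> r.
    move=> r0; apply/cvgrPdist_le => eps eps0.
    have /cvgrPdist_le/(_ eps eps0) := h_cvg; apply: filterS => N.
    rewrite sub0r normrN (ger0_norm (ltW (h0 N))) => hN.
    have [h1 h2] := kh N r r0; rewrite ger0_norm ?subr_ge0//; lra.
  have -> : dt = (fun N => (k N t)%:R * h N) \- (fun N => (k N s)%:R * h N).
    by apply/funext => N; rewrite dtE.
  by apply: cvgB; exact: d1.
have kT N : (k N s + (k N t - k N s))%:R * h N <= T.
  by rewrite subnKC//; exact: le_trans (kh N t t0).1 tT.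
have Xcs : (fun N => X (e N s)) @ U --> X (c s).
  apply/cvgrPdist_le => eps eps0; pose L' := L + 1.
  have L'0 : 0 < L' by rewrite ltr_wpDl.
  have /cvgrPdist_le/(_ (eps / L')) := cs; rewrite divr_gt0// => /(_ isT).
  apply: filterS => N hN.
  have Qe : Q (e N s) := (euler_dist (ltW (h0 N)) (le_trans (kh N s s0).1 sT)).2.
  apply: (le_trans (XL Qs Qe)); apply: (@le_trans _ _ (L' * `|c s - e N s|)).
    by rewrite ler_wpM2r// lerDl.
  by rewrite mulrC -ler_pdivlMr.
split=> //.
- have F1 : (fun N => `|e N t - e N s - dt N *: X (e N s)|) @ U --> `|c t - c s - (t - s) *: X (c s)|.
    by apply: cvg_norm; apply: cvgB; [exact: cvgB|exact: cvgZ].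
  have F2 : (fun N => L * B * (dt N) ^+ 2) @ U --> L * B * (t - s) ^+ 2.
    by apply: cvgM; [exact: cvg_cst|rewrite expr2; under eq_fun do rewrite expr2; exact: cvgM].
  apply: (ler_cvg_to F1 F2); apply: filterE => N.
  have := euler_quad (ltW (h0 N)) (kT N); rewrite subnKC//.
- have F1 : (fun N => `|e N t - e N s|) @ U --> `|c t - c s|.
    by apply: cvg_norm; exact: cvgB.
  have F2 : (fun N => dt N * B) @ U --> (t - s) * B.
    by apply: cvgM => //; exact: cvg_cst.
  apply: (ler_cvg_to F1 F2); apply: filterE => N.
  by have := euler_increment (ltW (h0 N)) (kT N); rewrite subnKC.
Qed.

End EulerScheme.

Lemma ode_local (R : realType) (W : normedModType R) (X : W -> W) (a0 a : W) (rho B L T : R) :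
  compact [set b : W | `|b - a0| <= rho] ->
  (forall b, `|b - a0| <= rho -> `|X b| <= B) ->
  (forall b c, `|b - a0| <= rho -> `|c - a0| <= rho -> `|X b - X c| <= L * `|b - c|) ->
  0 <= B -> 0 <= L -> 0 < T -> `|a - a0| + T * B <= rho ->
  exists c : R -> W, c 0 = a /\ forall t, `|t| < T ->
    `|c t - a0| <= rho /\ is_derive t (1 : R) c (X (c t)).
Proof.
move=> cQ XB XL B0 L0 T0 aT.
have [c [c0 Hc]] := euler_limit cQ XB XL B0 L0 T0 aT.
have [d [d0 Hd]] : exists c : R -> W, c 0 = a /\
  forall s t, 0 <= s <= t -> t <= T ->
   [/\ [set b : W | `|b - a0| <= rho] (c s), `|c t - c s - (t - s) *: (- X (c s))| <= L * B * (t - s) ^+ 2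
     & `|c t - c s| <= (t - s) * B].
  apply: (euler_limit (X := fun b => - X b)) => //.
    by move=> b Qb; rewrite normrN XB.
  by move=> b b' Qb Qb'; rewrite -opprD normrN XL.
have LB0 : 0 <= L * B by exact: mulr_ge0.
(* The one-sided estimate is extended to t < s by exchanging the two times; replacing Y (f t) by Y
   (f s) costs another L B (t - s)^2, whence the factor 2. *)
have two (Y : W -> W) (f : R -> W) :
    (forall b c, `|b - a0| <= rho -> `|c - a0| <= rho -> `|Y b - Y c| <= L * `|b - c|) ->
    (forall s t, 0 <= s <= t -> t <= T ->
      [/\ [set b : W | `|b - a0| <= rho] (f s), `|f t - f s - (t - s) *: Y (f s)| <= L * B * (t - s) ^+ 2
        & `|f t - f s| <= (t - s) * B]) ->
    forall s t, 0 <= s < T -> 0 <= t < T ->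
      `|f t - f s - (t - s) *: Y (f s)| <= 2 * (L * B) * (t - s) ^+ 2.
  move=> YL Hf s t /andP[s0 sT] /andP[t0 tT].
  have sq0 := sqr_ge0 (t - s); have [st|ts] := leP s t.
    have [||_ h _] := Hf s t; rewrite ?s0//; first exact: ltW.
    apply: (le_trans h); rewrite ler_wpM2r//; lra.
  have [||Qt h1 h2] := Hf t s; rewrite ?t0 ?(ltW ts) ?(ltW sT)//.
  have [||Qs _ _] := Hf s s; rewrite ?s0 ?lexx ?(ltW sT)//.
  have -> : f t - f s - (t - s) *: Y (f s) =
     - (f s - f t - (s - t) *: Y (f t)) + (s - t) *: (Y (f s) - Y (f t)).
    have -> : (t - s) *: Y (f s) = - ((s - t) *: Y (f s)) by rewrite -scaleNr opprB.
    by rewrite opprK scalerBr !opprB [RHS]addrC addrA subrK addrC.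
  have st0 : 0 <= s - t by rewrite subr_ge0 ltW.
  apply: (le_trans (ler_normD _ _)); rewrite normrN normrZ (ger0_norm st0).
  have e1 := YL _ _ Qs Qt.
  have e2 : L * `|f s - f t| <= L * ((s - t) * B) by rewrite ler_wpM2l.
  have e3 : (s - t) * `|Y (f s) - Y (f t)| <= (s - t) * (L * ((s - t) * B)).
    by rewrite ler_wpM2l// (le_trans e1).
  apply: (le_trans (lerD h1 e3)); rewrite le_eqVlt; apply/orP; left; apply/eqP; ring.
(* Backward in time the solution is the forward solution for the opposite field. *)
pose f t := if 0 <= t then c t else d (- t).
have f0 : f 0 = a by rewrite /f lexx.
have fN t : t <= 0 -> f t = d (- t).
  rewrite /f; have [t0 t0'|//] := leP 0 t; have -> : t = 0 by lra.
  by rewrite oppr0 c0 d0.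
exists f; split=> // t tT.
have Qf s : `|s| < T -> `|f s - a0| <= rho.
  rewrite ltr_norml => /andP[sT1 sT2]; rewrite /f; have [s0|s0] := leP 0 s.
    by have [||] := Hc s s; rewrite ?s0 ?lexx ?(ltW sT2).
  by have [||] := Hd (- s) (- s); rewrite ?lexx ?andbT; lra || by [].
split; first exact: Qf.
move: (tT); rewrite ltr_norml => /andP[tT1 tT2].
have XL2 : forall b c, `|b - a0| <= rho -> `|c - a0| <= rho -> `|- X b - - X c| <= L * `|b - c|.
  by move=> b b' Qb Qb'; rewrite -opprD normrN XL.
have est1 s t' : 0 <= s < T -> 0 <= t' < T -> `|f s - f t' - (s - t') *: X (f t')| <= 2 * (L * B) * (s - t') ^+ 2.
  move=> hs ht; have := two X c XL Hc t' s ht hs.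
  by rewrite /f; case/andP: hs => -> _; case/andP: ht => -> _.
have est2 s t' : - T < s <= 0 -> - T < t' <= 0 ->
    `|f s - f t' - (s - t') *: X (f t')| <= 2 * (L * B) * (s - t') ^+ 2.
  move=> /andP[hs1 hs2] /andP[ht1 ht2].
  have := two (fun b => - X b) d XL2 Hd (- t') (- s); rewrite -!fN//.
  have -> : - s - - t' = - (s - t') by rewrite opprD.
  rewrite sqrrN scalerN scaleNr opprK => h.
  apply: h; apply/andP; split; lra.
apply: (@quad_derive _ _ _ _ _ (2 * (L * B))).
have [t0|t0|t0] := ltgtP t 0.
- have : \forall s \near t, - T < s < 0.
    by near=> s; apply/andP; split; near: s; [exact: lt_nbhsr|exact: lt_nbhsl].
  by apply: filterS => s /andP[s1 s2]; apply: est2; rewrite ?s1 ?tT1 ?ltW.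
- have : \forall s \near t, 0 < s < T.
    by near=> s; apply/andP; split; near: s; [exact: lt_nbhsr|exact: lt_nbhsl].
  by apply: filterS => s /andP[s1 s2]; apply: est1; rewrite ?s2 ?tT2 ?ltW.
- have : \forall s \near t, - T < s < T.
    by near=> s; apply/andP; split; near: s; [exact: lt_nbhsr|exact: lt_nbhsl].
  apply: filterS => s /andP[s1 s2]; have [s0|/ltW s0] := leP 0 s.
    by apply: est1; rewrite ?s0 ?t0 ?lexx.
  by apply: est2; rewrite ?s0 ?s1 ?t0 ?lexx ?oppr_lt0 ?T0.
Unshelve. all: by end_near. Qed.

(** * Absolutely continuous functions and their variation *)

Section AbsoluteContinuity.
Variable R : realType.
Implicit Types (f g : R -> R) (a b c m : R).

(** The index is an arbitrary finite type, so that a family can be enlarged by one interval (sum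
    type) or refined interval by interval (sigma type). Degenerate intervals are allowed. *)
Definition family (I : finType) (x y : I -> R) a b : Prop :=
  (forall k, [/\ a <= x k, x k <= y k & y k <= b]) /\
  (forall k l t, x k < t < y k -> x l < t < y l -> k = l).

Definition vsum f (I : finType) (x y : I -> R) : R := \sum_k `|f (y k) - f (x k)|.

Definition ac f a b : Prop := forall e : R, 0 < e -> exists2 d : R, 0 < d &
  forall (I : finType) (x y : I -> R), family x y a b ->
    \sum_k (y k - x k) < d -> vsum f x y < e.

Lemma abs_continuous_on_ac n (F : R -> 'rV[R]_n) a b j :
  abs_continuous_on F a b -> ac (fun t => F t 0 j) a b.
Proof.
move=> HF e e0; have [d d0 Hd] := HF e e0; exists d => // I x y [xy dis] sd.
have reI (G : I -> R) : \sum_k G k = \sum_(k < #|I|) G (enum_val k).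
  by rewrite -[RHS](big_enum_val G); apply: eq_bigl => i; rewrite inE.
apply: (@le_lt_trans _ _ (\sum_(k < #|I|) `|F (y (enum_val k)) - F (x (enum_val k))|)).
  rewrite /vsum reI; apply: ler_sum => k _.
  by have := row_norm_ge (F (y (enum_val k)) - F (x (enum_val k))) j; rewrite !mxE.
apply: (Hd _ (fun k => x (enum_val k)) (fun k => y (enum_val k))) => //.
  move=> k l _ _ [t []]; rewrite /= !in_itv/= => h1 h2.
  by apply: enum_val_inj; exact: (dis _ _ t).
by move: sd; rewrite (reI (fun k => y k - x k)); exact.
Qed.

(** Disjointness is turned into a bound on lengths by the additivity of Lebesgue measure. *)
Lemma family_length (I : finType) (x y : I -> R) a b : a <= b -> family x y a b ->
  \sum_k (y k - x k) <= b - a.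
Proof.
move=> ab [xy dis]; pose mu : {measure set (measurableTypeR R) -> \bar R} := @lebesgue_measure R.
have muE k : @lebesgue_measure R `]x k, y k[%classic = (y k - x k)%:E.
  have [_ xyk _] := xy k; rewrite lebesgue_measure_itv/= lte_fin.
  case: ltP => [_ //|yx].
  by have /eqP -> : y k == x k; [rewrite eq_le yx xyk|rewrite subrr].
have setTE : [set: I] = [set` index_enum I].
  by apply/seteqP; split=> k // _; rewrite /= mem_index_enum.
have E : (\sum_k (y k - x k))%:E = mu (\bigcup_(k in [set: I]) `]x k, y k[%classic).
  rewrite measure_fin_bigcup//=.
  - rewrite setTE -fsbig_seq ?index_enum_uniq// -sumEFin.
    by apply: eq_bigr => k _; exact: esym (muE k).
  - move=> k l _ _ [t []]; rewrite /= !in_itv/= => h1 h2; exact: (dis _ _ t).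
rewrite -lee_fin E (_ : (b - a)%:E = @lebesgue_measure R `[a, b]%classic); last first.
  rewrite lebesgue_measure_itv/= lte_fin; case: ltP => [_ //|ba].
  by have /eqP -> : b == a; [rewrite eq_le ba ab|rewrite subrr].
apply: le_measure; rewrite ?inE//; first by apply: fin_bigcup_measurable.
move=> t [k _]; rewrite /= !in_itv/= => /andP[h1 h2]; have [h3 _ h4] := xy k.
by rewrite (le_trans h3 (ltW h1)) (le_trans (ltW h2) h4).
Qed.

(** Clipping at m sends the intervals beyond m to degenerate ones, so that, together with
    [family_max], a family splits into one on each side of m. *)
Lemma family_min (I : finType) (x y : I -> R) a b m : a <= m -> family x y a b ->
  family (fun k => Num.min (x k) m) (fun k => Num.min (y k) m) a m.
Proof.
move=> am [xy dis]; split=> [k|k l t].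
  have [h1 h2 h3] := xy k; split.
  - by rewrite le_min h1.
  - by rewrite le_min !ge_min h2 lexx orbT.
  - by rewrite ge_min lexx orbT.
have cl (u v : R) : Num.min u m < t < Num.min v m -> u < t < v.
  by rewrite lt_min gt_min => /andP[/orP[->|mt] /andP[-> tm]//]; have := lt_trans mt tm; rewrite ltxx.
by move=> /cl h1 /cl h2; exact: (dis _ _ t).
Qed.

Lemma family_max (I : finType) (x y : I -> R) a b m : m <= b -> family x y a b ->
  family (fun k => Num.max (x k) m) (fun k => Num.max (y k) m) m b.
Proof.
move=> mb [xy dis]; split=> [k|k l t].
  have [h1 h2 h3] := xy k; split.
  - by rewrite le_max lexx orbT.
  - by rewrite ge_max !le_max h2 lexx orbT.
  - by rewrite ge_max h3.
have cl (u v : R) : Num.max u m < t < Num.max v m -> u < t < v.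
  rewrite gt_max lt_max => /andP[/andP[-> mt] /orP[->//|tm]].
  by have := lt_trans mt tm; rewrite ltxx.
by move=> /cl h1 /cl h2; exact: (dis _ _ t).
Qed.

Lemma vsum_split f (I : finType) (x y : I -> R) m : (forall k, x k <= y k) ->
  vsum f x y <= vsum f (fun k => Num.min (x k) m) (fun k => Num.min (y k) m)
              + vsum f (fun k => Num.max (x k) m) (fun k => Num.max (y k) m).
Proof.
move=> xy; rewrite /vsum -big_split/=; apply: ler_sum => k _; have := xy k => xyk.
have [ym|my] := leP (y k) m.
  by rewrite (min_l (le_trans xyk ym)) lerDl.
have [xm|mx] := leP (x k) m.
  have -> : f (y k) - f (x k) = (f m - f (x k)) + (f (y k) - f m) by ring.
  exact: ler_normD.
by rewrite subrr normr0 add0r.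
Qed.

Definition vars f a b : set R :=
  [set v | exists (I : finType) (x y : I -> R), family x y a b /\ v = vsum f x y].

(** The total variation. For an absolutely continuous f it is finite, and it yields f as a
    difference of two nondecreasing functions. *)
Definition V f a b : R := sup (vars f a b).

Lemma vars0 f a b : vars f a b 0.
Proof.
exists 'I_0, (fun=> 0), (fun=> 0); split; first by split=> [[]//|[]//].
by rewrite /vsum big_ord0.
Qed.

(** An interval shorter than the d attached to 1 carries variation at most 1; the induction cuts off
    pieces of length d / 2 from the right. *)
Lemma vars_bounded f a b : ac f a b -> a <= b ->
  forall c, a <= c <= b -> has_sup (vars f a c).
Proof.
move=> fac ab; have [d d0 Hd] := fac 1 ltr01.
have fam_widen (I : finType) (x y : I -> R) u v : a <= u -> v <= b -> family x y u v -> family x y a b.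
  by move=> au vb [xy dis]; split=> // k; have [h1 h2 h3] := xy k; split=> //; [exact: le_trans h1|exact: le_trans vb].
have H (N : nat) : forall c, a <= c <= b -> c - a <= N%:R * (d / 2) ->
    forall v, vars f a c v -> v <= N%:R.
  elim: N => [|N IH] c /andP[ac cb] cN v [I [x [y [xyf ->]]]].
    have ca : c = a by apply/eqP; rewrite eq_le ac andbT -subr_le0 (le_trans cN)// mul0r.
    rewrite /vsum big1// => k _; have [h1 h2 h3] := xyf.1 k.
    have -> : x k = a by apply/eqP; rewrite eq_le h1 andbT (le_trans h2)// -ca.
    have -> : y k = a by apply/eqP; rewrite eq_le (le_trans h1 h2) andbT -ca.
    by rewrite subrr normr0.
  pose m := Num.max a (c - d / 2).
  have am : a <= m by rewrite le_max lexx.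
  have mc : m <= c by rewrite ge_max ac gerBl divr_ge0// ltW.
  apply: (le_trans (vsum_split f m _)); first by move=> k; have [] := xyf.1 k.
  rewrite -natr1; apply: lerD.
    apply: (IH m); rewrite ?am ?(le_trans mc)//.
      have N0 : 0 <= N%:R * (d / 2) by rewrite mulr_ge0// divr_ge0// ltW.
      rewrite -natr1 mulrDl mul1r in cN; rewrite /m maxEle; case: ifP => _; lra.
    by do 3 eexists; split; first exact: (family_min am xyf).
  have F2 := family_max mc xyf.
  apply: ltW; apply: (Hd _ _ _ (fam_widen _ _ _ _ _ am cb F2)).
  apply: le_lt_trans (family_length mc F2) _.
  have : c - d / 2 <= m by rewrite le_max lexx orbT.
  lra.
move=> c acb; split; first by exists 0; exact: vars0.
pose N := Num.truncn ((c - a) / (d / 2)).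
exists N.+1%:R => v; apply: H => //.
have d20 : 0 < d / 2 by rewrite divr_gt0.
by rewrite -ler_pdivrMr// ltW// truncnS_gt.
Qed.

Lemma V_ge0 f a b c : ac f a b -> a <= c <= b -> 0 <= V f a c.
Proof.
move=> fac acb; have ab : a <= b by case/andP: acb => h1 h2; exact: le_trans h2.
by apply: ub_le_sup; [exact: (vars_bounded fac ab acb).2|exact: vars0].
Qed.

Lemma ac_sub f a b u v : a <= u -> v <= b -> ac f a b -> ac f u v.
Proof.
move=> au vb fac e e0; have [d d0 Hd] := fac e e0; exists d => // I x y [xy dis].
by apply: Hd; split=> // k; have [h1 h2 h3] := xy k; split=> //; [exact: le_trans h1|exact: le_trans vb].
Qed.

Lemma V_triangle f a b m c : ac f a b -> a <= m -> m <= c -> c <= b ->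
  V f a c <= V f a m + V f m c.
Proof.
move=> fac am mc cb; have ab : a <= b by exact: le_trans (le_trans am mc) cb.
apply: sup_le_ub; first by exists 0; exact: vars0.
move=> v [I [x [y [xyf ->]]]].
apply: (le_trans (vsum_split f m _)); first by move=> k; have [] := xyf.1 k.
apply: lerD; apply: ub_le_sup.
- by have [] := vars_bounded fac ab (_ : a <= m <= b); rewrite ?am ?(le_trans mc).
- by do 3 eexists; split; first exact: (family_min am xyf).
- have [] := vars_bounded (ac_sub am cb fac) mc (_ : m <= c <= c); by rewrite ?mc ?lexx.
- by do 3 eexists; split; first exact: (family_max mc xyf).
Qed.

Lemma V_increment f a b m c : ac f a b -> a <= m -> m <= c -> c <= b ->
  V f a m + `|f c - f m| <= V f a c.
Proof.
move=> fac am mc cb; have ab : a <= b by exact: le_trans (le_trans am mc) cb.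
rewrite -lerBrDr; apply: sup_le_ub; first by exists 0; exact: vars0.
move=> v [I [x [y [[xy dis] ->]]]]; rewrite lerBrDr.
apply: ub_le_sup; first by have [] := vars_bounded fac ab (_ : a <= c <= b); rewrite ?cb ?(le_trans am).
exists (I + unit)%type, (fun o => if o is inl k then x k else m), (fun o => if o is inl k then y k else c).
split.
  split=> [[k|[]]//|]; first by have [h1 h2 h3] := xy k; split=> //; exact: le_trans mc.
  have ex k t : x k < t < y k -> m < t < c -> False.
    by move=> /andP[_ h1] /andP[h2 _]; have [_ _ h3] := xy k; have := lt_le_trans (lt_trans h2 h1) h3; rewrite ltxx.
  move=> [k|[]] [l|[]] t// h1 h2; first by congr inl; exact: (dis _ _ t).
    by case: (ex k t).
  by case: (ex l t).
by rewrite /vsum big_sumType/= [X in _ = _ + X](big_pred1 tt) => [|[]].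
Qed.

(** On each interval of a family, V increases by nearly the variation of f over some finer family;
    these refinements together form one family of no greater length, to which the absolute
    continuity of f applies. *)
Lemma ac_V f a b : ac f a b -> a <= b -> ac (V f a) a b.
Proof.
move=> fac ab e e0; have e20 : 0 < e / 2 by rewrite divr_gt0.
have [d d0 Hd] := fac _ e20; exists d => // I x y [xy dis] sd.
(* [eta] shares e / 2 among the intervals; the successor keeps it positive when there are none. *)
pose eta := e / 2 / (#|I|.+1)%:R; have eta0 : 0 < eta by rewrite divr_gt0.
have ex k : exists (J : finType) (p : (J -> R) * (J -> R)),
    family p.1 p.2 (x k) (y k) /\ V f (x k) (y k) - eta < vsum f p.1 p.2.
  have [h1 h2 h3] := xy k.
  have hs : has_sup (vars f (x k) (y k)).
    by apply: (vars_bounded (ac_sub h1 h3 fac)); rewrite ?h2 ?lexx.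
  by have [_ [J [u [v [uvf ->]]]] h] := sup_adherent eta0 hs; exists J, (u, v).
pose J k : finType := sval (cid (ex k)).
have ex2 k : exists p : (J k -> R) * (J k -> R),
    family p.1 p.2 (x k) (y k) /\ V f (x k) (y k) - eta < vsum f p.1 p.2 by exact: svalP (cid (ex k)).
pose P k := sval (cid (ex2 k)).
have PF k : family (P k).1 (P k).2 (x k) (y k) := (svalP (cid (ex2 k))).1.
have PV k : V f (x k) (y k) - eta < vsum f (P k).1 (P k).2 := (svalP (cid (ex2 k))).2.
pose K : finType := {k : I & J k}.
pose u (q : K) := (P (tag q)).1 (tagged q); pose v (q : K) := (P (tag q)).2 (tagged q).
have Fuv : family u v a b.
  split=> [[k j]|[k j] [l i] t]; rewrite /u /v/=.
    have [h1 h2 h3] := xy k; have [h4 h5 h6] := (PF k).1 j.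
    by split=> //; [exact: le_trans h4|exact: le_trans h3].
  move=> h1 h2.
  have kl : k = l.
    apply: (dis _ _ t).
      have [h4 _ h6] := (PF k).1 j; case/andP: h1 => h7 h8.
      by rewrite (le_lt_trans h4 h7) (lt_le_trans h8 h6).
    have [h4 _ h6] := (PF l).1 i; case/andP: h2 => h7 h8.
    by rewrite (le_lt_trans h4 h7) (lt_le_trans h8 h6).
  case: _ / kl i h2 => i h2; congr existT; exact: ((PF k).2 _ _ t).
have sumK (F : forall k, J k -> R) : \sum_k \sum_(j : J k) F k j = \sum_(q : K) F (tag q) (tagged q).
  by rewrite sig_big_dep.
have sK : \sum_(q : K) (v q - u q) < d.
  rewrite -(sumK (fun k j => (P k).2 j - (P k).1 j)); apply: le_lt_trans sd.
  by apply: ler_sum => k _; have [_ h _] := xy k; exact: family_length h (PF k).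
have := Hd _ _ _ Fuv sK; rewrite /vsum -(sumK (fun k j => `|f ((P k).2 j) - f ((P k).1 j)|)) => h.
have : \sum_k `|V f a (y k) - V f a (x k)| <= \sum_k (vsum f (P k).1 (P k).2 + eta).
  apply: ler_sum => k _; have [h1 h2 h3] := xy k.
  rewrite ger0_norm; last first.
    by rewrite subr_ge0 (le_trans _ (V_increment fac h1 h2 h3))// lerDl.
  rewrite lerBlDl (le_trans (V_triangle fac h1 h2 h3))// lerD2l.
  by rewrite -lerBlDr ltW.
rewrite big_split/= sumr_const => h'; apply: (le_lt_trans h').
have : eta *+ #|I| <= e / 2.
  rewrite /eta -mulr_natr -mulrA ger_pMr// mulrC ler_pdivrMr// mul1r ler_nat.
  by rewrite cardE leqnSn.
rewrite /vsum in h *; move: h; set S := \sum_k _; move=> h; lra.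
Qed.

End AbsoluteContinuity.

Lemma derive1_is_derive (R : realType) (F : R -> R) (x v : R) :
  derivable F x 1 -> derive1 F x = v -> is_derive x (1 : R) F v.
Proof. by move=> dF <-; rewrite derive1E; exact: derivableP. Qed.

(** * The fundamental theorem of calculus for absolutely continuous functions *)

Section MonotoneFTC.
Variable R : realType.
Local Notation leb := (@lebesgue_measure R).

(** The projection on [a, b]. Composing with it extends a function from [a, b] to the whole line by
    constants, as a Stieltjes measure requires. *)
Definition clip (a b t : R) : R := Num.max a (Num.min b t).

Lemma clip_itv (a b t : R) : a <= b -> a <= clip a b t <= b.
Proof. by move=> ab; rewrite /clip le_max lexx/= ge_max ab ge_min lexx. Qed.

Lemma clip_id (a b t : R) : a <= t <= b -> clip a b t = t.
Proof. by move=> /andP[h1 h2]; rewrite /clip (min_r h2) max_r. Qed.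

Lemma clip_homo (a b s t : R) : s <= t -> clip a b s <= clip a b t.
Proof.
move=> st; rewrite /clip ge_max le_max lexx/= le_max; apply/orP; right.
by rewrite le_min ge_min lexx/= ge_min st orbT.
Qed.

Lemma clip_lip (a b s t : R) : a <= b -> s <= t -> clip a b t - clip a b s <= t - s.
Proof. by move=> ab st; rewrite /clip !maxEle !minEle; repeat case: ifPn; rewrite -?ltNge => *; lra. Qed.

Lemma ac_pair (f : R -> R) a b : ac f a b -> forall e : R, 0 < e -> exists2 d : R, 0 < d &
  forall u v, a <= u -> u <= v -> v <= b -> v - u < d -> `|f v - f u| < e.
Proof.
move=> fac e e0; have [d d0 Hd] := fac e e0; exists d => // u v au uv vb vu.
have := Hd 'I_1 (fun=> u) (fun=> v); rewrite /vsum !big_ord1; apply=> //.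
by split=> // k l t _ _; rewrite (ord1 k) (ord1 l).
Qed.

Section Monotone.
Variables (g : R -> R) (a b : R).
Hypotheses (ab : a < b) (gnd : {homo g : x y / x <= y}) (gac : ac g a b).
Hypothesis gcl : forall t, g t = g (clip a b t).

Lemma mono_continuous : continuous g.
Proof.
move=> t; apply/cvgrPdist_lt => e e0; have [d d0 Hd] := ac_pair gac e0.
have ab' := ltW ab.
have N : \forall s \near t, `|t - s| < d by apply/nbhs_normP; exists d.
apply: filterS N => s sd; rewrite (gcl t) (gcl s).
have [h1 h2] := andP (clip_itv s ab'); have [h3 h4] := andP (clip_itv t ab').
have [st|/ltW ts] := leP s t.
  apply: Hd => //; first exact: clip_homo.
  by apply: le_lt_trans (clip_lip ab' st) _; rewrite -[t - s]ger0_norm// subr_ge0.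
rewrite distrC; apply: Hd => //; first exact: clip_homo.
by apply: le_lt_trans (clip_lip ab' ts) _; rewrite -[s - t]ger0_norm ?subr_ge0// distrC.
Qed.

Lemma mono_rc : right_continuous g.
Proof. exact: right_continuousW mono_continuous. Qed.

Let gc : cumulative R R := HB.pack g (isCumulative.Build R _ R g gnd mono_rc).
Let mug := lebesgue_stieltjes_measure gc.

Lemma stieltjes_ocitv (x y : R) : x <= y -> mug `]x, y]%classic = (g y - g x)%:E.
Proof.
move=> xy; rewrite /mug /lebesgue_stieltjes_measure /measure_extension.
by rewrite measurable_mu_extE/=; [rewrite wlength_itv_bnd|exact: is_ocitv].
Qed.

(** Outer regularity encloses B in an open set of Lebesgue measure below d. Its disjoint intervals
    form families of length below d, so absolute continuity bounds their Stieltjes mass by e. *)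
Lemma mono_null (B : set (measurableTypeR R)) : measurable B -> leb B = 0%E ->
  B `<=` `]a, b]%classic -> mug B = 0%E.
Proof.
move=> mB B0 Bab; apply/eqP; rewrite eq_le measure_ge0 andbT.
apply/lee_addgt0Pr => e e0; rewrite add0e.
have [d d0 Hd] := gac e0.
have B_fin : (leb B < +oo)%E by rewrite B0 ltry.
have [U [oU BU Ud]] := lebesgue_regularity_outer mB B_fin d0.
(* Intersecting with a bounded interval makes the infimum and the supremum of each component
   meaningful. *)
pose W := U `&` `]a - 1, b + 1[%classic.
have oW : open W by apply: openI => //; exact: interval_open.
have BW : B `<=` W.
  move=> t Bt; split; first exact: BU.
  have := Bab t Bt; rewrite /= !in_itv/= => /andP[h1 h2]; apply/andP; split; lra.
have Wd : (leb W < d%:E)%E.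
  apply: le_lt_trans Ud.
  apply: (@le_trans _ _ (leb (U `\` B) + leb B)%E); last by rewrite B0 adde0.
  have mU := open_measurable oU; have mW := open_measurable oW.
  apply: (@le_trans _ _ (leb ((U `\` B) `|` B))).
    apply: le_measure; rewrite ?inE//; first by apply: measurableU => //; exact: measurableD.
    by move=> t [Ut _]; have [Bt|nBt] := pselect (B t); [right|left].
  by apply: measureU2 => //; exact: measurableD.
have [I [oiI tI WI]] := OpenSetDisjointItvs.open_disjoint_itv oW.
have oI q : open (I q) := (oiI q).1.
have mI q : measurable (I q : set (measurableTypeR R)) by exact: open_measurable.
have IW q : I q `<=` `]a - 1, b + 1[%classic by move=> t It; have [] : W t by rewrite WI; exists q.
pose x q := inf (I q); pose y q := sup (I q).
have bnd q : I q !=set0 -> has_inf (I q) /\ has_sup (I q).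
  move=> I0; split; split=> //; [exists (a - 1)|exists (b + 1)] => t /IW;
    rewrite /= in_itv/= => /andP[/ltW h1 /ltW h2]//.
have xyI q t : I q !=set0 -> x q < t < y q -> I q t.
  move=> I0 /andP[xt ty]; have [hi hs] := bnd q I0.
  have [u Iu ut] : exists2 u, I q u & u < t.
    have pos : 0 < t - x q by rewrite subr_gt0.
    have [u Iu hu] := inf_adherent pos hi.
    by exists u => //; move: hu; rewrite /x addrC subrK.
  have [v Iv tv] : exists2 v, I q v & t < v.
    have pos : 0 < y q - t by rewrite subr_gt0.
    have [v Iv hv] := sup_adherent pos hs.
    by exists v => //; move: hv; rewrite /y opprB addrC subrK.
  by apply: ((oiI q).2 _ _ Iu Iv); rewrite !ltW.
have Ixy q t : I q t -> x q < t < y q.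
  move=> It; have [hi hs] := bnd q (ex_intro _ t It).
  have /nbhs_normP[r /= r0 Hr] : nbhs t (I q) by apply: open_nbhs_nbhs.
  have r2 : 0 < r / 2 by rewrite divr_gt0.
  have I1 : I q (t - r / 2).
    by apply: Hr; rewrite /= opprB addrC subrK ger0_norm ?ltW// ltr_pdivrMr// ltr_pMr// ltr1n.
  have I2 : I q (t + r / 2).
    by apply: Hr; rewrite /= opprD addrA subrr add0r normrN ger0_norm ?ltW// ltr_pdivrMr// ltr_pMr// ltr1n.
  have := ge_inf hi.2 I1; have := ub_le_sup hs.2 I2; rewrite -/(x q) -/(y q) => h1 h2.
  apply/andP; split; lra.
(* the empty members of the family are replaced by degenerate intervals *)
pose x' q := if pselect (I q !=set0) then x q else a.
pose y' q := if pselect (I q !=set0) then y q else a.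
have x'y' q : x' q <= y' q.
  rewrite /x' /y'; case: pselect => // -[t It].
  by have /andP[h1 h2] := Ixy q t It; rewrite ltW// (lt_trans h1).
have I'I q t : x' q < t < y' q -> I q t.
  rewrite /x' /y'; case: pselect => /= [I0|_]; first exact: xyI.
  by move=> /andP[h1 h2]; have := lt_trans h1 h2; rewrite ltxx.
have II' q t : I q t -> x' q < t < y' q.
  by move=> It; rewrite /x' /y'; case: pselect => /= [I0|nI]; [exact: Ixy|case: nI; exists t].
have ab' := ltW ab.
have mW (mu : {measure set (measurableTypeR R) -> \bar R}) : mu W = (\sum_(i <oo) mu (I i))%E.
  by rewrite WI measure_semi_bigcup// -WI; exact: open_measurable.
have fin_bound N : \sum_(k < N) (g (y' k) - g (x' k)) <= e.
  pose u (k : 'I_N) := clip a b (x' k); pose v (k : 'I_N) := clip a b (y' k).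
  have Fuv : family u v a b.
    split=> [k|k l t h1 h2].
      by have /andP[h1 _] := clip_itv (x' k) ab'; have /andP[_ h2] := clip_itv (y' k) ab'; split=> //; exact: clip_homo.
    have cl (p q : R) : clip a b p < t < clip a b q -> p < t < q.
      move=> /andP[h3 h4].
      have /andP[h5 _] := clip_itv p ab'; have /andP[_ h6] := clip_itv q ab'.
      have tab : a <= t <= b by rewrite (le_trans h5 (ltW h3)) (le_trans (ltW h4) h6).
      apply/andP; split; rewrite ltNge; apply/negP => hh.
        by move: (clip_homo a b hh); rewrite (clip_id tab) => /(lt_le_trans h3); rewrite ltxx.
      by move: (clip_homo a b hh); rewrite (clip_id tab) => /(lt_le_trans h4); rewrite ltxx.
    have I1 := I'I _ _ (cl _ _ h1); have I2 := I'I _ _ (cl _ _ h2).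
    by apply: val_inj; apply: (tI _ _ Logic.I Logic.I); exists t.
  have sl : \sum_k (v k - u k) < d.
    apply: (@le_lt_trans _ _ (\sum_(k < N) (y' k - x' k))).
      by apply: ler_sum => k _; exact: clip_lip.
    rewrite -lte_fin; apply: le_lt_trans Wd; rewrite -sumEFin.
    apply: (@le_trans _ _ (\sum_(k < N) leb (I k))%E).
      apply: lee_sum => k _; have -> : (y' k - x' k)%:E = leb `]x' k, y' k[%classic.
        rewrite lebesgue_measure_itv/= lte_fin; case: ltP => [_ //|yx].
        by have /eqP -> : y' k == x' k; [rewrite eq_le yx x'y'|rewrite subrr].
      apply: le_measure; rewrite ?inE//.
      by move=> t; rewrite /= in_itv/=; exact: I'I.
    rewrite -(@big_mkord _ _ _ _ xpredT (fun k => leb (I k))).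
    by rewrite (mW leb); exact: nneseries_lim_ge.
  have := Hd _ _ _ Fuv sl; move/ltW; apply: le_trans; rewrite /vsum.
  by apply: ler_sum => k _; rewrite (gcl (y' k)) (gcl (x' k)); exact: ler_norm.
have muI q : (mug (I q) <= (g (y' q) - g (x' q))%:E)%E.
  rewrite -stieltjes_ocitv//; apply: le_measure; rewrite ?inE//.
  by move=> t /II' /andP[h1 h2]; rewrite /= in_itv/= h1 ltW.
apply: (@le_trans _ _ (mug W)).
  by apply: le_measure; rewrite ?inE//; exact: open_measurable.
have -> : mug W = (\sum_(i <oo) mug (I i))%E := mW mug.
apply: lime_le; first exact: is_cvg_nneseries.
apply: nearW => N; apply: (@le_trans _ _ (\sum_(0 <= k < N) (g (y' k) - g (x' k))%:E)%E).
  by apply: lee_sum => k _; exact: muI.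
by rewrite sumEFin lee_fin big_mkord; exact: fin_bound.
Qed.

(** Absolute continuity of g makes its Stieltjes measure on ]a, b] absolutely continuous with
    respect to Lebesgue measure; rho is the Radon-Nikodym density, and Lebesgue differentiation
    recovers it as the derivative. *)
Lemma mono_FTC : exists rho : R -> R, [/\ leb.-integrable setT (EFin \o rho),
    forall x, a <= x <= b -> (\int[leb]_(t in `]a, x]) (rho t)%:E = (g x - g a)%:E)%E
  & {ae leb, forall t, a < t < b -> is_derive t (1 : R) g (rho t)}].
Proof.
pose D : set (measurableTypeR R) := `]a, b]%classic.
have mD : measurable D by exact: measurable_itv.
have moo : (mug D < +oo)%E by rewrite stieltjes_ocitv ?ltry// ltW.
pose nu : {finite_measure set (measurableTypeR R) -> \bar R} := mfrestr mD moo.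
have nuE B : nu B = mug (B `&` D) by [].
have dom : nu `<< leb.
  move=> N nullN B mB BN; rewrite nuE; apply: mono_null; first exact: measurableI.
    by apply: nullN; [exact: measurableI|move=> t [/BN]].
  by move=> t [].
have [f [f0 ffin fint fE]] := radon_nikodym_sigma_finite dom.
pose rho t := fine (f t).
have rhoE : EFin \o rho = f by apply/funext => t; rewrite /= /rho fineK.
have rho_int : leb.-integrable setT (EFin \o rho) by rewrite rhoE.
have rhoI x : a <= x <= b -> (\int[leb]_(t in `]a, x]) (rho t)%:E = (g x - g a)%:E)%E.
  move=> /andP[ax xb]; have -> : (fun t => (rho t)%:E) = f := rhoE.
  have mx : measurable (`]a, x]%classic : set (measurableTypeR R)) by exact: measurable_itv.
  rewrite -(fE _ mx) nuE -stieltjes_ocitv//; congr (mug _).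
  by apply/setIidPl => t; rewrite /D /= !in_itv/= => /andP[-> tx]; exact: le_trans xb.
exists rho; split=> //.
have rho_loc : locally_integrable [set: R] rho by apply: open_integrable_locally => //; exact: openT.
have := @FTC1 R rho (BRight a) _ rho_loc.
have rint y : leb.-integrable [set` Interval (BRight a) (BRight y)] (EFin \o rho).
  by apply: integrableS rho_int => //; exact: measurable_itv.
move=> /(_ rint); apply: filterS; first exact: (ae_filter_ringOfSetsType leb).
move=> t Ht /andP[at_ tb].
have [dF FE] := Ht at_.
have near_g : \forall s \near t, (\int[leb]_(r in `]a, s]) rho r)%R + g a = g s.
  have : \forall s \near t, a < s < b.
    by near=> s; apply/andP; split; near: s; [exact: lt_nbhsr|exact: lt_nbhsl].
  apply: filterS => s /andP[/ltW as_ /ltW sb].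
  by rewrite /Rintegral rhoI ?as_//= subrK.
apply: (near_eq_is_derive near_g).
have dF' : is_derive t 1 (fun y => \int[leb]_(r in `]a, y]) rho r)%R (rho t).
  exact: derive1_is_derive dF FE.
rewrite -[rho t]addr0; exact: is_deriveD.
Unshelve. all: by end_near. Qed.

End Monotone.

(** Jordan decomposition: f = V - (V - f), where both terms are nondecreasing and absolutely
    continuous, so [mono_FTC] applies to each. *)
Lemma ac_FTC (f : R -> R) (a b : R) : a < b -> ac f a b ->
  exists rho : R -> R, [/\ leb.-integrable setT (EFin \o rho),
    (\int[leb]_(t in `]a, b]) (rho t)%:E = (f b - f a)%:E)%E
  & {ae leb, forall t, a < t < b -> is_derive t (1 : R) f (rho t)}].
Proof.
move=> ab fac; have ab' := ltW ab.
have clip_ac (h : R -> R) : ac h a b -> ac (h \o clip a b) a b.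
  move=> hac e e0; have [d d0 Hd] := hac e e0; exists d => // I x y F sd.
  have := Hd I x y F sd; rewrite /vsum; apply: le_lt_trans; apply: ler_sum => k _ /=.
  by have [h1 h2 h3] := F.1 k; rewrite !clip_id ?h1 ?h3 ?(le_trans h1) ?(le_trans h2).
have clip_nd (h : R -> R) : (forall s t, a <= s -> s <= t -> t <= b -> h s <= h t) ->
    {homo h \o clip a b : x y / x <= y}.
  move=> hnd s t st /=; have /andP[h1 _] := clip_itv s ab'; have /andP[_ h2] := clip_itv t ab'.
  by apply: hnd => //; exact: clip_homo.
have clip_cl (h : R -> R) t : (h \o clip a b) t = (h \o clip a b) (clip a b t).
  by rewrite /= [in RHS]clip_id//; exact: clip_itv.
have Vac : ac (V f a) a b by exact: ac_V.
have Wac : ac (fun t => V f a t - f t) a b.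
  move=> e e0; have e20 : 0 < e / 2 by rewrite divr_gt0.
  have [d1 d10 H1] := Vac _ e20; have [d2 d20 H2] := fac _ e20.
  exists (Num.min d1 d2) => [|I x y F]; first by rewrite lt_min d10.
  rewrite lt_min => /andP[s1 s2]; have h1 := H1 _ _ _ F s1; have h2 := H2 _ _ _ F s2.
  apply: (@le_lt_trans _ _ (vsum (V f a) x y + vsum f x y)); last by lra.
  rewrite /vsum -big_split/=; apply: ler_sum => k _.
  have -> : V f a (y k) - f (y k) - (V f a (x k) - f (x k)) =
    (V f a (y k) - V f a (x k)) - (f (y k) - f (x k)) by ring.
  exact: ler_normB.
have Vnd : {homo V f a \o clip a b : x y / x <= y}.
  apply: clip_nd => s t as_ st tb.
  by have := V_increment fac as_ st tb; apply: le_trans; rewrite lerDl.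
have Wnd : {homo (fun t => V f a t - f t) \o clip a b : x y / x <= y}.
  apply: clip_nd => s t as_ st tb.
  have := V_increment fac as_ st tb; have := ler_norm (f t - f s); lra.
have [r1 [i1 I1 D1]] := mono_FTC ab Vnd (clip_ac _ Vac) (clip_cl _).
have [r2 [i2 I2 D2]] := mono_FTC ab Wnd (clip_ac _ Wac) (clip_cl _).
exists (fun t => r1 t - r2 t); split.
- exact: (integrableB measurableT i1 i2).
- have mD : measurable (`]a, b]%classic : set (measurableTypeR R)) by exact: measurable_itv.
  have j1 := integrableS measurableT mD (@subsetT _ _) i1.
  have j2 := integrableS measurableT mD (@subsetT _ _) i2.
  have := integralB_EFin mD j1 j2.
  rewrite I1 ?I2 ?ab' ?lexx// => ->; rewrite -EFinB; congr (_%:E).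
  by rewrite /= !clip_id ?lexx ?ab'//; ring.
- apply: (@filterS2 _ _ (ae_filter_ringOfSetsType leb) _ _ _ _ D1 D2) => t H1 H2 tab.
  have near_f : \forall s \near t, (V f a \o clip a b) s - ((fun t => V f a t - f t) \o clip a b) s = f s.
    have /andP[at_ tb] := tab.
    have : \forall s \near t, a < s < b.
      by near=> s; apply/andP; split; near: s; [exact: lt_nbhsr|exact: lt_nbhsl].
    apply: filterS => s /andP[/ltW as_ /ltW sb].
    by rewrite /= clip_id ?as_//; ring.
  apply: (near_eq_is_derive near_f).
  by apply: is_deriveB; [exact: H1|exact: H2].
Unshelve. all: by end_near. Qed.

End MonotoneFTC.

(** * Lower bounds for integrals without measurability *)

Section LowerIntegral.
Context d (T : measurableType d) (R : realType).
Variable mu : {measure set T -> \bar R}.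
Implicit Types (f h : T -> \bar R) (D : set T).

(** The integral of a nonnegative function is a supremum over simple minorants, hence monotone
    without measurability. This matters for the action of an arbitrary curve, whose integrand is not
    known to be measurable. *)
Lemma ge0_le_lower_integral D h f : (forall x, D x -> 0 <= h x <= f x)%E ->
  (\int[mu]_(x in D) h x <= \int[mu]_(x in D) f x)%E.
Proof.
move=> hf.
rewrite !ge0_integralE; [|by move=> x Dx; have /andP[h1 h2] := hf x Dx; rewrite ?(le_trans h1)..].
apply: le_ereal_sup => _ [k kh <-]; exists k => // x; apply: le_trans (kh x) _.
rewrite !patchE; case: ifPn => // /set_mem Dx.
by have /andP[] := hf x Dx.
Qed.

Lemma le_lower_integral D h f : (forall x, D x -> h x <= f x)%E ->
  (\int[mu]_(x in D) h x <= \int[mu]_(x in D) f x)%E.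
Proof.
move=> hf; rewrite integralE [leRHS]integralE; apply: leeB.
  apply: ge0_le_lower_integral => x Dx; rewrite funeposE funeposE.
  by rewrite le_max lexx orbT/= ge_max !le_max hf//= lexx orbT.
apply: ge0_le_lower_integral => x Dx; rewrite !funenegE.
by rewrite le_max lexx orbT/= ge_max !le_max leeN2 hf//= lexx orbT.
Qed.

End LowerIntegral.

Section ActionLowerBound.
Variable R : realType.
Local Notation leb := (@lebesgue_measure R).

(* [F] need not be measurable: only measurable minorants of it are integrated. *)
Lemma ac_lower_bound (f : R -> R) (F : R -> R) (s C : R) : 0 <= s -> ac f 0 s ->
  (forall t, 0 <= t <= s -> - C <= F t) ->
  {ae leb, forall t, 0 < t < s -> forall df, is_derive t (1 : R) f df -> df <= F t} ->
  ((f s - f 0)%:E <= \int[leb]_(t in `[0%R, s]) (F t)%:E)%E.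
Proof.
rewrite le_eqVlt => /predU1P[<-|s0] fac FC Hd.
  by rewrite subrr set_itv1 integral_set1.
have [rho [ri rI rD]] := ac_FTC s0 fac.
have [N [mN N0 HN]] : leb.-negligible (~` [set t | 0 < t < s -> rho t <= F t]).
  apply: (@filterS2 _ _ (ae_filter_ringOfSetsType leb) _ _ _ _ Hd rD) => t H1 H2 ts; apply: H1 => //; exact: H2.
pose N' : set (measurableTypeR R) := N `|` [set 0] `|` [set s].
have mN' : measurable N' by apply: measurableU => //; exact: measurableU.
have N'0 : leb N' = 0%E.
  have z1 : leb (N `|` [set 0]) = leb N.
    by apply: measureU0 => //; exact: lebesgue_measure_set1.
  have z2 : leb N' = leb (N `|` [set 0]).
    by apply: measureU0 => //; [exact: measurableU|exact: lebesgue_measure_set1].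
  by rewrite z2 z1.
(* On the null set where rho <= F may fail, and at both ends, h takes the global lower bound - C;
   elsewhere it is the density. Thus h is a measurable minorant of F with the same integral as
   rho. *)
pose h t := if t \in N' then - C else rho t.
have mI : measurable (`[0, s]%classic : set (measurableTypeR R)) by exact: measurable_itv.
have mI' : measurable (`]0, s]%classic : set (measurableTypeR R)) by exact: measurable_itv.
have mrho : measurable_fun [set: measurableTypeR R] rho by apply/measurable_EFinP; case/integrableP: ri.
have mh : measurable_fun [set: measurableTypeR R] h.
  apply: measurable_fun_ifT => //.
  by apply: (@measurable_fun_bool _ _ _ _ true); rewrite setTI; have -> : (fun t => t \in N') @^-1` [set true] = N' by apply/seteqP; split=> t /=; [move/set_mem|move=> /mem_set].
have -> : (f s - f 0)%:E = (\int[leb]_(t in `[0%R, s]) (h t)%:E)%E.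
  rewrite -rI -integral_itv_obnd_cbnd; last first.
    by apply/measurable_EFinP; exact: measurable_funS mh.
  apply: ae_eq_integral => //.
  - by apply/measurable_EFinP; exact: measurable_funS mrho.
  - by apply/measurable_EFinP; exact: measurable_funS mh.
  - exists N'; split=> // t /= /not_implyP[_ hne]; apply: contrapT => nN'.
    by apply: hne; rewrite /h ifF//; apply/negbTE/negP => /set_mem.
apply: le_lower_integral => t /=; rewrite in_itv/= => /andP[t0 ts]; rewrite lee_fin /h.
case: ifPn => [_|/negP tN']; first by apply: FC; rewrite t0.
have tn0 : t != 0 by apply/negP => /eqP E; apply: tN'; apply/mem_set; left; right.
have tns : t != s by apply/negP => /eqP E; apply: tN'; apply/mem_set; right.
have t1 : 0 < t < s by rewrite !lt_neqAle eq_sym tn0 t0 tns.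
apply: contrapT => nle; apply: tN'; apply/mem_set; left; left; apply: HN => /= H.
by apply: nle; exact: H.
Qed.

End ActionLowerBound.

(** * Symmetry of second derivatives *)

Section Schwarz.
Variables (R : realType) (V : normedModType R).
Implicit Types (f : V -> R) (x v w : V) (D : set V).

Lemma second_difference f D x v w (s : R) : 0 < s ->
  (forall y, D y -> derivable f y v /\ derivable ('D_v f) y w) ->
  (forall r q, 0 <= r <= s -> 0 <= q <= s -> D (x + r *: v + q *: w)) ->
  exists r q, [/\ 0 <= r <= s, 0 <= q <= s &
    f (x + s *: v + s *: w) - f (x + s *: v) - f (x + s *: w) + f x
      = s ^+ 2 * 'D_w ('D_v f) (x + r *: v + q *: w)].
Proof.
move=> s0 fD sD; have s0' := ltW s0.
have H1 r : 0 <= r <= s -> is_derive r (1 : R) (fun r => f (x + s *: w + r *: v) - f (x + r *: v))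
    ('D_v f (x + s *: w + r *: v) - 'D_v f (x + r *: v)).
  move=> rs; apply: is_deriveB; apply: is_derive_line.
    by rewrite addrAC; apply: (fD _ _).1; apply: sD => //; rewrite s0' lexx.
  have -> : x + r *: v = x + r *: v + 0 *: w by rewrite scale0r addr0.
  by apply: (fD _ _).1; apply: sD => //; rewrite lexx.
have [r r01 E1] := mean_value s0' H1.
have H2 q : 0 <= q <= s -> is_derive q (1 : R) (fun q => 'D_v f (x + r *: v + q *: w))
    ('D_w ('D_v f) (x + r *: v + q *: w)).
  by move=> qs; apply: is_derive_line; apply: (fD _ _).2; exact: sD.
have [q q01 E2] := mean_value s0' H2.
exists r, q; split=> //.
move: E1 E2; rewrite !scale0r !addr0 !subr0 (addrAC x (s *: w)) (addrAC x (s *: w)) => E1 E2.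
have -> : f (x + s *: v + s *: w) - f (x + s *: v) - f (x + s *: w) + f x
  = f (x + s *: v + s *: w) - f (x + s *: v) - (f (x + s *: w) - f x) by ring.
by rewrite E1 E2 expr2; ring.
Qed.

Lemma close2 (a b a' b' e : R) : `|a - a'| <= e / 2 -> `|b - b'| <= e / 2 -> a' = b' ->
  `|a - b| <= e.
Proof.
move=> h1 h2 E; have -> : a - b = (a - a') - (b - b') by rewrite E; ring.
by rewrite (le_trans (ler_normB _ _))//; lra.
Qed.

(** The same symmetric second difference equals s^2 times either mixed derivative, taken at points
    close to x. This symmetry is what makes Hamilton's equations independent of the chart. *)
Lemma schwarz f D x v w : open D -> D x ->
  (forall y, D y -> [/\ derivable f y v, derivable f y w, derivable ('D_v f) y w
     & derivable ('D_w f) y v]) ->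
  {for x, continuous ('D_w ('D_v f))} -> {for x, continuous ('D_v ('D_w f))} ->
  'D_w ('D_v f) x = 'D_v ('D_w f) x.
Proof.
move=> oD Dx fD c1 c2; apply/eqP; rewrite -subr_eq0 -normr_le0; apply/ler_addgt0Pl => e e0.
rewrite addr0; have e2 : 0 < e / 2 by rewrite divr_gt0.
have N1 : \forall y \near x, `|'D_w ('D_v f) x - 'D_w ('D_v f) y| <= e / 2.
  by move/cvgrPdist_le : c1; apply.
have N2 : \forall y \near x, `|'D_v ('D_w f) x - 'D_v ('D_w f) y| <= e / 2.
  by move/cvgrPdist_le : c2; apply.
have N3 : nbhs x D by exact: open_nbhs_nbhs.
have [d /= d0 Hd] := (nbhs_normP x _).1 (filterI N3 (filterI N1 N2)).
pose k := `|v| + `|w| + 1; have k0 : 0 < k by rewrite ltr_wpDl// addr_ge0.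
(* The side s satisfies s k = d / 2, which keeps the whole parallelogram within distance d of x. *)
pose s := d / k / 2; have s0 : 0 < s by rewrite !divr_gt0.
have box (v' w' : V) r q : `|v'| + `|w'| + 1 = k -> 0 <= r <= s -> 0 <= q <= s ->
    `|x - (x + r *: v' + q *: w')| < d.
  move=> kE /andP[r0 rs] /andP[q0 qs].
  rewrite -addrA opprD addrA subrr sub0r normrN (le_lt_trans (ler_normD _ _))// !normrZ !ger0_norm//.
  have h1 : r * `|v'| <= s * `|v'| by rewrite ler_wpM2r.
  have h2 : q * `|w'| <= s * `|w'| by rewrite ler_wpM2r.
  have h3 : s * k = d / 2 by rewrite /s mulrAC divfK// gt_eqF.
  by move: h3; rewrite -kE !mulrDr mulr1; lra.
have [r1 [q1 [r1s q1s E1]]] : exists r q, [/\ 0 <= r <= s, 0 <= q <= s &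
    f (x + s *: v + s *: w) - f (x + s *: v) - f (x + s *: w) + f x
      = s ^+ 2 * 'D_w ('D_v f) (x + r *: v + q *: w)].
  apply: (@second_difference f D x v w s s0); first by move=> y /fD[h1 _ h3 _].
  by move=> r q rs qs; have [] := Hd (x + r *: v + q *: w) (box v w r q erefl rs qs).
have kE : `|w| + `|v| + 1 = k by rewrite /k (addrC `|w|).
have [r2 [q2 [r2s q2s E2]]] : exists r q, [/\ 0 <= r <= s, 0 <= q <= s &
    f (x + s *: w + s *: v) - f (x + s *: w) - f (x + s *: v) + f x
      = s ^+ 2 * 'D_v ('D_w f) (x + r *: w + q *: v)].
  apply: (@second_difference f D x w v s s0); first by move=> y /fD[_ h2 _ h4].
  by move=> r q rs qs; have [] := Hd (x + r *: w + q *: v) (box w v r q kE rs qs).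
have E : 'D_w ('D_v f) (x + r1 *: v + q1 *: w) = 'D_v ('D_w f) (x + r2 *: w + q2 *: v).
  have s2 : s ^+ 2 != 0 by rewrite expf_neq0// gt_eqF.
  have Exy : x + s *: w + s *: v = x + s *: v + s *: w by rewrite addrAC.
  apply: (mulfI s2); apply: (eq_trans (esym E1)); apply: (eq_trans _ E2).
  by rewrite Exy; congr (_ + _); rewrite addrAC.
have [_ [h1 _]] := Hd _ (box v w r1 q1 erefl r1s q1s).
have [_ [_ h2]] := Hd _ (box w v r2 q2 kE r2s q2s).
exact: (close2 h1 h2 E).
Qed.

End Schwarz.

Section CurveTools.
Variable R : realType.

Lemma is_derive_cvg (W : normedModType R) (c : R -> W) (t : R) (d : W) :
  is_derive t (1 : R) c d -> h^-1 *: (c (h *: 1 + t) - c t) @[h --> (0 : R)^'] --> d.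
Proof. by move=> [/cvg_ex[/= l cl] <-]; rewrite (_ : 'D_1 c t = l)//; exact: cvg_lim cl. Qed.

Lemma cvg_is_derive (W : normedModType R) (c : R -> W) (t : R) (d : W) :
  h^-1 *: (c (h *: 1 + t) - c t) @[h --> (0 : R)^'] --> d -> is_derive t (1 : R) c d.
Proof. by move=> C; apply: DeriveDef; [apply/cvg_ex; exists d|exact: cvg_lim C]. Qed.

Lemma is_derive_fst (U W : normedModType R) (c : R -> U * W) (t : R) d :
  is_derive t (1 : R) c d -> is_derive t (1 : R) (fun s => (c s).1) d.1.
Proof.
move=> /is_derive_cvg C; apply: cvg_is_derive.
exact: (cvg_comp _ _ C (@cvg_fst _ _ (nbhs d.1) (nbhs d.2) _)).
Qed.

Lemma is_derive_snd (U W : normedModType R) (c : R -> U * W) (t : R) d :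
  is_derive t (1 : R) c d -> is_derive t (1 : R) (fun s => (c s).2) d.2.
Proof.
move=> /is_derive_cvg C; apply: cvg_is_derive.
exact: (cvg_comp _ _ C (@cvg_snd _ _ (nbhs d.1) (nbhs d.2) _)).
Qed.

Lemma is_derive_pair (U W : normedModType R) (a : R -> U) (b : R -> W) (t : R) da db :
  is_derive t (1 : R) a da -> is_derive t (1 : R) b db ->
  is_derive t (1 : R) (fun s => (a s, b s)) (da, db).
Proof.
move=> /is_derive_cvg Ca /is_derive_cvg Cb; apply: cvg_is_derive.
exact: (cvg_pair Ca Cb).
Qed.

Lemma derive_line_eq (U U' W : normedModType R) (f : U -> W) (g : U' -> W) a v b w :
  (forall h : R, f (h *: v + a) = g (h *: w + b)) -> 'D_v f a = 'D_w g b.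
Proof.
move=> E; have E0 : f a = g b by have := E 0; rewrite !scale0r !add0r.
rewrite /derive; apply: (f_equal (fun F : R -> W => lim (F @ (0 : R)^'))).
by apply/funext => h; rewrite /= E E0.
Qed.

Lemma is_derive_unique (W : normedModType R) (c : R -> W) (t : R) d d' :
  is_derive t (1 : R) c d -> is_derive t (1 : R) c d' -> d = d'.
Proof. by move=> [_ <-] [_ <-]. Qed.

End CurveTools.

(** * Hamilton's equations under a change of chart *)

Section AbstractChartChange.
Variables (R : realType) (n : nat).
Local Notation V := 'rV[R]_n.
Local Notation E := ('rV[R]_n * 'rV[R]_n)%type.

Lemma is_derive_comp_D (U W : normedModType R) (f : U -> W) (c : R -> U) (t : R) dc :
  differentiable f (c t) -> is_derive t (1 : R) c dc ->
  is_derive t (1 : R) (fun s => f (c s)) ('D_dc f (c t)).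
Proof.
move=> df hc; have h := is_derive_comp_diff df hc.
exact: (is_derive_eq h (esym (deriveE _ df))).
Qed.

Lemma is_derive_comp_grad (h : E -> R) (a b : R -> V) (t : R) da db :
  differentiable h (a t, b t) -> is_derive t (1 : R) a da -> is_derive t (1 : R) b db ->
  is_derive t (1 : R) (fun s => h (a s, b s))
    (pairing (gx h (a t, b t)) da + pairing (gp h (a t, b t)) db).
Proof.
move=> dh ha hb; have h1 := is_derive_comp_diff (c := fun s => (a s, b s)) dh (is_derive_pair ha hb).
exact: (is_derive_eq h1 (diff_grad dh _)).
Qed.

Lemma gp_derive (h : E -> R) b w : differentiable h b -> 'D_((0, w) : E) h b = pairing (gp h b) w.
Proof.
move=> dh; apply: (eq_trans (deriveE _ dh)); apply: (eq_trans (diff_grad dh _)).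
exact: (eq_trans (f_equal (fun c => c + _) (pairing0r _)) (add0r _)).
Qed.

Lemma gp_change (h k : E -> R) (x y q : V) (J : 'M[R]_n) :
  differentiable h (x, q *m J^T) -> differentiable k (y, q) ->
  (forall q, k (y, q) = h (x, q *m J^T)) ->
  gp k (y, q) = gp h (x, q *m J^T) *m J.
Proof.
move=> dh dk kh; apply: pairing_inj => u.
have e1 : 'D_((0, u) : E) k (y, q) = 'D_((0, u *m J^T) : E) h (x, q *m J^T).
  apply: derive_line_eq => r.
  have -> : r *: ((0, u) : E) + (y, q) = (y, r *: u + q).
    by apply: injective_projections; rewrite /= ?scaler0 ?add0r.
  have -> : r *: ((0, u *m J^T) : E) + (x, q *m J^T) = (x, (r *: u + q) *m J^T).
    by apply: injective_projections; rewrite /= ?scaler0 ?add0r// mulmxDl scalemxAl.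
  exact: kh.
rewrite -(gp_derive _ dk) e1 (gp_derive _ dh).
by rewrite pairingC pairing_trmx pairingC.
Qed.

Lemma derive_sum_row (f : V -> V) (x w : V) : differentiable f x ->
  'D_w f x = \sum_l w 0 l *: 'D_(delta_mx 0 l) f x.
Proof.
move=> df; rewrite (deriveE _ df) {1}[w]row_sum_delta linear_sum; apply: eq_bigr => l _.
by rewrite linearZ/= (deriveE _ df).
Qed.

(** The covector q is fixed in the second chart and P y is its pullback at y in the first; the
    identity h(y, P y) = k(phi y, q) is differentiated along v. The last term carries the second
    derivatives of phi, put in this order by the symmetry hypothesis. *)
Lemma gx_change (h k : E -> R) (phi : V -> V) (x v q p yx dv : V) (P : V -> V) :
  P = (fun y => \row_l pairing q ('D_(delta_mx 0 l) phi y)) ->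
  P x = p -> phi x = yx -> 'D_v phi x = dv ->
  differentiable h (x, p) -> differentiable k (yx, q) -> differentiable phi x ->
  (forall u, differentiable ('D_u phi) x) ->
  (forall u, 'D_v ('D_u phi) x = 'D_u ('D_v phi) x) ->
  (\forall y \near x, h (y, P y) = k (phi y, q)) ->
  pairing (gx k (yx, q)) dv =
  pairing (gx h (x, p)) v + pairing q ('D_(gp h (x, p)) ('D_v phi) x).
Proof.
move=> PE <- <- <- dh dk dphi ddphi sch near_hk.
pose line (r : R) : V := x + r *: v.
have line0 : line 0 = x by rewrite /line scale0r addr0.
have dline : is_derive (0 : R) (1 : R) line v.
  have h0 : derivable (id : V -> V) (x + 0 *: v) v by exact: derivable_id.
  by apply: (is_derive_eq (is_derive_line h0)); rewrite derive_id.
have HP : is_derive (0 : R) (1 : R) (fun r => P (line r)) (\row_l pairing q ('D_v ('D_(delta_mx 0 l) phi) x)).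
  apply: is_derive_row => l; rewrite mxE.
  have -> : (fun r => P (line r) 0 l) = (fun r => pairing q ('D_(delta_mx 0 l) phi (line r))).
    by apply/funext => r; rewrite PE mxE.
  have dd : differentiable ('D_(delta_mx 0 l) phi) (line 0) by rewrite line0.
  have h1 := is_derive_pairing (is_derive_cst (q : V) (0 : R) (1 : R)) (is_derive_comp_D dd dline).
  by apply: (is_derive_eq h1); rewrite pairing0l add0r line0.
have dh' : differentiable h (line 0, P (line 0)) by rewrite line0.
have dphi' : differentiable phi (line 0) by rewrite line0.
have dk' : differentiable k (phi (line 0), q) by rewrite line0.
have L := is_derive_comp_grad (b := fun r => P (line r)) dh' dline HP.
have Rr := is_derive_comp_grad (a := fun r => phi (line r)) (b := fun=> q) dk' (is_derive_comp_D dphi' dline)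
  (is_derive_cst (q : V) (0 : R) (1 : R)).
have near_E : \forall r \near (0 : R), h (line r, P (line r)) = k (phi (line r), q).
  have cl : {for (0 : R), continuous line} := derive_continuous dline.
  have N : nbhs (line 0) (fun y => h (y, P y) = k (phi y, q)) by rewrite line0.
  exact: (cl _ N).
have := is_derive_unique (near_eq_is_derive near_E L) Rr.
rewrite /= line0 pairing0r addr0 => <-; congr (_ + _).
set w := gp h _; rewrite (derive_sum_row _ (ddphi v)) pairingE [RHS]pairingC.
have -> : forall (F : 'I_n -> V), pairing (\sum_l F l) q = \sum_l pairing (F l) q.
  by move=> F; apply: (big_morph (fun u => pairing u q)); [move=> u u'; exact: pairingDl|exact: pairing0l].
by apply: eq_bigr => l _; rewrite pairingZl mxE pairingC sch.
Qed.

(** The equation for the base point is the chain rule. The fibre equation comes from differentiating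
    the invariant pairing q(dphi v) = p(v); the differentiability of q needed for this is obtained
    first, from the inverse transition psi. *)
Lemma ham_eq_change (h k : E -> R) (phi psi : V -> V) (x p y q : R -> V) (t : R) (J : 'M[R]_n) :
  J \in unitmx ->
  is_derive t (1 : R) x (gp h (x t, p t)) -> is_derive t (1 : R) p (- gx h (x t, p t)) ->
  (\forall s \near t, [/\ phi (x s) = y s,
     forall v, pairing (q s) ('D_v phi (x s)) = pairing (p s) v
   & forall u, pairing (p s) ('D_u psi (y s)) = pairing (q s) u]) ->
  differentiable phi (x t) -> (forall v, differentiable ('D_v phi) (x t)) ->
  (forall v, differentiable ('D_v psi) (y t)) ->
  (forall v, 'D_v phi (x t) = v *m J) ->
  gp k (y t, q t) = gp h (x t, p t) *m J ->
  (forall v, pairing (gx k (y t, q t)) (v *m J) =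
   pairing (gx h (x t, p t)) v + pairing (q t) ('D_(gp h (x t, p t)) ('D_v phi) (x t))) ->
  is_derive t (1 : R) (fun s => (y s, q s)) (gp k (y t, q t), - gx k (y t, q t)).
Proof.
move=> Ju Hx Hp nearE dphi ddphi ddpsi phiJ gpE gxE.
have Hy : is_derive t (1 : R) y (gp k (y t, q t)).
  apply: (near_eq_is_derive (f := fun s => phi (x s))).
    by apply: filterS nearE => s [].
  by apply: (is_derive_eq (is_derive_comp_D dphi Hx)); rewrite phiJ gpE.
have [dq Hq] : exists dq, is_derive t (1 : R) q dq.
  have Hl l : exists d, is_derive t (1 : R) (fun s => q s 0 l) d.
    eexists; apply: (near_eq_is_derive _ (is_derive_pairing Hp (is_derive_comp_D (ddpsi (delta_mx 0 l)) Hy))).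
    by apply: filterS nearE => s [_ _ E]; rewrite E pairing_deltar.
  exists (\row_l sval (cid (Hl l))); apply: is_derive_row => l; rewrite mxE.
  exact: svalP (cid (Hl l)).
suff dqE : dq = - gx k (y t, q t) by rewrite -dqE; exact: is_derive_pair.
have key (v : V) : pairing dq (v *m J) = pairing (- gx k (y t, q t)) (v *m J).
  have h1 := is_derive_pairing Hq (is_derive_comp_D (ddphi v) Hx).
  have h2 := is_derive_pairing Hp (is_derive_cst (v : V) (t : R) (1 : R)).
  have near_E : \forall s \near t, pairing (q s) ('D_v phi (x s)) = pairing (p s) v.
    by apply: filterS nearE => s [].
  have := is_derive_unique (near_eq_is_derive near_E h1) h2.
  rewrite pairing0r addr0 phiJ !pairingNl gxE; lra.
by apply: pairing_inj => u; have := key (u *m invmx J); rewrite mulmxKV.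
Qed.

End AbstractChartChange.

Section ChartChange.
Variables (R : realType) (n : nat) (M : ptopologicalType) (A : C2atlas R n M).
Let V := 'rV[R]_n.
Let E := (V * V)%type.
Implicit Types (i j k : chart_index A) (x : M) (z : cotangent A).

Lemma transition_schwarz i j x (v w : V) : dom i x -> dom j x ->
  'D_w ('D_v (transition i j)) (chart i x) = 'D_v ('D_w (transition i j)) (chart i x).
Proof.
move=> di dj; set y := chart i x; have Dy : overlap i j y by exact: overlap_chart.
have oD : open (overlap i j) by exact: open_overlap.
have [C1 C2] : C2_on (overlap i j) (transition i j) by exact: transition_C2.
have coordE (g : V -> V) (u : V) b l : differentiable g b -> 'D_u (fun y => g y 0 l) b = ('D_u g b) 0 l.
  by move=> dg; rewrite derive_mx ?mxE//; exact: diff_derivable.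
have coordD (g : V -> V) (u : V) b l : differentiable g b -> derivable (fun y => g y 0 l) b u.
  by move=> dg; apply: (derivable_mxP g b u).1; exact: diff_derivable.
have H (u u' : V) b l : overlap i j b ->
    \forall c \near b, 'D_u (fun y => transition i j y 0 l) c = ('D_u (transition i j) c) 0 l.
  move=> Db; have : \forall c \near b, overlap i j c by apply: open_nbhs_nbhs.
  by apply: filterS => c Dc; apply: coordE; case: (C1 c Dc).
have H2 (u u' : V) b l : overlap i j b ->
   'D_u' ('D_u (fun y => transition i j y 0 l)) b = ('D_u' ('D_u (transition i j)) b) 0 l.
  move=> Db; rewrite (near_eq_derive _ (H u u' b l Db)) coordE//.
  by case: (C2 u b Db).
have H3 (u u' : V) b l : overlap i j b ->
   derivable ('D_u (fun y => transition i j y 0 l)) b u'.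
  move=> Db; apply: (@near_eq_derivable _ _ _ (fun c => ('D_u (transition i j) c) 0 l)).
    by have := H u u' b l Db; apply: filterS => c ->.
  by apply: coordD; case: (C2 u b Db).
have H4 (u u' : V) l : {for y, continuous ('D_u' ('D_u (fun y => transition i j y 0 l)))}.
  have near_E : \forall c \near y, ('D_u' ('D_u (transition i j)) c) 0 l = 'D_u' ('D_u (fun y => transition i j y 0 l)) c.
    have : \forall c \near y, overlap i j c by apply: open_nbhs_nbhs.
    by apply: filterS => c Dc; rewrite H2.
  suff h : 'D_u' ('D_u (fun y => transition i j y 0 l)) c @[c --> y] --> ('D_u' ('D_u (transition i j)) y) 0 l.
    by rewrite -H2 in h.
  apply: cvg_trans (near_eq_cvg near_E) _.
  have [_ /(_ u') ct] := C2 u y Dy.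
  exact: (cvg_comp _ _ ct (@coord_continuous _ _ _ 0 l _)).
apply/rowP => l; apply: (eq_trans (esym (H2 v w y l Dy))); apply: (eq_trans _ (H2 w v y l Dy)).
apply: (schwarz oD Dy _ (H4 v w l) (H4 w v l)) => c Dc.
by have [dc _] := C1 c Dc; split; [exact: coordD|exact: coordD|exact: (H3 v w)|exact: (H3 w v)].
Qed.

Lemma cot_coord1 i z : (cot_coord i z).1 = chart i z.1.
Proof. by []. Qed.

Lemma cot_coordV1 i (a : E) : (cot_coordV i a).1 = chartV i a.1.
Proof. by []. Qed.

Lemma cot_coord_eta i z : cot_coord i z = (chart i z.1, (cot_coord i z).2).
Proof. by []. Qed.

Local Opaque tjac.

Lemma transition_derive_diff (v : V) i j x : dom i x -> dom j x ->
  differentiable ('D_v (transition i j)) (chart i x).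
Proof. by move=> di dj; case: (transition_derive_C1 v (overlap_chart di dj)). Qed.

Lemma cot_coordV_trans i j x (q : V) : dom i x -> dom j x ->
  cot_coordV j (chart j x, q) = cot_coordV i (chart i x, q *m (tjac i j x)^T).
Proof.
move=> di dj; have cj : cot_codom j (chart j x, q) by exists x.
have zE : exists z, z = cot_coordV j (chart j x, q) by eexists.
case: zE => z zE; have zx : z.1 = x by rewrite zE cot_coordV1/= chartK.
have ci : cot_coord j z = (chart j x, q) by rewrite zE cot_coordVK.
have dzi : dom i z.1 by rewrite zx.
have dzj : dom j z.1 by rewrite zx.
rewrite -zE -(cot_coordK dzi); apply: (f_equal (cot_coordV i)).
apply: (eq_trans (cot_coord_trans dzj dzi)); rewrite ci zx.
have E0 : transition j i (chart j x) = chart i x by rewrite /transition/= chartK.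
exact: (f_equal (fun u => (u, q *m (tjac i j x)^T)) E0).
Qed.

Section Smooth.
Variable H : cotangent A -> R.
Hypothesis HC : forall i, C2_on (cot_codom i) (local_rep H i).

Lemma local_rep_trans i j x (q : V) : dom i x -> dom j x ->
  local_rep H j (chart j x, q) = local_rep H i (chart i x, q *m (tjac i j x)^T).
Proof. by move=> di dj; rewrite /local_rep (cot_coordV_trans q di dj). Qed.

Lemma local_rep_diff i x (p : V) : dom i x -> differentiable (local_rep H i) (chart i x, p).
Proof. by move=> di; case: ((HC i).1 (chart i x, p)) => //; exists x. Qed.

Lemma gp_trans i j x (q : V) : dom i x -> dom j x ->
  gp (local_rep H j) (chart j x, q) =
  gp (local_rep H i) (chart i x, q *m (tjac i j x)^T) *m tjac i j x.
Proof.
move=> di dj; apply: gp_change; [exact: local_rep_diff|exact: local_rep_diff|].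
by move=> u; exact: local_rep_trans.
Qed.

Lemma gx_trans i j x (q v : V) : dom i x -> dom j x ->
  pairing (gx (local_rep H j) (chart j x, q)) (v *m tjac i j x) =
  pairing (gx (local_rep H i) (chart i x, q *m (tjac i j x)^T)) v +
  pairing q ('D_(gp (local_rep H i) (chart i x, q *m (tjac i j x)^T)) ('D_v (transition i j)) (chart i x)).
Proof.
move=> di dj.
have PE x' : dom i x' -> dom j x' ->
    \row_l pairing q ('D_(delta_mx 0 l) (transition i j) (chart i x')) = q *m (tjac i j x')^T.
  move=> di' dj'; apply/rowP => l; rewrite mxE -[RHS]pairing_deltar pairing_trmx.
  by rewrite (transition_derive _ di' dj').
have phix : transition i j (chart i x) = chart j x by rewrite /transition/= chartK.
apply: (gx_change (erefl _) (PE _ di dj) phix (transition_derive _ di dj)).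
- exact: local_rep_diff.
- exact: local_rep_diff.
- exact: transition_differentiable.
- by move=> u; exact: transition_derive_diff.
- by move=> u; exact: transition_schwarz.
- apply: filterS (near_overlap di dj) => y /overlapP[cy djy].
  have [diy yE] := codom_chartP cy.
  have := local_rep_trans q diy djy; rewrite -(PE _ diy djy) yE => E0.
  exact: (esym E0).
Qed.

Lemma ham_eq_trans (c : R -> cotangent A) (t : R) i j : {for t, continuous c} ->
  dom i (c t).1 -> dom j (c t).1 ->
  is_derive t (1 : R) (fun s => cot_coord i (c s)) (ham_vf (local_rep H i) (cot_coord i (c t))) ->
  is_derive t (1 : R) (fun s => cot_coord j (c s)) (ham_vf (local_rep H j) (cot_coord j (c t))).
Proof.
move=> cc di dj.
have coord_eta k s : cot_coord k (c s) = (chart k (c s).1, (cot_coord k (c s)).2) by [].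
have vfE k : dom k (c t).1 -> ham_vf (local_rep H k) (cot_coord k (c t)) =
    (gp (local_rep H k) (chart k (c t).1, (cot_coord k (c t)).2),
   - gx (local_rep H k) (chart k (c t).1, (cot_coord k (c t)).2)).
  by move=> dk; rewrite [in LHS]coord_eta; apply: ham_vfE; exact: local_rep_diff.
move=> Hc0; have Hc := is_derive_eq Hc0 (vfE _ di).
suff Hj : is_derive t (1 : R) (fun s => cot_coord j (c s))
    (gp (local_rep H j) (chart j (c t).1, (cot_coord j (c t)).2),
   - gx (local_rep H j) (chart j (c t).1, (cot_coord j (c t)).2)).
  exact: (is_derive_eq Hj (esym (vfE j dj))).
have Hx := is_derive_fst Hc; have Hp := is_derive_snd Hc.
have trans2 k l s : dom k (c s).1 -> dom l (c s).1 ->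
    (cot_coord l (c s)).2 = (cot_coord k (c s)).2 *m (tjac l k (c s).1)^T.
  by move=> dk dl; rewrite (cot_coord_trans dk dl).
have near_dd : \forall s \near t, dom i (c s).1 /\ dom j (c s).1.
  have N1 : \forall s \near t, dom i (c s).1 := cc _ (near_dom di).
  have N2 : \forall s \near t, dom j (c s).1 := cc _ (near_dom dj).
  exact: filterI N1 N2.
have a2E := trans2 j i t dj di.
apply: (@ham_eq_change R n (local_rep H i) (local_rep H j) (transition i j) (transition j i)
  (fun s => chart i (c s).1) (fun s => (cot_coord i (c s)).2)
  (fun s => chart j (c s).1) (fun s => (cot_coord j (c s)).2) t (tjac i j (c t).1)).
- exact: (mulmx1_unit (tjacK di dj)).1.
- apply: filterS near_dd => s [ds1 ds2]; split.
  + by rewrite /transition/= chartK.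
  + move=> v; apply: (eq_trans (f_equal (pairing _) (transition_derive v ds1 ds2))).
    apply: (eq_trans (esym (pairing_trmx _ _ _))).
    exact: (f_equal (fun u => pairing u v) (esym (trans2 j i s ds2 ds1))).
  + move=> v; apply: (eq_trans (f_equal (pairing _) (transition_derive v ds2 ds1))).
    apply: (eq_trans (esym (pairing_trmx _ _ _))).
    exact: (f_equal (fun u => pairing u v) (esym (trans2 i j s ds1 ds2))).
- exact: (transition_differentiable di dj).
- by move=> v; exact: (transition_derive_diff v di dj).
- by move=> v; exact: (transition_derive_diff v dj di).
- by move=> v; exact: (transition_derive v di dj).
- apply: (eq_trans (gp_trans (cot_coord j (c t)).2 di dj)).
  exact: (f_equal (fun u => gp (local_rep H i) (chart i (c t).1, u) *m tjac i j (c t).1) (esym a2E)).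
- move=> v; apply: (eq_trans (gx_trans (cot_coord j (c t)).2 v di dj)).
  exact: (f_equal (fun u => pairing (gx (local_rep H i) (chart i (c t).1, u)) v +
    pairing (cot_coord j (c t)).2 ('D_(gp (local_rep H i) (chart i (c t).1, u))
      ('D_v (transition i j)) (chart i (c t).1))) (esym a2E)).
Qed.

End Smooth.
End ChartChange.

Section ChartFormulas.
Variables (R : realType) (n : nat) (M : ptopologicalType) (A : C2atlas R n M).

Lemma cot_coordE i (x : M) (q : 'rV[R]_n) :
  cot_coord i ((x, q) : cotangent A) = (chart i x, q *m (tjac i (chart_at A x) x)^T).
Proof. by []. Qed.

Lemma cot_coordV_chart i x (q : 'rV[R]_n) : dom i x ->
  cot_coordV i (chart i x, q) = (x, q *m (tjac (chart_at A x) i x)^T) :> cotangent A.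
Proof. by move=> di; rewrite /cot_coordV/= (chartK di). Qed.

Lemma local_repE (H : cotangent A -> R) i x q : dom i x ->
  local_rep H i (chart i x, q) = H (x, q *m (tjac (chart_at A x) i x)^T).
Proof. by move=> di; rewrite /local_rep cot_coordV_chart. Qed.

Lemma local_rep_coord (H : cotangent A -> R) i z : dom i z.1 -> local_rep H i (cot_coord i z) = H z.
Proof. by move=> di; rewrite /local_rep cot_coordK. Qed.

Lemma tjac_unit i j x : dom i x -> dom j x -> tjac (A := A) i j x \in unitmx.
Proof. by move=> di dj; exact: (mulmx1_unit (tjacK di dj)).1. Qed.

Lemma quad_form_bound (m : 'M[R]_n) (w : 'rV[R]_n) : `|(w *m m *m w^T) 0 0| <= n%:R * (n%:R * `|m| * `|w|) * `|w|.
Proof.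
have h : `|w *m m| <= n%:R * `|m| * `|w|.
  apply: row_norm_le; first by rewrite !mulr_ge0.
  move=> j; rewrite mxE; apply: le_trans (ler_norm_sum _ _ _) _.
  rewrite -mulrA -[n in n%:R]card_ord -sum1_card natr_sum mulr_suml.
  apply: ler_sum => k _; rewrite mul1r normrM mulrC; apply: ler_pM => //; last exact: row_norm_ge.
  by rewrite [leRHS]/Num.norm/= mx_normrE; apply: (le_bigmax _ _ (k, j)).
have := pairing_bound (w *m m) w; rewrite /pairing => /le_trans; apply; rewrite mulrA; apply: ler_wpM2r => //.
by apply: ler_wpM2l.
Qed.

End ChartFormulas.

Lemma cot_coord1_id (R : realType) n (M : ptopologicalType) (A : C2atlas R n M) (z : cotangent A) :
  cot_coord (chart_at A z.1) z = (chart (chart_at A z.1) z.1, z.2).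
Proof. by rewrite /cot_coord tjac_id ?trmx1 ?mulmx1//; exact: chart_atP. Qed.

Opaque tjac cot_coord cot_coordV.

(** * Local existence and uniqueness of Hamiltonian orbits *)

Section LocalODE.
Variables (R : realType) (n : nat).
Local Notation V := 'rV[R]_n.
Local Notation E := ('rV[R]_n * 'rV[R]_n)%type.

Lemma pair_increment (c dc : R -> E) (a b B : R) : a <= b ->
  (forall x, a <= x <= b -> is_derive x (1 : R) c (dc x)) ->
  (forall x, a <= x <= b -> `|dc x| <= B) -> `|c b - c a| <= B * (b - a).
Proof.
move=> ab Hd HB; apply: norm_pair_le.
  apply: (row_increment (c := fun s => (c s).1) (dc := fun s => (dc s).1) ab).
    by move=> x xab; apply: is_derive_fst; exact: Hd.
  by move=> x xab; apply: le_trans (norm_fst _) (HB x xab).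
apply: (row_increment (c := fun s => (c s).2) (dc := fun s => (dc s).2) ab).
  by move=> x xab; apply: is_derive_snd; exact: Hd.
by move=> x xab; apply: le_trans (norm_snd _) (HB x xab).
Qed.

Lemma gronwall_short (f df : R -> E) (L a b t0 : R) : 0 <= L -> L * (b - a) <= 1 / 2 ->
  a <= t0 <= b ->
  (forall t, a <= t <= b -> is_derive t (1 : R) f (df t)) ->
  (forall t, a <= t <= b -> `|df t| <= L * `|f t|) ->
  forall t, a <= t <= b -> `|f t| <= 2 * `|f t0|.
Proof.
move=> L0 Lab /andP[at0 t0b] Hd Hb; have ab : a <= b by exact: le_trans t0b.
have cf : {within `[a, b], continuous (fun t => `|f t|)}.
  apply: continuous_in_subspaceT => t /set_mem; rewrite /= in_itv/= => tab.
  apply: (@continuous_comp _ _ _ f (fun y : E => `|y|)); last exact: norm_continuous.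
  exact: derive_continuous (Hd t tab).
have [m] := EVT_max ab cf; rewrite in_itv/= => mab Hm.
pose F := `|f m|; have F0 : 0 <= F by exact: normr_ge0.
have HF t : a <= t <= b -> `|f t| <= F by move=> tab; apply: Hm; rewrite in_itv.
have inc s t : a <= s -> s <= t -> t <= b -> `|f t - f s| <= F / 2.
  move=> as_ st tb; apply: (@le_trans _ _ (L * F * (t - s))).
    apply: (pair_increment (dc := df) st) => r /andP[sr rt].
      by apply: Hd; rewrite (le_trans as_ sr) (le_trans rt tb).
    apply: le_trans (Hb r _) _; first by rewrite (le_trans as_ sr) (le_trans rt tb).
    by apply: ler_wpM2l => //; apply: HF; rewrite (le_trans as_ sr) (le_trans rt tb).
  have h : L * (t - s) <= 1 / 2 by apply: le_trans Lab; apply: ler_wpM2l => //; lra.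
  by have := ler_wpM2r F0 h; lra.
have h : F <= `|f t0| + F / 2.
  have [/andP[am mb]] := (mab).
  have E : `|f m| <= `|f t0| + `|f m - f t0|.
    by have := ler_normD (f t0) (f m - f t0); rewrite addrC subrK.
  apply: le_trans E _; rewrite lerD2l; have [tm|/ltW mt] := leP t0 m; first exact: inc.
  by rewrite distrC; exact: inc.
move=> t tab; have := HF t tab; lra.
Qed.

Definition eball (a0 : E) (rho : R) : set E := [set b | `|b - a0| <= rho].

Lemma cvg_near_eball (f : R -> E) (t : R) a0 rho : f s @[s --> t] --> a0 -> 0 < rho ->
  \forall s \near t, eball a0 rho (f s).
Proof. by move/cvgrPdist_le => h r0; apply: filterS (h rho r0) => s; rewrite /eball/= distrC. Qed.

Lemma compact_eball a0 rho : compact (eball a0 rho).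
Proof.
have -> : eball a0 rho = [set y : V | `|y - a0.1| <= rho] `*` [set y : V | `|y - a0.2| <= rho].
  apply/seteqP; split=> b.
    by rewrite /eball/= => h; split; apply: le_trans h; [exact: (norm_fst (b - a0))|exact: (norm_snd (b - a0))].
  by move=> [/= h1 h2]; exact: (@norm_pair_le _ _ (b - a0)).
by apply: compact_setX; exact: compact_row_ball.
Qed.

Lemma ball_convex (W : normedModType R) (x a b : W) (r s : R) : 0 <= s <= 1 ->
  `|a - x| <= r -> `|b - x| <= r -> `|a + s *: (b - a) - x| <= r.
Proof.
move=> /andP[s0 s1] ha hb.
have -> : a + s *: (b - a) - x = (1 - s) *: (a - x) + s *: (b - x).
  have -> : b - a = (b - x) - (a - x) by rewrite opprB addrA subrK.
  by rewrite scalerBr scalerBl scale1r addrAC -!addrA (addrC (s *: (b - x))).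
rewrite (le_trans (ler_normD _ _))// !normrZ (ger0_norm s0) (ger0_norm (_ : 0 <= 1 - s)) ?subr_ge0//.
have s1' : 0 <= 1 - s by rewrite subr_ge0.
have h1 := ler_wpM2l s1' ha; have h2 := ler_wpM2l s0 hb; lra.
Qed.

Lemma seg_closed_eball a0 rho : seg_closed (eball a0 rho).
Proof. by move=> a b s ha hb s01; exact: ball_convex. Qed.

Lemma eball_in_open (D : set E) (a0 : E) : open D -> D a0 -> exists2 rho : R, 0 < rho & eball a0 rho `<=` D.
Proof.
move=> oD Da; have [d /= d0 Hd] := (nbhs_normP a0 D).1 (open_nbhs_nbhs (conj oD Da)).
exists (d / 2); first by rewrite divr_gt0.
by move=> b; rewrite /eball/= => hb; apply: Hd => /=; rewrite distrC (le_lt_trans hb)// ltr_pdivrMr// ltr_pMr// ltr1n.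
Qed.

Lemma ham_vf_local (h : E -> R) (D : set E) (a0 : E) (rho : R) : C2_on D h -> eball a0 rho `<=` D ->
  exists B L : R, [/\ 0 <= B, 0 <= L,
    forall b, eball a0 rho b -> `|ham_vf h b| <= B
  & forall b c, eball a0 rho b -> eball a0 rho c -> `|ham_vf h b - ham_vf h c| <= L * `|b - c| ].
Proof.
move=> Ch bD; have cK := @compact_eball a0 rho; have cvx := @seg_closed_eball a0 rho.
have [B B0 HB] := grad_bounded Ch.1 cK bD.
have [L L0 HL] := grad_lipschitz Ch cK bD cvx.
have vfE b : eball a0 rho b -> ham_vf h b = (gp h b, - gx h b).
  by move=> /bD Db; apply: ham_vfE; case: (Ch.1 b Db).
exists B, L; split=> // [b kb|b c kb kc].
  by rewrite vfE//; have [h1 h2] := HB b kb; apply: norm_pair_le; rewrite /= ?normrN.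
rewrite !vfE//; have [h1 h2] := HL c b kc kb; apply: norm_pair_le => //=.
have -> : - gx h b - - gx h c = - (gx h b - gx h c) by rewrite opprB opprK addrC.
rewrite normrN; exact: h1.
Qed.

Lemma omega_diff (k h : E -> R) (a : E) : differentiable k a -> differentiable h a ->
  Omega a (ham_vf k a) (ham_vf h a) = 0 -> 'd k a (ham_vf h a) = 0.
Proof.
move=> dk dh; rewrite (ham_vfE dk) (ham_vfE dh) OmegaE diff_grad//=.
move: (gx k a) (gp k a) (gx h a) (gp h a) => u v u' v'.
by rewrite !pairingNl pairingNr (pairingC u' v) opprK addrC.
Qed.

Lemma sub_eq0 (W : zmodType) (u v : W) : u = v -> u - v = 0.
Proof. by move=> ->; rewrite subrr. Qed.

Lemma eq_is_derive_val (W : normedModType R) (f : R -> W) t (u v : W) :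
  u = v -> is_derive t (1 : R) f u -> is_derive t (1 : R) f v.
Proof. by move=> ->. Qed.

End LocalODE.

Section Orbits.
Variables (R : realType) (n : nat) (M : ptopologicalType) (A : C2atlas R n M).
Local Notation E := ('rV[R]_n * 'rV[R]_n)%type.
Implicit Types (i j k : chart_index A) (z : cotangent A) (c d : R -> cotangent A).
Variable H : cotangent A -> R.
Hypothesis HC : forall i, C2_on (cot_codom i) (local_rep H i).

(** Hamilton's equations at the single time t, in every chart around c t: a notion pointwise in time
    lets solutions be restricted, shifted and glued. *)
Definition solat c (t : R) : Prop := {for t, continuous c} /\
  forall i, dom i (c t).1 -> is_derive t (1 : R) (fun s => cot_coord i (c s))
                  (ham_vf (local_rep H i) (cot_coord i (c t))).

Lemma solat_chart c (t : R) i : {for t, continuous c} -> dom i (c t).1 ->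
  is_derive t (1 : R) (fun s => cot_coord i (c s)) (ham_vf (local_rep H i) (cot_coord i (c t))) ->
  solat c t.
Proof.
move=> cc di Hi; split; [exact: cc|].
move=> j dj; exact: (@ham_eq_trans _ _ _ _ H HC c t i j cc di dj Hi).
Qed.

Lemma solat_cotV i (c : R -> E) (e : R -> cotangent A) (t : R) : (forall s, e s = cot_coordV i (c s)) ->
  is_derive t (1 : R) c (ham_vf (local_rep H i) (c t)) ->
  (\forall s \near t, cot_codom i (c s)) -> solat e t.
Proof.
move=> eE Ht N; have Ct := nbhs_singleton N.
have cont : {for t, continuous e}.
  have -> : e = cot_coordV i \o c by apply/funext => s; exact: eE.
  apply: (@continuous_comp _ _ _ c (cot_coordV i)); first exact: derive_continuous Ht.
  exact: cot_coordV_continuous.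
have de : dom i (e t).1 by rewrite eE; exact: cot_coordV_dom.
have EE s : cot_codom i (c s) -> c s = cot_coord i (e s) by move=> Cs; rewrite eE cot_coordVK.
have D : is_derive t (1 : R) (fun s => cot_coord i (e s)) (ham_vf (local_rep H i) (c t)).
  by apply: (near_eq_is_derive _ Ht); apply: filterS N => s; exact: EE.
exact: (solat_chart cont de (eq_is_derive_val (f_equal (ham_vf (local_rep H i)) (EE t Ct)) D)).
Qed.

Lemma solat_near c d (t : R) : (\forall s \near t, c s = d s) -> solat c t -> solat d t.
Proof.
move=> cd [cc Hc]; have E0 : c t = d t := nbhs_singleton cd.
split.
  have near_E : \forall s \near t, c s = d s by exact: cd.
  suff h : d s @[s --> t] --> c t by move: h; rewrite E0.
  by apply: cvg_trans cc; exact: near_eq_cvg.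
move=> i; rewrite -E0 => di; apply: (near_eq_is_derive _ (Hc i di)).
by apply: filterS cd => s ->.
Qed.

Lemma is_derive_shift_time (W : normedModType R) (f : R -> W) (t s : R) v :
  is_derive (t + s) (1 : R) f v -> is_derive t (1 : R) (fun r => f (r + s)) v.
Proof.
move=> /is_derive_cvg C; apply: cvg_is_derive.
by under eq_fun do rewrite -addrA.
Qed.

Lemma continuous_shift_time (T : topologicalType) (f : R -> T) (t s : R) :
  {for t + s, continuous f} -> {for t, continuous (fun r => f (r + s))}.
Proof.
move=> cf; apply: (@continuous_comp _ _ _ (fun r => r + s) f) => //.
by apply: (@cvgD _ _ _ (nbhs t) _ id (cst s)); [exact: cvg_id|exact: cvg_cst].
Qed.

Lemma solat_shift c t s : solat c (t + s) -> solat (fun r => c (r + s)) t.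
Proof.
move=> [cc Hc]; split; first exact: continuous_shift_time.
by move=> i di; apply: is_derive_shift_time (Hc i di).
Qed.

Lemma near_solat_dom c t i : {for t, continuous c} -> dom i (c t).1 ->
  \forall s \near t, dom i (c s).1.
Proof. by move=> cc di; exact: (cc _ (near_dom di)). Qed.

(** Near t both curves stay in a ball of one chart where the field is Lipschitz; [gronwall_short]
    applies to their difference, which vanishes at t. *)
Lemma solat_agree c d (t : R) : (\forall s \near t, solat c s) -> (\forall s \near t, solat d s) ->
  c t = d t -> \forall s \near t, c s = d s.
Proof.
move=> sc sd E0; pose i := chart_at A (c t).1.
have di : dom i (c t).1 := chart_atP A _.
have [cc Hc] := nbhs_singleton sc; have [cd Hd] := nbhs_singleton sd.
have di' : dom i (d t).1 by rewrite -E0.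
pose a0 := cot_coord i (c t); have Ca : cot_codom i a0 by exact: cot_codom_coord.
have oD : open (cot_codom (A:=A) i) by exact: open_cot_codom.
have [rho rho0 bD] := eball_in_open oD Ca.
have [B [L [B0 L0 _ XL]]] := ham_vf_local (HC i) bD.
have inb (e : R -> cotangent A) : {for t, continuous e} -> dom i (e t).1 -> cot_coord i (e t) = a0 ->
    \forall s \near t, eball a0 rho (cot_coord i (e s)).
  move=> ce die Ee; have ccoord := cot_coord_continuous die.
  have h : cot_coord i (e s) @[s --> t] --> a0 by rewrite -Ee; exact: (cvg_comp _ _ ce ccoord).
  exact: cvg_near_eball h rho0.
have N : nbhs t ((solat c `&` ((fun s : R => dom i (c s).1) `&` (fun s : R => eball a0 rho (cot_coord i (c s)))))
       `&` (solat d `&` ((fun s : R => dom i (d s).1) `&` (fun s : R => eball a0 rho (cot_coord i (d s)))))).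
  exact: (filterI (filterI sc (filterI (near_solat_dom cc di) (inb c cc di (erefl _))))
                  (filterI sd (filterI (near_solat_dom cd di') (inb d cd di' (f_equal _ (esym E0)))))).
have [r /= r0 Hr] := (nbhs_normP t _).1 N.
pose L' := L + 1; have L'0 : 0 < L' by rewrite ltr_wpDl.
pose del := Num.min (r / 2) (1 / (4 * L')).
have LL' : L <= L' by rewrite lerDl.
have del0 : 0 < del by rewrite lt_min !divr_gt0// mulr_gt0.
have delr : del < r by rewrite gt_min ltr_pdivrMr// ltr_pMr// ltr1n.
have Ldel : L' * (t + del - (t - del)) <= 1 / 2.
  have h : del <= 1 / (4 * L') by rewrite ge_min lexx orbT.
  have := ler_wpM2l (ltW L'0) h; rewrite mul1r invfM mulrCA mulfV ?gt_eqF// mulr1; lra.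
have inr s : t - del <= s <= t + del -> `|t - s| < r.
  by move=> hs; apply: le_lt_trans delr; rewrite distrC ler_norml; lra.
clearbody del L'.
pose f s := cot_coord i (c s) - cot_coord i (d s).
pose df s := ham_vf (local_rep H i) (cot_coord i (c s)) - ham_vf (local_rep H i) (cot_coord i (d s)).
have tt : t - del <= t <= t + del by lra.
have Hf (s : R) : t - del <= s <= t + del -> is_derive s (1 : R) f (df s).
  move=> /inr /Hr [[[_ Hc'] [dc' _]] [[_ Hd'] [dd' _]]].
  exact: (is_deriveB (Hc' i dc') (Hd' i dd')).
have Hb (s : R) : t - del <= s <= t + del -> `|df s| <= L' * `|f s|.
  move=> /inr /Hr [[_ [_ bc]] [_ [_ bd]]].
  by apply: le_trans (XL _ _ bc bd) _; apply: ler_wpM2r.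
have key := gronwall_short (ltW L'0) Ldel tt Hf Hb.
apply/(nbhs_normP t _); exists del => // s /= hs.
have sd' : t - del <= s <= t + del by move: hs; rewrite distrC ltr_norml; lra.
have [[_ [dc' _]] [_ [dd' _]]] := Hr s (inr s sd').
have ft : f t = 0 by exact: (sub_eq0 (f_equal (cot_coord i) E0)).
have := key s sd'; rewrite ft normr0 mulr0 normr_le0 => /eqP fs.
have Ecd : cot_coord i (c s) = cot_coord i (d s) by apply/eqP; rewrite -subr_eq0; apply/eqP; exact: fs.
exact: (eq_trans (esym (cot_coordK dc')) (eq_trans (f_equal (cot_coordV i) Ecd) (cot_coordK dd'))).
Qed.

Hypothesis hM : hausdorff_space M.

(** The set of agreement is open by local uniqueness and closed because the cotangent bundle is
    Hausdorff; the interval of times is connected. *)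
Lemma solat_eq c d (T : R) : (forall t, `|t| < T -> solat c t) -> (forall t, `|t| < T -> solat d t) ->
  c 0 = d 0 -> forall t, `|t| < T -> c t = d t.
Proof.
move=> sc sd E0 t tT; have T0 : 0 < T by exact: le_lt_trans tT.
pose I : set R := `]- T, T[%classic.
have IE s : I s <-> `|s| < T by rewrite /I/= in_itv/= ltr_norml.
have oI : open I by exact: interval_open.
pose B := [set s | I s /\ c s = d s].
have nearI (s : R) : `|s| < T -> \forall r \near s, `|r| < T.
  move=> sT; have N : nbhs s I by apply: open_nbhs_nbhs; split=> //; exact: (IE s).2.
  by apply: filterS N => r /(IE r).1.
have oB : open B.
  rewrite openE => s [Is Es]; have sT := (IE s).1 Is; have N := nearI s sT.
  have N1 : \forall r \near s, solat c r by apply: filterS N.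
  have N2 : \forall r \near s, solat d r by apply: filterS N.
  by apply: filterS (filterI N (solat_agree N1 N2 Es)) => r [h1 h2]; split=> //; exact: (IE r).2.
have BE : B = I.
  have cI : connected I by apply/connected_intervalP; exact: interval_is_interval.
  apply: cI.
  - by exists 0; split=> //; apply: (IE 0).2; rewrite normr0.
  - by exists B => //; apply/seteqP; split=> [s [Is Es]|s [_ Bs]].
  - exists (closure B); first exact: closed_closure.
    apply/seteqP; split=> [s Bs|s [Is cs]]; first by split; [case: Bs|exact: subset_closure].
    split=> //; apply: (cot_hausdorff hM) => U W Uc Wd; have sT := (IE s).1 Is.
    have [cc _] := sc s sT; have [cd _] := sd s sT.
    have N1 : nbhs s (c @^-1` U) by exact: cc.
    have N2 : nbhs s (d @^-1` W) by exact: cd.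
    have [r [[_ Er] [Ur Wr]]] := cs _ (filterI N1 N2).
    by exists (c r); split; [exact: Ur|rewrite Er; exact: Wr].
by have [] : B t by rewrite BE; exact: (IE t).2.
Qed.

(** The existence time is the same for all z near z0, which lets the compactness of energy sublevels
    produce a common time. *)
Lemma local_flow z0 : exists2 del : R, 0 < del &
  \forall z \near z0, exists c, c 0 = z /\ forall t, `|t| < del -> solat c t.
Proof.
pose i := chart_at A z0.1; have di : dom i z0.1 := chart_atP A _.
pose a0 := cot_coord i z0; have Ca : cot_codom i a0 by exact: cot_codom_coord.
have oD : open (cot_codom (A:=A) i) by exact: open_cot_codom.
have [rho rho0 bD] := eball_in_open oD Ca.
have [B [L [B0 L0 XB XL]]] := ham_vf_local (HC i) bD.
pose T := rho / 2 / (B + 1); have B1 : 0 < B + 1 by rewrite ltr_wpDl.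
have T0 : 0 < T by rewrite !divr_gt0.
have TB : T * B <= rho / 2.
  have : T * (B + 1) = rho / 2 by rewrite /T divfK// gt_eqF.
  by have := ltW T0; rewrite mulrDr mulr1; lra.
exists T => //.
have N1 : \forall z \near z0, `|a0 - cot_coord i z| <= rho / 2.
  have := cot_coord_continuous di; move/cvgrPdist_le; apply; exact: divr_gt0.
apply: filterS (filterI N1 (near_dom di)) => z [hz dz].
have hr : `|cot_coord i z - a0| + T * B <= rho by rewrite distrC; lra.
have [c [c0 Hc]] := @ode_local R E (ham_vf (local_rep H i)) a0 (cot_coord i z) rho B L T
   (@compact_eball _ _ a0 rho) XB XL B0 L0 T0 hr.
exists (fun t => cot_coordV i (c t)); split; first by rewrite c0 cot_coordK.
move=> t tT; have [bt Ht] := Hc t tT; have Ct : cot_codom i (c t) by exact: bD.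
apply: (@solat_cotV i c _ t (fun=> erefl) Ht).
by apply: filterS (near_norm_lt tT) => s sT; apply: bD; case: (Hc s sT).
Qed.

Variable G : cotangent A -> R.
Hypothesis GC : forall i, C2_on (cot_codom i) (local_rep G i).
Hypothesis GH : poisson_commute G H.

Lemma solat_derive_first_integral c t : solat c t -> is_derive t (1 : R) (G \o c) 0.
Proof.
move=> [cc Hc]; pose i := chart_at A (c t).1; have di : dom i (c t).1 := chart_atP A _.
set a := cot_coord i (c t); have Ca : cot_codom i a by exact: cot_codom_coord.
have dG : differentiable (local_rep G i) a by case: ((GC i).1 a Ca).
have dH : differentiable (local_rep H i) a by case: ((HC i).1 a Ca).
have near_E : \forall s \near t, (local_rep G i \o (fun s => cot_coord i (c s))) s = (G \o c) s.
  by apply: filterS (near_solat_dom cc di) => s ds; rewrite /= /local_rep cot_coordK.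
apply: (near_eq_is_derive near_E); apply: (is_derive_eq (is_derive_comp_diff dG (Hc i di))).
exact: (omega_diff dG dH (GH Ca)).
Qed.

Lemma first_integral c (T : R) : (forall t, `|t| < T -> solat c t) ->
  forall t, `|t| < T -> G (c t) = G (c 0).
Proof.
move=> sc t tT; have [t0|/ltW t0] := leP 0 t.
  have [|s _] := @mean_value R (G \o c) (fun=> 0) 0 t t0; last by rewrite mul0r => /eqP; rewrite subr_eq0 => /eqP.
  move=> s /andP[s0 st]; apply: solat_derive_first_integral; apply: sc.
  by apply: le_lt_trans tT; rewrite !ger0_norm.
have [|s _] := @mean_value R (G \o c) (fun=> 0) t 0 t0; last by rewrite mul0r => /eqP; rewrite subr_eq0 => /eqP.
move=> s /andP[st s0]; apply: solat_derive_first_integral; apply: sc.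
by apply: le_lt_trans tT; rewrite !ler0_norm// lerN2.
Qed.

End Orbits.

(** * Positive definite forms and convexity in the fibres *)

Section QuadraticForms.
Variables (R : realType) (n : nat).
Local Notation V := 'rV[R]_n.

Lemma compact_min (T : topologicalType) (f : T -> R) (K : set T) : K !=set0 -> compact K ->
  (forall a, K a -> {for a, continuous f}) -> exists2 c, K c & forall t, K t -> f c <= f t.
Proof.
move=> K0 cK cf; have cw : {within K, continuous f}.
  by apply: continuous_in_subspaceT => x /set_mem; exact: cf.
have [c /set_mem Kc Hc] := compact_EVT_min K0 cK cw.
by exists c => // t Kt; apply: Hc; exact: mem_set.
Qed.

Lemma compact_sphere : compact [set v : V | `|v| = 1].
Proof.
have -> : [set v : V | `|v| = 1] = [set v : V | `|v - 0| <= 1] `&` (fun v => `|v|) @^-1` [set x : R | x = 1].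
  apply/seteqP; split=> v /=; first by rewrite subr0 => ->.
  by move=> [].
apply: compact_closedI; first exact: compact_row_ball.
apply: closed_comp; first by move=> v _; exact: norm_continuous.
exact: closed_eq.
Qed.

Lemma posdef_bound (T : topologicalType) (K : set T) (Q : T -> V -> R) : compact K ->
  (forall a w, K a -> {for (a, w), continuous (fun aw : T * V => Q aw.1 aw.2)}) ->
  (forall a w (t : R), K a -> Q a (t *: w) = t ^+ 2 * Q a w) ->
  (forall a w, K a -> w != 0 -> 0 < Q a w) ->
  exists2 c : R, 0 < c & forall a w, K a -> c * `|w| ^+ 2 <= Q a w.
Proof.
move=> cK cQ hQ pQ; pose S := K `*` [set v : V | `|v| = 1].
(* S is empty when K is, or in dimension 0, where w = 0 is the only vector. *)
have [S0|] := pselect (S !=set0); last first.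
  move=> NS; exists 1 => // a w Ka; have [->|w0] := eqVneq w 0.
    have := hQ a 0 0 Ka; rewrite scale0r expr0n/= mul0r => ->.
    by rewrite normr0 expr0n mulr0.
  exfalso; apply: NS; exists (a, `|w|^-1 *: w); split=> //=.
  by rewrite normrZ normfV normr_id mulVf// normr_eq0.
have cS : compact S by apply: compact_setX => //; exact: compact_sphere.
have [[a0 w0] [/= Ka0 w01] Hm] := @compact_min _ (fun aw : T * V => Q aw.1 aw.2) S S0 cS
  (fun aw h => cQ aw.1 aw.2 h.1).
exists (Q a0 w0).
  by apply: pQ => //; rewrite -normr_eq0 w01 oner_eq0.
move=> a w Ka; have [->|wn0] := eqVneq w 0.
  have := hQ a 0 0 Ka; rewrite scale0r expr0n/= mul0r => ->.
  by rewrite normr0 expr0n mulr0.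
have nw0 : `|w| != 0 by rewrite normr_eq0.
have Ew : w = `|w| *: (`|w|^-1 *: w) by rewrite scalerA mulfV// scale1r.
have Sw : S (a, `|w|^-1 *: w).
  by split=> //=; rewrite normrZ normfV normr_id mulVf.
have /= h := Hm (a, `|w|^-1 *: w) Sw.
rewrite {2}Ew hQ// mulrC; apply: ler_wpM2l h; exact: sqr_ge0.
Qed.

End QuadraticForms.

Lemma is_derive_sub_quad (R : realType) (f : R -> R) (s df k m : R) : is_derive s (1 : R) f df ->
  is_derive s (1 : R) (fun r => f r - r * k - m * (r * r)) (df - k - m * (2 * s)).
Proof. by move=> D; apply: is_derive_eq; rewrite /GRing.scale/=; ring. Qed.

Section FiberConvexity.
Variables (R : realType) (n : nat).
Local Notation V := 'rV[R]_n.
Local Notation E := ('rV[R]_n * 'rV[R]_n)%type.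
Variables (h : E -> R) (D : set E).
Hypotheses (oD : open D) (hC : C2_on D h).
Hypothesis hpos : forall a (w : V), D a -> w != 0 ->
  0 < 'D_((0, w) : E) (fun y => 'D_((0, w) : E) h y) a.

(** The second fibre derivative expanded in coordinates: written so, it is visibly quadratic in w
    and jointly continuous in (a, w), as the compactness argument of [posdef_bound] requires. *)
Definition hess (a : E) (w : V) : R :=
  \sum_j w 0 j * pairing (gp ('D_((0, delta_mx 0 j) : E) h) a) w.

Lemma C2_diff a : D a -> differentiable h a.
Proof. by move=> Da; case: (hC.1 a Da). Qed.

Lemma C2_diff1 w a : D a -> differentiable ('D_w h) a.
Proof. by move=> Da; case: (hC.2 w a Da). Qed.

Lemma hessE a w : D a -> 'D_((0, w) : E) ('D_((0, w) : E) h) a = hess a w.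
Proof.
move=> Da; pose k j : E -> R := w 0 j *: 'D_((0, delta_mx 0 j) : E) h.
have N : \forall y \near a, 'D_((0, w) : E) h y = (\sum_j k j) y.
  have ND : nbhs a D by exact: open_nbhs_nbhs.
  apply: filterS ND => y Dy; rewrite (gp_derive _ (C2_diff Dy)) pairingE fct_sumE.
  by apply: eq_bigr => j _; rewrite mxE mulrC.
rewrite (near_eq_derive _ N) derive_sum; last first.
  by move=> j; apply: derivableZ; apply: diff_derivable; exact: C2_diff1.
apply: eq_bigr => j _; rewrite deriveZ; last by apply: diff_derivable; exact: C2_diff1.
by rewrite (gp_derive _ (C2_diff1 _ Da)).
Qed.

Lemma hess_continuous a w : D a -> {for (a, w), continuous (fun aw : E * V => hess aw.1 aw.2)}.
Proof.
move=> Da; rewrite /continuous_at /hess /=; apply: cvg_big => [|j _]; first exact: add_continuous.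
have c2 : (fun aw : E * V => aw.2) x @[x --> (a, w)] --> w by exact: cvg_snd.
have c1 : (fun aw : E * V => aw.1) x @[x --> (a, w)] --> a by exact: cvg_fst.
apply: cvgM.
  exact: (cvg_comp _ _ c2 (@coord_continuous _ _ _ 0 j w)).
apply: (cvg_pairing _ c2); apply: cvg_row => l.
have /(_ (0, delta_mx 0 l)) cc := (hC.2 (0, delta_mx 0 j) a Da).2.
have -> : (fun t : E * V => gp ('D_((0, delta_mx 0 j) : E) h) t.1 0 l) =
   (fun t : E * V => 'D_((0, delta_mx 0 l) : E) ('D_((0, delta_mx 0 j) : E) h) t.1).
  by apply/funext => t; rewrite mxE.
by rewrite mxE; exact: (cvg_comp _ _ c1 cc).
Qed.

Lemma hess_bound K : compact K -> K `<=` D -> exists2 c : R, 0 < c &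
  forall a w, K a -> c * pairing w w <= 'D_((0, w) : E) ('D_((0, w) : E) h) a.
Proof.
move=> cK KD; have [|||c c0 Hc] := @posdef_bound R n _ K hess cK.
- by move=> a w Ka; apply: hess_continuous; exact: KD.
- move=> a w t Ka; rewrite /hess mulr_sumr; apply: eq_bigr => j _.
  by rewrite mxE pairingZr; ring.
- by move=> a w Ka w0; rewrite -hessE; [exact: hpos (KD _ Ka) w0|exact: KD].
have n0 : 0 < n%:R + 1 :> R by rewrite ltr_wpDl.
exists (c / (n%:R + 1)); first exact: divr_gt0.
move=> a w Ka; rewrite hessE; last exact: KD.
apply: le_trans (Hc a w Ka); rewrite mulrAC ler_pdivrMr// -mulrA.
apply: ler_wpM2l; first exact: ltW.
by have := pairing_vv_le w; have := sqr_ge0 `|w|; lra.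
Qed.

Lemma fiber_line a w (s : R) : D (a + s *: (0, w)) ->
  is_derive s (1 : R) (fun r => h (a + r *: (0, w))) (pairing (gp h (a + s *: (0, w))) w) /\
  is_derive s (1 : R) (fun r => 'D_((0, w) : E) h (a + r *: (0, w)))
    ('D_((0, w) : E) ('D_((0, w) : E) h) (a + s *: (0, w))).
Proof.
move=> Da; split; last by apply: is_derive_line; apply: diff_derivable; exact: C2_diff1.
by rewrite -(gp_derive _ (C2_diff Da)); apply: is_derive_line; apply: diff_derivable; exact: C2_diff.
Qed.

(** The Hessian bound integrated once along the segment from p to q gives the monotonicity of [gp];
    integrated twice, the quadratic lower bound for h. *)
Lemma fiber_convex K (c : R) x p q : 0 <= c -> K `<=` D -> seg_closed K ->
  (forall a w, K a -> c * pairing w w <= 'D_((0, w) : E) ('D_((0, w) : E) h) a) ->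
  K (x, p) -> K (x, q) ->
  c * pairing (q - p) (q - p) <= pairing (gp h (x, q) - gp h (x, p)) (q - p) /\
  h (x, p) + pairing (gp h (x, p)) (q - p) + c / 2 * pairing (q - p) (q - p) <= h (x, q).
Proof.
move=> c0 KD sK HK Kp Kq; set w := q - p; set N := pairing w w.
have E1 : (x, q) = (x, p) + 1 *: ((0, w) : E).
  by rewrite scale1r; congr pair; rewrite /= ?addr0// /w addrC subrK.
have E0 : (x, p) = (x, p) + 0 *: ((0, w) : E) by rewrite scale0r addr0.
have Ks s : 0 <= s <= 1 -> K ((x, p) + s *: ((0, w) : E)).
  move=> s01; have := sK _ _ s Kp Kq s01; suff -> : (x, q) - (x, p) = ((0, w) : E) by [].
  by congr pair; rewrite /= ?subrr.
pose f s := 'D_((0, w) : E) h ((x, p) + s *: (0, w)).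
have fE s : 0 <= s <= 1 -> f s = pairing (gp h ((x, p) + s *: (0, w))) w.
  by move=> /Ks /KD Ds; rewrite /f (gp_derive _ (C2_diff Ds)).
have incf s : 0 <= s <= 1 -> c * N * s <= f s - f 0.
  move=> /andP[s0 s1]; rewrite -{1}(subr0 s).
  apply: (derive_ge_increment (df := fun s => 'D_((0, w) : E) ('D_((0, w) : E) h) ((x, p) + s *: ((0, w) : E))) s0) => r /andP[r0 rs].
    by have [] := @fiber_line (x, p) w r (KD _ (Ks r _)); rewrite ?r0 ?(le_trans rs s1).
  by apply: HK; apply: Ks; rewrite r0 (le_trans rs s1).
have z01 : 0 <= (0 : R) <= 1 by rewrite lexx ler01.
have o01 : 0 <= (1 : R) <= 1 by rewrite lexx ler01.
split.
  by have := incf 1 o01; rewrite mulr1 !fE// -E1 -E0 pairingBl.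
pose g s := h ((x, p) + s *: ((0, w) : E)) - s * f 0 - c / 2 * N * (s * s).
have := @derive_ge_increment R g (fun s => f s - f 0 - c * N * s) 0 1 0 ler01.
rewrite mul0r /g -E1 -E0 !mul0r !mul1r mulr0 !subr0 => HH.
have : 0 <= h (x, q) - f 0 - c / 2 * N * 1 - h (x, p).
  apply: HH => s s01; last by have := incf s s01; lra.
  have [D1 _] := @fiber_line (x, p) w s (KD _ (Ks s s01)).
  apply: (eq_is_derive_val _ (is_derive_sub_quad (f 0) (c / 2 * N) D1)).
  by rewrite (fE s)//; lra.
by rewrite fE// -E0; lra.
Qed.

Lemma fiber_convex0 x p q : (forall r, D (x, r)) ->
  h (x, p) + pairing (gp h (x, p)) (q - p) <= h (x, q).
Proof.
move=> Dx; pose r := Num.max `|p| `|q|.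
(* A box of radius 0 in position lies in a single fibre. *)
have cK : compact (box x 0 r) by exact: compact_box.
have KD : box x 0 r `<=` D.
  by move=> [y s] [/=]; rewrite normr_le0 subr_eq0 => /eqP -> _; exact: Dx.
have [c c0 Hc] := hess_bound cK KD.
have B s : `|s| <= r -> box x 0 r (x, s) by move=> sr; split; rewrite /= ?subrr ?normr0.
have [] := @fiber_convex _ c x p q (ltW c0) KD (@seg_closed_box _ _ x 0 r) Hc (B p _) (B q _).
- by rewrite le_max lexx.
- by rewrite le_max lexx orbT.
move=> _; apply: le_trans; rewrite lerDl mulr_ge0 ?pairing_vv_ge0// divr_ge0//; exact: ltW.
Qed.

End FiberConvexity.

Lemma is_derive_affine (R : realType) (W : normedModType R) (q v : W) (s : R) :
  is_derive s (1 : R) (fun r => q + r *: v) v.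
Proof.
apply: (@quad_derive _ _ _ _ _ 0); near=> r.
by rewrite mul0r opprD addrACA subrr add0r -scalerBl subrr normr0.
Unshelve. all: by end_near.
Qed.

(** * Tonelli Hamiltonians and the Legendre transform in charts *)

Section TonelliCharts.
Variables (R : realType) (n : nat) (M : ptopologicalType) (A : C2atlas R n M).
Variables (g : riemannian A) (H : cotangent A -> R).
Hypothesis tH : tonelli g H.
Local Notation V := 'rV[R]_n.
Local Notation E := ('rV[R]_n * 'rV[R]_n)%type.

Lemma tonelli_C2 i : C2_on (cot_codom i) (local_rep H i).
Proof. by case: tH. Qed.

Lemma cot_codom_chart (i : chart_index A) x (q : V) : dom i x -> cot_codom i (chart i x, q).
Proof. by move=> di; exact: codom_chart_chart. Qed.

Lemma local_hess_pos i (a : E) (w : V) : cot_codom i a -> w != 0 ->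
  0 < 'D_((0, w) : E) ('D_((0, w) : E) (local_rep H i)) a.
Proof.
move: a => [y p] Ca w0; have [dx xE] := codom_chartP Ca; rewrite /= in xE.
set x := chartV i y in dx xE; set J := (tjac (chart_at A x) i x)^T.
have JE q : local_rep H i (y, q) = H (x, q *m J) by rewrite -xE local_repE.
have D1 q : 'D_((0, w) : E) (local_rep H i) (y, q) = 'D_(w *m J) (fun q' => H (x, q')) (q *m J).
  apply: derive_line_eq => s /=.
  have -> : s *: ((0, w) : E) + (y, q) = (y, s *: w + q) by congr pair; rewrite /= scaler0 add0r.
  by rewrite JE mulmxDl scalemxAl.
have -> : 'D_((0, w) : E) ('D_((0, w) : E) (local_rep H i)) (y, p) =
   'D_(w *m J) (fun q => 'D_(w *m J) (fun q' => H (x, q')) q) (p *m J).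
  apply: derive_line_eq => s /=.
  have -> : s *: ((0, w) : E) + (y, p) = (y, s *: w + p) by congr pair; rewrite /= scaler0 add0r.
  by rewrite D1 mulmxDl scalemxAl.
case: tH => _ _ _; apply; apply: contra w0 => /eqP wJ.
have uJ : J \in unitmx by rewrite unitmx_tr; apply: tjac_unit => //; exact: chart_atP.
by apply/eqP; rewrite -[w](mulmxK uJ) wJ mul0mx.
Qed.

Lemma tnorm_posdef x : exists2 c : R, 0 < c & forall v : V, c * `|v| ^+ 2 <= (v *m metric g x *m v^T) 0 0.
Proof.
have [||||c c0 Hc] := @posdef_bound R n V [set 0] (fun _ v => (v *m metric g x *m v^T) 0 0).
- exact: compact_set1.
- move=> a w _.
  have -> : (fun aw : V * V => (aw.2 *m metric g x *m aw.2^T) 0 0) = (fun aw : V * V => pairing (aw.2 *m metric g x) aw.2) by [].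
  have c2 : (fun aw : V * V => aw.2) y @[y --> (a, w)] --> w by exact: cvg_snd.
  apply: (cvg_pairing _ c2).
  apply: cvg_row => l.
  have mE (v : V) : (v *m metric g x) 0 l = pairing v (col l (metric g x))^T.
    by rewrite pairingE mxE; apply: eq_bigr => j _; rewrite !mxE.
  have -> : (fun aw : V * V => (aw.2 *m metric g x) 0 l) = (fun aw : V * V => pairing aw.2 (col l (metric g x))^T).
    by apply/funext => aw; exact: mE.
  by rewrite mE; apply: (cvg_pairing c2); exact: cvg_cst.
- by move=> a w t _; rewrite -scalemxAl linearZ/= -scalemxAr -scalemxAl !mxE mulrA.
- by move=> a w _; exact: metric_posdef.
by exists c => // v; exact: Hc.
Qed.

Lemma conorm_ge x (q v : V) : tnorm g x v <= 1 -> pairing q v <= conorm g x q.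
Proof.
move=> v1; apply: ub_le_sup; last by exists v.
have [c c0 Hc] := tnorm_posdef x.
exists (n%:R * (`|q| * (1 + c^-1))) => _ [w /= w1 <-].
apply: le_trans (ler_norm _) _; apply: pairing_bound_le => //.
have W1 : (w *m metric g x *m w^T) 0 0 <= 1.
  rewrite leNgt; apply/negP => W1; move: w1; rewrite leNgt => /negP; apply.
  by rewrite /tnorm -[ltLHS]sqrtr1 ltr_sqrt// (lt_trans ltr01).
have h : `|w| ^+ 2 <= c^-1 by rewrite -(ler_pM2l c0) mulfV ?gt_eqF//; apply: le_trans (Hc w) W1.
have [wl|wg] := leP `|w| 1; first by apply: le_trans wl _; rewrite lerDl invr_ge0 ltW.
apply: le_trans (_ : `|w| ^+ 2 <= _); first by rewrite expr2 ler_peMr// ltW.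
by apply: le_trans h _; rewrite lerDr.
Qed.

(** The matrix of the metric in the chart i is bounded near x0, so vectors with small coordinates
    lie in the unit ball; testing the conorm on the multiples k and - k of each basis vector bounds
    every coordinate of the covector. *)
Lemma conorm_ge_chart i x0 : dom i x0 -> exists2 k : R, 0 < k &
  \forall y \near x0, forall q : V, k * `|q *m (tjac i (chart_at A y) y)^T| <= conorm g y q.
Proof.
move=> di; pose m y := tjac i (chart_at A y) y *m metric g y *m (tjac i (chart_at A y) y)^T.
have cm : {for x0, continuous m} by exact: metric_continuous.
pose B := `|m x0| + 1; have B0 : 0 < B by rewrite ltr_wpDl.
have N : \forall y \near x0, `|m y| <= B.
  have cn : `|m y| @[y --> x0] --> `|m x0| by exact: cvg_norm.
  have : \forall y \near x0, `|m y| < B by apply: cvgr_lt cn _ _; rewrite ltrDl.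
  by apply: filterS => y /ltW.
pose k := (1 + n%:R * (n%:R * B))^-1.
have k0 : 0 < k by rewrite invr_gt0 ltr_pwDl// !mulr_ge0// ltW.
exists k => //; apply: filterS N => y mB q.
set p := q *m _; have nrm (w : V) : `|w| <= k -> tnorm g y (w *m tjac i (chart_at A y) y) <= 1.
  move=> wk; rewrite /tnorm -[leRHS]sqrtr1 ler_sqrt// trmx_mul !mulmxA -(mulmxA w) -(mulmxA w).
  apply: le_trans (ler_norm _) _; apply: le_trans (quad_form_bound (m y) w) _.
  apply: (@le_trans _ _ (n%:R * (n%:R * B * k) * k)).
    by apply: ler_pM; rewrite ?mulr_ge0//; apply: ler_wpM2l => //; apply: ler_pM; rewrite ?mulr_ge0//; exact: ler_wpM2l.
  have -> : n%:R * (n%:R * B * k) * k = (n%:R * (n%:R * B)) * k * k by ring.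
  have h : n%:R * (n%:R * B) * k <= 1.
    by rewrite ler_pdivrMr ?mul1r ?lerDr// ltr_pwDl// !mulr_ge0// ltW.
  have k1 : k <= 1 by rewrite invf_le1 ?lerDl ?ltr_pwDl// ?mulr_ge0// ltW.
  by rewrite -[leRHS]mulr1; apply: ler_pM => //; rewrite ?mulr_ge0// ltW.
have H1 (w : V) : `|w| <= k -> pairing p w <= conorm g y q.
  by move=> /nrm /(conorm_ge q); rewrite /p pairing_trmx.
have C0 : 0 <= conorm g y q by have := H1 0; rewrite normr0 pairing0r; apply; exact: ltW.
rewrite mulrC -ler_pdivlMr//; apply: row_norm_le; first by rewrite divr_ge0// ltW.
move=> j; rewrite ler_pdivlMr//.
have dn : `|k *: delta_mx 0 j : V| <= k.
  have e1 : `|delta_mx 0 j : V| <= 1.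
    by apply: row_norm_le => // l; rewrite mxE; case: (_ && _); rewrite ?normr1 ?normr0.
  by rewrite normrZ (gtr0_norm k0); apply: ler_piMr e1; exact: ltW.
have := H1 _ dn; have := H1 (- (k *: delta_mx 0 j)); rewrite normrN => /(_ dn).
rewrite pairingNr pairingZr pairing_deltar => h1 h2.
by have [p0|p0] := leP 0 (p 0 j); [rewrite ger0_norm//|rewrite ltr0_norm//]; lra.
Qed.

Lemma local_superlinear i x0 : dom i x0 -> exists2 r : R, 0 < r &
  (forall y : V, `|y - chart i x0| <= r -> codom_chart i y) /\
  forall K : R, 0 < K -> exists C : R, forall a : E, `|a.1 - chart i x0| <= r ->
    K * `|a.2| - C <= local_rep H i a.
Proof.
move=> di; have [k k0 N] := conorm_ge_chart di.
have N1 : \forall y \near chart i x0, forall q : V,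
    k * `|q *m (tjac i (chart_at A (chartV i y)) (chartV i y))^T| <= conorm g (chartV i y) q.
  pose U := [set y | forall q : V, k * `|q *m (tjac i (chart_at A y) y)^T| <= conorm g y q].
  have NU : nbhs (chartV i (chart i x0)) U by rewrite (chartK di); exact: N.
  exact: (@chartV_nbhs _ _ _ _ _ _ U (codom_chart_chart di) NU).
have N2 : nbhs (chart i x0) (codom_chart i).
  by apply: open_nbhs_nbhs; split; [exact: open_codom|exact: codom_chart_chart].
have [d /= d0 Hd] := (nbhs_normP (chart i x0) _).1 (filterI N1 N2).
have dd (y : V) : `|y - chart i x0| <= d / 2 -> `|chart i x0 - y| < d.
  by move=> h; rewrite distrC (le_lt_trans h)// ltr_pdivrMr// ltr_pMr// ltr1n.
exists (d / 2); first exact: divr_gt0.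
split=> [y /dd /Hd[]//|K K0].
case: tH => _ /(_ (K / k)) []; first exact: divr_gt0.
move=> C HC _ _; exists C => -[y p] /= /dd /Hd [Hy Cy].
have [dx xE] := codom_chartP Cy; set x := chartV i y in dx xE Hy.
have -> : local_rep H i (y, p) = H (x, p *m (tjac (chart_at A x) i x)^T) by rewrite -xE local_repE.
apply: le_trans (HC _ _); rewrite lerB//.
have := Hy (p *m (tjac (chart_at A x) i x)^T).
rewrite -mulmxA -trmx_mul tjacK//; last exact: chart_atP.
rewrite trmx1 mulmx1 => h; rewrite mulrAC ler_pdivlMr// -mulrA; apply: ler_wpM2l; first exact: ltW.
by rewrite mulrC.
Qed.

Lemma ham_continuous : continuous H.
Proof.
move=> z; pose i := chart_at A z.1; have di : dom i z.1 := chart_atP A _.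
have N : \forall w \near z, local_rep H i (cot_coord i w) = H w.
  by apply: (@filterS _ (nbhs z) (nbhs_filter z)) (near_dom di) => w; exact: local_rep_coord.
have cl : {for cot_coord i z, continuous (local_rep H i)}.
  apply: differentiable_continuous; have [C1 _] := tonelli_C2 i.
  by have [] := C1 _ (cot_codom_coord di).
have := @continuous_comp _ _ _ _ _ z (cot_coord_continuous di) cl.
move=> h; have {}h : (local_rep H i \o cot_coord i) w @[w --> z] --> H z.
  by rewrite -(local_rep_coord H di); exact: h.
by apply: cvg_trans h; apply: (@near_eq_cvg _ _ (nbhs z) (nbhs_filter z)); apply: (@filterS _ (nbhs z) (nbhs_filter z)) N => w Ew; first [exact: Ew | exact: esym Ew].
Qed.

Hypothesis cM : compact [set: M].

(** The bases of an ultrafilter on the sublevel converge, by compactness of M, to some x0.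
    Superlinearity of slope 1 in a chart at x0 then confines the covectors to a compact box. *)
Lemma sublevel_compact e : compact [set z | H z <= e].
Proof.
rewrite compact_ultra => U UU Ue; have FU : ProperFilter U by exact: ultra_proper.
have UF : UltraFilter (fst @ U : set_system M) by exact: ultra_fmap.
move: (cM); rewrite compact_ultra => /(_ _ UF) [|x0 [_ Ux0]].
  by apply: (@filterS _ U _ _ _ _ Ue).
pose i := chart_at A x0; have di : dom i x0 := chart_atP A _.
have [r r0 [rD Hr]] := local_superlinear di; have [C HC] := Hr 1 ltr01.
pose W := [set y : M | dom i y /\ `|chart i y - chart i x0| <= r].
have NW : nbhs x0 W.
  have N1 : nbhs x0 (dom i) by apply: open_nbhs_nbhs; split=> //; exact: open_dom.
  have := chart_continuous di; move/cvgrPdist_le => /(_ r r0) N2.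
  by apply: filterS (filterI N1 N2) => y [h1 h2]; split=> //; rewrite distrC.
pose B := box (chart i x0) r (e + C).
have BD : B `<=` cot_codom i by move=> a [h _]; exact: rD.
have cB : compact (cot_coordV i @` B).
  apply: continuous_compact; last exact: compact_box.
  by apply: continuous_in_subspaceT => a /set_mem /BD; exact: cot_coordV_continuous.
have UB : U (cot_coordV i @` B).
  have U1 : U (fst @^-1` W) by exact: Ux0.
  apply: (@filterS _ U _ _ _ _ (filterI U1 Ue)) => z [[dz hz] /= He].
  exists (cot_coord i z); last exact: cot_coordK.
  split; first by rewrite cot_coord1.
  have := HC (cot_coord i z); rewrite cot_coord1 => /(_ hz).
  by rewrite local_rep_coord// mul1r; lra.
move: cB; rewrite compact_ultra => /(_ _ UU UB) [z [_ Uz]]; exists z; split=> //=.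
rewrite leNgt; apply/negP => He.
have NH : nbhs z [set w | e < H w].
  have He' : 0 < H z - e by rewrite subr_gt0.
  have := @ham_continuous z; move/cvgrPdist_lt => /(_ _ He').
  apply: (@filterS _ (nbhs z) (nbhs_filter z)) => w /=; rewrite ltr_norml => /andP[_]; lra.
have [w [/= h1 h2]] := filter_ex (filterI Ue (Uz _ NH)).
by move: h1; rewrite leNgt h2.
Qed.

Lemma chart_superlinear i x : dom i x -> forall K : R, 0 < K -> exists C : R, forall q : V,
  K * `|q| - C <= local_rep H i (chart i x, q).
Proof.
move=> di K K0; have [r r0 [_ Hr]] := local_superlinear di; have [C HC] := Hr K K0.
by exists C => q; have h := HC (chart i x, q); apply: h; rewrite /= subrr normr0 ltW.
Qed.

Lemma lagrangian_chart i x (w q : V) : dom i x ->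
  pairing (q *m (tjac (chart_at A x) i x)^T) (w *m tjac i (chart_at A x) x) = pairing q w.
Proof. by move=> di; exact: (pairing_tjac q w di (chart_atP A x)). Qed.

Lemma lagrangian_ubound i x (w : V) : dom i x ->
  has_ubound [set pairing p (w *m tjac i (chart_at A x) x) - H (x, p) | p in [set: V]].
Proof.
move=> di; have K0 : 0 < n%:R * `|w| + 1 by rewrite ltr_wpDl// mulr_ge0.
have [C HC] := chart_superlinear di K0; exists C => _ [p _ <-].
pose q := p *m (tjac i (chart_at A x) x)^T.
have pE : p = q *m (tjac (chart_at A x) i x)^T.
  by rewrite /q -mulmxA -trmx_mul tjacK ?trmx1 ?mulmx1//; exact: chart_atP.
rewrite pE lagrangian_chart// -local_repE//.
have := HC q; have := le_trans (ler_norm _) (pairing_bound q w).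
have := normr_ge0 q; rewrite mulrDl mul1r -mulrA (mulrC `|q|); lra.
Qed.

Lemma fenchel i x (q w : V) : dom i x ->
  pairing q w - local_rep H i (chart i x, q) <= lagrangian H (x, w *m tjac i (chart_at A x) x).
Proof.
move=> di; apply: ub_le_sup; first exact: lagrangian_ubound.
exists (q *m (tjac (chart_at A x) i x)^T); first exact: I.
exact: (f_equal2 (fun a b : R => a - b) (lagrangian_chart w q di) (esym (local_repE H q di))).
Qed.

Lemma lagrangian_le i x (w : V) B : dom i x ->
  (forall q, pairing q w - local_rep H i (chart i x, q) <= B) ->
  lagrangian H (x, w *m tjac i (chart_at A x) x) <= B.
Proof.
move=> di HB; apply: ge_sup; first by exists (pairing 0 (w *m tjac i (chart_at A x) x) - H (x, 0)); exists 0.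
move=> _ [p _ <-]; pose q := p *m (tjac i (chart_at A x) x)^T.
have pE : p = q *m (tjac (chart_at A x) i x)^T.
  by rewrite /q -mulmxA -trmx_mul tjacK ?trmx1 ?mulmx1//; exact: chart_atP.
have P p' : p' = q *m (tjac (chart_at A x) i x)^T ->
    pairing p' (w *m tjac i (chart_at A x) x) - H (x, p') <= B.
  move=> ->; apply: le_trans (HB q); rewrite le_eqVlt; apply/orP; left; apply/eqP.
  exact: (f_equal2 (fun a b : R => a - b) (lagrangian_chart w q di) (esym (local_repE H q di))).
exact: P.
Qed.

Lemma fiber_conv i x (p q : V) : dom i x -> local_rep H i (chart i x, p) +
  pairing (gp (local_rep H i) (chart i x, p)) (q - p) <= local_rep H i (chart i x, q).
Proof.
move=> di; have oD : open (cot_codom (A := A) i) by exact: open_cot_codom.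
apply: (fiber_convex0 oD (tonelli_C2 i)); last by move=> r; exact: cot_codom_chart.
by move=> a w Ca w0; exact: local_hess_pos.
Qed.

Lemma fenchel_eq i x (q : V) : dom i x ->
  lagrangian H (x, gp (local_rep H i) (chart i x, q) *m tjac i (chart_at A x) x) =
  pairing q (gp (local_rep H i) (chart i x, q)) - local_rep H i (chart i x, q).
Proof.
move=> di; apply/eqP; rewrite eq_le fenchel// andbT; apply: lagrangian_le => // r.
have := fiber_conv q r di; rewrite pairingBr.
rewrite (pairingC r) (pairingC q); move: (pairing _ r) (pairing _ q) (local_rep H i _) (local_rep H i _) => a b c d; lra.
Qed.

(** The covector q is a minimizer of q |-> H(x, q) - q(w), which is coercive by superlinearity; the
    radius r is such that values outside the ball exceed the value at 0. *)
Lemma gp_surj i x (w : V) : dom i x -> exists q, gp (local_rep H i) (chart i x, q) = w.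
Proof.
move=> di; have K0 : 0 < n%:R * `|w| + 1 by rewrite ltr_wpDl// mulr_ge0.
have [C HC] := chart_superlinear di K0.
pose f q := local_rep H i (chart i x, q) - pairing q w.
have fC q : `|q| - C <= f q.
  have := HC q; have := le_trans (ler_norm _) (pairing_bound q w).
  by rewrite /f mulrDl mul1r -mulrA (mulrC `|q|); lra.
have dh q : differentiable (local_rep H i) (chart i x, q).
  by have [] := (tonelli_C2 i).1 _ (cot_codom_chart q di).
have fD (q v : V) (s : R) : is_derive s (1 : R) (fun s => f (q + s *: v))
    (pairing (gp (local_rep H i) (chart i x, q + s *: v) - w) v).
  have I : is_derive s (1 : R) (fun s : R => q + s *: v) v.
    exact: is_derive_affine.
  have D1 := is_derive_comp_grad (dh (q + s *: v)) (is_derive_cst (chart i x) s 1) I.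
  have D2 := is_derive_pairing I (is_derive_cst w s 1).
  apply: (eq_is_derive_val _ (is_deriveB D1 D2)).
  have EE (a b c d e : V) : pairing a 0 + pairing b e - (pairing e c + pairing d 0) = pairing (b - c) e.
    by rewrite !pairing0r addr0 add0r pairingBl (pairingC e).
  exact: EE.
pose r := Num.max 0 (f 0 + C) + 1.
have r0 : 0 < r by rewrite ltr_pwDr// le_max lexx.
have cf q : {for q, continuous f}.
  apply: (@cvgB _ _ _ (nbhs q) _ (fun q => local_rep H i (chart i x, q)) (fun q => pairing q w)).
    have c2 : {for (chart i x, q), continuous (local_rep H i)} by exact: differentiable_continuous.
    have c1 : (fun q => (chart i x, q)) y @[y --> q] --> ((chart i x, q) : E).
      exact: (@cvg_pair _ _ _ (nbhs q) (nbhs (chart i x)) (nbhs q) _ _ _ (fun=> chart i x) id (cvg_cst _) cvg_id).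
    exact: (cvg_comp _ _ c1 c2).
  by apply: cvg_pairing; [exact: cvg_id|exact: cvg_cst].
have cB : compact [set y : V | `|y - 0| <= r] by exact: compact_row_ball.
have [|q qr Hq] := @compact_min _ _ f [set y : V | `|y - 0| <= r] _ cB (fun q _ => cf q).
  by exists 0; rewrite /= subrr normr0 ltW.
have Hq' y : f q <= f y.
  have [h|h] := leP `|y - 0| r; first exact: Hq.
  have H0 : f q <= f 0 by apply: Hq; rewrite /= subrr normr0 ltW.
  apply: le_trans H0 _; apply: le_trans (fC y); move: h; rewrite subr0 /r.
  have : f 0 + C <= Num.max 0 (f 0 + C) by rewrite le_max lexx orbT.
  lra.
exists q; apply/eqP; rewrite -subr_eq0; apply/eqP/pairing_inj => v; rewrite pairing0l.
have D0 := fD q v 0; rewrite scale0r addr0 in D0.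
have H1 : is_derive (0 : R) (1 : R) (fun s => f (q + s *: v)) 0.
  apply: (@derive1_at_min _ (fun s => f (q + s *: v)) (-1) 1 0).
  - by lra.
  - by move=> t _; have [] := fD q v t.
  - by rewrite in_itv/=; lra.
  - by move=> t _; rewrite scale0r addr0; exact: Hq'.
exact: is_derive_unique D0 H1.
Qed.

(** Within distance 1 of p the gain over the tangent plane is quadratic by the Hessian bound.
    Farther away, convexity from the point p + e at distance 1 keeps the slope gained there, so the
    gain is still linear. *)
Lemma lagrangian_fiber_strong i x (p q : V) : dom i x -> exists2 c : R, 0 < c & forall q : V,
  local_rep H i (chart i x, p) + pairing (gp (local_rep H i) (chart i x, p)) (q - p) +
  c * Num.min (`|q - p| ^+ 2) `|q - p| <= local_rep H i (chart i x, q).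
Proof.
move=> di; have oD : open (cot_codom (A := A) i) by exact: open_cot_codom.
pose r0 := `|p| + 1; pose K := box (chart i x) 0 r0.
have cK : compact K by exact: compact_box.
have KD : K `<=` cot_codom i.
  by move=> [y s] [/=]; rewrite normr_le0 subr_eq0 => /eqP -> _; exact: cot_codom_chart.
have sK : seg_closed K by exact: seg_closed_box.
have hp (a : E) (w : V) : cot_codom i a -> w != 0 -> 0 < 'D_((0, w) : E) ('D_((0, w) : E) (local_rep H i)) a.
  exact: local_hess_pos.
have [c c0 Hc] := hess_bound oD (tonelli_C2 i) hp cK KD.
have Kin s : `|s - p| <= 1 -> K (chart i x, s).
  move=> s1; split; rewrite /= ?subrr ?normr0//.
  by have := ler_normD (s - p) p; rewrite subrK /r0; lra.
have Kp : K (chart i x, p) by apply: Kin; rewrite subrr normr0 ler01.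
have HS s (h : `|s - p| <= 1) := fiber_convex (tonelli_C2 i) (ltW c0) KD sK Hc Kp (Kin s h).
exists (c / 2); first exact: divr_gt0.
move=> s; have c20 : 0 <= c / 2 by rewrite divr_ge0// ltW.
have [s1|s1] := leP `|s - p| 1.
  have [_ h] := HS s s1; apply: le_trans h; rewrite lerD2l; apply: ler_wpM2l => //.
  by apply: le_trans (pairing_vv_ge _); rewrite ge_min lexx.
pose d := `|s - p|; pose e := d^-1 *: (s - p); have d0 : 0 < d by exact: lt_trans ltr01 s1.
have ne : `|e| = 1 by rewrite normrZ normfV normr_id mulVf// gt_eqF.
have N1 : 1 <= pairing e e by have := pairing_vv_ge e; rewrite ne expr1n.
have sE : s - p = d *: e by rewrite /e scalerA mulfV ?scale1r// gt_eqF.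
have e1 : `|p + e - p| <= 1 by rewrite addrAC subrr add0r ne.
have [h1 h2] := HS (p + e) e1; have h3 := fiber_conv (p + e) s di.
have Ee : p + e - p = e by rewrite addrAC subrr add0r.
have Es : s - (p + e) = (d - 1) *: e by rewrite opprD addrA sE scalerBl scale1r.
rewrite Ee in h1 h2; rewrite Es pairingZr in h3; rewrite sE pairingZr.
rewrite pairingBl in h1.
have hm : Num.min (`|d *: e| ^+ 2) `|d *: e| <= d.
  by rewrite normrZ ne mulr1 (gtr0_norm d0) ge_min lexx orbT.
have hm2 := ler_wpM2l c20 hm.
move: h1 h2 h3 hm2; move: (pairing (gp _ _) e) (pairing (gp _ _) e) (pairing e e) N1 => a b N N1.
have c0' := ltW c0; have d1 : 1 <= d by exact: ltW.
move: (local_rep H i _) (local_rep H i _) (local_rep H i _) (Num.min _ _) => A1 A2 A3 m h1 h2 h3 h4.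
have h5 : (d - 1) * (a + c * N) <= (d - 1) * b by apply: ler_wpM2l; lra.
have h6 : c * 1 <= c * N by apply: ler_wpM2l.
have h7 : (d - 1) * (c * 1) <= (d - 1) * (c * N) by apply: ler_wpM2l; lra.
nra.
Qed.

Lemma min_quad_bound (c d t : R) : 0 < c -> 0 <= d -> 0 <= t <= c ->
  t * d - c * Num.min (d ^+ 2) d <= c^-1 * t ^+ 2.
Proof.
move=> c0 d0 /andP[t0 tc]; have c0' := ltW c0.
have [d1|d1] := leP (d ^+ 2) d.
  rewrite mulrC [leRHS]mulrC ler_pdivlMr// !expr2.
  have := sqr_ge0 (c * d - t); have : 0 <= (c * d) * t by rewrite !mulr_ge0.
  by rewrite expr2; lra.
apply: (@le_trans _ _ 0); first by rewrite subr_le0 ler_wpM2r.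
by rewrite mulr_ge0 ?invr_ge0 ?sqr_ge0.
Qed.

(** The Lagrangian is known only as a supremum. Its derivative at v in the direction j is found by
    squeezing it between the affine minorant given by p and that minorant plus c^-1 s^2, the upper
    bound being a consequence of [lagrangian_fiber_strong]. *)
Lemma legendre_gp (x : M) (p : V) :
  legendre H (x, gp (local_rep H (chart_at A x)) (chart (chart_at A x) x, p)) = (x, p).
Proof.
set i := chart_at A x; have di : dom i x := chart_atP A x.
set v := gp _ _; rewrite /legendre/=; congr pair.
have [c c0 HS] := lagrangian_fiber_strong p p di; rewrite -/v in HS.
have T1 (w : V) : w *m tjac i i x = w by rewrite tjac_id ?mulmx1.
have F0 : lagrangian H (x, v) = pairing p v - local_rep H i (chart i x, p).
  by have := fenchel_eq p di; rewrite -/i -/v T1.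
apply/rowP => j; rewrite mxE; pose e : V := delta_mx 0 j.
pose G (s : R) := lagrangian H (x, v + s *: e).
have D : is_derive (0 : R) (1 : R) G (p 0 j).
  apply: (@quad_derive _ _ _ _ _ c^-1).
  have N : \forall s \near (0 : R), `|s| < c.
    by apply/(nbhs_normP (0 : R) _); exists c => // s /=; rewrite sub0r normrN.
  apply: filterS N => s sc; rewrite subr0 {2}/G scale0r addr0 F0.
  have pe : pairing p (v + s *: e) = pairing p v + s * p 0 j.
    by rewrite pairingDr pairingZr pairing_deltar.
  have lo : pairing p v + s * p 0 j - local_rep H i (chart i x, p) <= G s.
    by have := fenchel p (v + s *: e) di; rewrite -/i T1 pe.
  have up : G s <= pairing p v - local_rep H i (chart i x, p) + s * p 0 j + c^-1 * s ^+ 2.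
    rewrite /G -(T1 (v + s *: e)); apply: lagrangian_le => // q.
    have h1 := HS q; rewrite pairingDr pairingZr pairing_deltar.
    have h2 : s * q 0 j - s * p 0 j <= `|s| * `|q - p|.
      rewrite -mulrBr; apply: le_trans (ler_norm _) _; rewrite normrM; apply: ler_wpM2l => //.
      by have := row_norm_ge (q - p) j; rewrite !mxE.
    have h3 := min_quad_bound c0 (normr_ge0 (q - p)) (_ : 0 <= `|s| <= c).
    have {}h3 := h3 ltac:(by rewrite normr_ge0 ltW).
    rewrite real_normK ?num_real// in h3.
    move: h1 h2 h3; rewrite pairingBr (pairingC v q) (pairingC v p).
    move: (Num.min _ _) (local_rep H i _) (local_rep H i _) (pairing _ _) (pairing _ _) (`|s| * _) (c^-1 * _) => m a b u w y k; lra.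
  have k0 : 0 <= c^-1 * s ^+ 2 by rewrite mulr_ge0 ?invr_ge0 ?sqr_ge0// ltW.
  rewrite ler_norml /GRing.scale/=; move: lo up k0.
  move: (G s) (pairing p v) (local_rep H i _) (c^-1 * _) (s * _) => a b d k m; lra.
rewrite -[RHS](@derive_val _ _ _ _ _ _ _ D); apply: derive_line_eq => h /=.
by rewrite /G addr0 /GRing.scale/= mulr1 addrC.
Qed.

(** [legendreV] is a choice among preimages; since every velocity has the form [gp] ([gp_surj]),
    [legendre_gp] leaves only one. *)
Lemma legendreVE z :
  legendreV H z = (z.1, gp (local_rep H (chart_at A z.1)) (chart (chart_at A z.1) z.1, z.2)).
Proof.
case: z => x p; rewrite /legendreV; apply: xget_unique; first exact: legendre_gp.
move=> [y w] /= E0; have yx : y = x by move: E0 => [].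
subst y; have [q qw] := gp_surj w (chart_atP A x).
by move: E0; rewrite -qw legendre_gp => -[->].
Qed.

(** The Lagrangian transported to the cotangent bundle, that is p.dH/dp - H in a chart
    ([dens_chart]). It is the integrand both of [cot_action] and of [action] along projected
    orbits. *)
Definition dens z : R := lagrangian H (legendreV H z).

Lemma dens_chart i z : dom i z.1 ->
  dens z = pairing (cot_coord i z).2 (gp (local_rep H i) (cot_coord i z)) - H z.
Proof.
case: z => x p di; have dj := chart_atP A x; set j := chart_at A x in dj.
rewrite /dens legendreVE /= -/j.
pose q := p *m (tjac i j x)^T.
have pE : p = q *m (tjac j i x)^T by rewrite /q -mulmxA -trmx_mul tjacK// trmx1 mulmx1.
have gE := gp_trans tonelli_C2 p di dj.
apply: (eq_trans (f_equal (fun w => lagrangian H (x, w)) gE)).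
apply: (eq_trans (fenchel_eq q di)); rewrite cot_coordE.
exact: (f_equal (fun b : R => pairing q (gp (local_rep H i) (chart i x, q)) - b) (local_rep_coord H di)).
Qed.

Lemma solat_velocity (c : R -> cotangent A) (t : R) : solat H c t ->
  velocity A (fst \o c) t = legendreV H (c t).
Proof.
move=> [cc Hc]; have di := chart_atP A (c t).1; rewrite legendreVE /velocity/=; congr pair.
set i := chart_at A (c t).1 in di *.
have D := is_derive_fst (Hc i di).
have Ca : cot_codom i (cot_coord i (c t)) := cot_codom_coord di.
have dh : differentiable (local_rep H i) (cot_coord i (c t)) by have [] := (tonelli_C2 i).1 _ Ca.
have E1 : (ham_vf (local_rep H i) (cot_coord i (c t))).1 = gp (local_rep H i) (cot_coord i (c t)).
  exact: (f_equal fst (ham_vfE dh)).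
have E2 : cot_coord i (c t) = (chart i (c t).1, (c t).2).
  have := cot_coord1_id (c t); exact.
rewrite derive1E; apply: (eq_trans (@derive_val _ _ _ _ _ _ _ D)).
exact: (eq_trans E1 (f_equal (gp (local_rep H i)) E2)).
Qed.

End TonelliCharts.

(** Turns positive constants valid near each point of K into a single one, for properties inherited
    by smaller constants; it takes the place of the choice of finite subcovers. *)
Lemma compact_unif (R : realType) (T : topologicalType) (K : set T) (P : R -> T -> Prop) : compact K ->
  (forall a b z, 0 < a -> a <= b -> P b z -> P a z) ->
  (forall z, K z -> exists2 d : R, 0 < d & \forall y \near z, P d y) ->
  exists2 d : R, 0 < d & forall z, K z -> P d z.
Proof.
move=> /compact_near_coveringP cK mP lP.
have [|d /= d0 Hd] := (nbhs_normP (0 : R) _).1 (cK R (nbhs (0 : R)) (fun d z => 0 < d -> P d z) _ _).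
  move=> z Kz; have [d d0 N] := lP z Kz.
  exists ([set y | P d y], ball (0 : R) d); first by split=> //; exact: nbhsx_ballx.
  move=> [y e] [/= Py]; rewrite /ball/= sub0r normrN => ed e0; apply: mP Py => //.
  by apply: ltW; apply: le_lt_trans ed; rewrite ler_norm.
have d2 : 0 < d / 2 by exact: divr_gt0.
exists (d / 2) => // z Kz; apply: (Hd (d / 2)) => //=.
by rewrite sub0r normrN gtr0_norm// ltr_pdivrMr// ltr_pMr// ltr1n.
Qed.

(** * The global flow *)

Section GlobalFlow.
Variables (R : realType) (n : nat) (M : ptopologicalType) (A : C2atlas R n M).
Variables (g : riemannian A) (H : cotangent A -> R).
Hypothesis tH : tonelli g H.
Hypotheses (hM : hausdorff_space M) (cM : compact [set: M]).
Implicit Types (z : cotangent A) (c : R -> cotangent A).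

Let HC : forall i, C2_on (cot_codom i) (local_rep H i) := tonelli_C2 tH.

Lemma poisson_refl : poisson_commute H H.
Proof. by move=> i a Ca; rewrite OmegaE subrr. Qed.

Lemma energy_local c (T : R) : (forall t, `|t| < T -> solat H c t) ->
  forall t, `|t| < T -> H (c t) = H (c 0).
Proof. exact: (first_integral HC HC poisson_refl). Qed.

Definition flows_for (e T : R) := forall z, H z <= e ->
  exists c, c 0 = z /\ forall t, `|t| < T -> solat H c t.

Lemma flows_for_start e : exists2 T : R, 0 < T & flows_for e T.
Proof.
have cK : compact [set z | H z <= e] by exact: (sublevel_compact tH cM).
have [||d d0 Hd] := @compact_unif R _ [set z | H z <= e]
   (fun T z => exists c, c 0 = z /\ forall t, `|t| < T -> solat H c t) cK.
- by move=> a b z a0 ab [c [c0 Hc]]; exists c; split=> // t ta; apply: Hc; exact: lt_le_trans ab.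
- by move=> z _; exact: local_flow.
by exists d.
Qed.

(** Energy is conserved, so the points reached at the times s and - s are still in the sublevel and
    have orbits of length T of their own. They are taken T / 2 before the ends, where the pieces
    overlap and agree by uniqueness. *)
Lemma flows_for_step e T T1 : 0 < T -> T <= T1 -> flows_for e T -> flows_for e T1 ->
  flows_for e (T1 + T / 2).
Proof.
move=> T0 TT1 HT HT1 z ze; have [c [c0 Hc]] := HT1 z ze.
pose s := T1 - T / 2; have s0 : 0 < s by rewrite /s; lra.
have sT : `|s| < T1 by rewrite gtr0_norm// /s; lra.
have sT' : `|- s| < T1 by rewrite normrN.
have E1 : H (c s) <= e by rewrite (energy_local Hc)// c0.
have E2 : H (c (- s)) <= e by rewrite (energy_local Hc)// c0.
have [c1 [c10 Hc1]] := HT _ E1; have [c2 [c20 Hc2]] := HT _ E2.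
have T20 : 0 < T / 2 by exact: divr_gt0.
have A1 (t : R) : `|t| < T / 2 -> c (t + s) = c1 t.
  apply: (@solat_eq _ _ _ _ _ HC hM (fun t => c (t + s)) c1).
  - by move=> r rT; apply: solat_shift; apply: Hc; move: rT; rewrite !ltr_norml /s; lra.
  - by move=> r rT; apply: Hc1; move: rT; rewrite !ltr_norml; lra.
  - by rewrite add0r c10.
have A2 (t : R) : `|t| < T / 2 -> c (t - s) = c2 t.
  apply: (@solat_eq _ _ _ _ _ HC hM (fun t => c (t - s)) c2).
  - by move=> r rT; apply: (@solat_shift _ _ _ _ H c r (- s)); apply: Hc; move: rT; rewrite !ltr_norml /s; lra.
  - by move=> r rT; apply: Hc2; move: rT; rewrite !ltr_norml; lra.
  - by rewrite add0r c20.
pose d t := if t <= s then (if - s <= t then c t else c2 (t + s)) else c1 (t - s).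
have dc t : `|t| < T1 -> d t = c t.
  rewrite ltr_norml => /andP[t1 t2]; rewrite /d; case: leP => ts; last first.
    by rewrite -A1 ?subrK// ltr_norml; rewrite /s in ts *; lra.
  by case: leP => // st; rewrite -A2 ?addrK// ltr_norml; rewrite /s in st *; lra.
exists d; split; first by rewrite dc ?normr0//; lra.
have itvN (a b t : R) : a < t -> t < b -> \forall r \near t, a < r < b.
  move=> ta tb; have N : nbhs t (`]a, b[%classic : set R).
    by apply: open_nbhs_nbhs; split; [exact: interval_open|rewrite /= in_itv/= ta tb].
  by apply: filterS N => r; rewrite /= in_itv.
move=> t tT; have [tT1|] := ltP `|t| T1.
  apply: (@solat_near _ _ _ _ H c); last exact: Hc.
  move: tT1; rewrite ltr_norml => /andP[t1 t2].
  by apply: filterS (itvN _ _ _ t1 t2) => r rT; rewrite dc// ltr_norml.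
move: tT; rewrite ltr_norml => /andP[ta tb]; rewrite ler_normr => /orP[t1|t1].
  apply: (@solat_near _ _ _ _ H (fun r => c1 (r - s))).
    have ts : s < t by rewrite /s; lra.
    by apply: filterS (itvN _ _ _ ts tb) => r /andP[sr _]; rewrite /d leNgt sr.
  apply: (@solat_shift _ _ _ _ H c1 t (- s)); apply: Hc1; rewrite ltr_norml /s; lra.
apply: (@solat_near _ _ _ _ H (fun r => c2 (r + s))).
  have ts : t < - s by rewrite /s; lra.
  apply: filterS (itvN _ _ _ ta ts) => r /andP[_ rs]; rewrite /d [- s <= r]leNgt rs ifT//.
  by apply: ltW; apply: lt_trans rs _; lra.
by apply: solat_shift; apply: Hc2; rewrite ltr_norml /s; lra.
Qed.

Lemma flows_for_all e T : flows_for e T.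
Proof.
have [T0 T00 HT] := flows_for_start e.
have step k : flows_for e (T0 + k%:R * (T0 / 2)).
  elim: k => [|k IH]; first by rewrite mul0r addr0.
  rewrite -natr1 mulrDl mul1r addrA; apply: flows_for_step => //.
  by rewrite lerDl mulr_ge0// divr_ge0// ltW.
have [k Hk] : exists k : nat, T <= k%:R * (T0 / 2).
  exists (Num.truncn (T / (T0 / 2))).+1; rewrite -ler_pdivrMr ?divr_gt0//.
  by apply: ltW; exact: truncnS_gt.
move=> z ze; have [c [c0 Hc]] := step k z ze; exists c; split=> // t tT; apply: Hc.
by apply: lt_le_trans tT _; apply: le_trans Hk _; rewrite lerDr ltW.
Qed.

Lemma orbit_exists z : exists c, c 0 = z /\ forall t, solat H c t.
Proof.
have /choice[C HCc] : forall T, exists c, c 0 = z /\ forall t, `|t| < T -> solat H c t.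
  by move=> T; apply: (@flows_for_all (H z)).
pose c t := C (`|t| + 1) t; have C0 T := (HCc T).1; have CS T := (HCc T).2.
exists c; split=> [|t]; first by rewrite /c C0.
apply: (@solat_near _ _ _ _ H (C (`|t| + 2))); last by apply: CS; lra.
have N : \forall s \near t, `|s| < `|t| + 1.
  apply/(nbhs_normP t _); exists 1; [exact: ltr01|move=> s /= h].
  by have := ler_normD (s - t) t; rewrite subrK distrC; lra.
apply: filterS N => s st.
apply: (@solat_eq _ _ _ _ _ HC hM (C (`|t| + 2)) (C (`|s| + 1)) (`|s| + 1)).
- by move=> r rs; apply: CS; lra.
- by move=> r rs; exact: CS.
- by rewrite !C0.
- by lra.
Qed.

Local Notation Phi := (ham_flow H).

Lemma ham_flow_is_flow : is_flow H Phi.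
Proof.
apply: (@xgetPex _ ((fun _ z => z) : R -> cotangent A -> cotangent A) [set Phi | is_flow H Phi]).
have /choice[c Hc] := orbit_exists; exists (fun t z => c z t); split=> [z|z]; first by case: (Hc z).
by split=> [t|t i]; have [cc Hd] := (Hc z).2 t; [exact: cc|exact: Hd].
Qed.

Lemma flow0 z : Phi 0 z = z.
Proof. by case: ham_flow_is_flow. Qed.

Lemma flow_solat z t : solat H (Phi^~ z) t.
Proof. by have [_ /(_ z)[cc Hd]] := ham_flow_is_flow; split; [exact: cc|exact: Hd]. Qed.

Lemma flow_unique c (T : R) : (forall t, `|t| < T -> solat H c t) ->
  forall t, `|t| < T -> c t = Phi t (c 0).
Proof.
move=> Hc t tT; apply: (@solat_eq _ _ _ _ _ HC hM c (Phi^~ (c 0)) T) => //.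
  by move=> r _; exact: flow_solat.
by rewrite flow0.
Qed.

Lemma flowD s t z : Phi (s + t) z = Phi s (Phi t z).
Proof.
have := @flow_unique (fun r => Phi (r + t) z) (`|s| + 1) _ s.
rewrite add0r; apply; last by rewrite ltrDl.
by move=> r _; apply: (@solat_shift _ _ _ _ H (Phi^~ z)); exact: flow_solat.
Qed.

Lemma flowK t : cancel (Phi t) (Phi (- t)).
Proof. by move=> z; rewrite -flowD addNr flow0. Qed.

Lemma flowNK t : cancel (Phi (- t)) (Phi t).
Proof. by move=> z; rewrite -flowD addrN flow0. Qed.

Lemma flow_first_integral G : (forall i, C2_on (cot_codom i) (local_rep G i)) ->
  poisson_commute G H -> forall t z, G (Phi t z) = G z.
Proof.
move=> GC GH t z; have := @first_integral _ _ _ _ _ HC G GC GH (Phi^~ z) (`|t| + 1) _ t.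
by rewrite flow0; apply=> [r _|]; [exact: flow_solat|rewrite ltrDl].
Qed.

Lemma flow_energy t z : H (Phi t z) = H z.
Proof. exact: (flow_first_integral HC poisson_refl). Qed.

End GlobalFlow.

(** * Uniform estimates of the flow in a chart *)

Section MonotoneStep.
Variables (R : realType) (n : nat).
Local Notation V := 'rV[R]_n.
Local Notation E := ('rV[R]_n * 'rV[R]_n)%type.

Lemma monotone_estimate (L c t d N n' e : R) : 0 <= L -> 0 < c -> 0 <= d -> 0 <= t -> L * t <= 1 / 4 ->
  0 <= n' -> t * (3 * n' * L ^+ 2 + 2 * c * L) <= c / 2 ->
  (1 - L * t) * d <= e -> e ^+ 2 <= N ->
  c / 2 * d ^+ 2 <= c * N - n' * (L * (L * t * d) * d) - n' * (L * (2 * d) * (L * t * d)).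
Proof.
move=> L0 c0 d0 t0 Lt n0 Ht He HN.
have h1 : (1 - 2 * (L * t)) * d ^+ 2 <= e ^+ 2.
  have h0 : 0 <= (1 - L * t) * d by rewrite mulr_ge0//; lra.
  have := ler_pM h0 h0 He He; rewrite -!expr2.
  have : 0 <= (L * t * d) ^+ 2 by exact: sqr_ge0.
  by rewrite !expr2; lra.
have h2 := ler_wpM2l (ltW c0) (le_trans h1 HN).
have h3 := ler_wpM2r (sqr_ge0 d) Ht.
by move: h2 h3; rewrite !expr2; lra.
Qed.

Lemma norm_pairN_le (u v : V) (k : R) : `|u| <= k -> `|v| <= k -> `|((u, - v) : E)| <= k.
Proof. by move=> h1 h2; apply: norm_pair_le; rewrite /= ?normrN. Qed.

Lemma box_mix (x : V) (r k : R) a b : box x r k a -> box x r k b -> box x r k (a.1, b.2).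
Proof. by move=> [h _] [_ k']. Qed.

Lemma le_sub3 (A x y a b d : R) : A <= d -> - x <= a -> - y <= b -> A - x - y <= a + b + d.
Proof. lra. Qed.

Lemma same_base_diff (x p q : V) (u v : E) (k : R) : `|u - v - ((x, q) - (x, p))| <= k ->
  `|u.1 - v.1| <= k /\ `|u.2 - v.2 - (q - p)| <= k.
Proof.
move=> h; split; last exact: le_trans (norm_snd _) h.
by have := le_trans (norm_fst _) h; rewrite /= subrr subr0.
Qed.

(** D is the initial difference of the covectors over one base point, and a, b are the states at
    time t. The difference of velocities is split at the mixed state (a.1, b.2): its fibre part is
    strongly monotone, and the rest is an error of order t |D|^2, absorbed for small t. *)
Lemma fiber_mono_step (h : E -> R) (Q : set E) (c L t : R) (a b : E) (D : V) :
  0 < c -> 0 <= L -> 0 <= t -> L * t <= 1 / 4 -> t * (3 * n%:R * L ^+ 2 + 2 * c * L) <= c / 2 ->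
  Q a -> Q b -> Q (a.1, b.2) ->
  (forall a b, Q a -> Q b -> `|gp h b - gp h a| <= L * `|b - a|) ->
  (forall x p q, Q (x, p) -> Q (x, q) ->
     c * pairing (q - p) (q - p) <= pairing (gp h (x, q) - gp h (x, p)) (q - p)) ->
  `|b.1 - a.1| <= L * t * `|D| -> `|b.2 - a.2 - D| <= L * t * `|D| ->
  c / 2 * `|D| ^+ 2 <= pairing (gp h b - gp h a) D.
Proof.
move=> c0 L0 t0 LsT sS Qa Qb Qm lipQ cvQ lx lp.
case: a b Qa Qb Qm lx lp => [x p] [y q] /= Qa Qb Qm lx lp.
have h1 := lipQ (x, q) (y, q) Qm Qb; have h2 := lipQ (x, p) (x, q) Qa Qm.
have n1 : `|((y, q) : E) - (x, q)| <= L * t * `|D|.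
  by apply: norm_pair_le => //=; rewrite subrr normr0; apply: le_trans lx.
have lp2 : `|q - p| <= 2 * `|D|.
  have hn := ler_normD (q - p - D) D; rewrite subrK in hn.
  have h' : L * t * `|D| <= 1 * `|D| by apply: ler_wpM2r => //; lra.
  by lra.
have n2 : `|((x, q) : E) - (x, p)| <= 2 * `|D|.
  by apply: norm_pair_le => //=; rewrite subrr normr0 mulr_ge0.
have h3 := cvQ x p q Qa Qm.
set u1 := gp h (y, q) - gp h (x, q); set u2 := gp h (x, q) - gp h (x, p).
have u1b : `|u1| <= L * (L * t * `|D|) by apply: le_trans h1 _; exact: ler_wpM2l.
have u2b : `|u2| <= L * (2 * `|D|) by apply: le_trans h2 _; exact: ler_wpM2l.
have dE : pairing (gp h (y, q) - gp h (x, p)) D = pairing u1 D + pairing u2 (D - (q - p)) + pairing u2 (q - p).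
  by rewrite -addrA -pairingDr subrK -pairingDl /u1 /u2 addrA subrK.
have e1 := pairing_bound_le u1b (lexx `|D|).
have lp' : `|D - (q - p)| <= L * t * `|D| by rewrite distrC.
have e2 := pairing_bound_le u2b lp'.
have le_ : (1 - L * t) * `|D| <= `|q - p|.
  have hD := ler_normD (D - (q - p)) (q - p); rewrite subrK in hD.
  by rewrite mulrBl mul1r lerBlDr addrC; apply: le_trans hD _; rewrite lerD2r.
have key := monotone_estimate L0 c0 (normr_ge0 D) t0 LsT (ler0n R n) sS le_ (pairing_vv_ge _).
apply: le_trans key _; rewrite dE; move: e1 e2; rewrite !ler_norml => /andP[e1 _] /andP[e2 _].
exact: le_sub3 h3 e1 e2.
Qed.

Lemma norm_symplectic_le (u1 u2 v1 v2 : V) (k : R) : `|u1 - v1| <= k -> `|u2 - v2| <= k ->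
  `|((u1, - u2) : E) - (v1, - v2)| <= k.
Proof. by move=> h1 h2; apply: norm_pair_le => //=; rewrite opprK addrC distrC. Qed.

End MonotoneStep.

Section ChartBox.
Variables (R : realType) (n : nat) (M : ptopologicalType) (A : C2atlas R n M).
Variables (g : riemannian A) (H : cotangent A -> R).
Hypothesis tH : tonelli g H.
Hypotheses (hM : hausdorff_space M) (cM : compact [set: M]).
Local Notation V := 'rV[R]_n.
Local Notation E := ('rV[R]_n * 'rV[R]_n)%type.
Local Notation Phi := (ham_flow H).
Local Notation hh := (local_rep H).

Definition chart_flow i (a : E) (t : R) : E := cot_coord i (Phi t (cot_coordV i a)).

Lemma chart_flowE i a t : chart_flow i a t = cot_coord i (Phi t (cot_coordV i a)).
Proof. by []. Qed.

Opaque chart_flow.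

(** The flow read in one chart, with estimates uniform over the initial box. [fb_mono] is the twist
    property: over a fixed base point, the position at time t is strongly monotone in the covector.
    The fibre radius K + 5 leaves room for the covectors by which [calibration] tests Fenchel's
    inequality, at distance at most 4 from the orbit. *)
Record flow_box i (x0 : V) (K r T L m : R) : Prop := FlowBox {
  fb_r : 0 < r <= 1;
  fb_T : 0 < T;
  fb_L : 0 <= L;
  fb_LT : L * T <= 1 / 4;
  fb_m : 0 < m;
  fb_codom : forall x : V, `|x - x0| <= r + r -> codom_chart (A := A) i x;
  fb_dom : forall a t, box x0 r K a -> `|t| <= T -> dom i (Phi t (cot_coordV i a)).1;
  fb_box : forall a t, box x0 r K a -> `|t| <= T -> box x0 (r + r) (K + 1) (chart_flow i a t);
  fb_speed : forall a t, box x0 r K a -> `|t| <= T -> `|chart_flow i a t - a| <= L * `|t|;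
  fb_eq : forall a t, box x0 r K a -> `|t| <= T -> is_derive t (1 : R) (chart_flow i a)
    (gp (hh i) (chart_flow i a t), - gx (hh i) (chart_flow i a t));
  fb_lip : forall a b t, box x0 r K a -> box x0 r K b -> `|t| <= T ->
    `|(chart_flow i b t - chart_flow i a t) - (b - a)| <= L * `|t| * `|b - a|;
  fb_mono : forall x p q t, `|x - x0| <= r -> `|p| <= K -> `|q| <= K -> `|t| <= T ->
    m * t ^+ 2 * `|q - p| ^+ 2 <=
    t * pairing ((chart_flow i (x, q) t).1 - (chart_flow i (x, p) t).1) (q - p);
  fb_grad : forall a, box x0 (r + r) (K + 5) a -> `|gx (hh i) a| <= L /\ `|gp (hh i) a| <= L;
  fb_gradL : forall a b, box x0 (r + r) (K + 5) a -> box x0 (r + r) (K + 5) b ->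
    `|gx (hh i) b - gx (hh i) a| <= L * `|b - a| /\ `|gp (hh i) b - gp (hh i) a| <= L * `|b - a|;
  fb_taylor : forall a b, box x0 (r + r) (K + 5) a -> box x0 (r + r) (K + 5) b ->
    `|hh i b - hh i a - pairing (gx (hh i) a) (b.1 - a.1) - pairing (gp (hh i) a) (b.2 - a.2)|
      <= L * `|b - a| ^+ 2 }.

Lemma flow_box_exists i (x0 : V) (K r : R) : 0 < r <= 1 -> 0 <= K ->
  (forall x : V, `|x - x0| <= r + r -> codom_chart (A := A) i x) ->
  exists T L m : R, flow_box i x0 K r T L m.
Proof.
move=> /andP[r0 r1] K0 rD; pose Q := box x0 (r + r) (K + 5).
have QD : Q `<=` cot_codom i by move=> a [h _]; exact: rD.
have cQ : compact Q by exact: compact_box.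
have sQ : seg_closed Q by exact: seg_closed_box.
have HC := tonelli_C2 tH i.
have oD : open (cot_codom (A := A) i) by exact: open_cot_codom.
have [B B0 HB] := grad_bounded HC.1 cQ QD.
have [L1 L10 HL1] := grad_lipschitz HC cQ QD sQ.
have [L2 L20 HL2] := taylor2 HC cQ QD sQ.
have hp (a : E) (w : V) : cot_codom i a -> w != 0 -> 0 < 'D_((0, w) : E) ('D_((0, w) : E) (hh i)) a.
  exact: (local_hess_pos tH).
have [c c0 Hc] := hess_bound oD HC hp cQ QD.
pose L := 2 * (B + L1 + L2); have L0 : 0 <= L by rewrite /L; lra.
have BL : B <= L by rewrite /L; lra.
have L1L : 2 * L1 <= L by rewrite /L; lra.
have L2L : L2 <= L by rewrite /L; lra.
have L1L' : L1 <= L by rewrite /L; lra.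
clearbody L.
have sub1 a : box x0 (r + r) (K + 1) a -> Q a by move=> [h1 h2]; split=> //; lra.
pose S := 3 * n%:R * L ^+ 2 + 2 * c * L.
have S0 : 0 <= S by rewrite /S addr_ge0// !mulr_ge0 ?sqr_ge0// ltW.
(* [T0] keeps orbits within distance r of their start and L T0 below 1 / 8; [T] moreover makes T S
   at most half the convexity constant c, where S collects the errors of [fiber_mono_step]. *)
pose T0 := Num.min (r / (L + 1)) (1 / (8 * (L + 1))).
pose T := Num.min T0 (c / (2 * (S + 1))).
have L1p : 0 < L + 1 by lra.
have S1p : 0 < S + 1 by lra.
have T00 : 0 < T0 by rewrite lt_min !divr_gt0// mulr_gt0.
have T'0 : 0 < T by rewrite lt_min T00 divr_gt0// mulr_gt0.
have TT0 : T <= T0 by rewrite ge_min lexx.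
have T0r : L * T0 <= r.
  have : T0 <= r / (L + 1) by rewrite ge_min lexx.
  by rewrite ler_pdivlMr//; lra.
have T08 : L * T0 <= 1 / 8.
  have : T0 <= 1 / (8 * (L + 1)) by rewrite ge_min lexx orbT.
  by rewrite ler_pdivlMr ?mulr_gt0//; lra.
have TS : T * S <= c / 2.
  have : T <= c / (2 * (S + 1)) by rewrite ge_min lexx orbT.
  by rewrite ler_pdivlMr ?mulr_gt0//; lra.
have SE : S = 3 * n%:R * L ^+ 2 + 2 * c * L by [].
clearbody T T0 S.
have sol a : box x0 r K a -> forall t, `|t| < T0 ->
    [/\ dom i (Phi t (cot_coordV i a)).1, `|chart_flow i a t - a| <= r &
      is_derive t (1 : R) (chart_flow i a) (ham_vf (hh i) (chart_flow i a t))].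
  move=> [ax ap]; have inQ b : `|b - a| <= r -> box x0 (r + r) (K + 1) b.
    move=> ba; have h1 := le_trans (norm_fst (b - a)) ba; have h2 := le_trans (norm_snd (b - a)) ba.
    split.
      by rewrite -(subrK a.1 b.1) -addrA; apply: le_trans (ler_normD _ _) _; apply: lerD.
    by rewrite -(subrK a.2 b.2); apply: le_trans (ler_normD _ _) _; have := lerD h2 ap; rewrite /=; lra.
  have vfE b : `|b - a| <= r -> ham_vf (hh i) b = (gp (hh i) b, - gx (hh i) b).
    by move=> /inQ /sub1 /QD Db; apply: ham_vfE; case: (HC.1 b Db).
  have XB b : `|b - a| <= r -> `|ham_vf (hh i) b| <= B.
    by move=> ba; rewrite vfE//; have [h1 h2] := HB b (sub1 _ (inQ _ ba)); exact: norm_pairN_le.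
  have XL b d : `|b - a| <= r -> `|d - a| <= r -> `|ham_vf (hh i) b - ham_vf (hh i) d| <= L1 * `|b - d|.
    move=> ba da; rewrite !vfE//; have [h1 h2] := HL1 d b (sub1 _ (inQ _ da)) (sub1 _ (inQ _ ba)).
    exact: norm_symplectic_le h2 h1.
  have cb : compact [set b : E | `|b - a| <= r] by exact: compact_eball.
  have side : `|a - a| + T0 * B <= r.
    rewrite subrr normr0 add0r mulrC; apply: le_trans T0r; apply: ler_wpM2r => //; exact: ltW.
  (* The orbit is solved inside the chart and then recognized as the global flow by uniqueness; this
     shows that the flow stays in the chart. *)
  have [d [d0 Hd]] := ode_local cb XB XL B0 L10 T00 side.
  have Ca : cot_codom i a by apply: QD; apply: sub1; apply: inQ; rewrite subrr normr0 ltW.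
  have S' t : `|t| < T0 -> solat H (fun t => cot_coordV i (d t)) t.
    move=> tT; have [bt Ht] := Hd t tT.
    apply: (@solat_cotV _ _ _ _ H (tonelli_C2 tH) i d _ t (fun=> erefl) Ht).
    by apply: filterS (near_norm_lt tT) => s sT; apply: QD; apply: sub1; apply: inQ; case: (Hd s sT).
  have dE t : `|t| < T0 -> cot_coordV i (d t) = Phi t (cot_coordV i a).
    by move=> tT; have := flow_unique tH hM cM S' tT; rewrite d0.
  have Cd t : `|t| < T0 -> cot_codom i (d t).
    by move=> tT; apply: QD; apply: sub1; apply: inQ; case: (Hd t tT).
  have cfE t : `|t| < T0 -> chart_flow i a t = d t.
    by move=> tT; rewrite chart_flowE -dE// cot_coordVK//; exact: Cd.
  move=> t tT; have [bt Ht] := Hd t tT; split.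
  - by rewrite -dE//; apply: cot_coordV_dom; exact: Cd.
  - by rewrite cfE.
  - rewrite cfE//; apply: (near_eq_is_derive _ Ht).
    by apply: filterS (near_norm_lt tT) => s sT; rewrite cfE.
exists (T / 2), L, (c / 2).
have T2 : T / 2 < T0 by have := ltW T'0; lra.
have inT (t : R) : `|t| <= T / 2 -> `|t| < T0 by move=> h; exact: le_lt_trans T2.
have inbox a t : box x0 r K a -> `|t| <= T / 2 -> box x0 (r + r) (K + 1) (chart_flow i a t).
  move=> ba /inT tT; have [_ h _] := sol a ba t tT; case: ba => ax ap.
  have h1 := le_trans (norm_fst (chart_flow i a t - a)) h; have h2 := le_trans (norm_snd (chart_flow i a t - a)) h.
  split.
    by rewrite -(subrK a.1 (chart_flow i a t).1) -addrA; apply: le_trans (ler_normD _ _) _; apply: lerD.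
  by rewrite -(subrK a.2 (chart_flow i a t).2); apply: le_trans (ler_normD _ _) _; have := lerD h2 ap; rewrite /=; lra.
have eqd a (t : R) : box x0 r K a -> `|t| <= T / 2 -> is_derive t (1 : R) (chart_flow i a)
    (gp (hh i) (chart_flow i a t), - gx (hh i) (chart_flow i a t)).
  move=> ba tT; have [_ _ D] := sol a ba t (inT t tT).
  apply: (eq_is_derive_val _ D); apply: ham_vfE.
  by case: (HC.1 _ (QD _ (sub1 _ (inbox a t ba tT)))).
have X0 a : box x0 r K a -> chart_flow i a 0 = a.
  move=> ba; rewrite chart_flowE (flow0 tH hM cM) cot_coordVK//; apply: QD; case: ba => h1 h2; split=> //.
    by have := ltW r0; lra.
  by lra.
have btw (t s : R) : `|t| <= T / 2 -> 0 <= s <= t \/ t <= s <= 0 -> `|s| <= T / 2.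
  by rewrite !ler_norml; lra.
have inc (f df : R -> E) (k t : R) : `|t| <= T / 2 ->
    (forall s, `|s| <= T / 2 -> is_derive s (1 : R) f (df s)) ->
    (forall s, `|s| <= T / 2 -> `|df s| <= k) -> `|f t - f 0| <= k * `|t|.
  move=> tT Hd Hk; have [t0|/ltW t0] := leP 0 t.
    rewrite (ger0_norm t0) -{2}(subr0 t); apply: (pair_increment (dc := df) t0) => s st.
      by apply: Hd; apply: btw tT _; left.
    by apply: Hk; apply: btw tT _; left.
  rewrite (ler0_norm t0) distrC -(add0r (- t)); apply: (pair_increment (dc := df) t0) => s st.
    by apply: Hd; apply: btw tT _; right.
  by apply: Hk; apply: btw tT _; right.
have speed a (t : R) : box x0 r K a -> `|t| <= T / 2 -> `|chart_flow i a t - a| <= L * `|t|.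
  move=> ba tT; rewrite -{2}(X0 a ba).
  apply: (inc (chart_flow i a) (fun t => (gp (hh i) (chart_flow i a t), - gx (hh i) (chart_flow i a t)))) => // s sT.
    exact: eqd.
  have [h1 h2] := HB _ (sub1 _ (inbox a s ba sT)).
  exact: norm_pairN_le (le_trans h2 BL) (le_trans h1 BL).
have LT2 : L * (T / 2 - - (T / 2)) <= 1 / 2.
  have := ler_wpM2l L0 TT0; lra.
have dist2 a b (t : R) : box x0 r K a -> box x0 r K b -> `|t| <= T / 2 ->
    `|chart_flow i b t - chart_flow i a t| <= 2 * `|b - a|.
  move=> ba bb tT; rewrite -{2}(X0 a ba) -{2}(X0 b bb).
  pose f t := chart_flow i b t - chart_flow i a t.
  pose df t : E := (gp (hh i) (chart_flow i b t), - gx (hh i) (chart_flow i b t)) - (gp (hh i) (chart_flow i a t), - gx (hh i) (chart_flow i a t)).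
  have tI (s : R) : - (T / 2) <= s <= T / 2 -> `|s| <= T / 2 by rewrite ler_norml.
  apply: (@gronwall_short _ _ f df L (- (T / 2)) (T / 2) 0 L0 LT2).
  - by have := ltW T'0; lra.
  - by move=> s /tI sT; exact: (is_deriveB (eqd b s bb sT) (eqd a s ba sT)).
  - move=> s /tI sT; have [h1 h2] := HL1 _ _ (sub1 _ (inbox a s ba sT)) (sub1 _ (inbox b s bb sT)).
    have hL : L1 * `|f s| <= L * `|f s| by apply: ler_wpM2r L1L'; exact: normr_ge0.
    exact: norm_symplectic_le (le_trans h2 hL) (le_trans h1 hL).
  - by rewrite -ler_norml.
have lip a b (t : R) : box x0 r K a -> box x0 r K b -> `|t| <= T / 2 ->
    `|(chart_flow i b t - chart_flow i a t) - (b - a)| <= L * `|t| * `|b - a|.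
  move=> ba bb tT; rewrite -{2}(X0 a ba) -{2}(X0 b bb) mulrAC.
  apply: (inc (fun t => chart_flow i b t - chart_flow i a t) (fun t => (gp (hh i) (chart_flow i b t), - gx (hh i) (chart_flow i b t)) - (gp (hh i) (chart_flow i a t), - gx (hh i) (chart_flow i a t)))) => // s sT.
    exact: (is_deriveB (eqd b s bb sT) (eqd a s ba sT)).
  have [h1 h2] := HL1 _ _ (sub1 _ (inbox a s ba sT)) (sub1 _ (inbox b s bb sT)).
  have hL : L1 * `|chart_flow i b s - chart_flow i a s| <= L * `|b - a|.
    apply: le_trans (ler_wpM2l L10 (dist2 a b s ba bb sT)) _.
    by rewrite mulrA; apply: ler_wpM2r; [exact: normr_ge0|rewrite mulrC].
  exact: norm_symplectic_le (le_trans h2 hL) (le_trans h1 hL).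
split=> //.
- by rewrite r0 r1.
- by exact: divr_gt0.
- by have := ler_wpM2l L0 TT0; lra.
- by exact: divr_gt0.
- by move=> a t ba /inT tT; have [] := sol a ba t tT.
- move=> x p q t xr pK qK tT.
  have ba : box x0 r K (x, p) by [].
  have bb : box x0 r K (x, q) by [].
  set D := q - p; pose phi s := pairing ((chart_flow i (x, q) s).1 - (chart_flow i (x, p) s).1) D.
  pose dphi s := pairing (gp (hh i) (chart_flow i (x, q) s) - gp (hh i) (chart_flow i (x, p) s)) D.
  have Dphi (s : R) : `|s| <= T / 2 -> is_derive s (1 : R) phi (dphi s).
    move=> sT; have D1 := is_deriveB (is_derive_fst (eqd _ s bb sT)) (is_derive_fst (eqd _ s ba sT)).
    apply: (eq_is_derive_val _ (is_derive_pairing D1 (is_derive_cst D s 1))).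
    by rewrite pairing0r addr0.
  have nD : `|((x, q) : E) - (x, p)| = `|D|.
    apply/eqP; rewrite eq_le; apply/andP; split.
      by apply: norm_pair_le => //=; rewrite subrr normr0.
    exact: (norm_snd (((x, q) : E) - (x, p))).
  have lb (s : R) : `|s| <= T / 2 -> c / 2 * `|D| ^+ 2 <= dphi s.
    move=> sT; have LsT : L * `|s| <= 1 / 4 by have := ler_wpM2l L0 (le_trans sT (ltW T2)); lra.
    have sS : `|s| * (3 * n%:R * L ^+ 2 + 2 * c * L) <= c / 2.
      by rewrite -SE; apply: le_trans TS; apply: ler_wpM2r => //; have := ltW T'0; lra.
    have l := lip _ _ s ba bb sT; rewrite nD in l.
    have [lx lp] := same_base_diff l.
    have Qa := sub1 _ (inbox _ s ba sT); have Qb := sub1 _ (inbox _ s bb sT).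
    have lipQ a b : Q a -> Q b -> `|gp (hh i) b - gp (hh i) a| <= L * `|b - a|.
      move=> ha hb; apply: le_trans (HL1 a b ha hb).2 _; apply: ler_wpM2r L1L'; exact: normr_ge0.
    have Qm : Q ((chart_flow i (x, p) s).1, (chart_flow i (x, q) s).2) by exact: box_mix Qa Qb.
    have cvQ u v w : Q (u, v) -> Q (u, w) ->
        c * pairing (w - v) (w - v) <= pairing (gp (hh i) (u, w) - gp (hh i) (u, v)) (w - v).
      by move=> Qv Qw; exact: (fiber_convex HC (ltW c0) QD sQ Hc Qv Qw).1.
    exact: (fiber_mono_step c0 L0 (normr_ge0 s) LsT sS Qa Qb Qm lipQ cvQ lx lp).
  have p0 : phi 0 = 0 by rewrite /phi (X0 _ ba) (X0 _ bb) /= subrr pairing0l.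
  have phiE : pairing ((chart_flow i (x, q) t).1 - (chart_flow i (x, p) t).1) D = phi t - phi 0 by rewrite p0 subr0.
  rewrite phiE; set mm := c / 2 * `|D| ^+ 2; have mE : c / 2 * t ^+ 2 * `|D| ^+ 2 = t * (mm * t) by rewrite /mm expr2; ring.
  rewrite mE; have [t0|/ltW t0] := leP 0 t.
    apply: ler_wpM2l => //; have := @derive_ge_increment _ phi dphi 0 t mm t0; rewrite subr0; apply=> s st.
      by apply: Dphi; apply: btw tT _; left.
    by apply: lb; apply: btw tT _; left.
  have := @derive_ge_increment _ phi dphi t 0 mm t0; rewrite sub0r => h.
  have {}h : mm * - t <= phi 0 - phi t.
    by apply: h => s st; [apply: Dphi|apply: lb]; apply: btw tT _; right.
  have {}h : phi t - phi 0 <= mm * t by rewrite -lerN2 opprB -mulrN.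
  exact: (ler_wnM2l t0 h).
- by move=> a /HB[h1 h2]; split; [exact: le_trans h1 BL|exact: le_trans h2 BL].
- move=> a b Qa Qb; have [h1 h2] := HL1 a b Qa Qb.
  by split; [apply: le_trans h1 _|apply: le_trans h2 _]; apply: ler_wpM2r L1L'; exact: normr_ge0.
- by move=> a b Qa Qb; apply: le_trans (HL2 a b Qa Qb) _; apply: ler_wpM2r L2L; exact: sqr_ge0.
Qed.

End ChartBox.

Opaque ham_flow.

(** * Shooting and continuity of the flow *)

Section ShootingReals.
Variable R : realType.

Lemma signed_row_increment n (f df : R -> 'rV[R]_n) (k t : R) :
  (forall s, `|s| <= `|t| -> is_derive s (1 : R) f (df s)) ->
  (forall s, `|s| <= `|t| -> `|df s| <= k) -> `|f t - f 0| <= k * `|t|.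
Proof.
move=> Hd Hk; have [t0|/ltW t0] := leP 0 t.
  rewrite (ger0_norm t0) -{2}(subr0 t); apply: (row_increment (dc := df) t0) => s /andP[s0 st].
    by apply: Hd; rewrite !ger0_norm.
  by apply: Hk; rewrite !ger0_norm.
rewrite (ler0_norm t0) distrC -(add0r (- t)); apply: (row_increment (dc := df) t0) => s /andP[ts s0].
  by apply: Hd; rewrite !ler0_norm// lerN2.
by apply: Hk; rewrite !ler0_norm// lerN2.
Qed.

Lemma lip_continuous (V W : normedModType R) (f : V -> W) (p : V) (k d : R) : 0 < d ->
  (forall q, `|q - p| < d -> `|f q - f p| <= k * `|q - p|) -> {for p, continuous f}.
Proof.
move=> d0 Hf; apply/cvgrPdist_le => e e0.
have k0 : 0 < `|k| + 1 by rewrite ltr_wpDl.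
apply/nbhs_normP; exists (Num.min d (e / (`|k| + 1))); first by rewrite /= lt_min d0 divr_gt0.
move=> q /=; rewrite lt_min distrC => /andP[qd qe]; rewrite distrC; apply: le_trans (Hf q qd) _.
move: qe; rewrite ltr_pdivlMr// => /ltW; rewrite mulrDr mulr1 => h.
apply: le_trans h; have h2 := ler_wpM2r (normr_ge0 (q - p)) (ler_norm k).
by apply: le_trans h2 _; rewrite mulrC lerDl.
Qed.

Lemma shoot_low (k C1 H0 hp h0 b : R) : hp + - b <= h0 -> k - C1 <= hp -> h0 <= H0 ->
  k - (C1 + H0) <= b.
Proof. lra. Qed.

Lemma norm_shift n (p q : 'rV[R]_n) (K e : R) : `|q - p| <= e -> e <= K - `|p| -> `|q| <= K.
Proof. by move=> h1 h2; have := ler_normD (q - p) p; rewrite subrK; lra. Qed.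

Lemma sq_abs_identity (L t ep e : R) :
  (L * `|t| * (ep * `|t| * e)) ^+ 2 = L ^+ 2 * t ^+ 2 * ((ep * t) ^+ 2 * e ^+ 2).
Proof. by rewrite !exprMn !real_normK ?num_real//; ring. Qed.

Lemma scale_le (L t a : R) : 0 <= t -> 0 < L + 1 -> t <= a / (L + 1) -> L * t <= a.
Proof. by move=> t0 L1; rewrite ler_pdivlMr//; lra. Qed.

Lemma add_shift (V : zmodType) (u v w : V) : v - w + (u - v) = u - w.
Proof. by rewrite addrC addrA subrK. Qed.

Lemma double_lt (V : normedModType R) (x a b : V) (d : R) : `|x| <= 2 * `|b - a| -> `|a - b| < d / 2 -> `|x| < d.
Proof. by rewrite distrC; lra. Qed.

Lemma pairing_sqrD n (u v : 'rV[R]_n) :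
  pairing (u + v) (u + v) = pairing u u + 2 * pairing v u + pairing v v.
Proof. by rewrite pairingDl !pairingDr (pairingC u v); ring. Qed.

Lemma half_sum_lt (a b e d : R) : a <= e -> e <= d / 2 -> b < d / 2 -> a + b < d.
Proof. lra. Qed.

(* Growth at |p| = K of the distance to the target, read along t p. *)
Lemma shoot_boundary (N t K C D L K1 a b c e : R) : 0 <= N -> 0 < t -> 0 < K -> D <= K ->
  N * L ^+ 2 * t <= 1 -> - (N * (L ^+ 2 * t ^+ 2 * K)) <= a -> K1 * K - D <= b ->
  c <= N * (C * t * K) -> t * (a + t * b - c) <= t * (N * (e * K)) ->
  t * (K1 - 2 - N * C) <= N * e.
Proof.
move=> N0 t0 K0 DK h1 ha hb hc; rewrite ler_pM2l// => h.
have h2 : t * (K1 * K - D) <= t * b by rewrite ler_pM2l.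
have h3 : t * D <= t * K by rewrite ler_pM2l.
have h4 : N * L ^+ 2 * t * (t * K) <= 1 * (t * K) by apply: ler_wpM2r => //; rewrite mulr_ge0// ltW.
rewrite -(ler_pM2r K0).
have -> : t * (K1 - 2 - N * C) * K = t * (K1 * K) - 2 * (t * K) - N * (C * t * K) by ring.
have h5 : N * (L ^+ 2 * t ^+ 2 * K) = N * L ^+ 2 * t * (t * K) by ring.
rewrite mulrBr in h2; rewrite -mulrA; lra.
Qed.

(** One step of descent for the squared miss: moving the covector against t times the miss makes the
    first order term negative by the twist, and a small ep lets it dominate the second order
    term. *)
Lemma shoot_descent (N L m ep t e2 ee de dd : R) : 0 < ep -> t != 0 -> 0 < e2 ->
  N * L ^+ 2 * t ^+ 2 * ep <= m -> 0 < m -> m * t ^+ 2 * ((ep * t) ^+ 2 * e2) <= - (ep * t ^+ 2) * de ->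
  dd <= N * (L ^+ 2 * t ^+ 2 * ((ep * t) ^+ 2 * e2)) -> ee + 2 * de + dd < ee.
Proof.
move=> ep0 t0 e0 hN m0 hm hd; have t2 : 0 < t ^+ 2 by rewrite exprn_even_gt0.
have et : 0 < ep * t ^+ 2 by rewrite mulr_gt0.
have h1 : de <= - (m * (ep * t ^+ 2) * e2).
  rewrite -(ler_pM2l et); have -> : ep * t ^+ 2 * - (m * (ep * t ^+ 2) * e2) = - (m * t ^+ 2 * ((ep * t) ^+ 2 * e2)) by ring.
  by rewrite lerNr -mulNr.
have h2 : N * (L ^+ 2 * t ^+ 2 * ((ep * t) ^+ 2 * e2)) <= m * (ep * t ^+ 2 * e2).
  have -> : N * (L ^+ 2 * t ^+ 2 * ((ep * t) ^+ 2 * e2)) = N * L ^+ 2 * t ^+ 2 * ep * (ep * t ^+ 2 * e2) by ring.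
  by apply: ler_wpM2r => //; rewrite mulr_ge0// ltW.
have h3 : 0 < m * (ep * t ^+ 2 * e2) by exact: mulr_gt0 m0 (mulr_gt0 et e0).
by rewrite -mulrA in h1; lra.
Qed.

Lemma shoot_ratio (N t e e0 c : R) : 0 <= N -> 0 < t -> 0 <= e0 -> 0 <= e -> e ^+ 2 <= N * e0 ^+ 2 -> e0 <= t * c ->
  N * e < t * (1 + N * (N + 1) * c).
Proof.
move=> N0 t0 e00 ee0 h hc.
have h1 : e <= (N + 1) * e0.
  rewrite -ler_sqr ?nnegrE ?mulr_ge0 ?addr_ge0// exprMn; apply: le_trans h _.
  by apply: ler_wpM2r; [exact: sqr_ge0|rewrite expr2; have := mulr_ge0 N0 N0; lra].
have h2 : N * e <= N * ((N + 1) * (t * c)).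
  apply: ler_wpM2l => //; apply: le_trans h1 _; apply: ler_wpM2l => //; lra.
apply: le_lt_trans h2 _; rewrite mulrDr mulr1.
have -> : t * (N * (N + 1) * c) = N * ((N + 1) * (t * c)) by ring.
by rewrite ltrDr.
Qed.

End ShootingReals.

Section Shooting.
Variables (R : realType) (n : nat) (M : ptopologicalType) (A : C2atlas R n M).
Variables (g : riemannian A) (H : cotangent A -> R).
Hypothesis tH : tonelli g H.
Hypotheses (hM : hausdorff_space M) (cM : compact [set: M]).
Local Notation V := 'rV[R]_n.
Local Notation E := ('rV[R]_n * 'rV[R]_n)%type.
Local Notation Phi := (ham_flow H).
Local Notation hh := (local_rep H).
Local Notation cflow := (chart_flow H).

Lemma flow_box_le i (x0 : V) K r T T' L m : 0 < T' -> T' <= T ->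
  flow_box H i x0 K r T L m -> flow_box H i x0 K r T' L m.
Proof.
move=> T0 TT [h1 h2 h3 h4 h5 h6 h7 h8 h9 h10 h11 h12 h13 h14 h15].
have tr (t : R) : `|t| <= T' -> `|t| <= T by move=> h; exact: le_trans TT.
split=> //.
- by apply: le_trans h4; exact: ler_wpM2l.
- by move=> a t ba /tr; exact: h7.
- by move=> a t ba /tr; exact: h8.
- by move=> a t ba /tr; exact: h9.
- by move=> a t ba /tr; exact: h10.
- by move=> a b t ba bb /tr; exact: h11.
- by move=> x p q t hx hp hq /tr; exact: h12.
Qed.

Section InBox.
Variables (i : chart_index A) (x0 : V) (K r T L m : R).
Hypothesis FB : flow_box H i x0 K r T L m.

Lemma cflow0 a : box x0 r K a -> cflow i a 0 = a.
Proof.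
move=> [h1 h2]; rewrite chart_flowE (flow0 tH hM cM) cot_coordVK//.
apply: (fb_codom FB); have /andP[r0 _] := fb_r FB; lra.
Qed.

Lemma cflow_le2 a b t : box x0 r K a -> box x0 r K b -> `|t| <= T ->
  `|cflow i b t - cflow i a t| <= 2 * `|b - a|.
Proof.
move=> ba bb tT; have h := fb_lip FB ba bb tT.
have := ler_normD (cflow i b t - cflow i a t - (b - a)) (b - a); rewrite subrK => h2.
have h3 : L * `|t| <= 1 by have := ler_wpM2l (fb_L FB) tT; have := fb_LT FB; lra.
have h4 : L * `|t| * `|b - a| <= 1 * `|b - a| by apply: ler_wpM2r.
apply: le_trans h2 _; rewrite -[2]/(1 + 1) mulrDl mul1r; apply: lerD => //.
by rewrite mul1r in h4; exact: le_trans h h4.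
Qed.

Lemma fb_sub a : box x0 (r + r) (K + 1) a -> box x0 (r + r) (K + 5) a.
Proof. by move=> [h1 h2]; split=> //; lra. Qed.

Lemma fb_base a : box x0 r K a -> box x0 (r + r) (K + 5) a.
Proof. by move=> [h1 h2]; have /andP[r0 _] := fb_r FB; split; lra. Qed.

Lemma cflow_taylor x p t : box x0 r K (x, p) -> `|t| <= T ->
  `|(cflow i (x, p) t).1 - x - t *: gp (hh i) (x, p)| <= L ^+ 2 * t ^+ 2.
Proof.
move=> ba tT; set a : E := (x, p); pose v := gp (hh i) a.
pose f s := (cflow i a s).1 - s *: v; pose df s := gp (hh i) (cflow i a s) - v.
have tr (s : R) : `|s| <= `|t| -> `|s| <= T by move=> h; exact: le_trans tT.
have D s : `|s| <= `|t| -> is_derive s (1 : R) f (df s).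
  move=> /tr sT; have D1 := is_derive_fst (fb_eq FB ba sT).
  have D2 : is_derive s (1 : R) (fun s => s *: v) v.
    have -> : (fun s : R => s *: v) = (fun s => 0 + s *: v) by apply/funext => r'; rewrite add0r.
    exact: is_derive_affine.
  exact: is_deriveB D1 D2.
have B s : `|s| <= `|t| -> `|df s| <= L ^+ 2 * `|t|.
  move=> st; have sT := tr s st.
  have [_ h] := fb_gradL FB (fb_base ba) (fb_sub (fb_box FB ba sT)).
  apply: le_trans h _; rewrite expr2 -mulrA; apply: ler_wpM2l; first exact: (fb_L FB).
  apply: le_trans (fb_speed FB ba sT) _; apply: ler_wpM2l => //; exact: (fb_L FB).
have h := signed_row_increment D B.
have f0 : f 0 = x by rewrite /f scale0r subr0; exact: (f_equal fst (cflow0 ba)).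
have fE : (cflow i a t).1 - x - t *: v = f t - x by rewrite /f addrAC.
have tE : L ^+ 2 * t ^+ 2 = L ^+ 2 * `|t| * `|t| by rewrite -mulrA -expr2 real_normK ?num_real.
rewrite f0 in h; rewrite fE tE; exact: h.
Qed.

End InBox.

(** The covector minimizes, over the ball of radius K, the squared miss between the end of the orbit
    and the target w. Inside the ball a nonzero miss could be decreased by the twist. On the sphere,
    superlinearity with a slope large compared with C would make the miss larger than a minimizer,
    compared with the covector 0, can have. *)
Lemma shooting i (x0 : M) (r1 : R) : dom i x0 -> 0 < r1 -> exists r : R, [/\ 0 < r, r <= r1, r <= 1,
    (forall x : V, `|x - chart i x0| <= r + r -> codom_chart i x) & forall C K0 : R, 0 <= C -> 0 <= K0 ->
    exists K T L m : R, [/\ K0 <= K, flow_box H i (chart i x0) (K + 1) r T L m &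
      forall x w t, `|x - chart i x0| <= r -> 0 < `|t| <= T -> `|w - x| <= C * `|t| ->
        exists2 p : V, `|p| <= K & (cflow i (x, p) t).1 = w]].
Proof.
move=> di r10; have [r0 r00 [rD Hr]] := local_superlinear tH di.
have HC := tonelli_C2 tH i.
pose r := Num.min (Num.min r1 1) (r0 / 2).
have r'0 : 0 < r by rewrite !lt_min r10 ltr01 divr_gt0.
have rr1 : r <= r1 by rewrite !ge_min lexx.
have r11 : r <= 1 by rewrite !ge_min lexx orbT.
have rr : r + r <= r0 by have : r <= r0 / 2 by [rewrite !ge_min lexx !orbT]; lra.
clearbody r; set c0 := chart i x0.
have rD' (x : V) : `|x - c0| <= r + r -> codom_chart i x by move=> h; apply: rD; exact: le_trans rr.
exists r; split=> // C K0 C0 K00.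
have cQ0 : compact (box c0 r 0) by exact: compact_box.
have Q0D : box c0 r 0 `<=` cot_codom i by move=> a [h _]; apply: rD'; lra.
have [B0 B00 HB0] := grad_bounded HC.1 cQ0 Q0D.
have [H0 H00 HH0] : exists2 C : R, 0 <= C & forall a, box c0 r 0 a -> `|hh i a| <= C.
  apply: near_pinfty_ex; apply: continuous_near_bounded => // a /Q0D Da.
  by apply: differentiable_continuous; case: (HC.1 a Da).
pose N : R := n%:R; have N0 : 0 <= N by exact: ler0n.
(* The shot with covector 0 misses by at most c1 |t|. The slope K1 is chosen so that K1 - 2 - N C =
   1 + N (N + 1) c1, the value at which [shoot_boundary] contradicts [shoot_ratio]. *)
pose c1 := B0 + C + 1; pose K1 := 3 + N * C + N * (N + 1) * c1.
have c10 : 0 <= c1 by rewrite /c1; lra.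
have K10 : 0 < K1 by rewrite /K1 ltr_pwDl// ?mulr_ge0 ?addr_ge0// ltr_pwDl// mulr_ge0.
have [C1 HC1] := Hr K1 K10.
pose K := Num.max K0 (Num.max 1 (C1 + H0)).
have KK0 : K0 <= K by rewrite le_max lexx.
have K1' : 1 <= K by rewrite !le_max lexx orbT.
have KC : C1 + H0 <= K by rewrite !le_max lexx !orbT.
clearbody K; have Kp1 : 0 <= K + 1 by lra.
have [T [L [m FB]]] := flow_box_exists tH hM cM (ltac:(by rewrite r'0 r11) : 0 < r <= 1) Kp1 rD'.
have L0 := fb_L FB; have T0 := fb_T FB; have m0 := fb_m FB.
pose S := (N + 1) * L ^+ 2 + 1.
have S0 : 0 < S by rewrite ltr_pwDr// mulr_ge0 ?addr_ge0 ?sqr_ge0.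
pose T' := Num.min T S^-1; have T'0 : 0 < T' by rewrite lt_min T0 invr_gt0.
have T'T : T' <= T by rewrite ge_min lexx.
have T'S : S * T' <= 1.
  by rewrite -(mulfV (lt0r_neq0 S0)) ler_pM2l// ge_min lexx orbT.
have {}FB : flow_box H i c0 (K + 1) r T' L m by exact: flow_box_le FB.
clearbody T'; exists K, T', L, m; split=> // x w t xr /andP[t0 tT] wx.
have xr2 : `|x - c0| <= r + r by apply: le_trans xr _; rewrite lerDl ltW.
have xr0 : `|x - c0| <= r0 by exact: le_trans rr.
have NLt : N * L ^+ 2 * `|t| <= 1.
  apply: le_trans T'S; apply: ler_pM => //; first by rewrite mulr_ge0 ?sqr_ge0.
  by rewrite /S mulrDl mul1r; have := sqr_ge0 L; lra.
have Lt : L ^+ 2 * `|t| <= 1.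
  apply: le_trans T'S; apply: ler_pM => //; first by rewrite sqr_ge0.
  by rewrite /S mulrDl mul1r; have := mulr_ge0 N0 (sqr_ge0 L); lra.
have bx (p : V) : `|p| <= K + 1 -> box c0 r (K + 1) (x, p) by [].
pose f p := (cflow i (x, p) t).1; pose e p := f p - w; pose F p := pairing (e p) (e p).
have flip (p q : V) : `|p| <= K + 1 -> `|q| <= K + 1 -> `|f q - f p| <= L * `|t| * `|q - p|.
  move=> pK qK; have h := fb_lip FB (bx p pK) (bx q qK) tT.
  have [h1 _] := same_base_diff h; apply: le_trans h1 _; apply: ler_wpM2l; first by rewrite mulr_ge0.
  by apply: norm_pair_le => //=; rewrite subrr normr0.
have Fc (p : V) : `|p - 0| <= K -> {for p, continuous F}.
  rewrite subr0 => pK; have ec : {for p, continuous e}.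
    apply: (@lip_continuous _ _ _ e p 1 1 ltr01) => q q1.
    have qK : `|q| <= K + 1.
      have := ler_normD (q - p) p; rewrite subrK; lra.
    rewrite /e opprB addrA subrK mul1r; apply: le_trans (flip p q _ qK) _; first lra.
    rewrite -[leRHS]mul1r; apply: ler_wpM2r => //.
    by have := fb_LT FB; have := ler_wpM2l L0 tT; lra.
  have ec2 := ec; apply: (@cvg_pairing _ _ _ (nbhs p) _ e e (e p) (e p)); [exact: ec|exact: ec2].
have cB : compact [set y : V | `|y - 0| <= K] by exact: compact_row_ball.
have B0' : [set y : V | `|y - 0| <= K] !=set0 by exists 0; rewrite /= subrr normr0; lra.
have [p /= pK Hp] := compact_min B0' cB Fc; rewrite subr0 in pK.
have pK1 : `|p| <= K + 1 by lra.
have z1 : `|0 : V| <= K + 1 by rewrite normr0.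
exists p => //; apply/eqP; rewrite -subr_eq0; apply/negP => /negP en0.
rewrite -/(f p) -/(e p) in en0.
have e0b : `|e 0| <= `|t| * c1.
  have h1 := cflow_taylor FB (bx 0 z1) tT; have [_ h2] := HB0 (x, 0) (conj xr (ltac:(by rewrite normr0) : `|(x, 0 : V).2| <= 0)).
  have -> : e 0 = (f 0 - x - t *: gp (hh i) (x, 0)) + t *: gp (hh i) (x, 0) - (w - x).
    by rewrite subrK /e opprB addrA subrK.
  apply: le_trans (ler_normB _ _) _; apply: le_trans (lerD (ler_normD _ _) wx) _.
  apply: le_trans (lerD (lerD h1 (lexx _)) (lexx _)) _; rewrite normrZ.
  have h3 := ler_wpM2l (normr_ge0 t) h2; have h4 := ler_wpM2r (normr_ge0 t) Lt.
  rewrite /c1; move: h3 h4; rewrite -[t ^+ 2]real_normK ?num_real// expr2; lra.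
have Fle : `|e p| ^+ 2 <= N * `|e 0| ^+ 2.
  apply: le_trans (pairing_vv_ge _) _; apply: le_trans (pairing_vv_le _).
  by apply: Hp; rewrite /= subrr normr0; exact: le_trans K1'.
have rat := shoot_ratio N0 t0 (normr_ge0 (e 0)) (normr_ge0 (e p)) Fle e0b.
have pint : `|p| < K.
  rewrite lt_neqAle pK andbT; apply/eqP => pE.
  have xD : codom_chart i x by exact: rD'.
  have [dx xE] := codom_chartP xD.
  have bel := fiber_conv tH p 0 dx; rewrite xE sub0r pairingNr in bel.
  have low := HC1 (x, p) xr0; rewrite /= pE in low.
  have up := le_trans (ler_norm _) (HH0 (x, 0) (conj xr (ltac:(by rewrite normr0) : `|(x, 0 : V).2| <= 0))).
  have h1 := cflow_taylor FB (bx p pK1) tT.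
  have b1 := pairing_bound_le h1 (lexx `|p|); rewrite pE in b1.
  have b2 := pairing_bound_le wx (lexx `|p|); rewrite pE in b2.
  have b3 := pairing_bound (e p) p; rewrite pE in b3.
  set a := pairing (f p - x - t *: gp (hh i) (x, p)) p in b1.
  set b := pairing (gp (hh i) (x, p)) p in bel.
  set cc := pairing (w - x) p in b2.
  have eE : pairing (e p) p = a + t * b - cc.
    rewrite /a /b /cc -pairingZl -pairingDl -pairingBl; congr pairing.
    by rewrite subrK /e opprB addrA subrK.
  have sE : Num.sg t * (a + t * b - cc) = Num.sg t * a + `|t| * b - Num.sg t * cc.
    by rewrite mulrBr mulrDr mulrA -normrEsg.
  have sgl (y B : R) : `|y| <= B -> - B <= Num.sg t * y /\ Num.sg t * y <= B.
    move=> yB; apply/andP; rewrite -ler_norml normrM normr_sg.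
    by case: (t != 0) => /=; rewrite ?mul1r ?mul0r//; apply: le_trans yB.
  have [a1 _] := sgl _ _ b1; have [_ c2] := sgl _ _ b2; have [_ e3] := sgl _ _ b3.
  have Kp : 0 < K by exact: lt_le_trans K1'.
  have D1 := shoot_low bel low up.
  rewrite -[t ^+ 2]real_normK ?num_real// in a1.
  rewrite eE sE in e3.
  have := shoot_boundary N0 t0 Kp KC NLt a1 D1 c2 (ler_wpM2l (ltW t0) e3).
  have -> : K1 - 2 - N * C = 1 + N * (N + 1) * c1 by rewrite /K1; ring.
  by rewrite leNgt rat.
have ne0 : 0 < `|e p| by rewrite normr_gt0.
pose ep := Num.min ((K - `|p|) / (`|t| * `|e p|)) (m / (N * L ^+ 2 * t ^+ 2 + 1)).
have den : 0 < N * L ^+ 2 * t ^+ 2 + 1 := ltr_wpDl (mulr_ge0 (mulr_ge0 N0 (sqr_ge0 L)) (sqr_ge0 t)) ltr01.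
have ep0 : 0 < ep by rewrite lt_min !divr_gt0// ?mulr_gt0// subr_gt0.
have ep1 : ep * (`|t| * `|e p|) <= K - `|p|.
  by rewrite -ler_pdivlMr ?mulr_gt0// ge_min lexx.
have ep2 : N * L ^+ 2 * t ^+ 2 * ep <= m.
  have : ep <= m / (N * L ^+ 2 * t ^+ 2 + 1) by rewrite ge_min lexx orbT.
  by rewrite ler_pdivlMr// mulrDr mulr1 mulrC => h; apply: le_trans h; rewrite lerDl ltW.
clearbody ep; pose q := p - (ep * t) *: e p.
have qp : q - p = - ((ep * t) *: e p) by rewrite /q addrAC subrr add0r.
have nqp : `|q - p| = ep * `|t| * `|e p| by rewrite qp normrN normrZ normrM (gtr0_norm ep0).
have qK : `|q| <= K.
  apply: (@norm_shift R n p q K _ (lexx _)); rewrite nqp -mulrA; exact: ep1.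
have qK1 : `|q| <= K + 1 by apply: le_trans qK _; rewrite lerDl.
have tn0 : t != 0 by rewrite -normr_gt0.
have hm := fb_mono FB xr pK1 qK1 tT; rewrite nqp qp pairingNr pairingZr in hm.
have hl := flip p q pK1 qK1; rewrite nqp in hl.
have {}hm : m * t ^+ 2 * (ep * `|t| * `|e p|) ^+ 2 <= t * - (ep * t * pairing (f q - f p) (e p)) by exact: hm.
set d := f q - f p in hl hm.
have dd : pairing d d <= N * (L ^+ 2 * t ^+ 2 * ((ep * t) ^+ 2 * `|e p| ^+ 2)).
  apply: le_trans (pairing_vv_le _) _; apply: ler_wpM2l => //.
  have := ler_pM (normr_ge0 d) (normr_ge0 d) hl hl; rewrite -!expr2 => /le_trans; apply.
  by rewrite sq_abs_identity.
have := Hp q; rewrite /= subr0 => /(_ qK); rewrite leNgt => /negP; apply.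
have -> : F q = F p + 2 * pairing d (e p) + pairing d d.
  have eq_ : e q = e p + d by exact: (esym (add_shift (f q) (f p) w)).
  have -> : F q = pairing (e p + d) (e p + d) by exact: (f_equal (fun v => pairing v v) eq_).
  exact: pairing_sqrD.
apply: (@shoot_descent R N L m ep t (`|e p| ^+ 2)) => //; first by rewrite exprn_gt0.
have hm' : m * t ^+ 2 * (ep * `|t| * `|e p|) ^+ 2 = m * t ^+ 2 * ((ep * t) ^+ 2 * `|e p| ^+ 2).
  by rewrite !exprMn real_normK ?num_real.
rewrite -hm'; apply: le_trans hm _; rewrite le_eqVlt; apply/orP; left; apply/eqP; rewrite expr2; ring.
Qed.

Lemma box_of_dist (a b : E) (r : R) : `|a - b| <= r -> r <= 1 -> box a.1 r (`|a.2| + 1) b.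
Proof.
move=> h r1; have h1 := le_trans (norm_fst (a - b)) h; have h2 := le_trans (norm_snd (a - b)) h.
split; first by rewrite distrC.
apply: (@norm_shift R n a.2 b.2 _ r); first by rewrite distrC.
by rewrite addrAC subrr add0r.
Qed.

Lemma flow_box_at i (z : cotangent A) : dom i z.1 -> exists K r T L m : R,
  [/\ flow_box H i (chart i z.1) K r T L m, box (chart i z.1) r K (cot_coord i z) &
   \forall w \near z, dom i w.1 /\ box (chart i z.1) r K (cot_coord i w)].
Proof.
move=> di; pose K := `|(cot_coord i z).2| + 1.
have K0 : 0 <= K by rewrite addr_ge0.
have [r0 r00 [rD _]] := local_superlinear tH di.
pose r := Num.min 1 (r0 / 2); have r'0 : 0 < r by rewrite lt_min ltr01 divr_gt0.
have r1 : r <= 1 by rewrite ge_min lexx.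
have rr : r + r <= r0 by have : r <= r0 / 2 by [rewrite ge_min lexx orbT]; lra.
clearbody r.
have rD' (x : V) : `|x - chart i z.1| <= r + r -> codom_chart i x by move=> h; apply: rD; exact: le_trans rr.
have [T [L [m FB]]] := flow_box_exists tH hM cM (ltac:(by rewrite r'0 r1) : 0 < r <= 1) K0 rD'.
exists K, r, T, L, m; split=> //.
  by split; rewrite ?cot_coord1 ?subrr ?normr0 ?(ltW r'0)// /K lerDl.
have N1 : \forall w \near z, `|cot_coord i z - cot_coord i w| <= r.
  by have := cot_coord_continuous di; move/cvgrPdist_le; apply.
apply: (@filterS _ (nbhs z) (nbhs_filter z) _ _ _ (filterI N1 (near_dom di))) => w [h dw]; split=> //.
by have := box_of_dist h r1; rewrite cot_coord1.
Qed.

Lemma cot_near_coord i (w : cotangent A) (U : set (cotangent A)) : dom i w.1 -> nbhs w U ->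
  exists2 d : R, 0 < d & forall a : E, `|a - cot_coord i w| < d -> U (cot_coordV i a).
Proof.
move=> dw NU; have cV := cot_coordV_continuous (cot_codom_coord dw).
have N : nbhs (cot_coord i w) (cot_coordV i @^-1` U) by apply: cV; rewrite (cot_coordK dw).
have [d /= d0 Hd] := (nbhs_normP (cot_coord i w) _).1 N.
by exists d => // a; rewrite distrC; exact: Hd.
Qed.

Lemma cflow_coord i t (v : cotangent A) : dom i v.1 -> cflow i (cot_coord i v) t = cot_coord i (Phi t v).
Proof. by move=> dv; rewrite chart_flowE (cot_coordK dv). Qed.

Lemma flow_small (z : cotangent A) : exists2 d : R, 0 < d &
  \forall w \near z, (forall t, `|t| <= d -> {for w, continuous (Phi t)}).
Proof.
have di := chart_atP A z.1; set i := chart_at A z.1 in di.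
have [K [r [T [L [m [FB bz N]]]]]] := flow_box_at di.
exists T; first exact: (fb_T FB).
have N2 := nbhs_interior N.
apply: (@filterS _ (nbhs z) (nbhs_filter z) _ _ _ N2) => w Nw t tT U NU.
have [dw bw] := nbhs_singleton Nw.
have PhiE (v : cotangent A) : dom i v.1 -> box (chart i z.1) r K (cot_coord i v) -> Phi t v = cot_coordV i (cflow i (cot_coord i v) t).
  move=> dv bv; have dPv := fb_dom FB bv tT; rewrite (cot_coordK dv) in dPv.
  rewrite (cflow_coord t dv); exact: esym (cot_coordK dPv).
have dPw : dom i (Phi t w).1 by have := fb_dom FB bw tT; rewrite (cot_coordK dw).
have [d d0 Hd] := cot_near_coord dPw NU.
have N3 : \forall v \near w, `|cot_coord i w - cot_coord i v| < d / 2.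
  by have := cot_coord_continuous dw; move/cvgrPdist_lt; apply; exact: divr_gt0.
apply: (@filterS _ (nbhs w) (nbhs_filter w) _ _ _ (filterI Nw N3)) => v [[dv bv] hv].
change (U (Phi t v)); rewrite (PhiE v dv bv).
have Hd' := eq_ind _ (fun b => forall a : E, `|a - b| < d -> U (cot_coordV i a)) Hd _ (esym (cflow_coord t dw)).
exact: (Hd' _ (double_lt (cflow_le2 FB bw bv tT) hv)).
Qed.

(** Continuity for short times holds uniformly on the compact sublevel of z, which the flow
    preserves; composition extends it to all times. *)
Lemma flow_continuous t : continuous (Phi t).
Proof.
move=> z; pose S := [set w | H w <= H z].
have cS : compact S by exact: (sublevel_compact tH cM).
have [||d d0 Hd] := @compact_unif R _ S (fun d w => forall t, `|t| <= d -> {for w, continuous (Phi t)}) cS.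
- by move=> a b w _ ab Hb s sa; apply: Hb; exact: le_trans ab.
- by move=> w _; exact: flow_small.
have it k : forall s, `|s| <= d -> {for z, continuous (Phi (k%:R * s))}.
  elim: k => [|k IH] s sd.
    have -> : Phi (0%:R * s) = id by apply/funext => w; rewrite mul0r (flow0 tH hM cM).
    exact: cvg_id.
  have -> : Phi (k.+1%:R * s) = Phi s \o Phi (k%:R * s).
    by apply/funext => w; rewrite /= -(flowD tH hM cM) -natr1 mulrDl mul1r addrC.
  apply: continuous_comp; first exact: IH.
  by apply: Hd => //; rewrite /S/= (flow_energy tH hM cM).
pose k := (Num.truncn (`|t| / d)).+1.
have k0 : 0 < k%:R :> R by rewrite ltr0n.
have tk : `|t / k%:R| <= d.
  rewrite normrM normfV (gtr0_norm k0) ler_pdivrMr// mulrC -ler_pdivrMr//.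
  by apply: ltW; exact: truncnS_gt.
by have := it k _ tk; rewrite mulrC divfK// gt_eqF.
Qed.

Lemma flow_joint0 (z : cotangent A) (U : set (cotangent A)) : nbhs z U ->
  exists2 d : R, 0 < d & \forall w \near z, forall t, `|t| <= d -> U (Phi t w).
Proof.
have di := chart_atP A z.1; set i := chart_at A z.1 in di.
have [K [r [T [L [m [FB bz N]]]]]] := flow_box_at di => NU.
have [d d0 Hd] := cot_near_coord di NU.
have L1 : 0 < L + 1 by rewrite ltr_wpDl// (fb_L FB).
exists (Num.min T (d / 2 / (L + 1))); first by rewrite lt_min (fb_T FB) !divr_gt0.
have N3 : \forall v \near z, `|cot_coord i z - cot_coord i v| < d / 2.
  by have := cot_coord_continuous di; move/cvgrPdist_lt; apply; exact: divr_gt0.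
apply: (@filterS _ (nbhs z) (nbhs_filter z) _ _ _ (filterI N N3)) => v [[dv bv] hv] t.
rewrite le_min => /andP[tT td]; have dPv := fb_dom FB bv tT; rewrite (cot_coordK dv) in dPv.
rewrite -(cot_coordK dPv); apply: Hd.
have h1 := fb_speed FB bv tT; rewrite (cflow_coord t dv) in h1.
have h2 : L * `|t| <= d / 2.
  exact: scale_le (normr_ge0 t) L1 td.
rewrite distrC in hv; have := ler_normD (cot_coord i (Phi t v) - cot_coord i v) (cot_coord i v - cot_coord i z).
rewrite addrA subrK => h3; apply: le_lt_trans h3 _.
exact: half_sum_lt h1 h2 hv.
Qed.

Lemma flow_joint (t : R) (z : cotangent A) (U : set (cotangent A)) : nbhs (Phi t z) U ->
  exists2 d : R, 0 < d & \forall w \near z, forall s, `|s - t| <= d -> U (Phi s w).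
Proof.
move=> NU; have [d d0 N] := flow_joint0 NU; exists d => //.
apply: (@filterS _ (nbhs z) (nbhs_filter z) _ _ _ (@flow_continuous t z _ N)) => w Hw s st.
by rewrite -(subrK t s) (flowD tH hM cM); exact: Hw.
Qed.

End Shooting.

(** * Stability of absolute continuity *)

Section AcClosure.
Variable R : realType.
Implicit Types (f h : R -> R) (a b : R).

(** Domination of increments by those of two absolutely continuous functions; Lipschitz functions,
    sums and products are all instances. *)
Lemma ac_dom f h1 h2 (k1 k2 : R) a b : 0 <= k1 -> 0 <= k2 -> ac h1 a b -> ac h2 a b ->
  (forall s t, a <= s -> s <= t -> t <= b ->
     `|f t - f s| <= k1 * `|h1 t - h1 s| + k2 * `|h2 t - h2 s|) -> ac f a b.
Proof.
move=> k10 k20 A1 A2 Hf e e0.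
have e1 : 0 < e / 2 / (k1 + 1) by rewrite !divr_gt0// ltr_wpDl.
have e2 : 0 < e / 2 / (k2 + 1) by rewrite !divr_gt0// ltr_wpDl.
have [d1 d10 H1] := A1 _ e1; have [d2 d20 H2] := A2 _ e2.
exists (Num.min d1 d2); first by rewrite lt_min d10.
move=> I x y F; rewrite lt_min => /andP[l1 l2].
have h1' := H1 I x y F l1; have h2' := H2 I x y F l2.
have K (k v : R) : 0 <= k -> 0 <= v -> v < e / 2 / (k + 1) -> k * v < e / 2.
  move=> k0 v0 hv; have k1p : 0 < k + 1 by rewrite ltr_wpDl.
  move: hv; rewrite ltr_pdivlMr// => hv; apply: le_lt_trans hv; rewrite mulrDr mulr1 mulrC lerDl.
  exact: v0.
have V0 h : 0 <= vsum h x y by apply: sumr_ge0 => k _.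
have := K k1 _ k10 (V0 h1) h1'; have := K k2 _ k20 (V0 h2) h2' => q2 q1.
rewrite [e]splitr; apply: le_lt_trans (ltrD q1 q2).
rewrite /vsum !mulr_sumr -big_split/=; apply: ler_sum => k _.
by case: F => F1 _; have [ax xy yb] := F1 k; exact: Hf.
Qed.

Lemma ac_id a b : ac (fun t => t) a b.
Proof.
move=> e e0; exists e => // I x y [F _] h; rewrite /vsum (eq_bigr (fun k => y k - x k))//.
by move=> k _; have [_ xy _] := F k; rewrite ger0_norm// subr_ge0.
Qed.

Lemma ac_lip f (k : R) a b : 0 <= k -> (forall s t, a <= s -> s <= t -> t <= b ->
  `|f t - f s| <= k * (t - s)) -> ac f a b.
Proof.
move=> k0 Hf; apply: (@ac_dom f id id k 0 a b k0 (lexx 0) (@ac_id a b) (@ac_id a b)) => s t as_ st tb.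
by rewrite mul0r addr0 [X in _ * X]ger0_norm ?subr_ge0//; exact: Hf.
Qed.

Lemma ac_bounded f a b : a <= b -> ac f a b -> exists2 B, 0 <= B & forall t, a <= t <= b -> `|f t| <= B.
Proof.
move=> ab A; exists (`|f a| + V f a b).
  by rewrite addr_ge0// (V_ge0 A)// ab lexx.
move=> t /andP[at_ tb]; have h := V_increment A (lexx a) at_ tb.
have Vt : V f a t <= V f a b.
  by have := V_increment A at_ tb (lexx b); have := normr_ge0 (f b - f t); lra.
have V0 : 0 <= V f a a by rewrite (V_ge0 A)// lexx.
by have := ler_normD (f t - f a) (f a); rewrite subrK; lra.
Qed.

Lemma acD f h a b : ac f a b -> ac h a b -> ac (fun t => f t + h t) a b.
Proof.
move=> A1 A2; apply: (ac_dom ler01 ler01 A1 A2) => s t _ _ _.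
by rewrite !mul1r opprD addrACA; exact: ler_normD.
Qed.

Lemma acM f h a b : a <= b -> ac f a b -> ac h a b -> ac (fun t => f t * h t) a b.
Proof.
move=> ab A1 A2; have [B1 B10 H1] := ac_bounded ab A1; have [B2 B20 H2] := ac_bounded ab A2.
apply: (ac_dom B20 B10 A1 A2) => s t as_ st tb.
have -> : f t * h t - f s * h s = h t * (f t - f s) + f s * (h t - h s) by ring.
apply: le_trans (ler_normD _ _) _; rewrite !normrM; apply: lerD; apply: ler_wpM2r => //.
  by apply: H2; rewrite (le_trans as_ st).
by apply: H1; rewrite as_ (le_trans st tb).
Qed.

Lemma ac_sum n (f : 'I_n -> R -> R) a b : (forall j, ac (f j) a b) -> ac (fun t => \sum_j f j t) a b.
Proof.
move=> Hf; have ac0 : ac (fun _ : R => 0 : R) a b.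
  by apply: (@ac_lip _ 0) => // s t _ _ _; rewrite subrr normr0 mul0r.
elim: (index_enum 'I_n) => [|j l IH].
  by have -> : (fun t => \sum_(j <- [::]) f j t) = (fun _ => 0) by apply/funext => t; rewrite big_nil.
have -> : (fun t => \sum_(i <- j :: l) f i t) = (fun t => f j t + \sum_(i <- l) f i t).
  by apply/funext => t; rewrite big_cons.
exact: acD.
Qed.

Lemma ac_eq f h a b : (forall t, a <= t <= b -> f t = h t) -> ac f a b -> ac h a b.
Proof.
move=> E A e e0; have [d d0 Hd] := A e e0; exists d => // I x y F l.
have -> : vsum h x y = vsum f x y; last exact: Hd.
apply: eq_bigr => k _; case: F => F1 _; have [ax xy yb] := F1 k.
by rewrite !E// ?ax ?yb ?(le_trans xy yb) ?(le_trans ax xy).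
Qed.

Lemma ac_glue f a m b : a <= m -> m <= b -> ac f a m -> ac f m b -> ac f a b.
Proof.
move=> am mb A1 A2 e e0; have e2 : 0 < e / 2 by exact: divr_gt0.
have [d1 d10 H1] := A1 _ e2; have [d2 d20 H2] := A2 _ e2.
exists (Num.min d1 d2); first by rewrite lt_min d10.
move=> I x y F; rewrite lt_min => /andP[l1 l2].
have xy k : x k <= y k by case: F => F1 _; have [] := F1 k.
apply: le_lt_trans (vsum_split f m xy) _; rewrite [e]splitr; apply: ltrD.
  apply: H1; first exact: family_min F.
  apply: le_lt_trans l1; apply: ler_sum => k _.
  by have := xy k; rewrite /Num.min; case: ifP; case: ifP; rewrite -?leNgt; do ?move/negbT; rewrite -?leNgt; lra.
apply: H2; first exact: family_max F.
apply: le_lt_trans l2; apply: ler_sum => k _.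
by have := xy k; rewrite /Num.max; case: ifP; case: ifP; rewrite -?leNgt; do ?move/negbT; rewrite -?leNgt; lra.
Qed.

(** Continuation up to the supremum of the t with f absolutely continuous on [a, t]. It is needed
    because a curve crosses several charts. *)
Lemma ac_local f a b : a <= b -> (forall t, a <= t <= b -> exists2 d : R, 0 < d &
  forall u v, a <= u -> u <= v -> v <= b -> t - d <= u -> v <= t + d -> ac f u v) -> ac f a b.
Proof.
move=> ab Hl; have ab' : a <= b <= b by rewrite ab lexx.
have aa : a <= a <= b by rewrite ab lexx.
pose S : set R := [set t | a <= t <= b /\ ac f a t].
have Sa : S a.
  split=> //; have [d d0 Hd] := Hl a aa; apply: Hd => //; lra.
have bS : has_sup S by split; [exists a|exists b => t [/andP[]]].
pose s := sup S; have sb : s <= b by apply: ge_sup; [exists a|move=> t [/andP[]]].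
have as_ : a <= s by apply: ub_le_sup => //; case: bS.
have [d d0 Hd] := Hl s (ltac:(by rewrite as_ sb)).
have [t [/andP[at_ tb] At] tsd] : exists2 t, S t & s - d < t by apply: sup_adherent.
have ts : t <= s by apply: ub_le_sup; [case: bS|split; rewrite ?at_].
pose e := Num.min b (s + d); have te : t <= e by rewrite le_min tb; lra.
have eb : e <= b by rewrite ge_min lexx.
have Ae : ac f a e.
  apply: (ac_glue at_ te At); apply: Hd => //; first lra.
  by rewrite ge_min lexx orbT.
have es : e <= s by apply: ub_le_sup; [case: bS|split; rewrite ?eb ?(le_trans at_ te)].
suff <- : e = b by [].
by move: es; rewrite /e; case: (leP b (s + d)) => // _; lra.
Qed.

End AcClosure.

(** * The action along orbits *)

Section Antiderivative.
Variable R : realType.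

Lemma zero_derive_const (f : R -> R) (a b : R) : a <= b ->
  (forall x, a <= x <= b -> is_derive x (1 : R) f 0) -> f b = f a.
Proof.
move=> ab D; have [c _ E] := mean_value (df := fun=> 0) ab D.
by apply/eqP; rewrite -subr_eq0 E mul0r.
Qed.

Lemma antiderivative (f : R -> R) : continuous f ->
  exists F : R -> R, F 0 = 0 /\ forall t, is_derive t (1 : R) F (f t).
Proof.
move=> cf; pose leb := @lebesgue_measure R.
pose I (N t : R) := \int[leb]_(s in `[- N, t]) f s.
pose G (N t : R) := I N t - I N 0.
have DI (N t : R) : - N < t -> is_derive t (1 : R) (I N) (f t).
  move=> Nt; have [||||D E] := @continuous_FTC1 R f (BLeft (- N)) t (t + 1).
  - by rewrite ltrDl.
  - apply: continuous_compact_integrable; first exact: segment_compact.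
    exact: continuous_subspaceT.
  - by suff: (BLeft (- N) < BRight t)%O by []; rewrite bnd_simp ltW.
  - exact: cf.
  exact: derive1_is_derive.
have DG (N t : R) : - N < t -> is_derive t (1 : R) (G N) (f t).
  move=> Nt; apply: (eq_is_derive_val _ (is_deriveB (DI N t Nt) (is_derive_cst (I N 0) t 1))).
  by rewrite subr0.
have EG (N N' t : R) : `|t| < N -> `|t| < N' -> G N t = G N' t.
  move=> tN tN'; apply/eqP; rewrite -subr_eq0; apply/eqP.
  have D s : - `|t| <= s -> is_derive s (1 : R) (fun s => G N s - G N' s) 0.
    move=> ts; have N1 : - N < s by lra.
    have N2 : - N' < s by lra.
    by apply: (eq_is_derive_val _ (is_deriveB (DG N s N1) (DG N' s N2))); rewrite subrr.
  have G0 : G N 0 - G N' 0 = 0 by rewrite /G !subrr.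
  rewrite -[RHS]G0; have [t0|/ltW t0] := leP 0 t.
    apply: (zero_derive_const (f := fun s => G N s - G N' s) t0) => s /andP[s0 _]; apply: D.
    by have := normr_ge0 t; lra.
  apply/esym; apply: (zero_derive_const (f := fun s => G N s - G N' s) t0) => s /andP[ts _]; apply: D.
  by rewrite ler0_norm//; lra.
exists (fun t => G (`|t| + 1) t); split=> [|t]; first by rewrite /G subrr.
have tN : - (`|t| + 2) < t by have := ler_norm (- t); rewrite normrN; lra.
apply: (near_eq_is_derive _ (DG (`|t| + 2) t tN)).
apply/(nbhs_normP t _); exists 1; first exact: ltr01.
move=> s /= h; apply: EG; last by rewrite ltrDl.
by have := ler_normD (s - t) t; rewrite subrK distrC; lra.
Qed.

End Antiderivative.

Section ActDiffRate.
Variables (R : realType) (n : nat).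
Local Notation V := 'rV[R]_n.
Local Notation E := ('rV[R]_n * 'rV[R]_n)%type.

Lemma signed_increment (f df : R -> R) (k t : R) :
  (forall s, `|s| <= `|t| -> is_derive s (1 : R) f (df s)) ->
  (forall s, `|s| <= `|t| -> `|df s| <= k) -> `|f t - f 0| <= k * `|t|.
Proof.
move=> Hd Hk; have [t0|/ltW t0] := leP 0 t.
  have [s /andP[s0 st]|s /andP[s0 st] ->] := mean_value (f := f) (df := df) t0.
    by apply: Hd; rewrite !ger0_norm.
  by rewrite normrM subr0; apply: ler_wpM2r => //; apply: Hk; rewrite !ger0_norm.
rewrite distrC; have [s /andP[ts s0]|s /andP[ts s0] ->] := mean_value (f := f) (df := df) t0.
  by apply: Hd; rewrite !ler0_norm// lerN2.
by rewrite normrM sub0r normrN; apply: ler_wpM2r => //; apply: Hk; rewrite !ler0_norm// lerN2.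
Qed.

Lemma dens_diff_identity (u1 u2 v1 v2 a b c d : V) (hu hv : R) :
  pairing v2 d - hv - (pairing u2 c - hu) - (pairing (- a) (v1 - u1) + pairing u2 (d - c)) =
  (hu - hv - pairing b (u1 - v1) - pairing d (u2 - v2)) + pairing (a - b) (v1 - u1).
Proof. by rewrite !pairingNl !pairingBl !pairingBr (pairingC d u2) (pairingC d v2); ring. Qed.

Lemma pairing_at0 (x y : R) (a b a' b' : E) : x = 0 -> y = 0 -> a' = a -> b' = b ->
  x - y - pairing a'.2 (b'.1 - a'.1) = - pairing a.2 (b.1 - a.1).
Proof. by move=> -> -> -> ->; rewrite subrr sub0r. Qed.

Lemma sub_rearr (x y p q : R) : x - y - (p - q) = x - y - p - - q.
Proof. ring. Qed.

Lemma calib_identity (p gx' gp' e v : V) (k L h1 h0 N : R) : N = pairing e e ->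
  h1 - h0 - pairing gx' e - k * pairing gp' e <= L * N ->
  pairing p gp' - h0 + (pairing (- gx') e + pairing p (v - gp'))
    + (- (L * 2) / 2 * N + k / 2 * (pairing (v - gp') e + pairing e (v - gp')))
  <= pairing (p + k *: e) v - h1.
Proof.
move=> _; rewrite pairingNl pairingBl !pairingBr pairingDl pairingZl (pairingC v e) (pairingC e gp').
move: (pairing gp' e) (pairing e v) (pairing gx' e) (pairing p v) (pairing p _) => p1 p2 p3 p4 p5; lra.
Qed.

(** Here u and v are states of two orbits. By Hamilton's equations the subtracted term is the time
    derivative of u.2 paired with v.1 - u.1; what remains of the difference of the Lagrangians is
    quadratic by Taylor's formula. *)
Lemma act_diff_rate (h : E -> R) (L d : R) (u v : E) : 0 <= L ->
  `|h u - h v - pairing (gx h v) (u.1 - v.1) - pairing (gp h v) (u.2 - v.2)| <= L * `|u - v| ^+ 2 ->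
  `|gx h v - gx h u| <= L * `|v - u| -> `|v - u| <= 2 * d ->
  `|pairing v.2 (gp h v) - h v - (pairing u.2 (gp h u) - h u)
    - (pairing (- gx h u) (v.1 - u.1) + pairing u.2 (gp h v - gp h u))| <= 4 * (1 + n%:R) * L * d ^+ 2.
Proof.
move=> L0 tay lg d2.
have e1 : `|pairing (gx h u - gx h v) (v.1 - u.1)| <= n%:R * (L * `|v - u| * `|v - u|).
  by apply: pairing_bound_le; [rewrite distrC|exact: (norm_fst (v - u))].
have -> : pairing v.2 (gp h v) - h v - (pairing u.2 (gp h u) - h u)
    - (pairing (- gx h u) (v.1 - u.1) + pairing u.2 (gp h v - gp h u)) =
  (h u - h v - pairing (gx h v) (u.1 - v.1) - pairing (gp h v) (u.2 - v.2)) + pairing (gx h u - gx h v) (v.1 - u.1).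
  exact: dens_diff_identity.
apply: le_trans (ler_normD _ _) _; apply: le_trans (lerD tay e1) _.
have -> : L * `|u - v| ^+ 2 + n%:R * (L * `|v - u| * `|v - u|) = (1 + n%:R) * L * `|v - u| ^+ 2.
  by rewrite distrC expr2; ring.
have -> : 4 * (1 + n%:R) * L * d ^+ 2 = (1 + n%:R) * L * (2 * d) ^+ 2 by rewrite !expr2; ring.
apply: ler_wpM2l; first by rewrite mulr_ge0 ?addr_ge0.
by rewrite !expr2; apply: ler_pM.
Qed.

(** The pointwise inequality behind [calibration]. The left side is the derivative of the comparison
    function along the curve, the right side one term of Fenchel's inequality, at the covector a.2 +
    k (x - a.1). The bound |k| <= 1 keeps this covector within |x - a.1| of a.2, and k' = - 2 L pays
    for the Taylor remainder. *)
Lemma calib_rate (h : E -> R) (L k : R) (a : E) (x v : V) : - 1 <= k <= 0 ->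
  `|h (x, a.2 + k *: (x - a.1)) - h a - pairing (gx h a) (x - a.1)
      - pairing (gp h a) (a.2 + k *: (x - a.1) - a.2)| <= L * `|((x, a.2 + k *: (x - a.1)) : E) - a| ^+ 2 -> 0 <= L ->
  pairing a.2 (gp h a) - h a + (pairing (- gx h a) (x - a.1) + pairing a.2 (v - gp h a))
    + (- (L * 2) / 2 * pairing (x - a.1) (x - a.1)
       + k / 2 * (pairing (v - gp h a) (x - a.1) + pairing (x - a.1) (v - gp h a)))
  <= pairing (a.2 + k *: (x - a.1)) v - h (x, a.2 + k *: (x - a.1)).
Proof.
move=> /andP[k1 k0]; set e := x - a.1 => tay L0.
have nb : `|((x, a.2 + k *: e) : E) - a| <= `|e|.
  apply: norm_pair_le => //=; rewrite addrAC subrr add0r normrZ ler0_norm// -[leRHS]mul1r.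
  by apply: ler_wpM2r => //; lra.
have h1 : L * `|((x, a.2 + k *: e) : E) - a| ^+ 2 <= L * pairing e e.
  apply: ler_wpM2l => //; apply: le_trans (pairing_vv_ge e); rewrite !expr2; exact: ler_pM.
move: (le_trans tay h1); rewrite ler_norml => /andP[_].
have -> : a.2 + k *: e - a.2 = k *: e by rewrite addrAC subrr add0r.
by rewrite pairingZr; exact: calib_identity.
Qed.

End ActDiffRate.

Section ActionDensity.
Variables (R : realType) (n : nat) (M : ptopologicalType) (A : C2atlas R n M).
Variables (g : riemannian A) (H : cotangent A -> R).
Hypothesis tH : tonelli g H.
Hypotheses (hM : hausdorff_space M) (cM : compact [set: M]).
Local Notation V := 'rV[R]_n.
Local Notation E := ('rV[R]_n * 'rV[R]_n)%type.
Local Notation Phi := (ham_flow H).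
Local Notation hh := (local_rep H).
Local Notation cflow := (chart_flow H).

Lemma local_dens_continuous i (a : E) : cot_codom i a ->
  {for a, continuous (fun a : E => pairing a.2 (gp (hh i) a) - hh i a)}.
Proof.
move=> Ca; have [C1 C2] := tonelli_C2 tH i; have [dh cD] := C1 a Ca.
apply: (@cvgB _ _ _ (nbhs a) _ (fun a : E => pairing a.2 (gp (hh i) a)) (hh i)).
  apply: (@cvg_pairing _ _ _ (nbhs a)); first exact: cvg_snd.
  apply: cvg_row => l.
  have -> : (fun t : E => gp (hh i) t 0 l) = 'D_((0, delta_mx 0 l) : E) (hh i) by apply/funext => t; rewrite mxE.
  by rewrite mxE; exact: cD.
exact: differentiable_continuous.
Qed.

Lemma dens_continuous : continuous (dens H).
Proof.
move=> z; have di := chart_atP A z.1; set i := chart_at A z.1 in di.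
pose l (a : E) := pairing a.2 (gp (hh i) a) - hh i a.
have lE w : dom i w.1 -> l (cot_coord i w) = dens H w.
  by move=> dw; rewrite /l (dens_chart tH dw) (local_rep_coord H dw).
have cl := local_dens_continuous (cot_codom_coord di).
have h : l (cot_coord i w) @[w --> z] --> dens H z.
  by rewrite -(lE z di); exact: (@continuous_comp _ _ _ _ _ z (cot_coord_continuous di) cl).
apply: cvg_trans h; apply: (@near_eq_cvg _ _ (nbhs z) (nbhs_filter z)).
by apply: (@filterS _ (nbhs z) (nbhs_filter z)) (near_dom di) => w dw; rewrite -lE.
Qed.

Lemma orbit_continuous z : continuous (Phi^~ z).
Proof. by move=> t; have [] := flow_solat tH hM cM z t. Qed.

(** The primitive of [dens] along the orbit, available for negative times too; for t >= 0 it is the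
    [action] of the projected orbit ([base_action]). *)
Definition act z : R -> R := xget (fun=> 0)
  [set F | F 0 = 0 /\ forall t, is_derive t (1 : R) F (dens H (Phi t z))].

Lemma act_spec z : act z 0 = 0 /\ forall t, is_derive t (1 : R) (act z) (dens H (Phi t z)).
Proof.
apply: (@xgetPex _ (fun=> 0) [set F | F 0 = 0 /\ forall t, is_derive t (1 : R) F (dens H (Phi t z))]).
apply: antiderivative => t; apply: (@continuous_comp _ _ _ (Phi^~ z) (dens H)).
  exact: orbit_continuous.
exact: dens_continuous.
Qed.

Lemma act0 z : act z 0 = 0. Proof. exact: (act_spec z).1. Qed.

Lemma act_derive z t : is_derive t (1 : R) (act z) (dens H (Phi t z)).
Proof. exact: (act_spec z).2. Qed.

Lemma actD z s t : act z (s + t) = act z t + act (Phi t z) s.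
Proof.
pose f r := act z (r + t) - act (Phi t z) r.
have D r : is_derive r (1 : R) f 0.
  have D1 := is_derive_shift_time (act_derive z (r + t)).
  apply: (eq_is_derive_val _ (is_deriveB D1 (act_derive (Phi t z) r))).
  by rewrite (flowD tH hM cM) subrr.
have f0 : f 0 = act z t by rewrite /f add0r act0 subr0.
suff : f s = f 0 by rewrite f0 /f => <-; rewrite subrK.
have [s0|/ltW s0] := leP 0 s; first exact: zero_derive_const.
by apply/esym; exact: zero_derive_const.
Qed.

Lemma velocity_chart (c : R -> M) t i (v : V) : {for t, continuous c} -> dom i (c t) ->
  is_derive t (1 : R) (chart i \o c) v ->
  velocity A c t = (c t, v *m tjac i (chart_at A (c t)) (c t)).
Proof.
move=> cc di D; rewrite /velocity; congr pair; set j := chart_at A (c t).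
have dj : dom j (c t) := chart_atP A _.
have D1 := is_derive_comp_D (transition_differentiable di dj) D.
have N : \forall s \near t, transition i j ((chart i \o c) s) = (chart j \o c) s.
  have N1 : nbhs (c t) (dom i) by apply: open_nbhs_nbhs; split=> //; exact: open_dom.
  have N2 : nbhs t (c @^-1` dom i) by exact: cc.
  by apply: filterS N2 => s ds; rewrite /transition/= (chartK ds).
have D2 := near_eq_is_derive N D1.
rewrite derive1E; apply: (eq_trans (@derive_val _ _ _ _ _ _ _ D2)).
exact: transition_derive.
Qed.

(** Fenchel's inequality with the covector 0: H is bounded above on the zero section, by the second
    Tonelli condition with radius 0. *)
Lemma lagrangian_lb : exists2 C0 : R, 0 <= C0 & forall w, - C0 <= lagrangian H w.
Proof.
case: (tH) => _ _ /(_ 0 (lexx 0)) + _.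
set S := [set (H z)%:E | z in _] => Sfin.
have H0 x : (H (x, 0) <= fine (ereal_sup S)).
  have hs : ((H (x, 0))%:E <= ereal_sup S)%E.
    apply: ereal_sup_ubound; exists (x, 0) => //=.
    apply: ge_sup => [|_ [v _ <-]]; last by rewrite pairing0l.
    by exists (pairing (0 : V) 0), 0 => //=; rewrite /tnorm !mul0mx mxE sqrtr0.
  have fin : ereal_sup S \is a fin_num by rewrite fin_numElt Sfin andbT (lt_le_trans _ hs)// ltNyr.
  by rewrite -lee_fin fineK.
exists `|fine (ereal_sup S)| => // -[x v].
pose i := chart_at A x; have di : dom i x := chart_atP A x.
have := fenchel tH (0 : V) v di; rewrite (local_repE H _ di) mul0mx pairing0l sub0r (tjac_id di) mulmx1.
apply: le_trans; rewrite lerN2; apply: le_trans (H0 x) _; exact: ler_norm.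
Qed.

Lemma base_action z t : 0 <= t -> action H t (fst \o Phi^~ z) = (act z t)%:E.
Proof.
move=> t0; have vE s : lagrangian H (velocity A (fst \o Phi^~ z) s) = dens H (Phi s z).
  by rewrite /dens -(solat_velocity tH (flow_solat tH hM cM z s)).
rewrite /action; under eq_integral do rewrite vE.
move: t0; rewrite le_eqVlt => /predU1P[<-|t0].
  by rewrite set_itv1 integral_set1 act0.
have D s := act_derive z s.
have cf : continuous (fun s => dens H (Phi s z)).
  move=> s; apply: (@continuous_comp _ _ _ (Phi^~ z) (dens H)); first exact: orbit_continuous.
  exact: dens_continuous.
rewrite (@continuous_FTC2 _ (fun s => dens H (Phi s z)) (act z) 0 t t0).
- by rewrite act0 sube0.
- exact: continuous_subspaceT.
- split.
  + by move=> s _; have [] := D s.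
  + by apply: cvg_at_right_filter; exact: (derive_continuous (D 0)).
  + by apply: cvg_at_left_filter; exact: (derive_continuous (D t)).
- by move=> s _; rewrite derive1E; exact: (@derive_val _ _ _ _ _ _ _ (D s)).
Qed.

Lemma base_derive z i t : dom i (Phi t z).1 ->
  is_derive t (1 : R) (chart i \o (fst \o Phi^~ z)) (gp (hh i) (cot_coord i (Phi t z))).
Proof.
move=> di; have [_ /(_ i di) D] := flow_solat tH hM cM z t.
have dh : differentiable (hh i) (cot_coord i (Phi t z)).
  by have [] := (tonelli_C2 tH i).1 _ (cot_codom_coord di).
exact: (eq_is_derive_val (f_equal fst (ham_vfE dh)) (is_derive_fst D)).
Qed.

Lemma base_ac z s : abs_continuous_curve A s (fst \o Phi^~ z).
Proof.
split.
  apply: continuous_subspaceT => t; apply: (@continuous_comp _ _ _ (Phi^~ z) fst).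
    exact: orbit_continuous.
  exact: cot_fst_continuous.
move=> i a b a0 ab bs Hi.
have di t : a <= t <= b -> dom i (Phi t z).1.
  by move=> tab; apply: Hi; exists t => //=; rewrite in_itv.
pose dg t := gp (hh i) (cot_coord i (Phi t z)).
have [B B0 HB] : exists2 B : R, 0 <= B & forall t, a <= t <= b -> `|dg t| <= B.
  have [B B0 HB] : exists2 B : R, 0 <= B & forall t, [set t | a <= t <= b] t -> `| `|dg t| | <= B.
    apply: near_pinfty_ex; apply: continuous_near_bounded.
      have -> : [set t | a <= t <= b] = `[a, b]%classic by apply/seteqP; split=> t; rewrite /= in_itv.
      exact: segment_compact.
    move=> t tab; have dt := di t tab.
    have [dh cD] := (tonelli_C2 tH i).1 _ (cot_codom_coord dt).
    have cg : {for cot_coord i (Phi t z), continuous (gp (hh i))}.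
      apply: cvg_row => l.
      have -> : (fun a : E => gp (hh i) a 0 l) = 'D_((0, delta_mx 0 l) : E) (hh i) by apply/funext => w; rewrite mxE.
      by rewrite mxE; exact: cD.
    have c1 := @continuous_comp _ _ _ _ _ t (@orbit_continuous z t) (cot_coord_continuous dt).
    have c2 := @continuous_comp _ _ _ _ _ t c1 cg.
    exact: (@continuous_comp _ _ _ _ (fun v : V => `|v|) t c2 (@norm_continuous _ _ _)).
  by exists B => // t tab; have := HB t tab; rewrite normr_id.
move=> e e0; exists (e / (B + 1)); first by rewrite divr_gt0// ltr_wpDl.
move=> m x y F _ hs; apply: (@le_lt_trans _ _ (\sum_(k < m) (B + 1) * (y k - x k))).
  apply: ler_sum => k _; have [ax xy yb] := F k.
  apply: le_trans (row_increment (dc := dg) xy _ _) _ => [t /andP[xt ty]|t /andP[xt ty]|].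
  - by apply: base_derive; apply: di; rewrite (le_trans ax xt) (le_trans ty yb).
  - by apply: HB; rewrite (le_trans ax xt) (le_trans ty yb).
  - by apply: ler_wpM2r; [rewrite subr_ge0|rewrite lerDl].
by rewrite -mulr_sumr mulrC -ltr_pdivlMr// ltr_wpDl.
Qed.

Lemma dens_local i (a : E) : cot_codom i a -> dens H (cot_coordV i a) = pairing a.2 (gp (hh i) a) - hh i a.
Proof.
by move=> Ca; rewrite (dens_chart tH (cot_coordV_dom Ca)) (cot_coordVK Ca).
Qed.

Section InBox.
Variables (i : chart_index A) (c0 : V) (K r T L m : R).
Hypothesis FB : flow_box H i c0 K r T L m.

Lemma cflow_codom a t : box c0 r K a -> `|t| <= T -> cot_codom i (cflow i a t).
Proof. by move=> ba tT; rewrite chart_flowE; apply: cot_codom_coord; exact: (fb_dom FB ba tT). Qed.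

Lemma flow_cflow a t : box c0 r K a -> `|t| <= T -> Phi t (cot_coordV i a) = cot_coordV i (cflow i a t).
Proof. by move=> ba tT; rewrite chart_flowE (cot_coordK (fb_dom FB ba tT)). Qed.

Lemma act_local_derive a t : box c0 r K a -> `|t| <= T -> is_derive t (1 : R) (act (cot_coordV i a))
  (pairing (cflow i a t).2 (gp (hh i) (cflow i a t)) - hh i (cflow i a t)).
Proof.
move=> ba tT; apply: (eq_is_derive_val _ (act_derive (cot_coordV i a) t)).
by rewrite (flow_cflow ba tT); exact: dens_local (cflow_codom ba tT).
Qed.

(** The first variation of the action of an orbit with both ends free, with a quadratic error: the
    linear part consists of the two boundary terms. *)
Lemma act_diff a b t : box c0 r K a -> box c0 r K b -> `|t| <= T ->
  `|act (cot_coordV i b) t - act (cot_coordV i a) t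
    - (pairing (cflow i a t).2 ((cflow i b t).1 - (cflow i a t).1) - pairing a.2 (b.1 - a.1))|
  <= 4 * (1 + n%:R) * L * `|t| * `|b - a| ^+ 2.
Proof.
move=> ba bb tT.
pose f s := act (cot_coordV i b) s - act (cot_coordV i a) s - pairing (cflow i a s).2 ((cflow i b s).1 - (cflow i a s).1).
pose ga s := gp (hh i) (cflow i a s); pose gb s := gp (hh i) (cflow i b s).
pose df s := (pairing (cflow i b s).2 (gb s) - hh i (cflow i b s)) - (pairing (cflow i a s).2 (ga s) - hh i (cflow i a s))
   - (pairing (- gx (hh i) (cflow i a s)) ((cflow i b s).1 - (cflow i a s).1) + pairing (cflow i a s).2 (gb s - ga s)).
have D s : `|s| <= T -> is_derive s (1 : R) f (df s).
  move=> sT; have Da := fb_eq FB ba sT; have Db := fb_eq FB bb sT.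
  have D1 := is_deriveB (act_local_derive bb sT) (act_local_derive ba sT).
  have D2 := is_derive_pairing (is_derive_snd Da) (is_deriveB (is_derive_fst Db) (is_derive_fst Da)).
  exact: is_deriveB D1 D2.
have B s : `|s| <= T -> `|df s| <= 4 * (1 + n%:R) * L * `|b - a| ^+ 2.
  move=> sT; rewrite /df /ga /gb; have d2 := cflow_le2 FB ba bb sT.
  have Qa := fb_sub (fb_box FB ba sT); have Qb := fb_sub (fb_box FB bb sT).
  have tay := fb_taylor FB Qb Qa; have [lg _] := fb_gradL FB Qa Qb.
  move: tay lg d2; move: (cflow i a s) (cflow i b s) => u v tay lg d2.
  exact: act_diff_rate (fb_L FB) tay lg d2.
have f0 : f 0 = - pairing a.2 (b.1 - a.1).
  exact: (pairing_at0 (act0 _) (act0 _) (cflow0 tH hM cM FB ba) (cflow0 tH hM cM FB bb)).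
have -> : act (cot_coordV i b) t - act (cot_coordV i a) t
    - (pairing (cflow i a t).2 ((cflow i b t).1 - (cflow i a t).1) - pairing a.2 (b.1 - a.1)) = f t - f 0.
  by rewrite f0; exact: sub_rearr.
rewrite mulrAC; apply: (signed_increment (df := df)) => s st; [apply: D|apply: B]; exact: le_trans tT.
Qed.

End InBox.

End ActionDensity.

(** * Absolutely continuous curves on the manifold *)

Section CurveLemmas.
Variables (R : realType) (n : nat) (M : ptopologicalType) (A : C2atlas R n M).
Local Notation Vn := 'rV[R]_n.
Local Notation leb := (@lebesgue_measure R).
Implicit Types (c : R -> M) (u : M -> R) (i j : chart_index A).

Lemma within_itv_near c (s t : R) (U : set M) : {within `[0, s], continuous c} -> 0 <= t <= s ->
  nbhs (c t) U -> exists2 d : R, 0 < d & forall r, 0 <= r <= s -> `|r - t| < d -> U (c r).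
Proof.
move=> /subspace_continuousP cc ts NU.
have it : `[0, s]%classic t by rewrite /= in_itv.
have N : within `[0, s]%classic (nbhs t) (c @^-1` U) by exact: cc.
have [d /= d0 Hd] := (nbhs_normP t _).1 N.
by exists d => // r rs rt; apply: (Hd r); [rewrite /= distrC|rewrite in_itv].
Qed.

Lemma within_itv_cont c (s t : R) : {within `[0, s], continuous c} -> 0 < t < s -> {for t, continuous c}.
Proof.
move=> cc /andP[t0 ts] U NU.
have [|d d0 Hd] := within_itv_near cc (_ : 0 <= t <= s) NU; first by rewrite !ltW.
apply/(nbhs_normP t _); exists (Num.min d (Num.min t (s - t))).
  by rewrite /= !lt_min d0 t0 subr_gt0.
move=> r /=; rewrite !lt_min => /and3P[rd rt rs]; apply: Hd; last by rewrite distrC.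
by move: rt rs; rewrite !ltr_norml; lra.
Qed.

Lemma chart_derive_change c t i j (v : Vn) : {for t, continuous c} -> dom i (c t) -> dom j (c t) ->
  is_derive t (1 : R) (chart i \o c) v -> is_derive t (1 : R) (chart j \o c) (v *m tjac i j (c t)).
Proof.
move=> cc di dj D.
have D1 := is_derive_comp_D (transition_differentiable di dj) D.
have N : \forall s \near t, transition i j ((chart i \o c) s) = (chart j \o c) s.
  have N1 : nbhs (c t) (dom i) by apply: open_nbhs_nbhs; split=> //; exact: open_dom.
  have N2 : nbhs t (c @^-1` dom i) by exact: cc.
  by apply: filterS N2 => s ds; rewrite /transition/= (chartK ds).
exact: (eq_is_derive_val (transition_derive v di dj) (near_eq_is_derive N D1)).
Qed.

Lemma ae_chart_derivable i c (a b : R) : a < b -> abs_continuous_on (chart i \o c) a b ->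
  {ae leb, forall t, a < t < b -> exists v : Vn, is_derive t (1 : R) (chart i \o c) v}.
Proof.
move=> ab A1.
have Hj (j : 'I_n) : exists rho : R -> R, {ae leb, forall t, a < t < b -> is_derive t (1 : R) (fun s => chart i (c s) 0 j) (rho t)}.
  by have [rho [_ _ h]] := ac_FTC ab (abs_continuous_on_ac j A1); exists rho.
have /choice[rho Hrho] := Hj.
pose P (k : nat) (t : R) := forall j : 'I_n, val j = k -> a < t < b -> is_derive t (1 : R) (fun s => chart i (c s) 0 j) (rho j t).
have aeP : {ae leb, forall t, forall k, P k t}.
  apply: ae_foralln => k; have [kn|kn] := ltnP k n.
    apply: (@filterS _ _ (ae_filter_ringOfSetsType leb) _ _ _ (Hrho (Ordinal kn))) => t Ht j jk.
    by have -> : j = Ordinal kn by exact: val_inj.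
  apply: (@filterE _ _ (ae_filter_ringOfSetsType leb)) => t j jk; exfalso.
  by move: (ltn_ord j); rewrite jk ltnNge kn.
apply: (@filterS _ _ (ae_filter_ringOfSetsType leb) _ _ _ aeP) => t Ht tab.
exists (\row_j rho j t); apply: is_derive_row => j; rewrite mxE.
exact: (Ht _ j erefl tab).
Qed.

(** The atlas may be uncountable, so the null sets are indexed by pairs of rationals: for each
    interval carried by some chart one such chart is chosen. The other charts at the point follow by
    a change of coordinates. *)
Lemma ae_curve_derivable c (s : R) : abs_continuous_curve A s c ->
  {ae leb, forall t, 0 < t < s -> forall i, dom i (c t) -> exists v : Vn, is_derive t (1 : R) (chart i \o c) v}.
Proof.
move=> [cc Ac].
pose good (pq : rat * rat) (i : chart_index A) := [/\ 0 <= ratr pq.1 :> R, ratr pq.1 < ratr pq.2 :> R, ratr pq.2 <= s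
  & c @` `[ratr pq.1, ratr pq.2]%classic `<=` dom i].
pose P (k : nat) (t : R) := forall pq, unpickle k = Some pq -> (exists i, good pq i) ->
   ratr pq.1 < t < ratr pq.2 -> exists i v, dom i (c t) /\ is_derive t (1 : R) (chart i \o c) v.
have aeP : {ae leb, forall t, forall k, P k t}.
  apply: ae_foralln => k; have [[pq [Ek [i gi]]]|NE] := pselect (exists pq, unpickle k = Some pq /\ exists i, good pq i).
    have [p0 pltq qs Hi] := gi; have A1 := Ac i _ _ p0 (ltW pltq) qs Hi.
    apply: (@filterS _ _ (ae_filter_ringOfSetsType leb) _ _ _ (ae_chart_derivable pltq A1)) => t Ht pq'.
    rewrite Ek => -[<-] _ tpq; have [v D] := Ht tpq; exists i, v; split=> //.
    by apply: Hi; exists t => //=; rewrite in_itv/=; move: tpq => /andP[/ltW -> /ltW ->].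
  apply: (@filterE _ _ (ae_filter_ringOfSetsType leb)) => t pq E1 E2; exfalso.
  by apply: NE; exists pq.
apply: (@filterS _ _ (ae_filter_ringOfSetsType leb) _ _ _ aeP) => t Ht t0s j dj.
have [t0 ts] := andP t0s; have ct := within_itv_cont cc t0s.
have N : nbhs (c t) (dom j) by apply: open_nbhs_nbhs; split=> //; exact: open_dom.
have t0s' : 0 <= t <= s by rewrite !ltW.
have [d d0 Hd] := within_itv_near cc t0s' N.
have lo : Num.max 0 (t - d) < t by rewrite gt_max t0; lra.
have hi : t < Num.min s (t + d) by rewrite lt_min ts; lra.
have [p] := rat_in_itvoo lo; rewrite in_itv/= gt_max => /andP[/andP[p0 pd] pt].
have [q] := rat_in_itvoo hi; rewrite in_itv/= lt_min => /andP[tq /andP[qs qd]].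
have gd : good (p, q) j.
  split=> /=; rewrite ?(ltW p0) ?(ltW qs) ?(lt_trans pt tq)//.
  move=> _ [r hr <-]; move: hr; rewrite /= in_itv/= => /andP[pr rq]; apply: Hd; last by rewrite ltr_norml; lra.
  by rewrite (le_trans (ltW p0) pr) (le_trans rq (ltW qs)).
have [||i [v [di D]]] := Ht (pickle (p, q)) (p, q) (pickleK _).
- by exists j.
- by rewrite /= pt tq.
by exists (v *m tjac i j (c t)); exact: chart_derive_change.
Qed.

(** Lipschitz near every point in some chart, with constant and radius common to the family. A
    singleton gives the locally Lipschitz functions. *)
Definition equi_lip (F : set (M -> R)) := forall x, exists (i : chart_index A) (C r : R),
  [/\ dom i x, 0 <= C, 0 < r, (forall a : Vn, `|a - chart i x| <= r -> codom_chart i a)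
   & forall u, F u -> forall a b : Vn, `|a - chart i x| <= r -> `|b - chart i x| <= r ->
     `|u (chartV i a) - u (chartV i b)| <= C * `|a - b|].

Lemma ac_row_dom (f : R -> R) (h : R -> Vn) (k a b : R) : 0 <= k -> a <= b -> (forall j : 'I_n, ac (fun t => h t 0 j) a b) ->
  (forall s t, a <= s -> s <= t -> t <= b -> `|f t - f s| <= k * `|h t - h s|) -> ac f a b.
Proof.
move=> k0 ab Hh Hf; pose W t := \sum_(j < n) V (fun s => h s 0 j) a t.
have AW : ac W a b by apply: ac_sum => j; exact: ac_V.
apply: (ac_dom k0 (lexx 0) AW AW) => s t as_ st tb; rewrite mul0r addr0.
apply: le_trans (Hf s t as_ st tb) _; apply: ler_wpM2l => //.
have inc (j : 'I_n) : `|h t 0 j - h s 0 j| <= V (fun s => h s 0 j) a t - V (fun s => h s 0 j) a s.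
  by have := V_increment (Hh j) as_ st tb; lra.
have WE : W t - W s = \sum_j (V (fun s => h s 0 j) a t - V (fun s => h s 0 j) a s) by rewrite sumrB.
have W0 : 0 <= W t - W s by rewrite WE; apply: sumr_ge0 => j _; exact: le_trans (inc j).
rewrite ger0_norm//; apply: row_norm_le => // j; rewrite !mxE; apply: le_trans (inc j) _.
rewrite WE (bigD1 j)//= lerDl; apply: sumr_ge0 => l _; exact: le_trans (inc l).
Qed.

Lemma lip_comp_ac u c (s : R) : 0 <= s -> equi_lip [set u] -> abs_continuous_curve A s c -> ac (u \o c) 0 s.
Proof.
move=> s0 Lu [cc Ac]; apply: ac_local => // t ts.
have [i [C [r [di C0 r0 rD HL]]]] := Lu (c t).
have N : nbhs (c t) [set y | dom i y /\ `|chart i y - chart i (c t)| <= r].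
  have N1 : nbhs (c t) (dom i) by apply: open_nbhs_nbhs; split=> //; exact: open_dom.
  have := chart_continuous di; move/cvgrPdist_le => /(_ r r0) N2.
  by apply: filterS (filterI N1 N2) => y [h1 h2]; split=> //; rewrite distrC.
have [d d0 Hd] := within_itv_near cc ts N.
exists (d / 2); first exact: divr_gt0.
move=> a b a0 ab bs ta tb.
have Hr r' : a <= r' <= b -> dom i (c r') /\ `|chart i (c r') - chart i (c t)| <= r.
  move=> /andP[ar rb]; apply: Hd; first by rewrite (le_trans a0 ar) (le_trans rb bs).
  by rewrite ltr_norml; lra.
have A1 : abs_continuous_on (chart i \o c) a b.
  apply: Ac => // _ [r' hr' <-]; apply: (Hr r' _).1; by move: hr'; rewrite /= in_itv.
have A2 (j : 'I_n) : ac (fun t => (chart i \o c) t 0 j) a b := abs_continuous_on_ac j A1.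
apply: (@ac_row_dom (u \o c) (chart i \o c) C a b C0 ab A2) => p q ap pq qb.
have [dp hp] : dom i (c p) /\ `|chart i (c p) - chart i (c t)| <= r by apply: Hr; rewrite ap (le_trans pq qb).
have [dq hq] : dom i (c q) /\ `|chart i (c q) - chart i (c t)| <= r by apply: Hr; rewrite qb (le_trans ap pq).
have := HL u erefl _ _ hq hp; rewrite (chartK dp) (chartK dq); exact.
Qed.

Section ActionBound.
Variables (g : riemannian A) (H : cotangent A -> R).
Hypothesis tH : tonelli g H.

Lemma action_ge (f : R -> R) c (s : R) : 0 <= s -> abs_continuous_curve A s c -> ac f 0 s ->
  (forall t, 0 < t < s -> {for t, continuous c} -> exists2 i, dom i (c t) & forall (v : Vn) (df : R),
     is_derive t (1 : R) (chart i \o c) v -> is_derive t (1 : R) f df ->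
     df <= lagrangian H (c t, v *m tjac i (chart_at A (c t)) (c t))) ->
  ((f s - f 0)%:E <= action H s c)%E.
Proof.
move=> s0 Ac Af Hf; have [C0 C00 HC0] := lagrangian_lb tH.
apply: (@ac_lower_bound R f (fun t => lagrangian H (velocity A c t)) s C0 s0 Af) => [t _|].
  exact: HC0.
apply: (@filterS _ _ (ae_filter_ringOfSetsType leb) _ _ _ (ae_curve_derivable Ac)) => t Ht t0s df Df.
have ct := within_itv_cont Ac.1 t0s; have [i di Hi] := Hf t t0s ct.
have [v D] := Ht t0s i di.
by rewrite (velocity_chart ct di D); exact: Hi.
Qed.

End ActionBound.

End CurveLemmas.

Lemma is_derive_mul (R : realType) (f h : R -> R) (t df dh : R) : is_derive t (1 : R) f df ->
  is_derive t (1 : R) h dh -> is_derive t (1 : R) (fun s => f s * h s) (df * h t + f t * dh).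
Proof. by move=> D1 D2; apply: is_derive_eq; rewrite /GRing.scale/=; ring. Qed.

Lemma coord_fst_le (R : realType) n (u v : 'rV[R]_n * 'rV[R]_n) j : `|u.1 0 j - v.1 0 j| <= `|u - v|.
Proof. by have := row_norm_ge (u - v).1 j; rewrite !mxE => /le_trans; apply; exact: norm_fst. Qed.

Lemma coord_snd_le (R : realType) n (u v : 'rV[R]_n * 'rV[R]_n) j : `|u.2 0 j - v.2 0 j| <= `|u - v|.
Proof. by have := row_norm_ge (u - v).2 j; rewrite !mxE => /le_trans; apply; exact: norm_snd. Qed.

Lemma ac_C1 (R : realType) (F f : R -> R) (a b : R) : a <= b -> continuous f ->
  (forall t, is_derive t (1 : R) F (f t)) -> ac F a b.
Proof.
move=> ab cf D.
have [B B0 HB] := continuous_bounded (@segment_compact R a b) (fun t _ => cf t).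
apply: (@ac_lip _ _ B) => // s t as_ st tb.
have [c /andP[sc ct] ->] := mean_value (df := f) st (fun x _ => D x).
rewrite normrM [X in _ * X]ger0_norm ?subr_ge0//; apply: ler_wpM2r; first by rewrite subr_ge0.
by apply: HB; rewrite /= in_itv/= (le_trans as_ sc) (le_trans ct tb).
Qed.

(** * Minimality of short orbits *)

Section Calibration.
Variables (R : realType) (n : nat) (M : ptopologicalType) (A : C2atlas R n M).
Variables (g : riemannian A) (H : cotangent A -> R).
Hypothesis tH : tonelli g H.
Hypotheses (hM : hausdorff_space M) (cM : compact [set: M]).
Local Notation V := 'rV[R]_n.
Local Notation E := ('rV[R]_n * 'rV[R]_n)%type.
Local Notation hh := (local_rep H).
Local Notation cflow := (chart_flow H).

Lemma dens_orbit_continuous z : continuous (fun s => dens H (ham_flow H s z)).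
Proof.
move=> s; apply: (@continuous_comp _ _ _ (fun s => ham_flow H s z) (dens H)).
  by have [] := flow_solat tH hM cM z s.
exact: (dens_continuous tH).
Qed.

Variables (i : chart_index A) (c0 : V) (K r T L m : R).
Hypothesis FB : flow_box H i c0 K r T L m.

(* The action of c is compared with that of an orbit by integrating along c the exact differential
   of s |-> act + p.eta + k(s)/2 |eta|^2, where k' = - 2 L absorbs the second order terms. *)
Lemma calibration (a : E) (c : R -> M) (t k0 : R) : box c0 r K a -> 0 <= t <= T ->
  - 1 + L * 2 * t <= k0 -> k0 <= 0 -> abs_continuous_curve A t c ->
  (forall s, 0 <= s <= t -> dom i (c s) /\ `|chart i (c s) - c0| <= r + r) ->
  ((act H (cot_coordV i a) t
    + (pairing (cflow i a t).2 (chart i (c t) - (cflow i a t).1)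
       + (k0 - L * 2 * t) / 2 * pairing (chart i (c t) - (cflow i a t).1) (chart i (c t) - (cflow i a t).1))
    - (pairing a.2 (chart i (c 0) - a.1)
       + k0 / 2 * pairing (chart i (c 0) - a.1) (chart i (c 0) - a.1)))%:E
   <= action H t c)%E.
Proof.
move=> ba /andP[t0 tT] k1 k00 Ac Hc; have L0 := fb_L FB.
have sT (s : R) : 0 <= s <= t -> `|s| <= T by move=> /andP[s0 st]; rewrite ger0_norm//; exact: le_trans tT.
pose e s := chart i (c s) - (cflow i a s).1.
pose k s := k0 - L * 2 * s.
pose f s := act H (cot_coordV i a) s + (pairing (cflow i a s).2 (e s) + k s / 2 * pairing (e s) (e s)).
have A1 : abs_continuous_on (chart i \o c) 0 t.
  apply: Ac.2 => // _ [s hs <-]; apply: (Hc s _).1; by move: hs; rewrite /= in_itv.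
have lipE (s s' : R) : 0 <= s -> s <= s' -> s' <= t -> `|cflow i a s' - cflow i a s| <= L * (s' - s).
  move=> s0 ss st; pose dc s := (gp (hh i) (cflow i a s), - gx (hh i) (cflow i a s)) : E.
  apply: (pair_increment (dc := dc) ss) => q /andP[sq qs'].
    by apply: (fb_eq FB ba); apply: sT; rewrite (le_trans s0 sq) (le_trans qs' st).
  have qT : `|q| <= T by apply: sT; rewrite (le_trans s0 sq) (le_trans qs' st).
  have [h1 h2] := fb_grad FB (fb_sub (fb_box FB ba qT)).
  exact: norm_pairN_le.
have ac1 j : ac (fun s => (cflow i a s).1 0 j) 0 t.
  apply: (ac_lip L0) => s s' s0 ss st; apply: le_trans (lipE s s' s0 ss st).
  exact: coord_fst_le.
have ac2 j : ac (fun s => (cflow i a s).2 0 j) 0 t.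
  apply: (ac_lip L0) => s s' s0 ss st; apply: le_trans (lipE s s' s0 ss st).
  exact: coord_snd_le.
have ace j : ac (fun s => e s 0 j) 0 t.
  have aN : ac (fun s => - 1 * (cflow i a s).1 0 j) 0 t.
    by apply: acM => //; apply: (@ac_lip _ _ 0) => // s s' _ _ _; rewrite subrr normr0 mul0r.
  apply: (ac_eq _ (acD (abs_continuous_on_ac j A1) aN)) => s _.
  by rewrite /e !mxE mulN1r.
have acP (u v : R -> V) : (forall j, ac (fun s => u s 0 j) 0 t) -> (forall j, ac (fun s => v s 0 j) 0 t) ->
    ac (fun s => pairing (u s) (v s)) 0 t.
  move=> Hu Hv; have -> : (fun s => pairing (u s) (v s)) = (fun s => \sum_j u s 0 j * v s 0 j).
    by apply/funext => s; rewrite pairingE.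
  by apply: ac_sum => j; exact: acM.
have ack : ac (fun s => k s / 2) 0 t.
  apply: (@ac_lip _ _ L) => // s s' _ ss _; rewrite /k.
  have -> : (k0 - L * 2 * s') / 2 - (k0 - L * 2 * s) / 2 = - (L * (s' - s)) by lra.
  by rewrite normrN ger0_norm// mulr_ge0// subr_ge0.
have Af : ac f 0 t.
  apply: acD; last by apply: acD; [exact: acP|apply: acM => //; exact: acP].
  pose z := cot_coordV i a.
  have Dz s : is_derive s (1 : R) (act H z) (dens H (ham_flow H s z)) by exact: (act_derive tH hM cM).
  exact: (ac_C1 t0 (@dens_orbit_continuous z) Dz).
have f0 : f 0 = pairing a.2 (chart i (c 0) - a.1) + k0 / 2 * pairing (chart i (c 0) - a.1) (chart i (c 0) - a.1).
  by rewrite /f /e (act0 tH hM cM) (cflow0 tH hM cM FB ba) /k mulr0 subr0 add0r.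
rewrite -f0; apply: (action_ge tH t0 Ac Af) => s /andP[s0 st] cs.
have s0t : 0 <= s <= t by rewrite !ltW.
have [di hs] := Hc s s0t; exists i => // v df D Df.
have sT' := sT s s0t; have Dc := fb_eq FB ba sT'.
set w := cflow i a s; have bw := fb_box FB ba sT'; rewrite -/w in bw.
have De : is_derive s (1 : R) e (v - gp (hh i) w) := is_deriveB D (is_derive_fst Dc).
have Dk : is_derive s (1 : R) (fun s => k s / 2) (- (L * 2) / 2).
  have -> : (fun s => k s / 2) = (fun s : R => k0 / 2 + s *: (- (L * 2) / 2)).
    by apply/funext => q; rewrite /k /GRing.scale/=; lra.
  exact: is_derive_affine.
have D3 := is_derive_mul Dk (is_derive_pairing De De).
have D2 := is_derive_pairing (is_derive_snd Dc) De.
have D1 := act_local_derive tH hM cM FB ba sT'.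
have Dall := is_deriveD D1 (is_deriveD D2 D3).
rewrite (is_derive_unique Df Dall) -/w.
have ks : - 1 <= k s <= 0.
  have := ler_wpM2l L0 (ltW st); have := mulr_ge0 L0 (ltW s0); rewrite /k; lra.
have ne : `|e s| <= 4.
  have := ler_normB (chart i (c s) - c0) (w.1 - c0); rewrite opprB addrA subrK -/(e s).
  have /andP[_ r1] := fb_r FB; have [h _] := bw; lra.
have inQ : box c0 (r + r) (K + 5) (chart i (c s), w.2 + k s *: e s).
  split=> //=; apply: le_trans (ler_normD _ _) _; rewrite normrZ ler0_norm; last by case/andP: ks.
  have [_ h] := bw; have h2 : - k s * `|e s| <= 1 * 4 by apply: ler_pM => //; case/andP: ks; lra.
  lra.
have tay := fb_taylor FB (fb_sub bw) inQ.
have rate := calib_rate v ks tay L0.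
apply: le_trans _ (fenchel tH (w.2 + k s *: e s) v di).
rewrite [leLHS]addrA; exact: rate.
Qed.

End Calibration.

Section Expansions.
Variable R : realType.

Lemma derive_expand (W : normedModType R) (c : R -> W) (t : R) d : is_derive t (1 : R) c d ->
  forall e : R, 0 < e -> exists2 k : R, 0 < k & forall h : R, `|h| < k -> `|c (t + h) - c t - h *: d| <= e * `|h|.
Proof.
move=> D e e0; have /cvgrPdist_le /(_ e e0) /(nbhs_normP 0 _).1[k /= k0 Hk] := is_derive_cvg D.
exists k => // h hk; have [->|hn0] := eqVneq h 0.
  by rewrite addr0 subrr scale0r subrr !normr0 mulr0.
have := Hk h; rewrite /= sub0r normrN => /(_ hk hn0); rewrite -[h *: 1]/(h * 1) mulr1 => He.
have -> : c (t + h) - c t - h *: d = - (h *: (d - h^-1 *: (c (h + t) - c t))).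
  by rewrite scalerBr scalerA divff// scale1r opprB (addrC t).
by rewrite normrN normrZ mulrC; apply: ler_wpM2r.
Qed.

Lemma le_of_eps (x y C : R) : 0 <= C -> (forall e, 0 < e -> x <= y + C * e) -> x <= y.
Proof.
move=> C0 H; apply/ler_addgt0Pr => e e0; have C1 : 0 < C + 1 by lra.
apply: le_trans (H (e / (C + 1)) (divr_gt0 e0 C1)) _; rewrite lerD2l mulrA ler_pdivrMr//.
by rewrite mulrDr mulr1 mulrC; lra.
Qed.

Lemma left_derive_le (V : normedModType R) (F : R -> R) (w : R -> V) (t k d dF : R) (v : V) : 0 <= k ->
  is_derive t (1 : R) F dF -> is_derive t (1 : R) w v -> 0 < d ->
  (forall h, 0 < h < d -> F t - F (t - h) <= k * `|w (t - h) - w t|) -> dF <= k * `|v|.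
Proof.
move=> k0 DF Dw d0 HF; apply: (@le_of_eps _ _ (1 + k)) => [|e e0]; first lra.
have [k1 k10 H1] := derive_expand DF e0; have [k2 k20 H2] := derive_expand Dw e0.
pose h := Num.min d (Num.min k1 k2) / 2.
have mm : 0 < Num.min d (Num.min k1 k2) by rewrite !lt_min d0 k10.
have h0 : 0 < h by exact: divr_gt0.
have hm : h < Num.min d (Num.min k1 k2) by rewrite /h; lra.
move: hm; rewrite !lt_min => /and3P[hd hk1 hk2].
have nh : `|- h| = h by rewrite normrN gtr0_norm.
have := H1 (- h); have := H2 (- h); have := HF h; rewrite nh hd h0 => /(_ isT) h3 /(_ hk2) h2 /(_ hk1) h1.
have n2 : `|w (t - h) - w t| <= h * `|v| + e * h.
  have := ler_normD (w (t - h) - w t - - h *: v) (- h *: v); rewrite subrK normrZ nh.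
  by move: h2; lra.
have h4 := ler_wpM2l k0 n2; move: h1; rewrite ler_norml -[_ *: dF]/(_ * dF) => /andP[_ h1].
have : h * dF <= h * (k * `|v| + (1 + k) * e) by move: h1 h3 h4; lra.
by rewrite ler_pM2l.
Qed.

Lemma min_lip (x y r : R) : `|Num.min x r - Num.min y r| <= `|x - y|.
Proof.
have [h1|h1] := lerP x r; have [h2|h2] := lerP y r; rewrite ?subrr ?normr0//.
  by rewrite distrC (distrC x) !ger0_norm; lra.
by rewrite !ger0_norm; lra.
Qed.

Lemma ac_max (f : R -> R) (a s b : R) : a <= s <= b -> ac f a b -> ac (fun t => f (Num.max s t)) a b.
Proof.
move=> /andP[as_ sb] Af; apply: (ac_glue as_ sb).
  apply: (@ac_lip _ _ 0) => // u v _ uv vs; rewrite !max_l// ?subrr ?normr0 ?mul0r//; exact: le_trans vs.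
apply: (ac_eq _ (ac_sub as_ (lexx b) Af)) => t /andP[st _]; by rewrite max_r.
Qed.

End Expansions.

(** * Cost of leaving a chart *)

Section Escape.
Variables (R : realType) (n : nat) (M : ptopologicalType) (A : C2atlas R n M).
Variables (g : riemannian A) (H : cotangent A -> R).
Hypothesis tH : tonelli g H.
Hypotheses (hM : hausdorff_space M) (cM : compact [set: M]).
Local Notation V := 'rV[R]_n.
Local Notation E := ('rV[R]_n * 'rV[R]_n)%type.
Local Notation hh := (local_rep H).
Implicit Types (c : R -> M) (i j : chart_index A).

(** Truncation at rho, with the value rho off the chart, makes the chart distance to a a locally
    Lipschitz function on all of M, which can be followed along a curve that leaves the chart. *)
Definition trunc_dist i (a : V) (rho : R) (y : M) : R :=
  if `[< dom i y /\ `|chart i y - a| <= rho >] then `|chart i y - a| else rho.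

Lemma trunc_dist_in i a rho y : dom i y -> trunc_dist i a rho y = Num.min `|chart i y - a| rho.
Proof.
move=> dy; rewrite /trunc_dist; case: asboolP => [[_ h]|NE]; first by rewrite min_l.
by rewrite min_r// ltW// ltNge; apply/negP => h; apply: NE.
Qed.

Lemma trunc_dist_out i a rho y : ~ (dom i y /\ `|chart i y - a| <= rho) -> trunc_dist i a rho y = rho.
Proof. by rewrite /trunc_dist; case: asboolP. Qed.

(** The ball is the image of a compact set in a Hausdorff space. Its complement is therefore open,
    and [trunc_dist] is locally constant there. *)
Lemma chart_ball_closed i (a : V) (rho : R) : (forall b : V, `|b - a| <= rho -> codom_chart i b) ->
  closed [set y | dom i y /\ `|chart i y - a| <= rho].
Proof.
move=> aD; have -> : [set y | dom i y /\ `|chart i y - a| <= rho] = chartV i @` [set b : V | `|b - a| <= rho].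
  apply/seteqP; split=> [y [dy hy]|_ [b /= hb <-]]; first by exists (chart i y) => //; exact: chartK.
  by have [db bE] := codom_chartP (aD b hb); rewrite bE.
apply: (compact_closed hM); apply: continuous_compact; last exact: compact_row_ball.
apply: continuous_in_subspaceT => b /set_mem /aD Cb.
by have [db bE] := codom_chartP Cb; rewrite -bE; exact: chartV_continuous.
Qed.

Lemma chart_ball_in i x (U : set M) : dom i x -> nbhs x U ->
  exists2 r : R, 0 < r & forall a : V, `|a - chart i x| <= r -> codom_chart i a /\ U (chartV i a).
Proof.
move=> di NU.
have N1 : nbhs (chart i x) (codom_chart i) by apply: open_nbhs_nbhs; split; [exact: open_codom|exact: codom_chart_chart].
have N2 : nbhs (chart i x) (chartV i @^-1` U).
  by apply: chartV_nbhs; [exact: codom_chart_chart|rewrite chartK].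
have [r r0 Hr] := (nbhs_normP (chart i x) _).1 (filterI N1 N2).
exists (r / 2); first exact: divr_gt0.
by move=> a ha; apply: Hr; rewrite /= distrC; apply: le_lt_trans ha _; move: (r0 : 0 < r); lra.
Qed.

Lemma trunc_dist_lip i (a : V) (rho : R) : (forall b : V, `|b - a| <= rho -> codom_chart i b) ->
  @equi_lip R n M A [set trunc_dist i a rho].
Proof.
move=> aD x; have cB := chart_ball_closed aD; have [di|ndi] := pselect (dom i x).
  have Ni : nbhs x (dom i) by apply: open_nbhs_nbhs; split=> //; exact: open_dom.
  have [r r0 Hr] := chart_ball_in di Ni; exists i, 1, r; split=> //; first by move=> b /Hr[].
  move=> _ -> b b' /Hr[hb db] /Hr[hb' db'].
  rewrite !trunc_dist_in// (codom_chartP hb).2 (codom_chartP hb').2 mul1r.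
  apply: le_trans (min_lip _ _ _) _; apply: le_trans (ler_dist_dist _ _) _.
  by rewrite opprB addrA subrK.
have NU : nbhs x (~` [set y | dom i y /\ `|chart i y - a| <= rho]).
  by apply: open_nbhs_nbhs; split; [exact: closed_openC|move=> /= -[]].
have [r r0 Hr] := chart_ball_in (chart_atP A x) NU.
exists (chart_at A x), 0, r; split=> //; first exact: chart_atP; first by move=> b /Hr[].
by move=> _ -> b b' /Hr[_ hb] /Hr[_ hb']; rewrite !trunc_dist_out// subrr normr0 mul0r.
Qed.

(** Fenchel's inequality with the covector of norm at most K proportional to v; division by zero
    makes it 0 when v = 0. *)
Lemma lagrangian_superlinear i (c0 : V) (r K : R) : 0 <= K -> (forall b : V, `|b - c0| <= r -> codom_chart i b) ->
  exists2 C : R, 0 <= C & forall x (v : V), dom i x -> `|chart i x - c0| <= r ->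
    K * `|v| - C <= lagrangian H (x, v *m tjac i (chart_at A x) x).
Proof.
move=> K0 rD.
have [C C0 HC] : exists2 C : R, 0 <= C & forall a : E, box c0 r K a -> `|hh i a| <= C.
  apply: near_pinfty_ex; apply: continuous_near_bounded => [|a [h _]]; first by exact: compact_box.
  by apply: differentiable_continuous; have [C1 _] := tonelli_C2 tH i; have [] := C1 a (rD _ h).
exists C => // x v dx hx; pose q := (K / `|v|) *: v.
have hq : `|q| <= K.
  rewrite /q normrZ ger0_norm ?divr_ge0//; have [->|v0] := eqVneq `|v| 0; first by rewrite mulr0.
  by rewrite -mulrA mulVf// mulr1.
have hv : K * `|v| <= pairing q v.
  rewrite pairingZl; have [->|v0] := eqVneq `|v| 0; first by rewrite mulr0 invr0 mulr0 mul0r.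
  have := ler_wpM2l (divr_ge0 K0 (normr_ge0 v)) (pairing_vv_ge v).
  by rewrite expr2 mulrA -[K / _ * `|v|]mulrA mulVf// mulr1.
apply: le_trans (fenchel tH q v dx).
have := HC (chart i x, q) (conj hx hq); rewrite ler_norml => /andP[_ h].
by move: h hv; lra.
Qed.

(* Integrate the derivative of the truncated distance along the part of the curve after time s. *)
Lemma escape i (c0 : V) (rho K : R) : 0 < rho -> 0 <= K ->
  (forall b : V, `|b - c0| <= rho + rho -> codom_chart i b) ->
  exists2 C : R, 0 <= C & forall (a : V) (c : R -> M) (t : R), `|a - c0| <= rho -> 0 <= t ->
    abs_continuous_curve A t c -> dom i (c t) -> chart i (c t) = a ->
    forall s, 0 <= s <= t -> ((K * trunc_dist i a rho (c s) - C * t)%:E <= action H t c)%E.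
Proof.
move=> rho0 K0 rD; have [C1 C10 HC1] := lagrangian_superlinear K0 rD.
have [C2 C20 HC2] := lagrangian_lb tH; exists (C1 + C2); first lra.
move=> a c t ha t0 Ac dt ct s /andP[s0 st]; set th := trunc_dist i a rho; set C := C1 + C2.
have aD (b : V) : `|b - a| <= rho -> codom_chart i b.
  by move=> h; apply: rD; have := ler_normD (b - a) (a - c0); rewrite addrA subrK; lra.
have A1 := lip_comp_ac t0 (trunc_dist_lip aD) Ac.
have acF : ac (fun t' => K * (th (c s) - th (c (Num.max s t')))) 0 t.
  have h : ac (fun t' => - K * th (c (Num.max s t'))) 0 t.
    apply: acM => //; last by apply: (@ac_max R (th \o c)); rewrite ?s0.
    by apply: (@ac_lip _ _ 0) => // u v _ _ _; rewrite subrr normr0 mul0r.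
  have h' : ac (fun t' : R => K * th (c s)) 0 t.
    by apply: (@ac_lip _ _ 0) => // u v _ _ _; rewrite subrr normr0 mul0r.
  by apply: (ac_eq _ (acD h' h)) => u _; lra.
pose f t' := K * (th (c s) - th (c (Num.max s t'))) + - C * t'.
have acf : ac f 0 t.
  apply: acD acF _; apply: acM => //; last exact: ac_id.
  by apply: (@ac_lip _ _ 0) => // u v _ _ _; rewrite subrr normr0 mul0r.
have thct : th (c t) = 0 by rewrite /th trunc_dist_in// ct subrr normr0 min_l// ltW.
have -> : K * th (c s) - C * t = f t - f 0 by rewrite /f max_r// thct max_l//; lra.
apply: (action_ge tH t0 Ac acf) => t' t't cc.
(* Before time s the maximum freezes the truncated distance; after it, a bound on its left
   increments by k times those of the curve in a chart suffices. The factor k is K inside the ball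
   and 0 outside. *)
have key i' (v : V) (df k : R) (d : R) : 0 <= k -> 0 < d -> is_derive t' (1 : R) (chart i' \o c) v -> is_derive t' (1 : R) f df ->
    (s < t' -> forall h, 0 < h < d -> K * (th (c (t' - h)) - th (c t')) <= k * `|(chart i' \o c) (t' - h) - (chart i' \o c) t'|) ->
    df <= k * `|v| - C.
  move=> k0 d0 Dv Df Hh; pose F x := f x + C * x.
  have DF : is_derive t' (1 : R) F (df + C).
    have D2 : is_derive t' (1 : R) (fun x : R => C * x) C.
      by have := is_derive_affine 0 C t'; under eq_fun => x do rewrite add0r /GRing.scale/= mulrC.
    exact: is_deriveD Df D2.
  suff : df + C <= k * `|v| by lra.
  have [ts|ts] := leP t' s.
    apply: (left_derive_le k0 DF Dv ltr01) => h /andP[h0 _]; rewrite /F /f !max_l//; last lra.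
    by apply: le_trans (mulr_ge0 k0 (normr_ge0 _)); lra.
  have dd : 0 < Num.min d (t' - s) by rewrite lt_min d0 subr_gt0.
  apply: (left_derive_le k0 DF Dv dd) => h; rewrite lt_min => /and3P[h0 hd hs].
  rewrite /F /f (max_r (ltW ts)) max_r; last lra.
  by have := Hh ts h; rewrite h0 hd => /(_ isT); lra.
have [[di hi]|out] := pselect (dom i (c t') /\ `|chart i (c t') - a| <= rho).
  exists i => // v df Dv Df.
  have N : nbhs (c t') (dom i) by apply: open_nbhs_nbhs; split=> //; exact: open_dom.
  have [d d0 Hd] := (nbhs_normP t' _).1 (cc _ N).
  have hi' : `|chart i (c t') - c0| <= rho + rho.
    by have := ler_normD (chart i (c t') - a) (a - c0); rewrite addrA subrK; lra.
  apply: le_trans (HC1 _ v di hi'); suff : df <= K * `|v| - C by rewrite /C; lra.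
  apply: (key i v df K d) => // _ h /andP[h0 hd]; apply: ler_wpM2l => //.
  have dh : dom i (c (t' - h)) by apply: (Hd (t' - h)); rewrite /= opprB addrC subrK gtr0_norm.
  rewrite /th !trunc_dist_in//; apply: le_trans (ler_norm _) _.
  apply: le_trans (min_lip _ _ _) _; apply: le_trans (ler_dist_dist _ _) _.
  by rewrite opprB addrA subrK.
have cB := chart_ball_closed aD.
have N : nbhs (c t') (~` [set y | dom i y /\ `|chart i y - a| <= rho]).
  by apply: open_nbhs_nbhs; split; [exact: closed_openC|].
have [d d0 Hd] := (nbhs_normP t' _).1 (cc _ N).
exists (chart_at A (c t')); first exact: chart_atP.
move=> v df Dv Df; apply: le_trans (HC2 _).
suff : df <= 0 * `|v| - C by rewrite /C; lra.
apply: (key _ v df 0 d) => // _ h /andP[h0 hd]; rewrite /th trunc_dist_out; last first.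
  by apply: (Hd (t' - h)); rewrite /= opprB addrC subrK gtr0_norm.
by rewrite trunc_dist_out// subrr mulr0 mul0r.
Qed.

End Escape.

(** * Uniform oscillation of equi-Lipschitz families *)

Section Oscillation.
Variables (R : realType) (n : nat) (M : ptopologicalType) (A : C2atlas R n M).

Lemma equi_lip_sub (F G : set (M -> R)) : F `<=` G -> @equi_lip R n M A G -> @equi_lip R n M A F.
Proof. by move=> FG L x; have [i [C [r [h1 h2 h3 h4 h5]]]] := L x; exists i, C, r; split=> // u /FG; exact: h5. Qed.

Lemma equi_lip_near (F : set (M -> R)) x (e : R) : 0 < e -> @equi_lip R n M A F ->
  \forall y \near x, forall u, F u -> `|u y - u x| <= e.
Proof.
move=> e0 LF; have [i [C [r [di C0 r0 rD HL]]]] := LF x.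
have N1 : nbhs x (dom i) by apply: open_nbhs_nbhs; split=> //; exact: open_dom.
pose k := Num.min r (e / (C + 1)).
have k0 : 0 < k by rewrite lt_min r0 divr_gt0//; lra.
have := chart_continuous di; move/cvgrPdist_le => /(_ k k0) N2.
apply: filterS (filterI N1 N2) => y [dy hy] u Fu.
have [hr hk] : `|chart i x - chart i y| <= r /\ `|chart i x - chart i y| <= e / (C + 1).
  by move: hy; rewrite le_min => /andP[].
have := HL u Fu (chart i y) (chart i x); rewrite subrr normr0 distrC hr (ltW r0) (chartK dy) (chartK di).
move=> /(_ isT isT) h; apply: le_trans h _.
by apply: scale_le => //; lra.
Qed.

Lemma equi_lip_continuous u : @equi_lip R n M A [set u] -> continuous u.
Proof.
move=> L x; apply/cvgrPdist_le => e e0.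
by apply: filterS (equi_lip_near x e0 L) => y /(_ u erefl); rewrite distrC.
Qed.

(** Connectedness of M bounds |u y - u x0| at each y uniformly over the family; compactness then
    makes the bound uniform in y. *)
Lemma equi_lip_osc (F : set (M -> R)) : compact [set: M] -> connected [set: M] -> @equi_lip R n M A F ->
  exists2 D : R, 0 <= D & forall u x y, F u -> `|u x - u y| <= D.
Proof.
move=> cM kM LF; pose x0 : M := point.
pose S := [set y | exists D : R, forall u, F u -> `|u y - u x0| <= D].
have ST : S = [set: M].
  apply: kM.
  - by exists x0, 0 => u _; rewrite subrr normr0.
  - exists S; rewrite ?setTI//; rewrite openE => y [D HD]; rewrite /interior.
    apply: filterS (equi_lip_near y ltr01 LF) => z Hz; exists (1 + D) => u Fu.
    by have := ler_normD (u z - u y) (u y - u x0); have := Hz u Fu; have := HD u Fu; rewrite addrA subrK; lra.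
  - exists S; rewrite ?setTI// => y cy.
    have [z [[D HD] Hz]] := cy _ (equi_lip_near y ltr01 LF); exists (1 + D) => u Fu.
    have := ler_normD (u y - u z) (u z - u x0); have := Hz u Fu; have := HD u Fu; rewrite (distrC (u z) (u y)) addrA subrK; lra.
pose P (d : R) (y : M) := forall u, F u -> d * `|u y - u x0| <= 1.
have Pm (a b : R) z : 0 < a -> a <= b -> P b z -> P a z.
  by move=> a0 ab h u Fu; apply: le_trans (h u Fu); exact: ler_wpM2r.
have lP z : [set: M] z -> exists2 d : R, 0 < d & \forall y \near z, P d y.
  move=> _; have [D HD] : S z by rewrite ST.
  have D1 : 0 < `|D| + 1 by have := normr_ge0 D; lra.
  exists (`|D| + 1)^-1; first by rewrite invr_gt0.
  apply: filterS (equi_lip_near z ltr01 LF) => y Hy u Fu.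
  rewrite mulrC ler_pdivrMr// mul1r; have := ler_normD (u y - u z) (u z - u x0).
  by rewrite addrA subrK; have := Hy u Fu; have := HD u Fu; have := ler_norm D; lra.
have [d d0 Hd] := compact_unif cM Pm lP.
exists (d^-1 + d^-1) => [|u x y Fu]; first by rewrite addr_ge0// invr_ge0 ltW.
have h z : `|u z - u x0| <= d^-1 by rewrite -[d^-1]mul1r ler_pdivlMr// mulrC; exact: Hd.
by have := ler_normD (u x - u x0) (u x0 - u y); rewrite addrA subrK (distrC (u x0)); have := h x; have := h y; lra.
Qed.

End Oscillation.

(** * The Lax-Oleinik step for a short time *)

Section TStepReals.
Variable R : realType.

Lemma mono_ratio (m t d N e : R) : 0 < m -> t != 0 -> 0 <= d ->
  m * t ^+ 2 * d ^+ 2 <= `|t| * (N * (e * d)) -> 0 <= N -> 0 <= e -> d <= N / (m * `|t|) * e.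
Proof.
move=> m0 t0 d0 h N0 e0; have at0 : 0 < `|t| by rewrite normr_gt0.
have mt : 0 < m * `|t| by exact: mulr_gt0.
have [->|dn] := eqVneq d 0; first by rewrite mulr_ge0// divr_ge0// ltW.
have dp : 0 < d by rewrite lt_neqAle eq_sym dn.
rewrite mulrAC ler_pdivlMr//.
have : (`|t| * d) * (d * (m * `|t|)) <= (`|t| * d) * (N * e).
  by move: h; rewrite -(real_normK (num_real t)) !expr2; lra.
by rewrite ler_pM2l// mulr_gt0.
Qed.

Lemma vary_bound (N X k e d : R) : 0 <= N -> 0 <= d -> d <= (1 + k) * e -> X <= N * d ^+ 2 -> X <= N * (1 + k) ^+ 2 * e ^+ 2.
Proof.
move=> N0 d0 h hX; apply: le_trans hX _; rewrite -mulrA -exprMn; apply: ler_wpM2l => //.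
by rewrite ler_sqr ?nnegrE// (le_trans d0).
Qed.

Lemma fst_close n (x y w : 'rV[R]_n * 'rV[R]_n) (k : R) : x.1 = y.1 -> `|y - w| <= k -> `|x.1 - w.1| <= k.
Proof. by move=> ->; apply: le_trans; exact: (norm_fst (y - w)). Qed.

Lemma same_end n (x y : 'rV[R]_n * 'rV[R]_n) (q : 'rV[R]_n) (s1 s0 c X : R) : x.1 = y.1 ->
  `|s1 - s0 - (pairing q (x.1 - y.1) - c)| <= X -> `|s1 - s0 + c| <= X.
Proof. by move=> ->; rewrite subrr pairing0r sub0r opprK. Qed.

Lemma pair_near n (a : 'rV[R]_n * 'rV[R]_n) (b p : 'rV[R]_n) (k : R) : 0 <= k -> `|p - a.2| <= k * `|b - a.1| ->
  `|((b, p) : 'rV[R]_n * 'rV[R]_n) - a| <= (1 + k) * `|b - a.1|.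
Proof.
move=> k0 h; have n0 := normr_ge0 (b - a.1); have kn := mulr_ge0 k0 n0.
by apply: norm_pair_le => /=; rewrite mulrDl mul1r; lra.
Qed.

Lemma base_near n (a : 'rV[R]_n * 'rV[R]_n) (b : 'rV[R]_n) : `|a - ((b, a.2) : 'rV[R]_n * 'rV[R]_n)| <= `|b - a.1|.
Proof. by apply: norm_pair_le; rewrite /= ?subrr ?normr0// distrC. Qed.

Lemma value_lip n (u : 'rV[R]_n -> R) (x y : 'rV[R]_n * 'rV[R]_n) (a1 a0 c N X K L : R) : 0 <= X -> 0 <= L -> 0 <= N <= 1 ->
  `|u x.1 - u y.1| <= L * `|x.1 - y.1| -> `|x - y| <= 2 * N -> `|y.2| <= K -> c = 0 ->
  `|a1 - a0 - (pairing y.2 (x.1 - y.1) - c)| <= X * N ^+ 2 ->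
  `|u x.1 - a1 - (u y.1 - a0)| <= (L * 2 + (n%:R * (K * 2) + X)) * N.
Proof.
move=> X0 L0 /andP[N0 N1] h1 h2 h3 -> h4; have h5 := le_trans (norm_fst (x - y)) h2.
have h6 : `|pairing y.2 (x.1 - y.1)| <= n%:R * (K * (2 * N)) by exact: (pairing_bound_le h3 h5).
have h7 := le_trans h1 (ler_wpM2l L0 h5).
have h8 : X * N ^+ 2 <= X * N by apply: ler_wpM2l => //; rewrite expr2 -[leRHS]mulr1; exact: ler_wpM2l.
have h9 := le_trans h4 h8; move: h6 h7 h9.
generalize (u x.1) (u y.1) (pairing y.2 (x.1 - y.1)) (n%:R : R) => u1 u0 P n'.
by rewrite !ler_norml; lra.
Qed.

Lemma same_base_norm n (a p q : 'rV[R]_n) : `|((a, p) : 'rV[R]_n * 'rV[R]_n) - (a, q)| = `|p - q|.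
Proof.
apply/eqP; rewrite eq_le; apply/andP; split; last exact: (norm_snd (((a, p) : 'rV[R]_n * 'rV[R]_n) - (a, q))).
by apply: norm_pair_le; rewrite /= ?subrr ?normr0.
Qed.

Lemma dist_tri (V : normedModType R) (x a c : V) (s t : R) : `|x - a| <= s -> `|a - c| <= t -> `|x - c| <= s + t.
Proof. by move=> h1 h2; have := ler_normD (x - a) (a - c); rewrite addrA subrK; lra. Qed.

Lemma escape_bound (u0 X Ce uy C2 t : R) : u0 + (X - Ce * t) <= uy + C2 * t -> X <= uy - u0 + (C2 + Ce) * t.
Proof. lra. Qed.

Lemma escape_speed (Lam q X uy u0 Cs : R) : 0 <= q -> 0 <= X -> (Lam + 1 + q) * X <= uy - u0 + Cs -> uy - u0 <= Lam * X -> X <= Cs.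
Proof. by move=> q0 X0; have := mulr_ge0 q0 X0; lra. Qed.

Lemma fiber_near n (x a : 'rV[R]_n * 'rV[R]_n) (K s : R) : `|x - a| <= s -> s <= 1 / 4 -> `|a.2| <= K -> `|x.2| <= K + 1.
Proof.
move=> h s1 aK; have := ler_normD (x.2 - a.2) a.2; rewrite subrK; have := le_trans (norm_snd (x - a)) h.
by rewrite /=; lra.
Qed.

Lemma calib_k0 (L t : R) : L * t <= 1 / 4 -> - 1 + L * 2 * t <= 0.
Proof. lra. Qed.

End TStepReals.

Section TStep.
Variables (R : realType) (n : nat) (M : ptopologicalType) (A : C2atlas R n M).
Variables (g : riemannian A) (H : cotangent A -> R).
Hypothesis tH : tonelli g H.
Hypotheses (hM : hausdorff_space M) (cM : compact [set: M]).
Local Notation V := 'rV[R]_n.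
Local Notation E := ('rV[R]_n * 'rV[R]_n)%type.
Local Notation Phi := (ham_flow H).
Local Notation cflow := (chart_flow H).
Local Notation act := (act H).
Implicit Types (i : chart_index A) (u : M -> R).

Lemma actN z t : act (Phi (- t) z) t = - act z (- t).
Proof.
have := actD tH hM cM z t (- t); rewrite subrr (act0 tH hM cM) => h.
by apply/eqP; rewrite -subr_eq0 opprK addrC; apply/eqP.
Qed.

Lemma lax_oleinik_le u z t : 0 < t -> (lax_oleinik_neg H t u (Phi t z).1 <= (u z.1 + act z t)%:E)%E.
Proof.
move=> t0; rewrite /lax_oleinik_neg gt_eqF//; apply: ereal_inf_lbound.
exists (fst \o Phi^~ z); first by split=> //; exact: (base_ac tH hM cM).
by rewrite (base_action tH hM cM) ?ltW//= (flow0 tH hM cM).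
Qed.

(** The Lagrangian at zero velocity is bounded above on M, so a constant curve costs at most C t.
    Curves that cost more can be discarded in the minimization. *)
Lemma action_cst_le : exists2 C : R, 0 <= C & forall y t, 0 <= t -> (action (A := A) H t (fun=> y) <= (C * t)%:E)%E.
Proof.
have [C0 C00 HC0] := lagrangian_lb tH.
have [d d0 Hd] : exists2 d : R, 0 < d & forall y, [set: M] y -> d * (C0 + lagrangian H ((y, 0) : tangent A)) <= 1.
  apply: (@compact_unif R M [set: M] (fun d y => d * (C0 + lagrangian H ((y, 0) : tangent A)) <= 1) cM).
    move=> a b z a0 ab; apply: le_trans; apply: ler_wpM2r => //; have := HC0 (z, 0); lra.
  move=> y _; pose i := chart_at A y; have di : dom i y := chart_atP A y.
  have [r r0 [rD HL]] := local_superlinear tH di; have [C HC] := HL 1 ltr01.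
  have C1 : 0 < C0 + `|C| + 1 by have := normr_ge0 C; lra.
  exists (C0 + `|C| + 1)^-1; first by rewrite invr_gt0.
  have N1 : nbhs y (dom i) by apply: open_nbhs_nbhs; split=> //; exact: open_dom.
  have := chart_continuous di; move/cvgrPdist_le => /(_ r r0) N2.
  apply: filterS (filterI N1 N2) => x [dx hx]; rewrite mulrC ler_pdivrMr// mul1r.
  have -> : ((x, 0) : tangent A) = (x, 0 *m tjac i (chart_at A x) x) by rewrite mul0mx.
  suff : lagrangian H (x, (0 : V) *m tjac i (chart_at A x) x) <= `|C| by lra.
  apply: (lagrangian_le dx) => q; rewrite pairing0r.
  have := HC (chart i x, q); rewrite /= distrC => /(_ hx); have := normr_ge0 q; have := ler_norm C; lra.
exists d^-1 => [|y t t0]; first by rewrite invr_ge0 ltW.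
rewrite /action; have -> : (fun s : R => (lagrangian H (velocity A (fun=> y) s))%:E) = cst (lagrangian H ((y, 0) : tangent A))%:E.
  by apply/funext => s; rewrite /velocity derive1E; rewrite (_ : _ \o _ = cst (chart (chart_at A y) y)) ?derive_cst.
rewrite integral_cst//= lebesgue_measure_itv/= lte_fin.
case: ltP => [_|t0']; last by rewrite mule0 lee_fin mulr_ge0// invr_ge0 ltW.
rewrite EFinN sube0 -EFinM lee_fin; apply: ler_wpM2r => //.
by have := Hd y I; rewrite -ler_pdivlMl// mulr1; lra.
Qed.

Definition orbit_end i (a q : V) (t : R) : M := (Phi t (cot_coordV i (a, q))).1.

Section InBox.
Variables (i : chart_index A) (c0 : V) (C K r T L m : R).
Hypothesis FB : flow_box H i c0 (K + 1) r T L m.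
Hypothesis SH : forall x w t, `|x - c0| <= r -> 0 < `|t| <= T -> `|w - x| <= C * `|t| ->
  exists2 p : V, `|p| <= K & (cflow i (x, p) t).1 = w.

Lemma cflowD (a : E) s t : box c0 r (K + 1) a -> `|s| <= T -> cflow i (cflow i a s) t = cflow i a (t + s).
Proof.
move=> ba sT; rewrite chart_flowE -(flow_cflow FB ba sT) -(flowD tH hM cM).
by rewrite -chart_flowE.
Qed.

Lemma flow_cflow1 (a : E) t : box c0 r (K + 1) a -> `|t| <= T -> (Phi t (cot_coordV i a)).1 = chartV i (cflow i a t).1.
Proof. by move=> ba tT; rewrite (flow_cflow FB ba tT) cot_coordV1. Qed.

Lemma orbit_endE (a q : V) t : box c0 r (K + 1) (a, q) -> `|t| <= T -> orbit_end i a q t = chartV i (cflow i (a, q) t).1.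
Proof. exact: flow_cflow1. Qed.

Lemma orbit_end_eq (a q b p : V) t : box c0 r (K + 1) (a, q) -> box c0 r (K + 1) (b, p) -> `|t| <= T ->
  (cflow i (b, p) t).1 = (cflow i (a, q) t).1 -> orbit_end i b p t = orbit_end i a q t.
Proof. by move=> ba bb tT pE; rewrite (orbit_endE bb tT) pE -(orbit_endE ba tT). Qed.

(* The first variation of the action of an orbit with one endpoint fixed. *)
Definition base_variation t B := forall (a : E) (b : V),
  box c0 r (K + 1) a -> `|(cflow i a t).1 - a.1| <= (C - 1) * `|t| -> `|b - a.1| <= `|t| -> `|b - c0| <= r ->
  exists p : V, [/\ box c0 r (K + 1) (b, p), (cflow i (b, p) t).1 = (cflow i a t).1 &
    `|act (cot_coordV i (b, p)) t - act (cot_coordV i a) t + pairing a.2 (b - a.1)| <= B * `|b - a.1| ^+ 2].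

(** Shooting from b at the unchanged end gives p, and the twist bounds |p - a.2| by a multiple of |b
    - a.1|. The error in [act_diff] is then quadratic in |b - a.1|; its constant depends on t, which
    is fixed when superdifferentials are taken. *)
Lemma vary_base (t : R) : 0 < `|t| <= T -> exists2 B : R, 0 <= B & base_variation t B.
Proof.
move=> /andP[t0 tT]; have tn : t != 0 by rewrite -normr_gt0.
have L0 := fb_L FB; have m0 := fb_m FB.
pose k := n%:R / (m * `|t|) * 2.
have k0 : 0 <= k by rewrite /k mulr_ge0// divr_ge0// mulr_ge0// ltW.
have N0 : 0 <= 4 * (1 + n%:R) * L * `|t| by rewrite !mulr_ge0// addr_ge0.
exists (4 * (1 + n%:R) * L * `|t| * (1 + k) ^+ 2) => [|a b ba sa ba1 hb].
  by rewrite mulr_ge0// sqr_ge0.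
have [||p pK pE] := SH hb (_ : 0 < `|t| <= T) (_ : `|(cflow i a t).1 - b| <= C * `|t|).
- by rewrite t0.
- by have := ler_normD ((cflow i a t).1 - a.1) (a.1 - b); rewrite addrA subrK (distrC a.1); move: sa; lra.
have pK1 : `|p| <= K + 1 by exact: (ler_wpDr ler01 pK).
have bb : box c0 r (K + 1) (b, p) := conj hb pK1.
case: (ba) => _ ba2.
have bm : box c0 r (K + 1) (b, a.2) := conj hb ba2.
suff main : `|act (cot_coordV i (b, p)) t - act (cot_coordV i a) t + pairing a.2 (b - a.1)|
    <= 4 * (1 + n%:R) * L * `|t| * (1 + k) ^+ 2 * `|b - a.1| ^+ 2 by exists p; exact: (And3 bb pE main).
have cl := cflow_le2 FB bm ba tT.
have cl' := le_trans cl (ler_wpM2l (ler0n R 2) (base_near a b)).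
have e1 := fst_close pE cl'.
have mo := fb_mono FB hb ba2 pK1 tT.
have pb := pairing_bound_le e1 (lexx `|p - a.2|).
have mo' : m * t ^+ 2 * `|p - a.2| ^+ 2 <= `|t| * (n%:R * (2 * `|b - a.1| * `|p - a.2|)).
  apply: le_trans mo _; apply: le_trans (ler_norm _) _.
  by rewrite normrM; exact: (ler_wpM2l (normr_ge0 t) pb).
have ge : 0 <= 2 * `|b - a.1| by rewrite mulr_ge0.
have e2 := mono_ratio m0 tn (normr_ge0 _) mo' (ler0n R n) ge.
rewrite mulrA -/k in e2.
exact: (vary_bound N0 (normr_ge0 _) (pair_near k0 e2) (same_end pE (act_diff tH hM cM FB ba bb tT))).
Qed.

End InBox.

Lemma tstep_reals (K Lam D th Cs t rho : R) : K = Lam + 1 + (D + 1) / rho -> 0 < rho -> 0 <= Lam -> 0 <= D -> Cs * t <= 1 ->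
  K * th <= D + Cs * t -> th < rho.
Proof.
move=> KE r0 L0 D0 h1 h2; rewrite ltNge; apply/negP => h3.
have e : (D + 1) / rho * rho = D + 1 by rewrite divfK// gt_eqF.
have K0 : (Lam + 1) * rho <= (Lam + 1) * th by apply: ler_wpM2l => //; lra.
have h4 : (D + 1) / rho * rho <= (D + 1) / rho * th by apply: ler_wpM2l => //; rewrite divr_ge0 ?ltW//; lra.
have : (Lam + 1) * rho + (D + 1) <= K * th by rewrite KE (mulrDl (Lam + 1)); lra.
have : 0 < (Lam + 1) * rho by rewrite mulr_gt0//; lra.
by lra.
Qed.

(** A curve no dearer than the constant one cannot leave the chart ball ([escape]) and moves by at
    most Cs t. Shooting joins its ends by an orbit, which costs no more by [calibration]. The
    infimum over curves thus becomes the minimum of a continuous function over the ball |q| <= K.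
    The two last clauses provide competitors with the other end varied. *)
Lemma tstep_local (F : set (M -> R)) (D : R) (y0 : M) : equi_lip A F -> 0 <= D ->
  (forall u x y, F u -> `|u x - u y| <= D) ->
  exists i (r d K : R), [/\ dom i y0, 0 < r, 0 < d, (forall b : V, `|b - chart i y0| <= r -> codom_chart i b) &
    forall t, 0 < t <= d -> exists2 B : R, 0 <= B & forall u (a : V), F u -> `|a - chart i y0| <= r / 2 ->
    exists q, [/\ `|q| <= K, dom i (orbit_end i a q (- t)),
      lax_oleinik_neg H t u (chartV i a) = (u (orbit_end i a q (- t)) - act (cot_coordV i (a, q)) (- t))%:E,
      (forall b, `|b - a| <= t -> `|b - chart i y0| <= r -> exists p,
        orbit_end i b p (- t) = orbit_end i a q (- t) /\
        `|act (cot_coordV i (b, p)) (- t) - act (cot_coordV i (a, q)) (- t) + pairing q (b - a)| <= B * `|b - a| ^+ 2) &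
      let a' := cot_coord i (Phi (- t) (cot_coordV i (a, q))) in
      exists2 e : R, 0 < e & forall b, `|b - a'.1| <= e -> codom_chart i b /\ exists p, orbit_end i b p t = chartV i a /\
        `|act (cot_coordV i (b, p)) t - act (cot_coordV i a') t + pairing a'.2 (b - a'.1)| <= B * `|b - a'.1| ^+ 2]].
Proof.
move=> LF D0 HD; have [i [Lam [r0 [di Lam0 r00 r0D HL]]]] := LF y0.
have r02 : 0 < r0 / 2 by exact: divr_gt0.
have [r [rp rr1 r1 rD SHO]] := shooting tH hM cM di r02.
have rr0 : r + r <= r0 by lra.
have hrr : r <= r + r by lra.
have hr0 : r <= r0 by lra.
set c0 := chart i y0 in HL SHO rD r0D *; pose rho := r / 2; have rho0 : 0 < rho by exact: divr_gt0.
have rhor : rho + rho = r by rewrite /rho; lra.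
have hrho : rho <= r by lra.
have hrho0 : rho <= r0 by lra.
have hrho2 : rho / 2 + rho = r - rho / 2 by rewrite /rho; lra.
have hrho3 : r - rho / 2 <= r by lra.
have hrho4 : rho / 2 + (rho / 2 + rho) = r by lra.
(* The part (D + 1) / rho makes leaving the ball cost more than the oscillation D allows; the part
   Lam + 1 exceeds the Lipschitz constant of u, which bounds the displacement by Cs t. *)
pose Ke := Lam + 1 + (D + 1) / rho.
have Kd0 : 0 <= (D + 1) / rho by rewrite divr_ge0//; lra.
have Ke0 : 0 <= Ke by rewrite /Ke; lra.
have rhoD (b : V) : `|b - c0| <= rho + rho -> codom_chart i b by move=> h; apply: rD; move: h; rewrite /rho; lra.
have [Ce Ce0 ESC] := escape tH hM rho0 Ke0 rhoD.
have [C2 C20 HC2] := action_cst_le; pose Cs := C2 + Ce.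
have Cs0 : 0 <= Cs by rewrite /Cs; lra.
have C10 : 0 <= Cs + 1 by lra.
have [K [T [L [m [K0 FB SH]]]]] := SHO (Cs + 1) 0 C10 (lexx 0).
have T0 := fb_T FB; have L0 := fb_L FB.
pose d := Num.min T (Num.min 1 (rho / 2) / (Cs + 1)).
have Cs1 : 0 < Cs + 1 by lra.
have mr0 : 0 < Num.min 1 (rho / 2) by rewrite lt_min ltr01 divr_gt0.
have d0 : 0 < d by rewrite lt_min T0 divr_gt0.
exists i, r, d, K; split=> // [b hb|t /andP[t0 td]]; first by apply: rD; lra.
have tT : t <= T by apply: le_trans td _; rewrite ge_min lexx.
have [Cst1 Cstr] : Cs * t <= 1 /\ Cs * t <= rho / 2.
  have : t <= Num.min 1 (rho / 2) / (Cs + 1) by apply: le_trans td _; rewrite ge_min lexx orbT.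
  by move/(scale_le (ltW t0) Cs1); rewrite le_min => /andP[].
have nt : `|- t| = t by rewrite normrN gtr0_norm.
have nT : `|- t| <= T by rewrite nt.
have pT : `|t| <= T by rewrite gtr0_norm.
have ntT : 0 < `|- t| <= T by rewrite nt t0.
have ptT : 0 < `|t| <= T by rewrite gtr0_norm// t0.
have [B1 B10 VB1] := vary_base FB SH ntT; have [B2 B20 VB2] := vary_base FB SH ptT.
have LT : L * t <= 1 / 4 := le_trans (ler_wpM2l L0 tT) (fb_LT FB).
have [B1le B2le] : B1 <= B1 + B2 /\ B2 <= B1 + B2 by rewrite lerDl lerDr.
exists (B1 + B2) => [|u a Fu ha]; first exact: addr_ge0.
have ar : `|a - c0| <= r := le_trans ha hrho.
have ca : codom_chart i a by apply: rD; exact: le_trans ar hrr.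
have [day aE] := codom_chartP ca; set y := chartV i a in day aE *.
have bq (q : V) : `|q| <= K -> box c0 r (K + 1) (a, q) by move=> h; split=> //=; exact: ler_wpDr.
pose Fm q := u (chartV i (cflow i (a, q) (- t)).1) - act (cot_coordV i (a, q)) (- t).
have FmE q : `|q| <= K -> Fm q = u (orbit_end i a q (- t)) - act (cot_coordV i (a, q)) (- t).
  by move=> hq; rewrite /orbit_end (flow_cflow1 FB (bq q hq) nT).
have speed c : abs_continuous_curve A t c -> c t = y -> ((u (c 0))%:E + action H t c <= (u y + C2 * t)%:E)%E ->
    (forall s, 0 <= s <= t -> dom i (c s) /\ `|chart i (c s) - a| <= rho) /\ `|chart i (c 0) - a| <= Cs * t.
  move=> Ac ct bd.
  have dct : dom i (c t) by rewrite ct.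
  have act' : chart i (c t) = a by rewrite ct.
  have E s : 0 <= s <= t -> Ke * trunc_dist i a rho (c s) <= u y - u (c 0) + Cs * t.
    move=> st; have h1 := ESC a c t ha (ltW t0) Ac dct act' s st.
    have h2 : ((u (c 0))%:E + (Ke * trunc_dist i a rho (c s) - Ce * t)%:E <= (u (c 0))%:E + action H t c)%E by exact: leeD2l.
    by have := le_trans h2 bd; rewrite -EFinD lee_fin; exact: escape_bound.
  have Hs s : 0 <= s <= t -> [/\ dom i (c s), `|chart i (c s) - a| <= rho & trunc_dist i a rho (c s) = `|chart i (c s) - a|].
    move=> st; have h : trunc_dist i a rho (c s) < rho.
      apply: (tstep_reals (erefl Ke) rho0 Lam0 D0 Cst1); apply: le_trans (E s st) _; rewrite lerD2r.
      exact: le_trans (ler_norm _) (HD u y (c 0) Fu).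
    by move: h; rewrite /trunc_dist; case: asboolP => [[h1 h2] _|_]; [split|rewrite ltxx].
  split=> [s st|]; first by have [] := Hs s st.
  have i0 : (0 : R) <= 0 <= t by rewrite lexx ltW.
  have [dc0 hc0 tc0] := Hs 0 i0; have := E 0 i0; rewrite tc0 => h.
  have hl : u y - u (c 0) <= Lam * `|chart i (c 0) - a|.
    have h1 : `|a - c0| <= r0 := le_trans ar hr0.
    have h2 : `|chart i (c 0) - c0| <= r0.
      by apply: le_trans (dist_tri hc0 ha) _; rewrite rhor.
    have := HL u Fu a (chart i (c 0)) h1 h2; rewrite (chartK dc0) distrC (distrC a).
    by apply: le_trans; rewrite distrC; exact: ler_norm.
  exact: (escape_speed Kd0 (normr_ge0 _) h hl).
(* Shooting in time - t from the end of c reaches its start. The orbit so obtained, run forward from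
   its state b, is compared with c by [calibration] with k0 = 0; both quadratic terms vanish because
   the ends coincide. *)
have calib c : abs_continuous_curve A t c -> c t = y -> ((u (c 0))%:E + action H t c <= (u y + C2 * t)%:E)%E ->
    exists2 q : V, `|q| <= K & ((Fm q)%:E <= (u (c 0))%:E + action H t c)%E.
  move=> Ac ct bd; have [S1 S2] := speed c Ac ct bd.
  have i0 : (0 : R) <= 0 <= t by rewrite lexx ltW.
  have [dc0 hc0] := S1 0 i0.
  have [|q qK qE] := SH a (chart i (c 0)) (- t) ar ntT; first by rewrite nt; apply: le_trans S2 _; apply: ler_wpM2r; [exact: ltW|rewrite lerDl].
  exists q => //; have bb := bq q qK; have sp := fb_speed FB bb nT; rewrite nt in sp.
  set b := cflow i (a, q) (- t) in qE sp.
  have hbr : box c0 r (K + 1) b.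
    split; first by rewrite qE -rhor; exact: (dist_tri hc0 ha).
    exact: (fiber_near sp LT qK).
  have bt : cflow i b t = (a, q).
    by rewrite /b (cflowD FB t bb nT) subrr (cflow0 tH hM cM FB bb).
  have tT' : 0 <= t <= T by rewrite ltW.
  have k1 : - 1 + L * 2 * t <= 0 by exact: calib_k0.
  have inB s : 0 <= s <= t -> dom i (c s) /\ `|chart i (c s) - c0| <= r + r.
    move=> /S1[ds hs]; split=> //.
    by apply: le_trans (dist_tri hs ha) _; rewrite rhor.
  have := calibration tH hM cM FB hbr tT' k1 (lexx 0) Ac inB.
  rewrite bt ct aE qE !subrr !pairing0r !mulr0 !addr0 subr0 => h.
  have ae : act (cot_coordV i b) t = - act (cot_coordV i (a, q)) (- t).
    by rewrite -actN (flow_cflow FB bb nT).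
  rewrite ae in h; apply: le_trans (leeD2l _ h); rewrite -EFinD lee_fin /Fm -/b qE chartK//.
have cF (q : V) : `|q| <= K -> {for q, continuous Fm}.
  move=> qK; have XX : 0 <= 4 * (1 + n%:R) * L * `|- t| by rewrite !mulr_ge0// addr_ge0.
  apply: (@lip_continuous _ _ _ _ _ (Lam * 2 + (n%:R * ((K + 1 + 1) * 2) + 4 * (1 + n%:R) * L * `|- t|)) 1) => // q' q'q.
  have ba := bq q qK.
  have bb : box c0 r (K + 1) (a, q').
    split=> //=; rewrite addrC; have := ler_normD (q' - q) q; rewrite subrK => /le_trans; apply.
    by apply: lerD => //; exact: ltW.
  have h1 := act_diff tH hM cM FB ba bb nT; rewrite same_base_norm in h1.
  have h2 := cflow_le2 FB ba bb nT; rewrite same_base_norm in h2.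
  have [x1 p1] := fb_box FB ba nT; have [x2 _] := fb_box FB bb nT.
  have h3 := HL u Fu _ _ (le_trans x2 rr0) (le_trans x1 rr0).
  have N1 : 0 <= `|q' - q| <= 1 by rewrite normr_ge0 ltW.
  have c0E : pairing q (a - a) = 0 by rewrite subrr pairing0r.
  have vl := @value_lip R n (fun x => u (chartV i x)) _ _ _ _ _ _ _ _ _ XX Lam0 N1 h3 h2 p1 c0E h1.
  exact: vl.
have cK : compact [set q : V | `|q| <= K].
  by have := @compact_row_ball R n 0 K; under eq_set => q do rewrite subr0.
have [|q qK qmin] := compact_min _ cK cF; first by exists 0; rewrite /= normr0.
have {}qK : `|q| <= K by exact: qK.
have ba := bq q qK; exists q.
have cst : ((Fm q)%:E <= (u y + C2 * t)%:E)%E.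
  have Acst : abs_continuous_curve A t (fun=> y).
    split=> [|i' a' b' _ ab' _ e e0]; first by move=> x; exact: cvg_cst.
    by exists 1 => // m' x y' _ _ _; rewrite big1// => k _; rewrite subrr normr0.
  have bd : ((u y)%:E + action (A := A) H t (fun=> y) <= (u y + C2 * t)%:E)%E.
    by rewrite EFinD; apply: leeD2l; apply: HC2; exact: ltW.
  have [q' q'K h] := calib _ Acst erefl bd.
  by apply: le_trans bd; apply: le_trans h; rewrite lee_fin; exact: qmin.
have Fmin c : abs_continuous_curve A t c -> c t = y -> ((Fm q)%:E <= (u (c 0%R))%:E + action H t c)%E.
  (* A curve dearer than the constant one needs no comparison, since the bound C2 t already
     dominates the minimum. *)
  move=> Ac ct; have [bd|bd] := leP ((u (c 0%R))%:E + action H t c)%E (u y + C2 * t)%:E.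
    by have [q' q'K h] := calib c Ac ct bd; apply: le_trans h; rewrite lee_fin; exact: qmin.
  exact: le_trans cst (ltW bd).
set z' := cot_coordV i (a, q); have z'1 : z'.1 = y by rewrite /z' cot_coordV1.
have lax : lax_oleinik_neg H t u y = (Fm q)%:E.
  apply/eqP; rewrite eq_le; apply/andP; split.
    rewrite FmE// -(actN z' t) -z'1 -{1}(flowNK tH hM cM t z').
    exact: lax_oleinik_le.
  rewrite /lax_oleinik_neg gt_eqF//; apply: le_ereal_inf_tmp => _ [c [Ac ct] <-].
  exact: Fmin.
have dz : dom i (orbit_end i a q (- t)) := fb_dom FB ba nT.
set x := cflow i (a, q) (- t).
have xE : (cot_coord i (Phi (- t) z')) = x by rewrite /x chart_flowE.
have xa : `|x.1 - a| <= Cs * t.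
  have Ac := base_ac tH hM cM (Phi (- t) z') t.
  have ct : (fst \o Phi^~ (Phi (- t) z')) t = y by rewrite /= (flowNK tH hM cM).
  have bd : ((u ((fst \o Phi^~ (Phi (- t) z')) 0%R))%:E + action H t (fst \o Phi^~ (Phi (- t) z')) <= (u y + C2 * t)%:E)%E.
    rewrite (base_action tH hM cM); last exact: ltW.
    rewrite actN /= (flow0 tH hM cM) -EFinD.
    by have -> : u (Phi (- t) z').1 - act z' (- t) = Fm q by rewrite FmE.
  have [_] := speed _ Ac ct bd.
  by rewrite /= (flow0 tH hM cM) -xE cot_coord1.
split=> //; first by rewrite lax FmE.
  move=> b hb hbr; have xa' : `|x.1 - a| <= (Cs + 1 - 1) * `|- t| by rewrite nt addrK.
  have hb' : `|b - a| <= `|- t| by rewrite nt.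
  have [p [bp pE hp]] := VB1 (a, q) b ba xa' hb' hbr.
  exact: (ex_intro _ p (conj (orbit_end_eq FB ba bp nT pE) (le_trans hp (ler_wpM2r (sqr_ge0 _) B1le)))).
rewrite xE; have sp := fb_speed FB ba nT; rewrite nt -/x in sp.
have hx : box c0 r (K + 1) x.
  split; first by apply: le_trans (dist_tri (le_trans xa Cstr) ha) _; rewrite hrho2.
  exact: (fiber_near sp LT qK).
have xt : cflow i x t = (a, q) by rewrite /x (cflowD FB t ba nT) subrr (cflow0 tH hM cM FB ba).
exists (Num.min t (rho / 2)); first by rewrite lt_min t0 divr_gt0.
move=> b; rewrite le_min => /andP[hbt hbr].
have bc : `|b - c0| <= r.
  by have := dist_tri hbr (dist_tri (le_trans xa Cstr) ha); rewrite hrho4.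
split; first by apply: rD; exact: le_trans bc hrr.
have xa' : `|(cflow i x t).1 - x.1| <= (Cs + 1 - 1) * `|t| by rewrite xt /= distrC addrK gtr0_norm.
have hbt' : `|b - x.1| <= `|t| by rewrite gtr0_norm.
have [p [bp pE hp]] := VB2 x b hx xa' hbt' bc.
rewrite xt in pE; have pE' := eq_trans (orbit_endE FB bp pT) (congr1 (chartV i) pE).
exact: (ex_intro _ p (conj pE' (le_trans hp (ler_wpM2r (sqr_ge0 _) B2le)))).
Qed.

End TStep.

(** * Superdifferentials with quadratic error *)

Section Touching.
Variables (R : realType) (n : nat) (M : ptopologicalType) (A : C2atlas R n M).
Local Notation V := 'rV[R]_n.
Implicit Types (i j : chart_index A) (v : M -> R) (z : cotangent A) (c : R -> M).

Lemma min_derive0 (F : R -> R) (t d k : R) : is_derive t (1 : R) F d -> 0 < k ->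
  (forall h, `|h| < k -> F t <= F (t + h)) -> d = 0.
Proof.
move=> D k0 HF; apply/eqP/negPn/negP => d0; have ad : 0 < `|d| by rewrite normr_gt0.
have e0 : 0 < `|d| / 2 by exact: divr_gt0.
have [k1 k10 H1] := derive_expand D e0.
pose h := Num.min k k1 / 2; have m0 : 0 < Num.min k k1 by rewrite lt_min k0.
have h0 : 0 < h by exact: divr_gt0.
have : h < Num.min k k1 by rewrite /h; lra.
rewrite lt_min => /andP[hk hk1].
have sN : `|- Num.sg d * h| = h by rewrite normrM normrN normr_sg d0 mul1r gtr0_norm.
have := H1 (- Num.sg d * h); rewrite sN => /(_ hk1); have := HF (- Num.sg d * h); rewrite sN => /(_ hk).
rewrite ler_norml -[_ *: d]/(_ * d) => h1 /andP[_ h2].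
have e1 : - Num.sg d * h * d = - (`|d| * h) by rewrite [`|d|]normrEsg; ring.
rewrite e1 in h2; have := mulr_gt0 ad h0; lra.
Qed.

(* z belongs to the superdifferential of v, with a quadratic error. *)
Definition superdiff v z := exists i (C d : R), [/\ dom i z.1, 0 <= C, 0 < d & forall b : V, `|b - chart i z.1| < d ->
  codom_chart i b /\ v (chartV i b) - v z.1 <= pairing (cot_coord i z).2 (b - chart i z.1) + C * `|b - chart i z.1| ^+ 2].

Definition opp (z : cotangent A) : cotangent A := (z.1, - z.2).

Definition subdiff v z := superdiff (fun y => - v y) (opp z).

Lemma cot_coord_opp i z : cot_coord i (opp z) = ((cot_coord i z).1, - (cot_coord i z).2).
Proof. by case: z => x p; rewrite /opp !cot_coordE mulNmx. Qed.

Lemma superdiff_curve v z c (t : R) : superdiff v z -> c t = z.1 -> {for t, continuous c} -> exists i (C k : R),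
  [/\ dom i z.1, 0 <= C, 0 < k & forall h, `|h| < k -> dom i (c (t + h)) /\
    v (c (t + h)) - v (c t) <= pairing (cot_coord i z).2 (chart i (c (t + h)) - chart i (c t))
      + C * pairing (chart i (c (t + h)) - chart i (c t)) (chart i (c (t + h)) - chart i (c t))].
Proof.
move=> [i [C [d [di C0 d0 Hd]]]] ct cc.
have N1 : nbhs (c t) (dom i) by apply: open_nbhs_nbhs; split; [exact: open_dom|rewrite ct].
have di' : dom i (c t) by rewrite ct.
have := chart_continuous di'; move/cvgrPdist_lt => /(_ d d0) N2.
have [k k0 Hk] := (nbhs_normP t _).1 (cc _ (filterI N1 N2)).
exists i, C, k; split=> // h hk.
have [] : dom i (c (t + h)) /\ `|chart i (c t) - chart i (c (t + h))| < d.
  by apply: (Hk (t + h)); rewrite /= opprD addrA subrr sub0r normrN.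
rewrite distrC ct => dh hd; split=> //; have [_] := Hd _ hd; rewrite (chartK dh).
move/le_trans; apply; rewrite lerD2l; apply: ler_wpM2l => //; exact: pairing_vv_ge.
Qed.

Lemma quad_derive0 (w : R -> V) (t : R) (a : V) : is_derive t (1 : R) w a ->
  is_derive t (1 : R) (fun s => pairing (w s - w t) (w s - w t)) 0.
Proof.
move=> D; have D1 : is_derive t (1 : R) (fun s => w s - w t) a.
  by apply: (eq_is_derive_val (subr0 a)); exact: (is_deriveB D (is_derive_cst (w t) t 1)).
by apply: (eq_is_derive_val _ (is_derive_pairing D1 D1)); rewrite subrr pairing0r pairing0l addr0.
Qed.

Lemma pairing_affine_derive (w : R -> V) (p : V) (t : R) (a : V) : is_derive t (1 : R) w a ->
  is_derive t (1 : R) (fun s => pairing p (w s - w t)) (pairing p a).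
Proof.
move=> D; have D1 : is_derive t (1 : R) (fun s => w s - w t) a.
  by apply: (eq_is_derive_val (subr0 a)); exact: (is_deriveB D (is_derive_cst (w t) t 1)).
by apply: (eq_is_derive_val _ (is_derive_pairing (is_derive_cst p t 1) D1)); rewrite pairing0l add0r.
Qed.

Lemma touch_derive (w : R -> V) (p : V) (C t : R) (a : V) : is_derive t (1 : R) w a ->
  is_derive t (1 : R) (fun s => pairing p (w s - w t) + C * pairing (w s - w t) (w s - w t)) (pairing p a).
Proof.
move=> D; have D1 := pairing_affine_derive p D; have D2 := quad_derive0 D.
have D3 := is_derive_mul (is_derive_cst C t 1) D2.
by apply: (eq_is_derive_val _ (is_deriveD D1 D3)); rewrite mul0r mulr0 !addr0.
Qed.

Lemma coord_pairing_change i j z (a : V) : dom i z.1 -> dom j z.1 ->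
  pairing (cot_coord j z).2 (a *m tjac i j z.1) = pairing (cot_coord i z).2 a.
Proof.
move=> di dj; have h : (cot_coord j z).2 = (cot_coord i z).2 *m (tjac j i z.1)^T := congr1 snd (cot_coord_trans di dj).
exact: (eq_trans (congr1 (fun q => pairing q _) h) (pairing_tjac _ _ di dj)).
Qed.

Lemma cot_coord_inj i z z' : dom i z.1 -> z.1 = z'.1 -> (cot_coord i z).2 = (cot_coord i z').2 -> z = z'.
Proof.
case: z z' => x p [y q] /= di e1; subst y; rewrite !cot_coordE /= => e2.
have e : cot_coord i ((x, p) : cotangent A) = cot_coord i ((x, q) : cotangent A) by rewrite !cot_coordE e2.
have dq : dom i ((x, q) : cotangent A).1 := di. have dp : dom i ((x, p) : cotangent A).1 := di.
exact: eq_trans (esym (cot_coordK dp)) (eq_trans (congr1 (cot_coordV i) e) (cot_coordK dq)).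
Qed.

(** The quadratic majorant minus v along the curve has a minimum at t, so its derivative vanishes
    there; v itself need not be differentiable. *)
Lemma superdiff_derive v z c (t : R) j (a : V) (df : R) : superdiff v z -> c t = z.1 -> {for t, continuous c} ->
  dom j z.1 -> is_derive t (1 : R) (chart j \o c) a -> is_derive t (1 : R) (v \o c) df ->
  df = pairing (cot_coord j z).2 a.
Proof.
move=> S ct cc dj D Dv; have [i [C [k [di C0 k0 Hk]]]] := superdiff_curve S ct cc.
have di' : dom i (c t) by rewrite ct. have dj' : dom j (c t) by rewrite ct.
have Di := chart_derive_change cc dj' di' D.
have DT := touch_derive (cot_coord i z).2 C Di.
have DF := is_deriveB DT Dv.
apply/eqP; rewrite eq_sym -subr_eq0; apply/eqP.
rewrite ct (coord_pairing_change _ dj di) in DF.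
apply: (min_derive0 DF k0) => h hk; have [_ h1] := Hk h hk.
change (pairing (cot_coord i z).2 ((chart i \o c) t - (chart i \o c) t)
  + C * pairing ((chart i \o c) t - (chart i \o c) t) ((chart i \o c) t - (chart i \o c) t) - v (c t)
  <= pairing (cot_coord i z).2 (chart i (c (t + h)) - chart i (c t))
      + C * pairing (chart i (c (t + h)) - chart i (c t)) (chart i (c (t + h)) - chart i (c t)) - v (c (t + h))).
by rewrite subrr !pairing0r mulr0; move: h1; lra.
Qed.

Lemma opposite_bounds (X0 Y0 X Y v0 v1 : R) : X0 = 0 -> Y0 = 0 -> v1 - v0 <= X -> - v1 - - v0 <= Y -> X0 + Y0 <= X + Y.
Proof. lra. Qed.

(** Along any line through the base point, the sum of the two one-sided bounds is minimal at the
    point, and its derivative is the difference of the two covectors on the direction. *)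
Lemma sub_superdiff_eq v z z' : superdiff v z -> subdiff v z' -> z.1 = z'.1 -> z = z'.
Proof.
move=> S S' e1; have di : dom (chart_at A z.1) z.1 := chart_atP A _; set i := chart_at A z.1 in di.
suff e2 : (cot_coord i z).2 = (cot_coord i z').2.
  exact: cot_coord_inj di e1 e2.
apply: pairing_inj => a; pose x0 := chart i z.1.
pose c (s : R) := chartV i (x0 + s *: a).
have c0 : c 0 = z.1 by rewrite /c scale0r addr0 chartK.
have DL : is_derive (0 : R) (1 : R) (fun s : R => x0 + s *: a) a by exact: is_derive_affine.
have cc : {for 0, continuous c}.
  apply: (@continuous_comp _ _ _ (fun s : R => x0 + s *: a) (chartV i)); first exact: derive_continuous DL.
  by rewrite scale0r addr0; exact: chartV_continuous.
have N : \forall s \near (0 : R), x0 + s *: a = (chart i \o c) s.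
  have N1 : nbhs ((fun s : R => x0 + s *: a) 0) (codom_chart i).
    by rewrite scale0r addr0; apply: open_nbhs_nbhs; split; [exact: open_codom|exact: codom_chart_chart].
  have N2 : nbhs (0 : R) ((fun s : R => x0 + s *: a) @^-1` codom_chart i) by exact: (derive_continuous DL).
  by apply: filterS N2 => s cs; rewrite /c /= (codom_chartP cs).2.
have D := near_eq_is_derive N DL.
have c0' : c 0 = (opp z').1 by rewrite c0 e1.
have [j [C [k [dj C0 k0 Hk]]]] := superdiff_curve S c0 cc.
have [l [C' [k' [dl C'0 k'0 Hk']]]] := superdiff_curve S' c0' cc.
have dj' : dom j (c 0) by rewrite c0. have dl' : dom l (c 0) by rewrite c0'.
have di' : dom i (c 0) by rewrite c0.
have DF := is_deriveD (touch_derive (cot_coord j z).2 C (chart_derive_change cc di' dj' D))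
  (touch_derive (cot_coord l (opp z')).2 C' (chart_derive_change cc di' dl' D)).
have E1 : pairing (cot_coord j z).2 (a *m tjac i j (c 0)) = pairing (cot_coord i z).2 a.
  by rewrite c0; exact: coord_pairing_change.
have di2 : dom i (opp z').1 by rewrite -c0'.
have E2 : pairing (cot_coord l (opp z')).2 (a *m tjac i l (c 0)) = - pairing (cot_coord i z').2 a.
  rewrite c0'; apply: eq_trans (coord_pairing_change a di2 dl) _.
  have h : (cot_coord i (opp z')).2 = - (cot_coord i z').2 := congr1 snd (cot_coord_opp i z').
  by apply: eq_trans (congr1 (fun q => pairing q a) h) _; exact: pairingNl.
have DF' := eq_is_derive_val (f_equal2 (fun x y : R => x + y) E1 E2) DF.
apply/eqP; rewrite -subr_eq0; apply/eqP.
have m0 : 0 < Num.min k k' by rewrite lt_min k0.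
apply: (min_derive0 DF' m0) => h; rewrite lt_min => /andP[hk hk'].
have [_ h1] := Hk h hk; have [_ h2] := Hk' h hk'.
have z0 (q : V) (K : R) (b : V) : pairing q (b - b) + K * pairing (b - b) (b - b) = 0.
  by rewrite subrr !pairing0r mulr0 addr0.
exact: (opposite_bounds (z0 _ _ _) (z0 _ _ _) h1 h2).
Qed.

End Touching.

Lemma step_super_real (R : realType) (vb va x ab aa P X : R) : vb <= x - ab -> va = x - aa -> `|ab - aa + P| <= X -> vb - va <= P + X.
Proof. by move=> h1 ->; rewrite ler_norml => /andP[h2 _]; move: h1 h2; lra. Qed.

Lemma lip_real (R : realType) (d a b N c al : R) : d <= a + b -> `|a| <= c * N -> b <= al * N -> d <= (c + al) * N.
Proof. by move=> h1 h2 h3; have := ler_norm a; rewrite mulrDl; move: h1 h2 h3; lra. Qed.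

Lemma step_sub_real (R : realType) (ux az aa ub ab P Q X : R) : aa = - az -> ux - az <= ub + ab -> `|ab - aa + P| <= X -> Q = - P -> - ub - - ux <= Q + X.
Proof. by move=> -> h1 + ->; rewrite ler_norml => /andP[_ h2]; move: h1 h2; lra. Qed.

(** * Subsolutions and their Lax-Oleinik steps *)

Section Subsolutions.
Variables (R : realType) (n : nat) (M : ptopologicalType) (A : C2atlas R n M).
Variables (g : riemannian A) (H : cotangent A -> R).
Hypothesis tH : tonelli g H.
Hypotheses (hM : hausdorff_space M) (cM : compact [set: M]).
Local Notation V := 'rV[R]_n.
Local Notation E := ('rV[R]_n * 'rV[R]_n)%type.
Local Notation hh := (local_rep H).
Local Notation Phi := (ham_flow H).
Local Notation act := (act H).
Implicit Types (i : chart_index A) (u v : M -> R) (z : cotangent A) (al : R).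

Lemma subsol_orbit al u z t : subsolution (A := A) H al u -> 0 <= t -> u (Phi t z).1 - u z.1 <= act z t + t * al.
Proof.
move=> S t0; rewrite -lee_fin [leRHS]EFinD; apply: le_trans (S z.1 (Phi t z).1 t t0) _.
apply: leeD2r; rewrite -(base_action tH hM cM z t0); apply: ereal_inf_lbound.
exists (fst \o Phi^~ z) => //; split=> //=; first exact: (base_ac tH hM cM).
by rewrite (flow0 tH hM cM).
Qed.

Lemma subsol_orbit_to al u z t x y : subsolution (A := A) H al u -> 0 <= t -> z.1 = x -> (Phi t z).1 = y ->
  u y - u x <= act z t + t * al.
Proof. by move=> Su t0 <- <-; exact: subsol_orbit. Qed.

Lemma subsol_intro al v : (forall c t, 0 <= t -> abs_continuous_curve A t c ->
  ((v (c t) - v (c 0) - t * al)%:E <= action H t c)%E) -> subsolution (A := A) H al v.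
Proof.
move=> Hv x y t t0; have -> : v y - v x = (v y - v x - t * al) + t * al by lra.
rewrite [leLHS]EFinD; apply: leeD2r; apply: le_ereal_inf_tmp => _ [c [Ac <- <-] <-].
exact: Hv.
Qed.

Lemma right_derive_ge0 (F : R -> R) (t d k : R) : is_derive t (1 : R) F d -> 0 < k ->
  (forall h, 0 < h < k -> F t <= F (t + h)) -> 0 <= d.
Proof.
move=> D k0 HF; rewrite leNgt; apply/negP => d0.
have e0 : 0 < - d / 2 by rewrite divr_gt0// oppr_gt0.
have [k1 k10 H1] := derive_expand D e0.
pose h := Num.min k k1 / 2; have m0 : 0 < Num.min k k1 by rewrite lt_min k0.
have h0 : 0 < h by exact: divr_gt0.
have : h < Num.min k k1 by rewrite /h; lra.
rewrite lt_min => /andP[hk hk1]; have nh : `|h| = h by rewrite gtr0_norm.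
have := H1 h; rewrite nh => /(_ hk1); have := HF h; rewrite h0 hk => /(_ isT).
rewrite ler_norml -[_ *: d]/(_ * d) => h1 /andP[_ h2].
have : 0 < h * - d by rewrite mulr_gt0// oppr_gt0.
by move: h1 h2; lra.
Qed.

(** At almost every time of a curve c, v o c has the derivative p(c') given by the superdifferential
    p there, and Fenchel's inequality bounds it by L + H(p). One superdifferential at each point is
    therefore enough. *)
Lemma superdiff_subsol al v : equi_lip A [set v] -> (forall y, exists z, [/\ z.1 = y, superdiff v z & H z <= al]) ->
  subsolution (A := A) H al v.
Proof.
move=> Lv Hv; apply: subsol_intro => c t t0 Ac.
pose f s := v (c s) + - al * s.
have -> : v (c t) - v (c 0) - t * al = f t - f 0 by rewrite /f; lra.
have Af : ac f 0 t.
  apply: acD; first exact: (lip_comp_ac t0 Lv Ac).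
  apply: acM => //; last exact: ac_id.
  by apply: (@ac_lip _ _ 0) => // s s' _ _ _; rewrite subrr normr0 mul0r.
apply: (action_ge tH t0 Ac Af) => s st cs.
have [z [zE S hz]] := Hv (c s); exists (chart_at A (c s)); first exact: chart_atP.
set i := chart_at A (c s) => w df Dw Df.
have di : dom i z.1 by rewrite zE; exact: chart_atP.
have Dv : is_derive s (1 : R) (v \o c) (df + al).
  have D2 : is_derive s (1 : R) (fun x : R => al * x) al.
    by have := is_derive_affine 0 al s; under eq_fun => x do rewrite add0r /GRing.scale/= mulrC.
  have e : (v \o c) = (fun x => f x + al * x) by apply/funext => x; rewrite /f /=; lra.
  by rewrite e; exact: is_deriveD Df D2.
have h := superdiff_derive S (esym zE) cs di Dw Dv.
have F := fenchel tH (cot_coord i z).2 w di.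
have e2 : hh i (chart i z.1, (cot_coord i z).2) = H z.
  by apply: eq_trans (congr1 (hh i) (esym (cot_coord_eta i z))) _; exact: local_rep_coord.
rewrite e2 -h zE in F; apply: le_trans F; lra.
Qed.

(** The test curve is the orbit issued from z, for which Fenchel's inequality is an equality: at
    time 0 the subdifferential gives slope at least p.dH/dp, the subsolution slope at most p.dH/dp -
    H + al. *)
Lemma subsol_subdiff al u z : subsolution (A := A) H al u -> subdiff u z -> H z <= al.
Proof.
move=> Su S; pose c := fst \o Phi^~ z.
have c0 : c 0 = (opp z).1 by rewrite /c /= (flow0 tH hM cM).
have cc : {for 0, continuous c}.
  apply: (@continuous_comp _ _ _ (Phi^~ z) fst); first exact: (@orbit_continuous _ _ _ _ _ _ tH hM cM z).
  exact: cot_fst_continuous.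
have [i [C [k [di C0 k0 Hk]]]] := superdiff_curve S c0 cc.
have dz : dom i (Phi 0 z).1 by rewrite (flow0 tH hM cM).
have D := base_derive tH hM cM dz; rewrite (flow0 tH hM cM) in D.
have DT := touch_derive (cot_coord i (opp z)).2 C D.
have D2 : is_derive (0 : R) (1 : R) (fun x : R => al * x) al.
  by have := is_derive_affine 0 al (0 : R); under eq_fun => x do rewrite add0r /GRing.scale/= mulrC.
have DF := is_deriveD DT (is_deriveD (act_derive tH hM cM z 0) D2).
rewrite (flow0 tH hM cM) (dens_chart tH (di : dom i z.1)) in DF.
have e3 : (cot_coord i (opp z)).2 = - (cot_coord i z).2 := congr1 snd (cot_coord_opp i z).
have nn : 0 <= pairing (cot_coord i (opp z)).2 (gp (hh i) (cot_coord i z)) +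
   (pairing (cot_coord i z).2 (gp (hh i) (cot_coord i z)) - H z + al).
  apply: (right_derive_ge0 DF k0) => h /andP[h0 hk].
  have nh : `|h| < k by rewrite gtr0_norm.
  have [_ h1] := Hk h nh; have h2 := subsol_orbit z Su (ltW h0).
  have z0 (q : V) (K : R) (b : V) : pairing q (b - b) + K * pairing (b - b) (b - b) = 0.
    by rewrite subrr !pairing0r mulr0 addr0.
  have real (X0 X a0 ah v0 v1 : R) : X0 = 0 -> a0 = 0 -> - v1 - - v0 <= X -> v1 - v0 <= ah + h * al ->
    X0 + (a0 + al * 0) <= X + (ah + al * (0 + h)) by lra.
  apply: (real _ _ _ _ (u (c 0)) (u (c (0 + h))) (z0 _ _ _) (act0 tH hM cM z) h1).
  by rewrite c0 add0r.
by move: nn; rewrite e3 pairingNl; lra.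
Qed.

Lemma act_bound i c0 K r T L m : flow_box H i c0 K r T L m -> exists2 B : R, 0 <= B & forall a t, box c0 r K a -> `|t| <= T ->
  `|act (cot_coordV i a) t| <= B * `|t|.
Proof.
move=> FB; have L0 := fb_L FB.
have [B B0 HB] : exists2 B : R, 0 <= B & forall a : E, box c0 (r + r) (K + 5) a -> `|hh i a| <= B.
  apply: near_pinfty_ex; apply: continuous_near_bounded => [|a [h _]]; first by exact: compact_box.
  by apply: differentiable_continuous; have [C1 _] := tonelli_C2 tH i; have [] := C1 a (fb_codom FB h).
exists (n%:R * (`|K + 5| * L) + B) => [|a t ba tT]; first by rewrite addr_ge0// !mulr_ge0.
have := @signed_increment R (act (cot_coordV i a)) (fun s => dens H (Phi s (cot_coordV i a))) (n%:R * (`|K + 5| * L) + B) t.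
rewrite (act0 tH hM cM) subr0; apply=> s st; first exact: (act_derive tH hM cM).
have sT := le_trans st tT; rewrite (flow_cflow FB ba sT) (dens_local tH); last exact: (cflow_codom FB ba sT).
have bx := fb_sub (fb_box FB ba sT); have [_ gL] := fb_grad FB bx; have hB := HB _ bx.
have pK := le_trans bx.2 (ler_norm _).
by apply: le_trans (ler_normB _ _) _; apply: lerD => //; exact: pairing_bound_le.
Qed.

(** Two points at distance d in the chart are joined in time d by an orbit with a bounded covector,
    whose action is at most B d. *)
Lemma subsol_equi_lip al : equi_lip A [set u | subsolution (A := A) H al u].
Proof.
move=> x; pose i := chart_at A x; have di : dom i x := chart_atP A x.
have [r [r0 _ r1 rD SHO]] := shooting tH hM cM di (@ltr01 R).
have [K [T [L [m [_ FB SH]]]]] := SHO 1 0 ler01 (lexx 0).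
have [B B0 HB] := act_bound FB; have T0 := fb_T FB.
pose rho := Num.min r (T / 2).
have rho0 : 0 < rho by rewrite lt_min r0 divr_gt0.
have rr : rho <= r by rewrite ge_min lexx.
have rT : rho + rho <= T by have : rho <= T / 2 by [rewrite ge_min lexx orbT]; lra.
exists i, (B + `|al|), rho; split=> //; first by rewrite addr_ge0.
  by move=> a ha; apply: rD; lra.
have key u (a b : V) : subsolution (A := A) H al u -> `|a - chart i x| <= rho -> `|b - chart i x| <= rho ->
    u (chartV i b) - u (chartV i a) <= (B + `|al|) * `|b - a|.
  move=> Su ha hb; have [->|ab] := eqVneq b a; first by rewrite !subrr normr0 mulr0.
  have n0 : 0 < `|b - a| by rewrite normr_gt0 subr_eq0.
  have nT : `|b - a| <= T.
    by rewrite distrC in hb; apply: le_trans rT; rewrite distrC; exact: (dist_tri ha hb).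
  have n1 : 0 < `| `|b - a| | <= T by rewrite normr_id n0.
  have n2 : `|b - a| <= 1 * `| `|b - a| | by rewrite normr_id mul1r.
  have [p pK pE] := SH a b `|b - a| (le_trans ha rr) n1 n2.
  have ba : box (chart i x) r (K + 1) (a, p) by split; [exact: le_trans ha rr|exact: ler_wpDr].
  have nT' : `| `|b - a| | <= T by rewrite normr_id.
  have e1 := eq_trans (congr1 fst (flow_cflow FB ba nT')) (eq_trans (cot_coordV1 i _) (congr1 (chartV i) pE)).
  have h1 := subsol_orbit_to Su (normr_ge0 (b - a)) (cot_coordV1 i (a, p)) e1.
  have h2 := HB (a, p) `|b - a| ba nT'; rewrite normr_id in h2.
  have h3 : `|b - a| * al <= `|al| * `|b - a| by rewrite mulrC; apply: ler_wpM2r => //; exact: ler_norm.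
  exact: lip_real h1 h2 h3.
move=> u Su a b ha hb; rewrite ler_norml; apply/andP; split; last by have := key u b a Su hb ha.
by have := key u a b Su ha hb; rewrite distrC; lra.
Qed.

Definition lo t u y : R := fine (lax_oleinik_neg H t u y).

(** What a short step yields at one point y, bundled so that compactness of M can provide a time
    common to all y and to all u of an equi-Lipschitz family. *)
Definition step_at t u y := exists z, [/\ z.1 = y, lax_oleinik_neg H t u y = (u (Phi (- t) z).1 - act z (- t))%:E,
  superdiff (lo t u) z, subdiff u (Phi (- t) z) &
  exists i (C r : R), [/\ dom i y, 0 <= C, 0 < r, (forall a : V, `|a - chart i y| <= r -> codom_chart i a)
   & forall w, [set lo t u] w -> forall a b : V, `|a - chart i y| <= r -> `|b - chart i y| <= r ->
     `|w (chartV i a) - w (chartV i b)| <= C * `|a - b|]].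

(** The superdifferential of the image comes from moving the end of the minimizing orbit with its
    start fixed, the subdifferential of u from moving its start with the end fixed. The Lipschitz
    bound follows from the first variation at all points of the chart ball. *)
Lemma step_at_near (F : set (M -> R)) (D : R) (y0 : M) : equi_lip A F -> 0 <= D ->
  (forall u x y, F u -> `|u x - u y| <= D) ->
  exists2 d : R, 0 < d & \forall y \near y0, forall t u, 0 < t <= d -> F u -> step_at t u y.
Proof.
move=> LF D0 HD; have [i [r [d [K [di r0 d0 rD TS]]]]] := tstep_local tH hM cM y0 LF D0 HD.
exists d => //.
have N1 : nbhs y0 (dom i) by apply: open_nbhs_nbhs; split=> //; exact: open_dom.
have r4 : 0 < r / 4 by exact: divr_gt0.
have := chart_continuous di; move/cvgrPdist_le => /(_ (r / 4) r4) N2.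
apply: filterS (filterI N1 N2) => y [dy hy] t u td Fu; have [t0 td'] := andP td.
have [B B0 HB] := TS t td; rewrite distrC in hy; set c0 := chart i y0 in HB hy rD.
have r42 : r / 4 <= r / 2 by lra.
have Hv (b : V) q : `|b - c0| <= r / 2 ->
   lax_oleinik_neg H t u (chartV i b) = (u (orbit_end H i b q (- t)) - act (cot_coordV i (b, q)) (- t))%:E ->
   lo t u (chartV i b) = u (orbit_end H i b q (- t)) - act (cot_coordV i (b, q)) (- t).
  by rewrite /lo => _ ->.
have up (b : V) p : `|b - c0| <= r / 2 -> lo t u (chartV i b) <= u (orbit_end H i b p (- t)) - act (cot_coordV i (b, p)) (- t).
  move=> hb; have [q [_ _ lq _ _]] := HB u b Fu hb; rewrite (Hv b q hb lq) -lee_fin -lq.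
  have := lax_oleinik_le tH hM cM u (Phi (- t) (cot_coordV i (b, p))) t0.
  by rewrite (flowNK tH hM cM) cot_coordV1 /= (actN tH hM cM).
have ex (a b : V) : `|a - c0| <= r / 2 -> `|b - c0| <= r / 2 -> `|b - a| <= t -> forall q,
  lo t u (chartV i a) = u (orbit_end H i a q (- t)) - act (cot_coordV i (a, q)) (- t) ->
  (exists p, orbit_end H i b p (- t) = orbit_end H i a q (- t) /\
        `|act (cot_coordV i (b, p)) (- t) - act (cot_coordV i (a, q)) (- t) + pairing q (b - a)| <= B * `|b - a| ^+ 2) ->
  lo t u (chartV i b) - lo t u (chartV i a) <= pairing q (b - a) + B * `|b - a| ^+ 2.
  move=> ha hb hab q va [p [pE hp]]; have := up b p hb; rewrite pE => vb.
  exact: step_super_real vb va hp.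
have a2 := le_trans hy r42; set a := chart i y in hy a2.
have aV : chartV i a = y by exact: chartK.
have [q [qK dz lq VB ST]] := HB u a Fu a2.
have va := Hv a q a2 lq.
pose z := cot_coordV i (a, q).
have zE : z.1 = y by rewrite /z cot_coordV1.
have cz : cot_coord i z = (a, q) by apply: cot_coordVK; exact: codom_chart_chart.
have rr2 : r / 2 <= r by lra.
exists z; split=> //.
- by rewrite -aV lq.
- exists i, B, (Num.min t (r / 4)); split=> //; first by rewrite zE.
    by rewrite lt_min t0.
  move=> b; rewrite zE lt_min -/a => /andP[hbt hbr].
  have hb : `|b - c0| <= r / 2 by apply: le_trans (dist_tri (ltW hbr) hy) _; lra.
  split; first by apply: rD; exact: le_trans hb rr2.
  rewrite cz /= -aV; apply: (ex a b a2 hb (ltW hbt) q va); apply: VB; [exact: ltW|exact: le_trans hb rr2].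
- have [e e0 He] := ST; exists i, B, e; split=> //.
  have xE : (cot_coord i (Phi (- t) z)).1 = chart i (Phi (- t) z).1 by exact: cot_coord1.
  move=> b hb; have [|cb [p [pE hp]]] := He b.
    by apply: ltW; move: hb; rewrite /= -xE.
  split=> //; rewrite cot_coord_opp /= -xE.
  have h1 := lax_oleinik_le tH hM cM u (cot_coordV i (b, p)) t0.
  rewrite -[(Phi t (cot_coordV i (b, p))).1]/(orbit_end H i b p t) pE lq lee_fin cot_coordV1 /= in h1.
  have e1 : act (cot_coordV i (cot_coord i (Phi (- t) z))) t = - act z (- t).
    by rewrite (cot_coordK dz) (actN tH hM cM).
  exact: (step_sub_real e1 h1 hp (pairingNl _ _)).
- pose rho := Num.min (t / 2) (r / 4).
  have rho0 : 0 < rho by rewrite lt_min r4 divr_gt0.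
  have [rt rr] : rho <= t / 2 /\ rho <= r / 4 by rewrite /rho !ge_min !lexx orbT.
  have K0 : 0 <= K := le_trans (normr_ge0 q) qK.
  exists i, (n%:R * K + B * t), rho; split=> //; first by rewrite addr_ge0 ?mulr_ge0// ltW.
    move=> b hb; apply: rD; apply: le_trans (dist_tri (le_trans hb rr) hy) _; lra.
  move=> _ ->.
  have key (b b' : V) : `|b - a| <= rho -> `|b' - a| <= rho -> lo t u (chartV i b') - lo t u (chartV i b) <= (n%:R * K + B * t) * `|b' - b|.
    move=> hb hb'.
    have h1 : `|b - c0| <= r / 2 by apply: le_trans (dist_tri (le_trans hb rr) hy) _; lra.
    have h2 : `|b' - c0| <= r / 2 by apply: le_trans (dist_tri (le_trans hb' rr) hy) _; lra.
    have h3 : `|b' - b| <= t.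
      by rewrite distrC in hb; apply: le_trans (dist_tri hb' hb) _; lra.
    have [q' [q'K _ lq' VB' _]] := HB u b Fu h1.
    have := ex b b' h1 h2 h3 q' (Hv b q' h1 lq') (VB' b' h3 (le_trans h2 rr2)).
    have h4 := le_trans (ler_norm _) (pairing_bound_le q'K (lexx `|b' - b|)).
    have h5 : B * `|b' - b| ^+ 2 <= B * t * `|b' - b|.
      by rewrite expr2 mulrA; apply: ler_wpM2r => //; exact: ler_wpM2l.
    by rewrite mulrDl; move: h4 h5; lra.
  move=> b b' hb hb'; rewrite ler_norml; apply/andP; split; last exact: key.
  by have := key b b' hb hb'; rewrite distrC; lra.
Qed.

Lemma tstep (F : set (M -> R)) : connected [set: M] -> equi_lip A F ->
  exists2 d : R, 0 < d & forall t u y, 0 < t <= d -> F u -> step_at t u y.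
Proof.
move=> kM LF; have [D D0 HD] := equi_lip_osc cM kM LF.
have [d d0 Hd] := @compact_unif R M [set: M] (fun d y => forall t u, 0 < t <= d -> F u -> step_at t u y) cM
  (ltac:(by move=> a b z a0 ab h t u /andP[t0 ta]; apply: h; rewrite t0 (le_trans ta)))
  (fun y _ => step_at_near y LF D0 HD).
by exists d => // t u y td Fu; exact: Hd.
Qed.

Lemma step_lip t u : (forall y, step_at t u y) -> equi_lip A [set lo t u].
Proof. by move=> S x; have [z [_ _ _ _ h]] := S x. Qed.

End Subsolutions.

(** * Steps of one Hamiltonian on subsolutions of the other *)

Section CommutingStep.
Variables (R : realType) (n : nat) (M : ptopologicalType) (A : C2atlas R n M).
Variables (g : riemannian A) (G H : cotangent A -> R).
Hypotheses (tG : tonelli g G) (tH : tonelli g H) (GH : poisson_commute G H).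
Hypotheses (hM : hausdorff_space M) (cM : compact [set: M]).

(* The orbit realizing the step joins a subdifferential of u to a superdifferential of its image, and G is conserved on it. *)
Lemma step_subsol t u al : (forall y, step_at H t u y) -> subsolution (A := A) G al u -> subsolution (A := A) G al (lo (A := A) H t u).
Proof.
move=> S Su; apply: (superdiff_subsol tG (step_lip S)) => y; have [z [zE _ S1 S2 _]] := S y.
exists z; split=> //; rewrite -(flow_first_integral tH hM cM (tonelli_C2 tG) GH (- t) z).
exact: (subsol_subdiff tG hM cM Su S2).
Qed.

End CommutingStep.

(** * Reversal of time *)

Section Reversal.
Variables (R : realType) (n : nat) (M : ptopologicalType) (A : C2atlas R n M).
Local Notation V := 'rV[R]_n.
Local Notation E := ('rV[R]_n * 'rV[R]_n)%type.
Implicit Types (i : chart_index A) (h : E -> R) (G H : cotangent A -> R).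

Definition flip (a : E) : E := (a.1, - a.2).

Lemma flip_shift (s : R) (w a : E) : flip (s *: w + a) = s *: flip w + flip a.
Proof. by apply: injective_projections => //=; rewrite opprD scalerN. Qed.

Lemma derive_flip h w a : 'D_w (h \o flip) a = 'D_(flip w) h (flip a).
Proof. by apply: derive_line_eq => s /=; rewrite flip_shift. Qed.

Lemma flip_linear : linear flip.
Proof. by move=> s w a; rewrite flip_shift. Qed.

Lemma flip_continuous : continuous flip.
Proof.
move=> a; apply: (@lip_continuous _ _ _ _ _ 1 1) => // q _; rewrite mul1r; apply: norm_pair_le => /=.
  exact: (norm_fst (q - a)).
by rewrite -opprD normrN; exact: (norm_snd (q - a)).
Qed.

Lemma flip_differentiable a : differentiable flip a.
Proof.
pose f : {linear E -> E} := HB.pack flip (GRing.isLinear.Build R E E _ flip flip_linear).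
have cf : continuous f by exact: flip_continuous.
exact: (@linear_differentiable R E E f a cf).
Qed.

Lemma C1_flip h (D : set E) : (forall a, D (flip a) <-> D a) -> C1_on D h -> C1_on D (h \o flip).
Proof.
move=> DF Hh a Da; have Da' : D (flip a) by apply/DF.
have [d1 c1] := Hh _ Da'; split.
  by apply: differentiable_comp; [exact: flip_differentiable|exact: d1].
move=> w; have -> : (fun y => 'D_w (h \o flip) y) = (fun y => 'D_(flip w) h y) \o flip.
  by apply/funext => y; exact: derive_flip.
by apply: continuous_comp; [exact: flip_continuous|exact: c1].
Qed.

Transparent cot_coordV.
Lemma cot_coordV_flip i (a : E) : cot_coordV i (flip a) = ((cot_coordV i a).1, - (cot_coordV i a).2) :> cotangent A.
Proof. by rewrite /cot_coordV /flip /= mulNmx. Qed.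
Opaque cot_coordV.

Lemma local_rep_reversed H i : local_rep (reversed H) i = local_rep H i \o flip.
Proof. by apply/funext => a; rewrite /local_rep /reversed /= cot_coordV_flip. Qed.

Lemma C2_reversed H i : C2_on (cot_codom (A := A) i) (local_rep H i) -> C2_on (cot_codom (A := A) i) (local_rep (reversed H) i).
Proof.
have DF (a : E) : cot_codom (A := A) i (flip a) <-> cot_codom (A := A) i a by [].
move=> [h1 h2]; rewrite local_rep_reversed; split; first exact: (C1_flip DF h1).
move=> w; have -> : (fun y => 'D_w (local_rep H i \o flip) y) = (fun y => 'D_(flip w) (local_rep H i) y) \o flip.
  by apply/funext => y; exact: derive_flip.
exact: (C1_flip DF (h2 _)).
Qed.

Lemma tonelli_reversed (g : riemannian A) H : tonelli g H -> tonelli g (reversed H).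
Proof.
have tN x (v : V) : tnorm g x (- v) = tnorm g x v by rewrite /tnorm linearN /= mulmxN !mulNmx opprK.
have cN x (p : V) : conorm g x (- p) = conorm g x p.
  rewrite /conorm; congr sup; apply/seteqP; split=> [_ [v hv <-]|_ [v hv <-]]; exists (- v) => //=; rewrite ?tN//.
    by rewrite pairingNr pairingNl.
  by rewrite pairingNl pairingNr opprK.
move=> [h1 h2 h3 h4]; split.
- by move=> i; exact: C2_reversed.
- move=> K K0; have [C HC] := h2 K K0; exists C => x p; have := HC x (- p); rewrite cN; exact.
- move=> r r0; have -> : [set (reversed H z)%:E | z in [set z | (conorm g z.1 z.2 <= r)%R]] =
     [set (H z)%:E | z in [set z | (conorm g z.1 z.2 <= r)%R]]; last exact: h3.
  apply/seteqP; split=> [_ [[x p] /= hp <-]|_ [[x p] /= hp <-]]; exists (x, - p) => //=; rewrite ?cN//.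
  by rewrite /reversed /= opprK.
- move=> x p w w0; have := h4 x (- p) (- w); rewrite oppr_eq0 => /(_ w0).
  have e1 (q : V) : 'D_w (fun q' : V => reversed H (x, q')) q = 'D_(- w) (fun q' : V => H (x, q')) (- q).
    by apply: derive_line_eq => s; rewrite /reversed /= opprD scalerN.
  have -> : 'D_w (fun q => 'D_w (fun q' : V => reversed H (x, q')) q) p = 'D_(- w) (fun q => 'D_(- w) (fun q' : V => H (x, q')) q) (- p).
    by apply: derive_line_eq => s; rewrite e1 opprD scalerN.
  by [].
Qed.

Lemma gx_flip h a : gx (h \o flip) a = gx h (flip a).
Proof.
apply/rowP => j; rewrite !mxE derive_flip; congr ('D_ _ h _).
by rewrite /flip /= oppr0.
Qed.

Lemma gp_flip h a : differentiable h (flip a) -> gp (h \o flip) a = - gp h (flip a).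
Proof.
move=> dh; apply/rowP => j; rewrite !mxE derive_flip.
have -> : flip ((0, delta_mx 0 j) : E) = - ((0, delta_mx 0 j) : E) by rewrite /flip /=; congr pair; rewrite ?oppr0.
by rewrite !deriveE// linearN.
Qed.

Lemma poisson_flip h k a : differentiable h (flip a) -> differentiable k (flip a) -> differentiable (h \o flip) a ->
  differentiable (k \o flip) a -> Omega (flip a) (ham_vf h (flip a)) (ham_vf k (flip a)) = 0 ->
  Omega a (ham_vf (h \o flip) a) (ham_vf (k \o flip) a) = 0.
Proof.
move=> dh dk dh' dk'; rewrite (ham_vfE dh) (ham_vfE dk) (ham_vfE dh') (ham_vfE dk') !OmegaE /=.
rewrite (gx_flip h) (gx_flip k) (gp_flip dh) (gp_flip dk).
by move: (gx h _) (gp h _) (gx k _) (gp k _) => p q r s; rewrite !pairingNl !pairingNr; lra.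
Qed.

Lemma poisson_reversed G H : (forall i, C2_on (cot_codom (A := A) i) (local_rep G i)) -> (forall i, C2_on (cot_codom (A := A) i) (local_rep H i)) ->
  poisson_commute G H -> poisson_commute (reversed G) (reversed H).
Proof.
move=> CG CH GH i a ca; have ca' : cot_codom i (flip a) by [].
have [dG _] := (CG i).1 _ ca'; have [dH _] := (CH i).1 _ ca'.
have [dG' _] := (C2_reversed (CG i)).1 _ ca; have [dH' _] := (C2_reversed (CH i)).1 _ ca.
have h := GH i (flip a) ca'; rewrite !local_rep_reversed in dG' dH' *.
exact: poisson_flip dG dH dG' dH' h.
Qed.

Lemma reversedK H : reversed (reversed H) = H.
Proof. by apply/funext => -[x p]; rewrite /reversed /= opprK. Qed.

Lemma eps_collect (C e h df dn al f1 u1 u0 v1 a1 N : R) : 0 <= C -> 0 < h ->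
  h * df <= e * h + (u1 - u0) - al * h -> u1 - v1 <= C * N -> N <= 2 * (e * h) -> v1 - u0 <= a1 + h * al ->
  a1 - h * dn <= e * h -> df <= dn + (2 + 2 * C) * e.
Proof.
move=> C0 h0 h1 h2 h3 h4 h5; have h6 := ler_wpM2l C0 h3.
have : h * df <= h * (dn + (2 + 2 * C) * e) by lra.
by rewrite ler_pM2l.
Qed.

Variables (g : riemannian A) (H : cotangent A -> R).
Hypothesis tH : tonelli g H.
Hypotheses (hM : hausdorff_space M) (cM : compact [set: M]).

(* Run the curve backward: it is tangent to the orbit of the covector with the opposite velocity. *)
Lemma subsol_reversed al u : subsolution (A := A) H al u -> subsolution (A := A) (reversed H) al (fun y => - u y).
Proof.
move=> Su; have LF := subsol_equi_lip tH hM cM al.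
apply: subsol_intro => c t t0 Ac; pose f s := - u (c s) + - al * s.
have -> : - u (c t) - - u (c 0) - t * al = f t - f 0 by rewrite /f; lra.
have Lu : equi_lip A [set (fun y => - u y)].
  move=> x; have [i [C [r [h1 h2 h3 h4 h5]]]] := LF x; exists i, C, r; split=> // _ -> a b ha hb.
  by have -> : forall x y : R, - x - - y = - (x - y) by [move=> x' y'; rewrite opprB opprK addrC]; rewrite normrN; exact: h5.
have Af : ac f 0 t.
  apply: acD; first exact: (lip_comp_ac t0 Lu Ac).
  apply: acM => //; last exact: ac_id.
  by apply: (@ac_lip _ _ 0) => // s s' _ _ _; rewrite subrr normr0 mul0r.
apply: (action_ge (tonelli_reversed tH) t0 Ac Af) => s st cs.
have [i [C [r [di C0 r0 rD HL]]]] := LF (c s); exists i => // w df Dw Df.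
have [q qE] := gp_surj tH (- w) di; set x0 := chart i (c s) in qE rD HL.
pose z := cot_coordV i (x0, q).
have cz : cot_coord i z = (x0, q) by apply: cot_coordVK; exact: codom_chart_chart.
have z1 : z.1 = c s by rewrite /z cot_coordV1 /= chartK.
have dz : dom i (ham_flow H 0 z).1 by rewrite (flow0 tH hM cM) z1.
have Dz := base_derive tH hM cM dz; rewrite (flow0 tH hM cM) cz qE in Dz.
have F := fenchel (tonelli_reversed tH) (- q) w di.
rewrite local_rep_reversed /= /flip /= opprK -/x0 in F.
have hz : local_rep H i (x0, q) = H z by [].
have dE : dens H z = pairing q (- w) - H z.
  by rewrite (dens_chart tH (i := i)) ?z1// cz /= qE.
apply: le_trans F; rewrite hz pairingNl -pairingNr -dE.
apply: (@le_of_eps _ _ _ (2 + 2 * C)) => [|e e0]; first by rewrite addr_ge0// mulr_ge0.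
have Da := act_derive tH hM cM z 0; rewrite (flow0 tH hM cM) in Da.
have [k1 k10 H1] := derive_expand Df e0; have [k2 k20 H2] := derive_expand Dw e0.
have [k3 k30 H3] := derive_expand Dz e0; have [k4 k40 H4] := derive_expand Da e0.
have NU : nbhs (c s) [set y | dom i y /\ `|chart i y - x0| <= r].
  have N1 : nbhs (c s) (dom i) by apply: open_nbhs_nbhs; split=> //; exact: open_dom.
  have := chart_continuous di; move/cvgrPdist_le => /(_ r r0) N2.
  by apply: filterS (filterI N1 N2) => y [? ?]; split=> //; rewrite distrC.
have [k5 /= k50 H5] := (nbhs_normP s _).1 (cs _ NU).
pose b := fst \o (ham_flow H)^~ z.
have cb : {for 0, continuous b}.
  apply: (@continuous_comp _ _ _ ((ham_flow H)^~ z) fst); first exact: (@orbit_continuous _ _ _ _ _ _ tH hM cM z).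
  exact: cot_fst_continuous.
have b0 : b 0 = c s by rewrite /b /= (flow0 tH hM cM).
have NU' : nbhs (b 0) [set y | dom i y /\ `|chart i y - x0| <= r] by rewrite b0.
have [k6 /= k60 H6] := (nbhs_normP (0 : R) _).1 (cb _ NU').
pose m := Num.min k1 (Num.min k2 (Num.min k3 (Num.min k4 (Num.min k5 k6)))).
have m0 : 0 < m by rewrite !lt_min k10 k20 k30 k40 k50.
pose h := m / 2; have h0 : 0 < h by exact: divr_gt0.
have : h < m by rewrite /h; lra.
rewrite !lt_min => /and5P[h1 h2 h3 h4 /andP[h5 h6]].
have nh : `|h| = h by rewrite gtr0_norm.
have nnh : `|- h| = h by rewrite normrN.
have [dc hc] := H5 (s - h) (ltac:(by rewrite /= opprB addrC subrK nh)).
have [db hb] := H6 h (ltac:(by rewrite /= sub0r normrN nh)).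
have := H1 (- h); rewrite nnh => /(_ h1) e1; have := H2 (- h); rewrite nnh => /(_ h2) e2.
have := H3 h; rewrite nh => /(_ h3) e3; have := H4 h; rewrite nh => /(_ h4) e4.
have e5 := HL u Su _ _ hc hb; rewrite (chartK dc) (chartK db) in e5.
have e6 := subsol_orbit tH hM cM z Su (ltW h0); rewrite z1 in e6.
have N2 : `|chart i (c (s - h)) - chart i (b h)| <= 2 * (e * h).
  have -> : chart i (c (s - h)) - chart i (b h) =
     ((chart i \o c) (s + - h) - (chart i \o c) s - - h *: w) - ((chart i \o b) (0 + h) - (chart i \o b) 0 - h *: - w).
    rewrite add0r /= b0 scalerN scaleNr !opprK opprD opprB addrACA subrr addr0 addrACA.
    by rewrite -!addrA; congr (_ + _); rewrite [in RHS]addrCA !addrA addNr add0r.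
  by apply: le_trans (ler_normB _ _) _; move: e2 e3; lra.
apply: (@eps_collect C e h df (dens H z) al 0 (u (c (s - h))) (u (c s)) (u (b h)) (act H z h) _ C0 h0 _ (le_trans (ler_norm _) e5) N2 e6).
  by move: e1; rewrite ler_norml -[_ *: df]/(_ * df) /f => /andP[_ ]; lra.
by move: e4; rewrite ler_norml (act0 tH hM cM) add0r -[_ *: dens _ _]/(_ * dens H z) => /andP[_ ]; lra.
Qed.

End Reversal.

Lemma norm_eq2 (R : realType) (V : normedModType R) (x y x' y' : V) (k : R) : x = x' -> y = y' -> `|x' - y'| <= k -> `|x - y| <= k.
Proof. by move=> -> ->. Qed.

Lemma act_cont_real (R : realType) (x0 y0 x y P Q d1 nn K' X : R) : x0 = x -> y0 = y -> 0 <= d1 -> d1 <= 1 -> 0 <= nn -> 0 <= K' -> 0 <= X ->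
  `|x0 - y0 - (P - Q)| <= X * d1 ^+ 2 -> `|P| <= nn * ((K' + 1) * (2 * d1)) ->
  `|Q| <= nn * (K' * d1) -> `|x - y| <= (2 * (nn * (K' + 1) + nn * K') + X) * d1.
Proof.
move=> <- <- d10 d11 n0 K'0 X0 q1 q2 q3; have q4 : X * d1 ^+ 2 <= X * d1.
  by apply: ler_wpM2l => //; rewrite expr2 -[leRHS]mulr1; exact: ler_wpM2l.
have q5 : 0 <= nn * (K' * d1) by rewrite !mulr_ge0.
by move: q1 q2 q3 q4 q5; rewrite !ler_norml; lra.
Qed.

(** * Calibrated orbits and the Aubry set *)

Section Calibrated.
Variables (R : realType) (n : nat) (M : ptopologicalType) (A : C2atlas R n M).
Variables (g : riemannian A) (G : cotangent A -> R).
Hypothesis tG : tonelli g G.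
Hypotheses (hM : hausdorff_space M) (cM : compact [set: M]).
Local Notation E := ('rV[R]_n * 'rV[R]_n)%type.
Local Notation Phi := (ham_flow G).
Local Notation act := (act G).
Implicit Types (i : chart_index A) (u v : M -> R) (z : cotangent A).

(** Orbits from nearby points b to the same end Phi t z are competitors: v is calibrated on the
    orbit of z and only subcalibrated on them, so the first variation bounds v b from below. *)
Lemma forward_subdiff v z (t1 : R) : subsolution (A := A) G 0 v -> 0 < t1 ->
  (forall t, 0 <= t <= t1 -> v (Phi t z).1 - v z.1 = act z t) -> subdiff v z.
Proof.
move=> Sv t10 Hz; pose i := chart_at A z.1; have di : dom i z.1 := chart_atP A _.
have dz : dom i (Phi 0 z).1 by rewrite (flow0 tG hM cM).
have D := base_derive tG hM cM dz; set w := gp _ _ in D.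
have [k k0 Hk] := derive_expand D (@ltr01 R).
have C0 : 0 <= `|w| + 2 by rewrite addr_ge0.
have [r [r0 _ r1 rD SHO]] := shooting tG hM cM di (@ltr01 R).
(* For short times the orbit moves at speed at most |w| + 1, and [base_variation] requires one unit
   more for moving the start. *)
have [K [T [L [m [K0 FB SH]]]]] := SHO (`|w| + 2) `|(cot_coord i z).2| C0 (normr_ge0 _).
have T0 := fb_T FB; pose t := Num.min (k / 2) (Num.min T t1).
have t0 : 0 < t by rewrite !lt_min T0 t10 divr_gt0.
have [tk tT tt1] : [/\ t <= k / 2, t <= T & t <= t1] by rewrite /t !ge_min !lexx !orbT.
have at0 : `|t| = t by rewrite gtr0_norm.
have aT : `|t| <= T by rewrite at0.
have aT' : 0 < `|t| <= T by rewrite at0 t0.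
have [B B0 VB] := vary_base tG hM cM FB SH aT'.
pose a := cot_coord i z; have a1 : a.1 = chart i z.1 by exact: cot_coord1.
have aE : (a.1, a.2) = a by case: a {a1}.
have ba : box (chart i z.1) r (K + 1) a.
  by split; [rewrite a1 subrr normr0 ltW|exact: ler_wpDr].
have za : cot_coordV i a = z by exact: cot_coordK.
have sp : `|(chart_flow G i a t).1 - a.1| <= (`|w| + 2 - 1) * `|t|.
  have ea := eq_trans (congr1 fst (cflow_coord G t di)) (cot_coord1 i (Phi t z)).
  apply: (norm_eq2 ea a1); rewrite at0.
  have := Hk t; rewrite at0 => /(_ (ltac:(by lra))); rewrite add0r /= (flow0 tG hM cM) mul1r => h.
  have := ler_normD (chart i (Phi t z).1 - chart i z.1 - t *: w) (t *: w); rewrite subrK normrZ at0 => h2.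
  by apply: le_trans h2 _; move: h; lra.
exists i, B, (Num.min t r); split=> //; first by rewrite lt_min t0.
move=> b; rewrite lt_min => /andP[hbt hbr].
split; first by apply: rD; apply: le_trans (ltW hbr) _; lra.
have hb1 : `|b - a.1| <= `|t| by rewrite a1 at0 ltW.
have [p [bp pE hp]] := VB a b ba sp hb1 (ltW hbr).
have ba' : box (chart i z.1) r (K + 1) (a.1, a.2) by rewrite aE.
have pE' : (chart_flow G i (b, p) t).1 = (chart_flow G i (a.1, a.2) t).1 by rewrite aE.
have e1 := orbit_end_eq FB ba' bp aT pE'.
have e2 : (Phi t (cot_coordV i (b, p))).1 = (Phi t z).1.
  by apply: eq_trans e1 _; rewrite /orbit_end aE za.
have h1 := subsol_orbit_to tG hM cM Sv (ltW t0) (cot_coordV1 i (b, p)) e2.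
have tt : 0 <= t <= t1 by rewrite ltW.
have h2 := Hz t tt; rewrite za in hp.
have e3 : (cot_coord i (opp z)).2 = - a.2 := congr1 snd (cot_coord_opp i z).
rewrite e3 pairingNl -[chart i (opp z).1]/(chart i z.1) -a1.
have real (vt va vb ac ab P X : R) : vt - va = ac -> vt - vb <= ab + t * 0 -> `|ab - ac + P| <= X -> - vb - - va <= - P + X.
  by move=> q1 q2; rewrite ler_norml => /andP[_ q3]; move: q1 q2 q3; lra.
exact: real h2 h1 hp.
Qed.

Lemma neg_weak_KAM_subsol u : neg_weak_KAM (A := A) G u -> subsolution (A := A) G 0 u.
Proof.
move=> HU; apply: subsol_intro => c t t0 Ac; have := HU t (c t) t0.
have [->|tn] := eqVneq t 0; first by rewrite /action set_itv1 integral_set1 mul0r subr0 subrr.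
rewrite /lax_oleinik_neg (negPf tn) => h; rewrite mulr0 subr0.
have : ((u (c t))%:E <= (u (c 0))%:E + action G t c)%E by rewrite h; apply: ereal_inf_lbound; exists c.
by rewrite EFinB leeBlDl.
Qed.

(** The subsolution inequalities on [0, s] and on [s, t] add up to an equality, so both are
    equalities. *)
Lemma interp_calibrated u z t s : subsolution (A := A) G 0 u -> 0 <= s <= t -> u (Phi t z).1 - u z.1 = act z t ->
  u (Phi s z).1 - u z.1 = act z s.
Proof.
move=> Su /andP[s0 st] Ht; have h1 := subsol_orbit tG hM cM z Su s0.
have ts : 0 <= t - s by rewrite subr_ge0.
have h2 := subsol_orbit tG hM cM (Phi s z) Su ts.
rewrite -(flowD tG hM cM) subrK in h2; have := actD tG hM cM z (t - s) s; rewrite subrK.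
by move: h1 h2 Ht; rewrite !mulr0 !addr0; lra.
Qed.

Lemma backward_forward u z t : u z.1 = u (Phi (- t) z).1 - act z (- t) ->
  u (Phi t (Phi (- t) z)).1 - u (Phi (- t) z).1 = act (Phi (- t) z) t.
Proof. by rewrite (flowNK tG hM cM) (actN tG hM cM) => ->; lra. Qed.

Lemma interp_backward u z t s : subsolution (A := A) G 0 u -> 0 <= s <= t -> u z.1 = u (Phi (- t) z).1 - act z (- t) ->
  u z.1 = u (Phi (- s) z).1 - act z (- s).
Proof.
move=> Su /andP[s0 st] /backward_forward h.
have st' : 0 <= t - s <= t by apply/andP; split; lra.
have := interp_calibrated Su st' h.
rewrite -(flowD tG hM cM) => e; have e1 : t - s + - t = - s by lra.
rewrite e1 in e; move: h; rewrite (flowNK tG hM cM) => h.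
have := actD tG hM cM z (t - s) (- t); rewrite e1 (actN tG hM cM) in h * => h3.
by move: h e h3; lra.
Qed.

(* A sub- and a superdifferential at the same point coincide, so that consecutive steps glue into one orbit. *)
Lemma fixed_chain u t : (forall y, step_at G t u y) -> (forall y, lo G t u y = u y) -> forall y, exists z,
  [/\ z.1 = y, superdiff u z & forall k : nat, u y = u (Phi (- (k%:R * t)) z).1 - act z (- (k%:R * t))].
Proof.
move=> S E y; have El : lo G t u = u by apply/funext.
have loE y' z' : lax_oleinik_neg G t u y' = (u (Phi (- t) z').1 - act z' (- t))%:E -> u y' = u (Phi (- t) z').1 - act z' (- t).
  by move=> h; rewrite -[LHS]E /lo h.
have [z [zE lz S1 S2 _]] := S y; rewrite El in S1; have lz' := loE _ _ lz.
exists z; split=> // -[|k].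
  by rewrite mul0r oppr0 (flow0 tG hM cM) (act0 tG hM cM) subr0 zE.
suff : u y = u (Phi (- (k.+1%:R * t)) z).1 - act z (- (k.+1%:R * t)) /\ subdiff u (Phi (- (k.+1%:R * t)) z) by case.
elim: k => [|k [IH1 IH2]]; first by rewrite mul1r.
have [z' [zE' /loE lz2 S1' S2' _]] := S (Phi (- (k.+1%:R * t)) z).1; rewrite El in S1'.
have e : z' = Phi (- (k.+1%:R * t)) z by apply: (sub_superdiff_eq S1').
subst z'; have e2 : - (k.+2%:R * t) = - t + - (k.+1%:R * t) by rewrite -[k.+2]addn1 natrD mulrDl mul1r opprD addrC.
rewrite e2 (flowD tG hM cM); split=> //.
by rewrite (actD tG hM cM) IH1 lz2; lra.
Qed.

(** A short time d is fixed for which steps are realized by orbits; u is invariant under it, so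
    [fixed_chain] gives calibration at all multiples of d, and interpolation at the times
    between. *)
Lemma backward_orbit u : connected [set: M] -> neg_weak_KAM (A := A) G u -> forall y, exists z,
  [/\ z.1 = y, superdiff u z & forall s, 0 <= s -> u z.1 = u (Phi (- s) z).1 - act z (- s)].
Proof.
move=> kM HU y; have Su := neg_weak_KAM_subsol HU.
have LF : equi_lip A [set u] by apply: equi_lip_sub (subsol_equi_lip tG hM cM 0) => _ ->.
have [d d0 Hd] := tstep tG hM cM kM LF; have dd : 0 < d <= d by rewrite d0 lexx.
have E y' : lo G d u y' = u y' by rewrite /lo -(HU d y' (ltW d0)).
have [z [zE S1 Hz]] := fixed_chain (fun y => Hd d u y dd erefl) E y.
exists z; split=> // s s0; have [k Hk] : exists k : nat, s <= k%:R * d.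
  exists (Num.truncn (s / d)).+1; rewrite -ler_pdivrMr//; apply: ltW; exact: truncnS_gt.
by apply: (interp_backward Su (_ : 0 <= s <= k%:R * d)); rewrite ?s0// zE; exact: Hz.
Qed.

Lemma act_continuous_small z : exists2 d : R, 0 < d & \forall w \near z, forall t, `|t| <= d -> {for w, continuous (act^~ t)}.
Proof.
pose i := chart_at A z.1; have di : dom i z.1 := chart_atP A _.
have [K [r [T [L [m [FB _ N]]]]]] := flow_box_at tG hM cM di.
exists T; first exact: (fb_T FB).
have NI : nbhs z (interior [set w : cotangent A | dom i w.1 /\ box (chart i z.1) r K (cot_coord i w)]).
  by apply: nbhs_interior; exact: N.
apply: (@filterS _ (nbhs z) (nbhs_filter z) _ _ _ NI) => w Iw t tT.
have [dw bw] := interior_subset Iw.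
pose f (b : E) := act (cot_coordV i b) t; set a := cot_coord i w in bw.
have L0 := fb_L FB; pose X := 4 * (1 + n%:R) * L * `|t|.
have X0 : 0 <= X by rewrite !mulr_ge0// addr_ge0.
pose N' := 2 * (n%:R * (K + 1) + n%:R * K) + X.
apply/(@cvgrPdist_le _ _ _ (nbhs w) (nbhs_filter w)) => e e0.
have K0 : 0 <= K := le_trans (normr_ge0 _) bw.2.
have N0 : 0 < N' + 1 by rewrite /N' -addrA ltr_wpDl// ?mulr_ge0 ?addr_ge0 ?mulr_ge0 ?addr_ge0// ltr_wpDl.
have cc : \forall w' \near w, `|a - cot_coord i w'| <= Num.min 1 (e / (N' + 1)).
  have := cot_coord_continuous dw; move/cvgrPdist_le; apply.
  by rewrite lt_min ltr01 divr_gt0.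
apply: (@filterS _ (nbhs w) (nbhs_filter w) _ _ _ (filterI cc Iw)) => w' [].
rewrite le_min => /andP[h1 he] [dw' bw'].
have ad := act_diff tG hM cM FB bw bw' tT.
have c2 := cflow_le2 FB bw bw' tT; have [_ p2] := fb_box FB bw tT.
rewrite distrC in h1; rewrite distrC in he.
have b1 := pairing_bound_le p2 (le_trans (norm_fst (chart_flow G i (cot_coord i w') t - chart_flow G i a t)) c2).
have b2 := pairing_bound_le bw.2 (norm_fst (cot_coord i w' - a)).
rewrite distrC.
have e1 := congr1 (act^~ t) (cot_coordK dw'); have e2 := congr1 (act^~ t) (cot_coordK dw).
apply: le_trans (act_cont_real e1 e2 (normr_ge0 _) h1 (ler0n R n) K0 X0 ad b1 b2) _.
by apply: (scale_le (normr_ge0 _) N0 he).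
Qed.

Lemma act_continuous t : continuous (act^~ t).
Proof.
move=> z; have cK : compact [set z' | G z' <= G z] by exact: (sublevel_compact tG cM).
pose P (d : R) (z' : cotangent A) := forall t, `|t| <= d -> {for z', continuous (act^~ t)}.
have Pm (a b : R) (z' : cotangent A) : 0 < a -> a <= b -> P b z' -> P a z' by move=> a0 ab h s sa; apply: h; exact: le_trans ab.
have [d d0 Hd] := @compact_unif R (cotangent A) _ P cK Pm (fun z' _ => act_continuous_small z').
have [k Hk] : exists k : nat, `|t| <= k.+1%:R * d.
  exists (Num.truncn (`|t| / d)); rewrite -ler_pdivrMr//; apply: ltW; exact: truncnS_gt.
pose s := t / k.+1%:R; have k0 : (k.+1%:R : R) != 0 by rewrite pnatr_eq0.
have sd : `|s| <= d by rewrite /s normrM normfV (ger0_norm (ler0n R k.+1)) ler_pdivrMr ?ltr0n// mulrC.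
have -> : t = k.+1%:R * s by rewrite /s mulrCA divff// mulr1.
elim: (k.+1) => [|j IH].
  have e : act^~ (0%:R * s) = (fun=> 0) by apply/funext => w; rewrite mul0r; exact: (act0 tG hM cM).
  by rewrite /continuous_at e mul0r (act0 tG hM cM); move=> U /= NU; apply: (@filterE _ (nbhs z) (nbhs_filter z)) => w; exact: (nbhs_singleton NU).
have -> : act^~ (j.+1%:R * s) = (fun w => act w (j%:R * s) + act (Phi (j%:R * s) w) s).
  by apply/funext => w; rewrite -(actD tG hM cM) -natr1 mulrDl mul1r addrC.
apply: (@cvgD _ _ _ (nbhs z)); first exact: IH.
apply: (@continuous_comp _ _ _ (Phi (j%:R * s)) (act^~ s)); first exact: (@flow_continuous _ _ _ _ _ _ tG hM cM _ _).
by apply: Hd => //=; rewrite (flow_energy tG hM cM).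
Qed.

Lemma cluster_value (T : topologicalType) (F : set_system T) (f : T -> R) (l : R) (p : T) : ProperFilter F ->
  {for p, continuous f} -> f x @[x --> F] --> l -> cluster F p -> f p = l.
Proof.
move=> PF cf fl cp; apply/eqP; rewrite -subr_eq0 -normr_le0; apply/ler_addgt0Pr => e e0; rewrite add0r.
have e2 : 0 < e / 2 by exact: divr_gt0.
move/cvgrPdist_le: fl => /(_ _ e2) N1; have := cf; move/cvgrPdist_le => /(_ _ e2) N2.
have [x [h1 h2]] := cp _ _ N1 N2.
by have := ler_normD (f p - f x) (f x - l); rewrite addrA subrK (distrC (f x)); move: h1 h2; lra.
Qed.

Lemma base_comp_continuous u t : continuous u -> continuous (fun z : cotangent A => u (Phi t z).1).
Proof.
move=> cu z; apply: (@continuous_comp _ _ _ (fun z => (Phi t z).1) u); last exact: cu.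
apply: (@continuous_comp _ _ _ (Phi t) fst); first exact: (@flow_continuous _ _ _ _ _ _ tG hM cM _ _).
exact: cot_fst_continuous.
Qed.

(** The Aubry set lifted to the cotangent bundle, described by the forward calibration of all
    subsolutions of level 0 at once. *)
Definition aubry : set (cotangent A) := [set z | forall w, subsolution (A := A) G 0 w ->
  forall t, 0 <= t -> w (Phi t z).1 - w z.1 = act z t].

Lemma subsol_continuous al u : subsolution (A := A) G al u -> continuous u.
Proof. by move=> Su; apply: (@equi_lip_continuous _ _ _ A); apply: equi_lip_sub (subsol_equi_lip tG hM cM al) => _ ->. Qed.

(* Along a backward calibrated orbit u - w is monotone for every subsolution w, hence constant on the limit set. *)
Lemma alpha_limit u z : subsolution (A := A) G 0 u -> (forall s, 0 <= s -> u z.1 = u (Phi (- s) z).1 - act z (- s)) ->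
  exists2 p, aubry p & cluster ((fun k : nat => Phi (- k%:R) z) @ \oo) p.
Proof.
move=> Su Hz; have cu := subsol_continuous Su.
pose x (k : nat) := Phi (- k%:R) z.
have [p [_ cp]] : [set z' | G z' <= G z] `&` cluster (x @ \oo) !=set0.
  have FK : (x @ \oo) [set z' | G z' <= G z].
    by exists 0%N => // k _; rewrite /= (flow_energy tG hM cM); exact: lexx.
  have cK : compact [set z' | G z' <= G z] by exact: (sublevel_compact tG cM).
  exact: (cK (x @ \oo) _ FK).
exists p => // w Sw t t0; have cw := subsol_continuous Sw.
pose f s := u (Phi (- s) z).1 - w (Phi (- s) z).1.
have fm (a b : R) : 0 <= a -> a <= b -> f b <= f a.
  move=> a0 ab; have ba : 0 <= b - a by rewrite subr_ge0.
  have h := subsol_orbit tG hM cM (Phi (- b) z) Sw ba.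
  rewrite -(flowD tG hM cM) in h; have e : b - a + - b = - a by lra.
  rewrite e in h; have := actD tG hM cM z (b - a) (- b); rewrite e => h2.
  have := Hz a a0; have := Hz b (le_trans a0 ab); rewrite /f; move: h h2; rewrite mulr0 addr0; lra.
have [m Hm] : exists m, forall s, 0 <= s -> m <= f s.
  have cf : continuous (fun y => u y - w y) by move=> y; apply: cvgB; [exact: cu|exact: cw].
  have ne : [set: M] !=set0 by exists z.1.
  have [c _ Hc] := compact_min ne cM (fun a _ => cf a).
  by exists (u c - w c) => s _; exact: Hc.
pose fk (k : nat) := f k%:R.
have [l fl] : exists l : R, fk k @[k --> \oo] --> l.
  exists (inf (range fk)); apply: nonincreasing_cvgn => //.
    by move=> j k jk; apply: fm => //; rewrite ler_nat.
  by exists m => _ [k _ <-]; exact: Hm.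
have flt : f (k%:R - t) @[k --> \oo] --> l.
  have [N HN] : exists N : nat, t <= N%:R by exists (Num.truncn t).+1; apply: ltW; exact: truncnS_gt.
  apply: (@squeeze_cvgr _ _ _ _ fk (fun k => fk (k - N)%N)); last first.
  - apply/cvgrPdist_le => e e0; move/cvgrPdist_le: fl => /(_ e e0)[j _ Hj]; exists (j + N)%N => // k /= jk.
    by apply: Hj; rewrite /= leq_subRL ?(leq_trans (leq_addl _ _) jk)// addnC.
  - exact: fl.
  near=> k; have Nk : (N <= k)%N by near: k; exact: nbhs_infty_ge.
  have kt : 0 <= (k%:R : R) - t by rewrite subr_ge0 (le_trans HN)// ler_nat.
  by apply/andP; split; apply: fm => //; [lra|rewrite natrB//; lra].
have e1 : u p.1 - w p.1 = l.
  have c0 : {for p, continuous (fun q : cotangent A => u q.1 - w q.1)}.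
    by apply: (@cvgB _ _ _ (nbhs p)); [exact: (cvg_comp _ _ (@cot_fst_continuous _ _ _ A p) (cu p.1))|exact: (cvg_comp _ _ (@cot_fst_continuous _ _ _ A p) (cw p.1))].
  exact: (cluster_value _ c0 fl cp).
have e2 : u (Phi t p).1 - w (Phi t p).1 = l.
  have c0 : {for p, continuous (fun q : cotangent A => u (Phi t q).1 - w (Phi t q).1)}.
    by apply: (@cvgB _ _ _ (nbhs p)); exact: base_comp_continuous.
  have fE : (fun k : nat => f (k%:R - t)) = (fun k => u (Phi t (x k)).1 - w (Phi t (x k)).1).
    by apply/funext => k; rewrite /f /x -(flowD tG hM cM) opprB.
  rewrite fE in flt; exact: (cluster_value _ c0 flt cp).
have e3 : u (Phi t p).1 - u p.1 - act p t = 0.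
  have c0 : {for p, continuous (fun q : cotangent A => u (Phi t q).1 - u q.1 - act q t)}.
    apply: (@cvgB _ _ _ (nbhs p)); last exact: act_continuous.
    by apply: (@cvgB _ _ _ (nbhs p)); [exact: base_comp_continuous|exact: (cvg_comp _ _ (@cot_fst_continuous _ _ _ A p) (cu p.1))].
  suff c1 : u (Phi t (x k)).1 - u (x k).1 - act (x k) t @[k --> \oo] --> (0 : R) by exact: (cluster_value _ c0 c1 cp).
  apply: cvg_near_cst; near=> k.
  have kt : t <= k%:R by near: k; exact: nbhs_infty_ger.
  rewrite -(flowD tG hM cM); have a0 : 0 <= (k%:R : R) - t by rewrite subr_ge0.
  have e : t + - k%:R = - ((k%:R : R) - t) by lra.
  have := actD tG hM cM z t (- k%:R); rewrite e.
  by have := Hz _ a0; have := Hz k%:R (ler0n R k); lra.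
by move: e1 e2 e3; lra.
Unshelve. all: by end_near.
Qed.

End Calibrated.

(** * The Aubry set of one Hamiltonian and the flow of the other *)

Section CommutingPair.
Variables (R : realType) (n : nat) (M : ptopologicalType) (A : C2atlas R n M).
Variables (g : riemannian A) (G H : cotangent A -> R).
Hypotheses (tG : tonelli g G) (tH : tonelli g H) (GH : poisson_commute G H).
Hypotheses (hM : hausdorff_space M) (cM : compact [set: M]) (kM : connected [set: M]).
Local Notation E := ('rV[R]_n * 'rV[R]_n)%type.
Local Notation PhiH := (ham_flow H).
Local Notation Gsub := [set u : M -> R | subsolution (A := A) G 0 u].
Implicit Types (i : chart_index A) (u v w : M -> R) (z : cotangent A).

Lemma aubry_subdiff w z : aubry G z -> Gsub w -> subdiff w z.
Proof. by move=> Az Sw; apply: (forward_subdiff tG hM cM Sw ltr01) => t /andP[t0 _]; exact: Az. Qed.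

Lemma Omega_anti (a v w : E) : Omega a v w = 0 -> Omega a w v = 0.
Proof. by rewrite !OmegaE; lra. Qed.

Lemma poisson_sym : poisson_commute H G.
Proof. move=> i a ca; exact: Omega_anti (GH ca). Qed.

Lemma limit_value z p : cluster (ham_flow G (- k%:R) z @[k --> \oo]) p -> H p = H z.
Proof.
move=> cp; have c1 : H (ham_flow G (- k%:R) z) @[k --> \oo] --> H z.
  have -> : (fun k : nat => H (ham_flow G (- k%:R) z)) = (fun=> H z); last exact: cvg_cst.
  by apply/funext => k; rewrite (flow_first_integral tG hM cM (tonelli_C2 tH) poisson_sym).
exact: (cluster_value _ (@ham_continuous _ _ _ _ _ _ tH p) c1 cp).
Qed.

Lemma cluster_ge (T : topologicalType) (F : set_system T) (f : T -> R) (c : R) (p : T) :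
  {for p, continuous f} -> F [set x | c <= f x] -> cluster F p -> c <= f p.
Proof.
move=> cf Fc cp; apply/ler_addgt0Pr => e e0; have := cf; move/cvgrPdist_le => /(_ e e0) N.
have [x [/= h1 h2]] := cp _ _ Fc N; move: h2; rewrite ler_norml => /andP[h2 _]; lra.
Qed.

Section Step.
Variable t : R.
Hypotheses (t0 : 0 < t) (St : forall s u y, 0 < s <= t -> Gsub u -> step_at H s u y).

Lemma step_sub s w : 0 < s <= t -> Gsub w -> Gsub (lo (A := A) H s w).
Proof. by move=> st Sw; apply: (step_subsol tG tH GH hM cM _ Sw) => y; exact: St. Qed.

(** The step supplies a superdifferential of the image at the same base point; it must coincide with
    the given subdifferential z, so the minimizing orbit is the one that ends at z. *)
Lemma step_meet s w z : 0 < s <= t -> Gsub w -> subdiff (lo H s w) z ->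
  lo H s w z.1 = w (PhiH (- s) z).1 - act H z (- s) /\ subdiff w (PhiH (- s) z).
Proof.
move=> st Sw S; have [z' [zE lz S1 S2 _]] := St z.1 st Sw.
have e := sub_superdiff_eq S1 S zE; subst z'.
by split=> //; rewrite /lo lz.
Qed.

Lemma aubry_step s w z : aubry G z -> 0 < s <= t -> Gsub w ->
  lo H s w z.1 = w (PhiH (- s) z).1 - act H z (- s) /\ subdiff w (PhiH (- s) z).
Proof. by move=> Az st Sw; apply: step_meet => //; apply: aubry_subdiff Az _; exact: step_sub. Qed.

(* At every intermediate point w is subdifferentiable with the covector of the orbit,
   hence it is differentiable along the orbit almost everywhere with the expected derivative. *)
Lemma aubry_value s w z : aubry G z -> 0 < s <= t -> Gsub w -> lo H s w z.1 = w z.1 - s * H z.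
Proof.
move=> Az /andP[s0 st] Sw; have [-> _] := aubry_step Az (introT andP (conj s0 st)) Sw.
set z1 := PhiH (- s) z; have Lw : equi_lip A [set w] by apply: equi_lip_sub (subsol_equi_lip tG hM cM 0) => _ ->.
pose c := fst \o PhiH^~ z1; pose f r := w (c r) - act H z1 r + - H z * r.
have Ac := base_ac tH hM cM z1 s.
have Aact : ac (act H z1) 0 s.
  have Dz r : is_derive r (1 : R) (act H z1) (dens H (PhiH r z1)) by exact: (act_derive tH hM cM).
  exact: (ac_C1 (ltW s0) (@dens_orbit_continuous _ _ _ _ _ _ tH hM cM z1) Dz).
have acst k : ac (fun _ : R => k) 0 s by apply: (@ac_lip _ _ 0) => // r r' _ _ _; rewrite subrr normr0 mul0r.
have Af : ac f 0 s.
  apply: acD; last by apply: acM => //; [exact: ltW|exact: ac_id].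
  apply: acD; first exact: (lip_comp_ac (ltW s0) Lw Ac).
  by apply: (ac_eq _ (acM (ltW s0) (acst (-1)) Aact)) => r _; rewrite mulN1r.
have Anf : ac (fun r => - f r) 0 s.
  by apply: (ac_eq _ (acM (ltW s0) (acst (-1)) Af)) => r _; rewrite mulN1r.
have Df0 r df : 0 < r < s -> is_derive r (1 : R) f df -> df = 0.
  move=> /andP[r0 rs] Df; pose zr := PhiH r z1.
  have rst : 0 < s - r <= t by apply/andP; split; lra.
  have [_ Sz] := aubry_step Az rst Sw.
  have zE : PhiH (- (s - r)) z = zr by rewrite /zr /z1 -(flowD tH hM cM); congr (PhiH _ z); lra.
  rewrite zE in Sz.
  have cc : {for r, continuous c}.
    apply: (@continuous_comp _ _ _ (PhiH^~ z1) fst); first exact: (@orbit_continuous _ _ _ _ _ _ tH hM cM z1).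
    exact: cot_fst_continuous.
  pose i := chart_at A zr.1; have di : dom i zr.1 := chart_atP A _.
  have D := base_derive tH hM cM di.
  have Dw : is_derive r (1 : R) (fun r => - w (c r)) (- (df + dens H zr + H z)).
    have D2 : is_derive r (1 : R) (fun x : R => H z * x) (H z).
      by have := is_derive_affine 0 (H z) r; under eq_fun => x do rewrite add0r /GRing.scale/= mulrC.
    have e : (fun r => - w (c r)) = (fun x => - (f x + act H z1 x + H z * x)) by apply/funext => x; rewrite /f; lra.
    rewrite e; exact: (is_deriveN (is_deriveD (is_deriveD Df (act_derive tH hM cM z1 r)) D2)).
  have h := superdiff_derive Sz (erefl : c r = (opp zr).1) cc (di : dom i (opp zr).1) D Dw.
  have e2 : (cot_coord i (opp zr)).2 = - (cot_coord i zr).2 := congr1 snd (cot_coord_opp i zr).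
  rewrite e2 pairingNl -/zr in h.
  have Hz : H zr = H z by rewrite /zr /z1 !(flow_energy tH hM cM).
  have hd := dens_chart tH di; rewrite Hz in hd; move: h hd.
  by move: (pairing _ _) (dens H zr) (H z) => P Q S h1 h2; lra.
have le0 k : ac k 0 s -> (forall r df, 0 < r < s -> is_derive r (1 : R) k df -> df = 0) -> k s - k 0 <= 0.
  move=> Ak Hk; rewrite -lee_fin; apply: le_trans (ac_lower_bound (F := fun=> 0) (C := 0) (ltW s0) Ak _ _) _.
  - by move=> r _; rewrite oppr0.
  - apply: (@filterE _ _ (ae_filter_ringOfSetsType (@lebesgue_measure R))) => r rs df Df.
    by rewrite (Hk r df rs Df).
  - by rewrite integral0.
have l1 := le0 f Af Df0.
have l2 : - f s - - f 0 <= 0.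
  apply: (le0 (fun r => - f r) Anf) => r df rs D; apply/eqP; rewrite -oppr_eq0; apply/eqP; apply: (Df0 r _ rs).
  by have -> : f = (fun x => - - f x) by [apply/funext => x; rewrite opprK]; exact: is_deriveN D.
move: l1 l2; rewrite /f (act0 tH hM cM) /c /= (flow0 tH hM cM) {1 3}/z1 (flowNK tH hM cM) (actN tH hM cM).
by rewrite -/z1; lra.
Qed.

Lemma iter_sub s k w : 0 < s <= t -> Gsub w -> Gsub (iter k (lo (A := A) H s) w).
Proof. by move=> st Sw; elim: k => //= k IH; exact: step_sub. Qed.

Lemma aubry_iter s k w z : aubry G z -> 0 < s <= t -> Gsub w -> iter k (lo (A := A) H s) w z.1 = w z.1 - k%:R * (s * H z).
Proof.
move=> Az st Sw; elim: k => [|k IH]; first by rewrite mul0r subr0.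
rewrite iterS (aubry_value Az st (iter_sub k st Sw)) IH -natr1; lra.
Qed.

(** The start of each step is a subdifferential of the function before it, which is what [step_meet]
    needs to continue backward along the same orbit. *)
Lemma aubry_chain s k w z : aubry G z -> 0 < s <= t -> Gsub w ->
  iter k (lo (A := A) H s) w z.1 = w (PhiH (- (k%:R * s)) z).1 - act H z (- (k%:R * s)) /\ subdiff w (PhiH (- (k%:R * s)) z).
Proof.
move=> Az st; elim: k w => [|k IH] w Sw.
  rewrite mul0r oppr0 (flow0 tH hM cM) (act0 tH hM cM) subr0; split=> //.
  exact: aubry_subdiff.
have [e1 S1] := IH _ (step_sub st Sw); rewrite iterSr e1.
have [e2 S2] := step_meet st Sw S1.
have e3 : - (k.+1%:R * s) = - s + - (k%:R * s) by rewrite -natr1 mulrDl mul1r opprD addrC.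
rewrite e3 (flowD tH hM cM) (actD tH hM cM); split=> //.
by rewrite e2; lra.
Qed.

(** After k steps of time t the values at z and z' have dropped by k t H(z) and k t H(z'), while the
    iterate is still a subsolution of G and oscillates by at most D. Distinct values of H would
    violate this for large k. *)
Lemma aubry_const z z' : aubry G z -> aubry G z' -> Gsub !=set0 -> H z = H z'.
Proof.
move=> Az Az' [w Sw]; have [D D0 HD] := equi_lip_osc cM kM (subsol_equi_lip tG hM cM 0).
have tt : 0 < t <= t by rewrite t0 lexx.
apply/eqP; rewrite -subr_eq0; apply/negPn/negP => d0.
have ad : 0 < t * `|H z - H z'| by rewrite mulr_gt0// normr_gt0.
pose k := (Num.truncn ((D + D) / (t * `|H z - H z'|))).+1.
have hk : D + D < k%:R * (t * `|H z - H z'|) by rewrite -ltr_pdivrMr//; exact: truncnS_gt.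
have h1 := HD _ z.1 z'.1 (iter_sub k tt Sw); have h2 := HD _ z.1 z'.1 Sw.
rewrite (aubry_iter k Az tt Sw) (aubry_iter k Az' tt Sw) in h1.
have e : k%:R * (t * `|H z - H z'|) = `|k%:R * (t * (H z - H z'))| by rewrite !normrM (gtr0_norm t0) ger0_norm.
have e2 : k%:R * (t * (H z - H z')) = (w z.1 - w z'.1) - (w z.1 - k%:R * (t * H z) - (w z'.1 - k%:R * (t * H z'))) by lra.
rewrite e e2 in hk; have := ler_normB (w z.1 - w z'.1) (w z.1 - k%:R * (t * H z) - (w z'.1 - k%:R * (t * H z'))).
by move: hk h1 h2; lra.
Qed.

(** Over the time k t the drop k t H(z) equals a difference of values of w minus the action of an
    orbit of H. The first is at most D, and a subsolution of H bounds the action below by - D'. *)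
Lemma aubry_le0 z : aubry G z -> Gsub !=set0 -> (exists u, subsolution (A := A) H 0 u) -> H z <= 0.
Proof.
move=> Az [w Sw] [u Su]; have tt : 0 < t <= t by rewrite t0 lexx.
have [D D0 HD] := equi_lip_osc cM kM (subsol_equi_lip tG hM cM 0).
have [D' D'0 HD'] := equi_lip_osc cM kM (subsol_equi_lip tH hM cM 0).
rewrite leNgt; apply/negP => c0; have th : 0 < t * H z by exact: mulr_gt0.
pose k := (Num.truncn ((D + D') / (t * H z))).+1.
have hk : D + D' < k%:R * (t * H z) by rewrite -ltr_pdivrMr//; exact: truncnS_gt.
have [e1 _] := aubry_chain k Az tt Sw; rewrite (aubry_iter k Az tt Sw) in e1.
have kt : 0 <= k%:R * t by rewrite mulr_ge0// ltW.
have := subsol_orbit tH hM cM (PhiH (- (k%:R * t)) z) Su kt.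
rewrite (flowNK tH hM cM) (actN tH hM cM) mulr0 addr0 => h.
have h1 := HD _ z.1 (PhiH (- (k%:R * t)) z).1 Sw; have h2 := HD' _ z.1 (PhiH (- (k%:R * t)) z).1 Su.
by move: h1 h2; rewrite !ler_norml => /andP[_ h1] /andP[h2 _]; move: e1 h hk h1 h2; lra.
Qed.

End Step.

Variable um : M -> R.
Hypotheses (critH : is_critical_value (A := A) H 0) (hum : neg_weak_KAM (A := A) G um).

Lemma step_exists : exists2 t : R, 0 < t & forall s u y, 0 < s <= t -> Gsub u -> step_at H s u y.
Proof. exact: (tstep tH hM cM kM (subsol_equi_lip tG hM cM 0)). Qed.

Lemma um_sub : Gsub um. Proof. exact: (neg_weak_KAM_subsol hum). Qed.

(** For the lower bound, H is constant on the orbits of G, so on the covectors of the backward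
    orbits of um it takes the common value c it has on the Aubry set. Then um is a subsolution of H
    at level c, and the critical value is at most c. *)
Lemma aubry_zero z : aubry G z -> H z = 0.
Proof.
move=> Az; have [t t0 St] := step_exists; have ne : Gsub !=set0 by exists um; exact: um_sub.
apply/eqP; rewrite eq_le; apply/andP; split; first exact: (aubry_le0 t0 St Az ne critH.1).
apply: critH.2; exists um; apply: (superdiff_subsol tH).
  by apply: equi_lip_sub (subsol_equi_lip tG hM cM 0) => _ ->; exact: um_sub.
move=> y; have [z' [zE S Hz]] := backward_orbit tG hM cM kM hum y; exists z'; split=> //.
have [p Ap cp] := alpha_limit tG hM cM um_sub Hz.
by rewrite -(limit_value cp) (aubry_const t0 St Ap Az ne) lexx.
Qed.

Lemma um_subsol : subsolution (A := A) H 0 um.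
Proof.
apply: (superdiff_subsol tH).
  by apply: equi_lip_sub (subsol_equi_lip tG hM cM 0) => _ ->; exact: um_sub.
move=> y; have [z' [zE S Hz]] := backward_orbit tG hM cM kM hum y; exists z'; split=> //.
have [p Ap cp] := alpha_limit tG hM cM um_sub Hz.
by rewrite -(limit_value cp) (aubry_zero Ap) lexx.
Qed.

Lemma divide_time (t s : R) : 0 < t -> 0 < s -> exists (k : nat) (r : R), 0 < r <= t /\ k%:R * r = s.
Proof.
move=> t0 s0; pose k := (Num.truncn (s / t)).+1; have k0 : 0 < (k%:R : R) by rewrite ltr0n.
have kn : (k%:R : R) != 0 by rewrite gt_eqF.
exists k, (s / k%:R); split; last by rewrite mulrCA divff// mulr1.
rewrite divr_gt0//= ler_pdivrMr// mulrC -ler_pdivrMr//; apply: ltW; exact: truncnS_gt.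
Qed.

(** The chained steps are realized by the orbit ending at z ([aubry_chain]), and they do not change
    w at z since H z = 0 ([aubry_iter]). *)
Lemma aubry_backward w z s : aubry G z -> Gsub w -> 0 <= s -> w z.1 = w (PhiH (- s) z).1 - act H z (- s).
Proof.
move=> Az Sw; rewrite le_eqVlt => /predU1P[<-|s0].
  by rewrite oppr0 (flow0 tH hM cM) (act0 tH hM cM) subr0.
have [t t0 St] := step_exists; have [k [r [rt <-]]] := divide_time t0 s0.
have [<- _] := aubry_chain St k Az rt Sw.
by rewrite (aubry_iter St k Az rt Sw) (aubry_zero Az) !mulr0 subr0.
Qed.

(** The step does not lower um, a subsolution of H. Conversely its image v is a subsolution of G, so
    v - um does not decrease backward along the calibrated orbits of um; these accumulate on the
    Aubry set, where v = um. *)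
Lemma um_fixed t s y : 0 < t -> (forall s u y, 0 < s <= t -> Gsub u -> step_at H s u y) -> 0 < s <= t -> lo H s um y = um y.
Proof.
move=> t0 St st; have [s0 _] := andP st; apply/eqP; rewrite eq_le; apply/andP; split; last first.
  have [z [zE lz _ _ _]] := St s um y st um_sub.
  have := subsol_orbit tH hM cM (PhiH (- s) z) um_subsol (ltW s0).
  by rewrite (flowNK tH hM cM) (actN tH hM cM) zE /lo lz /=; lra.
have [z' [zE S Hz]] := backward_orbit tG hM cM kM hum y.
have [p Ap cp] := alpha_limit tG hM cM um_sub Hz.
have Sv := step_sub St st um_sub; set v := lo H s um in Sv *.
have cv := subsol_continuous tG hM cM Sv; have cu := subsol_continuous tG hM cM um_sub.
have c0 : {for p, continuous (fun q : cotangent A => v q.1 - um q.1)}.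
  by apply: (@cvgB _ _ _ (nbhs p)); [exact: (cvg_comp _ _ (@cot_fst_continuous _ _ _ A p) (cv p.1))|exact: (cvg_comp _ _ (@cot_fst_continuous _ _ _ A p) (cu p.1))].
have ge (k : nat) : v y - um y <= v (ham_flow G (- k%:R) z').1 - um (ham_flow G (- k%:R) z').1.
  have := subsol_orbit tG hM cM (ham_flow G (- k%:R) z') Sv (ler0n R k).
  rewrite (flowNK tG hM cM) (actN tG hM cM) zE mulr0 addr0; have := Hz k%:R (ler0n R k); rewrite zE; lra.
have FF : ((fun k : nat => ham_flow G (- k%:R) z') @ \oo) [set q : cotangent A | v y - um y <= v q.1 - um q.1].
  by exists 0%N => // k _; exact: ge.
have := cluster_ge c0 FF cp.
by rewrite /= /v (aubry_value St Ap st um_sub) (aubry_zero Ap) mulr0 subr0 subrr; lra.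
Qed.

(** For arbitrary curves the inequality is that of a subsolution; it is attained on the orbit
    obtained by chaining steps of equal short length whose sum is s. *)
Lemma um_neg_weak_KAM : neg_weak_KAM (A := A) H um.
Proof.
move=> s x; rewrite le_eqVlt => /predU1P[<-|s0]; first by rewrite /lax_oleinik_neg eqxx.
apply/eqP; rewrite eq_le; apply/andP; split.
  rewrite /lax_oleinik_neg gt_eqF//; apply: le_ereal_inf_tmp => _ [c [Ac cx] <-].
  rewrite -leeBlDl// -EFinB; apply: le_trans (um_subsol (c 0) x (ltW s0)) _.
  by rewrite mulr0 adde0; apply: ereal_inf_lbound; exists c.
have [t t0 St] := step_exists; have [k [r [rt ks]]] := divide_time t0 s0.
have [z [zE _ Hz]] := fixed_chain tH hM cM (fun y => St r um y rt um_sub) (fun y => um_fixed y t0 St rt) x.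
have := lax_oleinik_le tH hM cM um (PhiH (- s) z) s0.
rewrite (flowNK tH hM cM) zE (actN tH hM cM) => /le_trans; apply.
by rewrite lee_fin (Hz k) ks.
Qed.

End CommutingPair.

(** * Compactness in Hausdorff spaces *)

Section CompactInduction.
Variable X : topologicalType.

(** Compactness as an induction principle for ideals of sets: the sets B such that K minus B
    satisfies Q form a filter, and a cluster point of it contradicts Q near that point. *)
Lemma compact_induct (K : set X) (Q : set X -> Prop) : compact K -> Q set0 -> (forall S S', S `<=` S' -> Q S' -> Q S) ->
  (forall S S', Q S -> Q S' -> Q (S `|` S')) -> (forall x, K x -> exists2 N, nbhs x N & Q N) -> Q K.
Proof.
move=> cK Q0 Qle QU Ql; apply: contrapT => NQ.
pose F : set_system X := [set B | Q (K `\` B)].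
have FF : Filter F.
  split=> [|P P' FP FP'|P P' PP' FP]; first by apply: Qle Q0 => x [_ /(_ I)].
    by apply: Qle (QU _ _ FP FP') => x [Kx /not_andP[]]; [left|right].
  by apply: Qle FP => x [Kx nP]; split=> // /PP'.
have PF : ProperFilter F by split=> //; rewrite /F /= setD0.
have FK : F K by rewrite /F /= setDv.
have [x [Kx cx]] := cK F PF FK; have [N Nx QN] := Ql x Kx.
have FN : F (~` N) by apply: Qle QN => y [_ /contrapT].
by have [y []] := cx _ _ FN Nx.
Qed.

Lemma compact_sep_point (K : set X) x : hausdorff_space X -> compact K -> ~ K x -> exists2 N, nbhs x N & K `&` closure N = set0.
Proof.
move=> hX cK Kx; apply: (compact_induct (Q := fun S => exists2 N, nbhs x N & S `&` closure N = set0) cK).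
- by exists setT; [exact: filterT|rewrite set0I].
- by move=> S S' SS' [N Nx e]; exists N => //; apply/seteqP; split=> // y [/SS' Sy cy]; rewrite -e.
- move=> S S' [N Nx e] [N' Nx' e']; exists (N `&` N'); first exact: filterI.
  apply/seteqP; split=> // y [[Sy|Sy] cy]; [rewrite -e|rewrite -e']; split=> //; apply: closure_subset cy.
    exact: subIsetl.
  exact: subIsetr.
move=> y Ky; have yx : y != x by apply/eqP => e; apply: Kx; rewrite -e.
move: (hX); rewrite open_hausdorff => /(_ _ _ yx)[[U V] /= [/set_mem Uy /set_mem Vx] [oU oV /eqP UV]].
exists U; first exact: open_nbhs_nbhs.
exists V; first exact: open_nbhs_nbhs.
apply/seteqP; split=> // w [Uw cw].
have [v [Vv Uv]] := cw U (open_nbhs_nbhs (conj oU Uw)).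
have : (U `&` V) v by split.
by rewrite UV.
Qed.

(** The compact sets K minus U and K minus V are disjoint; an open W around the first, with closure
    missing the second, cuts K in two. This yields finite subadditivity of contents on open sets. *)
Lemma compact_split (K U V : set X) : hausdorff_space X -> compact K -> open U -> open V -> K `<=` U `|` V ->
  exists K1 K2, [/\ compact K1, compact K2, K1 `<=` U, K2 `<=` V & K `<=` K1 `|` K2].
Proof.
move=> hX cK oU oV KUV; have clK := compact_closed hX cK.
have cKU : compact (K `\` U).
  by apply: (subclosed_compact _ cK) => [|x []//]; apply: closedI => //; exact: open_closedC.
have cKV : compact (K `\` V).
  by apply: (subclosed_compact _ cK) => [|x []//]; apply: closedI => //; exact: open_closedC.
have [W oW [KW WV]] : exists2 W, open W & K `\` U `<=` W /\ (K `\` V) `&` closure W = set0.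
  apply: (compact_induct (Q := fun S => exists2 W, open W & S `<=` W /\ (K `\` V) `&` closure W = set0) cKU).
  - by exists set0; [exact: open0|split=> //; rewrite closure0 setI0].
  - by move=> S S' SS' [W oW [h1 h2]]; exists W => //; split=> //; exact: subset_trans h1.
  - move=> S S' [W oW [h1 h2]] [W' oW' [h1' h2']]; exists (W `|` W'); first exact: openU.
    by split; [exact: setUSS|rewrite closureU setIUr h2 h2' setU0].
  move=> x [Kx Ux]; have nV : ~ (K `\` V) x by move=> [_]; have [//|] := KUV x Kx.
  have [N Nx e] := compact_sep_point hX cKV nV.
  exists (interior N); first exact: nbhs_interior.
  exists (interior N); first exact: open_interior.
  split=> //; apply/seteqP; split=> // y [h1 h2]; rewrite -e; split=> //.
  by apply: closure_subset h2; exact: interior_subset.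
exists (K `\` W), (K `&` closure W); split.
- by apply: (subclosed_compact _ cK) => [|x []//]; apply: closedI => //; exact: open_closedC.
- by apply: (subclosed_compact _ cK) => [|x []//]; apply: closedI => //; exact: closed_closure.
- by move=> x [Kx Wx]; apply: contrapT => Ux; apply: Wx; apply: KW.
- by move=> x [Kx Wx]; apply: contrapT => Vx; rewrite -[False]/(set0 x) -WV.
- by move=> x Kx; have [Wx|Wx] := pselect (W x); [right; split=> //; exact: subset_closure|left].
Qed.

End CompactInduction.

(** * A Borel measure from a finitely additive content *)

Section RegularMeasure.
Local Open Scope ereal_scope.
Variables (R : realType) (X : ptopologicalType) (Lam : set X -> R) (K0 : set X).
Hypotheses (hX : hausdorff_space X) (Lam_le : forall B B', B `<=` B' -> (Lam B <= Lam B')%R)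
  (LamU : forall B B', B `&` B' = set0 -> Lam (B `|` B') = (Lam B + Lam B')%R)
  (cK0 : compact K0) (LamT : Lam setT = 1%R) (LamK0 : Lam (~` K0) = 0%R).

Lemma Lam0 : Lam set0 = 0%R.
Proof. by have := LamU (set0I set0); rewrite setU0; lra. Qed.

Lemma Lam_sub B B' : (Lam (B `|` B') <= Lam B + Lam B')%R.
Proof.
have -> : B `|` B' = B `|` (B' `\` B).
  apply/seteqP; split=> x [h|h]; [by left| |by left|by right; case: h].
  by have [?|?] := pselect (B x); [left|right].
rewrite LamU; last by apply/seteqP; split=> // x [? []].
by rewrite lerD2l; apply: Lam_le => x [].
Qed.

(** Lam is only finitely additive. As in the Riesz construction, open sets are measured from inside
    by compact sets, and all sets from outside by open ones; compactness then provides countable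
    subadditivity. *)
Definition inner_lam (U : set X) : \bar R := ereal_sup [set (Lam K)%:E | K in [set K | compact K /\ K `<=` U]].
Definition outer_lam (B : set X) : \bar R := ereal_inf [set inner_lam U | U in [set U | open U /\ B `<=` U]].

Lemma inner_ge K U : compact K -> K `<=` U -> (Lam K)%:E <= inner_lam U.
Proof. by move=> cK KU; apply: ereal_sup_ubound; exists K. Qed.

Lemma inner_le U U' : U `<=` U' -> inner_lam U <= inner_lam U'.
Proof. by move=> UU; apply: ge_ereal_sup => _ [K [cK KU] <-]; apply: inner_ge => //; exact: subset_trans UU. Qed.

Lemma inner_ub U : inner_lam U <= (Lam U)%:E.
Proof. by apply: ge_ereal_sup => _ [K [cK KU] <-]; rewrite lee_fin; exact: Lam_le. Qed.

Lemma inner_ge0 U : 0 <= inner_lam U.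
Proof. by apply: le_trans (inner_ge compact0 (@sub0set _ U)); rewrite Lam0. Qed.

Lemma outer_open U : open U -> outer_lam U = inner_lam U.
Proof.
move=> oU; apply/eqP; rewrite eq_le; apply/andP; split; first by apply: ereal_inf_lbound; exists U => //; split.
by apply: le_ereal_inf_tmp => _ [V [oV UV] <-]; exact: inner_le.
Qed.

Lemma outer_lam0 : outer_lam set0 = 0.
Proof.
rewrite (outer_open open0); apply/eqP; rewrite eq_le inner_ge0 andbT.
by apply: le_trans (inner_ub _) _; rewrite Lam0.
Qed.

Lemma outer_lam_ge0 B : 0 <= outer_lam B.
Proof. by apply: le_ereal_inf_tmp => _ [V [oV UV] <-]; exact: inner_ge0. Qed.

Lemma outer_lam_le : {homo outer_lam : B B' / B `<=` B' >-> B <= B'}.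
Proof.
move=> B B' BB'; apply: le_ereal_inf_tmp => _ [V [oV UV] <-]; apply: ereal_inf_lbound; exists V => //; split=> //.
exact: subset_trans UV.
Qed.

(** A compact subset of the union is covered by finitely many of the open sets, and [compact_split]
    distributes it among them. *)
Lemma inner_bigcup (U : (set X)^nat) : (forall i, open (U i)) -> inner_lam (\bigcup_i U i) <= \sum_(i <oo) inner_lam (U i).
Proof.
move=> oU; apply: ge_ereal_sup => _ [K [cK KU] <-].
have [N HN] : exists N, K `<=` \bigcup_(i < N) U i.
  apply: (compact_induct (Q := fun S => exists N, S `<=` \bigcup_(i < N) U i) cK); first by exists 0%N => x.
  - by move=> S S' SS' [N h]; exists N; exact: subset_trans h.
  - move=> S S' [N h] [N' h']; exists (maxn N N') => x [/h|/h'] [i /= iN Ui]; exists i => //=; rewrite leq_max iN ?orbT//.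
  move=> x /KU [i _ Ui]; exists (U i); first exact: open_nbhs_nbhs.
  by exists i.+1 => y Uy; exists i => /=.
apply: le_trans (nneseries_lim_ge N _); last by move=> i _ _; exact: inner_ge0.
elim: N K cK {KU} HN => [|N IH] K cK KN.
  rewrite big_geq// lee_fin -Lam0; apply: Lam_le => x /KN[i /=]; by rewrite ltn0.
have oUN : open (\bigcup_(i < N) U i) by apply: bigcup_open => i _.
have [|K1 [K2 [c1 c2 h1 h2 h12]]] := compact_split hX cK oUN (oU N).
  by move=> x /KN[i /=]; rewrite ltnS leq_eqVlt => /predU1P[->|iN] Ux; [right|left; exists i].
rewrite big_nat_recr//=; apply: (@le_trans _ _ ((Lam K1)%:E + (Lam K2)%:E)).
  by rewrite -EFinD lee_fin; apply: le_trans (Lam_sub _ _); exact: Lam_le.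
by apply: leeD; [exact: IH|exact: inner_ge].
Qed.

Lemma outer_sigma_subadditive : sigma_subadditive outer_lam.
Proof.
move=> F; apply/lee_addgt0Pr => e e0.
have Hex n : exists V, [/\ open V, F n `<=` V & inner_lam V <= outer_lam (F n) + (e / (2 ^ n.+1)%:R)%:E].
  have fin : outer_lam (F n) \is a fin_num.
    rewrite ge0_fin_numE ?outer_lam_ge0//; apply: (@le_lt_trans _ _ 1); last by rewrite ltry.
    apply: le_trans (outer_lam_le (@subsetT _ (F n))) _; rewrite (outer_open openT).
    by apply: le_trans (inner_ub _) _; rewrite LamT.
  have d0 : (0 < e / (2 ^ n.+1)%:R)%R by rewrite divr_gt0// ltr0n expn_gt0.
  by have [_ [V [oV FV] <-] h] := lb_ereal_inf_adherent d0 fin; exists V; split=> //; exact: ltW.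
have [V HV] := choice Hex.
apply: le_trans (epsilon_trick xpredT _ (ltW e0)); last by move=> n; exact: outer_lam_ge0.
apply: (@le_trans _ _ (inner_lam (\bigcup_i V i))).
  apply: ereal_inf_lbound; exists (\bigcup_i V i) => //; split.
    by apply: bigcup_open => i _; have [] := HV i.
  by move=> x [i _ Fx]; exists i => //; have [_ + _] := HV i; apply.
apply: le_trans (inner_bigcup _) _; first by move=> i; have [] := HV i.
by apply: lee_nneseries => [n _ _|n _]; [exact: inner_ge0|have [] := HV n].
Qed.

HB.instance Definition _ := isOuterMeasure.Build R X outer_lam outer_lam0 outer_lam_ge0 outer_lam_le outer_sigma_subadditive.

(** A compact K1 exhausts V inside U, and then a compact K2 exhausts V minus K1; K1 and K2 are
    disjoint subsets of V, so their contents add. *)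
Lemma open_caratheodory U : open U -> outer_lam.-caratheodory U.
Proof.
move=> oU; apply: (@le_caratheodory_measurable R X outer_lam) => B.
apply: le_ereal_inf_tmp => _ [V [oV BV] <-].
apply: (@le_trans _ _ (inner_lam (V `&` U) + outer_lam (V `\` U))).
  apply: leeD; last by apply: outer_lam_le; exact: setSI.
  by apply: ereal_inf_lbound; exists (V `&` U) => //; split; [exact: openI|exact: setSI].
have fin : outer_lam (V `\` U) \is a fin_num.
  rewrite ge0_fin_numE ?outer_lam_ge0//; apply: (@le_lt_trans _ _ 1); last by rewrite ltry.
  apply: le_trans (outer_lam_le (@subsetT _ (V `\` U))) _; rewrite (outer_open openT).
  by apply: le_trans (inner_ub _) _; rewrite LamT.
rewrite -leeBrDr//; apply: ge_ereal_sup => _ [K1 [c1 h1] <-]; rewrite leeBrDr//.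
have oV1 : open (V `\` K1) by apply: openI => //; apply: closed_openC; exact: compact_closed.
apply: (@le_trans _ _ ((Lam K1)%:E + inner_lam (V `\` K1))).
  apply: leeD2l; apply: ereal_inf_lbound; exists (V `\` K1) => //; split=> //.
  by move=> x [Vx Ux]; split=> // /h1 [].
rewrite -leeBrDl//; apply: ge_ereal_sup => _ [K2 [c2 h2] <-]; rewrite leeBrDl// -EFinD -LamU.
  by apply: inner_ge; [exact: compactU|move=> x [/h1[]|/h2[]]].
by apply/seteqP; split=> // x [x1 /h2[]].
Qed.

Local Notation T := (g_sigma_algebraType (@open X)).

Lemma borel_caratheodory (B : set T) : measurable B -> outer_lam.-caratheodory B.
Proof.
have : <<s @open X >> `<=` outer_lam.-cara.-measurable.
  apply: smallest_sub; last by move=> U oU; exact: open_caratheodory.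
  exact: (@sigma_algebra_measurable _ (caratheodory_type outer_lam)).
by move=> + mB; apply.
Qed.

Definition borel_outer : set T -> \bar R := outer_lam.

Lemma borel_outer_additive : semi_sigma_additive borel_outer.
Proof.
move=> F mF tF mU; apply: (@caratheodory_measure_sigma_additive R X outer_lam F) => //.
  by move=> i; exact: borel_caratheodory.
exact: borel_caratheodory.
Qed.

HB.instance Definition _ := isMeasure.Build _ T R borel_outer outer_lam0 outer_lam_ge0 borel_outer_additive.

(** The compact K0 of full content prevents mass from being lost in the inner approximation. *)
Lemma borel_outerT : borel_outer setT = 1.
Proof.
rewrite /borel_outer (outer_open openT); apply/eqP; rewrite eq_le; apply/andP; split.
  by apply: le_trans (inner_ub _) _; rewrite LamT.
apply: le_trans (inner_ge cK0 (@subsetT _ K0)); rewrite lee_fin -LamT.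
have -> : [set: X] = K0 `|` ~` K0 by rewrite setUv.
by apply: le_trans (Lam_sub _ _) _; rewrite LamK0 addr0.
Qed.

HB.instance Definition _ := Measure_isProbability.Build _ T R borel_outer borel_outerT.

Lemma regular_measure : exists mu : probability T R, forall B, mu B = outer_lam B.
Proof. by exists borel_outer. Qed.

End RegularMeasure.

(** * Invariant measures and their action *)

Section InvariantMeasures.
Variables (R : realType) (n : nat) (M : ptopologicalType) (A : C2atlas R n M).
Variables (g : riemannian A) (G : cotangent A -> R).
Hypothesis tG : tonelli g G.
Hypotheses (hM : hausdorff_space M) (cM : compact [set: M]).
Local Notation Phi := (ham_flow G).
Local Notation act := (act G).
Local Notation T := (cot_borel A).
Implicit Types (u w : M -> R) (z : cotangent A) (mu nu : probability T R).

Lemma sum_mesh (t x : R) (N : nat) : \sum_(k < N.+1) t / N.+1%:R * x = t * x.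
Proof. by rewrite sumr_const card_ord -mulrnAl -mulrnAr -[_^-1 *+ _]mulr_natl divff ?mulr1// pnatr_eq0. Qed.

Lemma integral_const mu (c : R) : (\int[mu]_z (cst c%:E z) = c%:E)%E.
Proof. by rewrite integral_cst//= -[X in (_ * X)%E]/(mu [set: T]) (@probability_setT _ T R mu) mule1. Qed.

Lemma open_borel (U : set T) : open (U : set (cotangent A)) -> measurable U.
Proof. by move=> oU; exact: sub_sigma_algebra. Qed.

Lemma continuous_borel (f : cotangent A -> R) : continuous f -> measurable_fun [set: T] (fun z : T => (f z)%:E).
Proof.
move=> /continuousP cf; apply/measurable_EFinP.
apply: (measurability (@RGenOInfty.G R)) => [|/= _ [_ [r ->] <-]]; first exact: RGenOInfty.measurableE.
by rewrite setTI; apply: open_borel; apply: cf; exact: interval_open.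
Qed.

Lemma flow_borel t : measurable_fun [set: T] (Phi t : T -> T).
Proof.
apply: (@measurability _ _ T T setT _ (@open (cotangent A)) erefl) => _ [U oU <-]; rewrite setTI; apply: open_borel.
by have /continuousP := @flow_continuous _ _ _ _ _ _ tG hM cM t; apply.
Qed.

Lemma integral_flow mu t (f : cotangent A -> R) : invariant_measure G mu -> continuous f -> (forall z, 0 <= f z) ->
  (\int[mu]_z (f (Phi t z))%:E = \int[mu]_z (f z)%:E)%E.
Proof.
move=> im cf f0; have h := ge0_integral_pushforward (flow_borel t) mu measurableT (continuous_borel cf).
rewrite preimage_setT in h; rewrite -h; last by move=> z _; rewrite lee_fin.
by apply: (@eq_measure_integral _ T R setT mu); [exact: flow_borel|move=> mP B mB _; exact: im].
Qed.

Lemma dist_half (x y c e : R) : `|c - x| <= e / 2 -> `|c - y| <= e / 2 -> `|x - y| <= e.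
Proof. by rewrite !ler_norml => /andP[? ?] /andP[? ?]; apply/andP; split; lra. Qed.

Lemma act_unif z0 e : 0 < e -> exists2 d : R, 0 < d & forall z, G z <= G z0 -> forall h, 0 <= h <= d ->
  `|act z h - h * dens G z| <= e * h.
Proof.
move=> e0; have cK : compact [set z | G z <= G z0] by exact: (sublevel_compact tG cM).
have e2 : 0 < e / 2 by exact: divr_gt0.
pose P (d : R) z := forall h, 0 <= h <= d -> `|act z h - h * dens G z| <= e * h.
have Pm (a b : R) z : 0 < a -> a <= b -> P b z -> P a z.
  by move=> a0 ab Pb h /andP[h0 ha]; apply: Pb; rewrite h0 (le_trans ha).
have lP z : [set z | G z <= G z0] z -> exists2 d : R, 0 < d & \forall y \near z, P d y.
  move=> _; have N : nbhs z [set w | `|dens G z - dens G w| <= e / 2].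
    by have := @dens_continuous _ _ _ _ _ _ tG z; move/(@cvgrPdist_le _ _ _ (nbhs z) (nbhs_filter z)); apply.
  have [d d0 Nd] := flow_joint0 tG hM cM N; exists d => //.
  apply: (@filterS _ (nbhs z) (nbhs_filter z) _ _ _ (filterI N Nd)) => w [/= hw Hw] h /andP[h0 hd].
  have D s : 0 <= s <= h -> is_derive s (1 : R) (act w) (dens G (Phi s w)) by move=> _; exact: (act_derive tG hM cM w s).
  have [c /andP[c0 ch] E] := mean_value h0 D.
  move: E; rewrite (act0 tG hM cM) !subr0 => ->.
  have cd : `|c| <= d by rewrite ger0_norm// (le_trans ch).
  have hc : `|dens G z - dens G (Phi c w)| <= e / 2 := Hw c cd.
  by rewrite mulrC -mulrBr normrM (ger0_norm h0) mulrC; apply: ler_wpM2r => //; exact: dist_half hc hw.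
have [d d0 Hd] := @compact_unif R (cotangent A) _ P cK Pm lP.
by exists d.
Qed.

Lemma act_sum z h k : act z (k%:R * h) = \sum_(j < k) act (Phi (j%:R * h) z) h.
Proof.
elim: k => [|k IH]; first by rewrite mul0r (act0 tG hM cM) big_ord0.
by rewrite big_ord_recr /= -IH -natr1 mulrDl mul1r (addrC (k%:R * h)) (actD tG hM cM).
Qed.

Lemma riemann_act z t : 0 < t ->
  \sum_(k < N.+1) (t / N.+1%:R) * dens G (Phi (k%:R * (t / N.+1%:R)) z) @[N --> \oo] --> act z t.
Proof.
move=> t0; apply/cvgrPdist_le => e e0; have et0 : 0 < e / t by exact: divr_gt0.
have [d d0 Hd] := act_unif z et0.
have [N0 HN0] : exists N0 : nat, t / d <= N0%:R by exists (Num.truncn (t / d)).+1; apply: ltW; exact: truncnS_gt.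
exists N0 => // N /= N0N; set h := t / N.+1%:R.
have n0 : 0 < (N.+1%:R : R) by rewrite ltr0n.
have h0 : 0 <= h by rewrite divr_ge0// ltW.
have hd : h <= d.
  rewrite ler_pdivrMr// mulrC -ler_pdivrMr//; apply: le_trans HN0 _.
  by rewrite ler_nat; exact: leq_trans (leqnSn N).
have th : t = N.+1%:R * h by rewrite /h mulrCA divff ?mulr1// gt_eqF.
rewrite {1}th act_sum -sumrB; apply: le_trans (ler_norm_sum _ _ _) _.
have b (k : 'I_N.+1) : `|act (Phi (k%:R * h) z) h - h * dens G (Phi (k%:R * h) z)| <= e / t * h.
  by apply: Hd; rewrite ?(flow_energy tG hM cM)// h0.
apply: le_trans (ler_sum _ (fun k _ => b k)) _.
by rewrite sumr_const card_ord -mulr_natl mulrCA -th divfK// gt_eqF.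
Qed.

Variable C0 : R.
Hypotheses (C00 : 0 <= C0) (HC0 : forall z, - C0 <= dens G z).

(** The action of a measure may be infinite. Adding C0 makes the integrand nonnegative, so that
    Fatou's lemma and additivity apply; [shifted_actionE] undoes the shift. *)
Definition shifted_action mu : \bar R := (\int[mu]_z (dens G z + C0)%:E)%E.

Lemma dens_shift_continuous : continuous (fun z => dens G z + C0).
Proof.
move=> z; apply: (@cvgD _ _ _ (nbhs z)); first exact: (dens_continuous tG).
exact: (@cvg_cst _ _ _ (nbhs z) (nbhs_filter z)).
Qed.

Lemma dens_shift_ge0 z : 0 <= dens G z + C0. Proof. by have := HC0 z; lra. Qed.

Lemma shifted_actionE mu : (cot_action G mu + C0%:E = shifted_action mu)%E.
Proof.
have cl := dens_continuous tG; have mT := @measurableT _ T.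
pose p z := Num.max (dens G z) 0; pose m z := Num.max (- dens G z) 0.
have cp : continuous p.
  by move=> z; apply: (@continuous_comp _ _ _ (dens G) (fun x => Num.max x 0)); [exact: cl|apply: continuous_max; [exact: cvg_id|exact: cvg_cst]].
have cm : continuous m.
  by move=> z; apply: (@continuous_comp _ _ _ (dens G) (fun x => Num.max (- x) 0)); [exact: cl|apply: continuous_max; [exact: cvgN|exact: cvg_cst]].
have m0 z : 0 <= m z by rewrite /m le_max lexx orbT.
have p0 z : 0 <= p z by rewrite /p le_max lexx orbT.
have mC z : m z <= C0 by rewrite /m ge_max C00 andbT; have := HC0 z; lra.
have pm z : dens G z = p z - m z.
  by rewrite /p /m; case: (leP (dens G z) 0) => h; case: (leP (- dens G z) 0) => h'; lra.
have cCm : continuous (fun z => C0 - m z).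
  by move=> z; apply: (@continuous_comp _ _ _ m (fun x => C0 - x)); [exact: cm|apply: cvgB; [exact: cvg_cst|exact: cvg_id]].
have e1 : (\int[mu]_z (dens G z + C0)%:E = \int[mu]_z (p z)%:E + \int[mu]_z (C0 - m z)%:E)%E.
  rewrite -ge0_integralD//; first last.
  - exact: continuous_borel.
  - by move=> z _; rewrite lee_fin subr_ge0.
  - exact: continuous_borel.
  - by move=> z _; rewrite lee_fin.
  by apply: eq_integral => z _; rewrite -EFinD pm; congr EFin; lra.
have e2 : (\int[mu]_z (C0 - m z)%:E + \int[mu]_z (m z)%:E = C0%:E)%E.
  rewrite -ge0_integralD//; first last.
  - exact: continuous_borel.
  - by move=> z _; rewrite lee_fin.
  - exact: continuous_borel.
  - by move=> z _; rewrite lee_fin subr_ge0.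
  transitivity (\int[mu]_z (cst C0%:E z))%E.
    by apply: eq_integral => z _; rewrite -EFinD subrK.
  by rewrite integral_const.
have bm0 : (0 <= \int[mu]_z (m z)%:E)%E by apply: integral_ge0 => z _; rewrite lee_fin.
have bc0 : (0 <= \int[mu]_z (C0 - m z)%:E)%E by apply: integral_ge0 => z _; rewrite lee_fin subr_ge0.
have ip : (\int[mu]_z (p z)%:E = \int[mu]_z ((fun z => (dens G z)%:E)^\+ z))%E.
  by apply: eq_integral => z _; rewrite funeposE EFin_max.
have im : (\int[mu]_z (m z)%:E = \int[mu]_z ((fun z => (dens G z)%:E)^\- z))%E.
  by apply: eq_integral => z _; rewrite funenegE EFin_max.
rewrite /cot_action /shifted_action integralE e1 -ip -im; move: e2 bm0 bc0.
have : (0 <= \int[mu]_z (p z)%:E)%E by apply: integral_ge0 => z _; rewrite lee_fin.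
case: (\int[mu]_z (p z)%:E)%E => [x| |] //; case: (\int[mu]_z (m z)%:E)%E => [y| |] //; case: (\int[mu]_z (C0 - m z)%:E)%E => [v| |] //= _.
by rewrite -!EFinD => -[h] _ _; congr EFin; lra.
Qed.

Lemma calibration_continuous w t : subsolution (A := A) G 0 w -> continuous (fun z => act z t - (w (Phi t z).1 - w z.1)).
Proof.
move=> Sw; have cw := subsol_continuous tG hM cM Sw.
have cr : continuous (fun z : cotangent A => w z.1) by move=> z; apply: (@continuous_comp _ _ _ (fst : cotangent A -> M) w); [exact: cot_fst_continuous|exact: cw].
have cq : continuous (fun z : cotangent A => w (Phi t z).1).
  by move=> z; apply: (@continuous_comp _ _ _ (Phi t) (fun z : cotangent A => w z.1)); [exact: (@flow_continuous _ _ _ _ _ _ tG hM cM t z)|exact: cr].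
move=> z; apply: (@cvgB _ _ _ (nbhs z)); first exact: (@act_continuous _ _ _ _ _ _ tG hM cM t).
by apply: (@cvgB _ _ _ (nbhs z)); [exact: cq|exact: cr].
Qed.

(* Fatou's lemma along the Riemann sums of the action, whose integrals do not depend on the mesh by invariance. *)
Lemma invariant_defect mu w t : invariant_measure G mu -> subsolution (A := A) G 0 w -> 0 < t ->
  (\int[mu]_z (act z t - (w (Phi t z).1 - w z.1))%:E + (C0 * t)%:E <= t%:E * shifted_action mu)%E.
Proof.
move=> im Sw t0; have mT := @measurableT _ T; have cw := subsol_continuous tG hM cM Sw.
have ca := @act_continuous _ _ _ _ _ _ tG hM cM t.
have [W W0 HW] := continuous_bounded cM (fun y _ => cw y).
have Wge y : 0 <= w y + W by have := HW y I; rewrite ler_norml => /andP[]; lra.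
pose gN (N : nat) (z : T) : \bar R := (\sum_(k < N.+1) ((t / N.+1%:R) * (dens G (Phi (k%:R * (t / N.+1%:R)) z) + C0))%:E)%E.
have hN (N : nat) : 0 <= t / N.+1%:R by rewrite divr_ge0// ltW.
have cD (s : R) : continuous (fun z => dens G (Phi s z) + C0).
  by move=> z; apply: (@continuous_comp _ _ _ (Phi s) (fun z => dens G z + C0)); [exact: (@flow_continuous _ _ _ _ _ _ tG hM cM s z)|exact: dens_shift_continuous].
have D0 (s : R) z : 0 <= dens G (Phi s z) + C0 by exact: dens_shift_ge0.
have mD (N k : nat) (s : R) : measurable_fun [set: T] (fun z : T => ((t / N.+1%:R) * (dens G (Phi s z) + C0))%:E).
  apply: continuous_borel => z; apply: (@continuous_comp _ _ _ (fun z => dens G (Phi s z) + C0) (fun x => (t / N.+1%:R) * x)); first exact: cD.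
  by apply: cvgM; [exact: cvg_cst|exact: cvg_id].
have mg N : measurable_fun [set: T] (gN N) by apply: emeasurable_sum => k; exact: mD.
have g0 N z : [set: T] z -> (0 <= gN N z)%E.
  by move=> _; apply: sume_ge0 => k _; rewrite lee_fin mulr_ge0.
have lg z : limn_einf (gN^~ z) = (act z t + C0 * t)%:E.
  have cv : gN^~ z N @[N --> \oo] --> (act z t + C0 * t)%:E.
    have e (N : nat) : gN N z = (\sum_(k < N.+1) (t / N.+1%:R) * dens G (Phi (k%:R * (t / N.+1%:R)) z) + C0 * t)%:E.
      rewrite /gN sumEFin; congr EFin; under eq_bigr do rewrite mulrDr; rewrite big_split /=; congr (_ + _).
      by rewrite sum_mesh mulrC.
    rewrite (_ : gN^~ z = (fun N => (\sum_(k < N.+1) (t / N.+1%:R) * dens G (Phi (k%:R * (t / N.+1%:R)) z) + C0 * t)%:E)); last by apply/funext => N; exact: e.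
    apply: cvg_EFin; first exact: nearW.
    by apply: cvgD; [exact: riemann_act|exact: cvg_cst].
  by rewrite is_cvg_limn_einfE; [exact: cvg_lim cv|apply/cvg_ex; exists (act z t + C0 * t)%:E].
have ig N : (\int[mu]_z gN N z = t%:E * shifted_action mu)%E.
  rewrite ge0_integral_sum//; [|by move=> k; exact: mD|by move=> k z _; rewrite lee_fin mulr_ge0].
  under eq_bigr => k _.
    under eq_integral => z _ do rewrite EFinM.
    rewrite ge0_integralZl_EFin//; last 2 first.
    - by move=> z _; rewrite lee_fin.
    - exact: continuous_borel.
    rewrite (integral_flow (f := fun z => dens G z + C0) _ im dens_shift_continuous dens_shift_ge0).
    over.
  rewrite -ge0_sume_distrl; last by move=> k _; rewrite lee_fin.
  have eN : \sum_(k < N.+1) t / N.+1%:R = t.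
    by have := sum_mesh t 1 N; rewrite !mulr1.
  by rewrite sumEFin eN.
have fat : (\int[mu]_z (act z t + C0 * t)%:E <= t%:E * shifted_action mu)%E.
  have := fatou mu mT mg g0; under eq_integral => z _ do rewrite lg.
  move/le_trans; apply; under eq_fun do rewrite ig.
  by rewrite is_cvg_limn_einfE; [rewrite lim_cst//|exact: is_cvg_cst].
(* The shift by W makes the two terms of the coboundary nonnegative with finite integrals, equal by
   invariance, so they can be cancelled. *)
pose q z := w (Phi t z).1 + W; pose r z := w z.1 + W.
have cr : continuous r.
  move=> z; apply: (@continuous_comp _ _ _ (fst : cotangent A -> M) (fun y => w y + W)); first exact: cot_fst_continuous.
  by apply: cvgD; [exact: cw|exact: cvg_cst].
have cq : continuous q by move=> z; apply: (@continuous_comp _ _ _ (Phi t) r); [exact: (@flow_continuous _ _ _ _ _ _ tG hM cM t z)|exact: cr].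
have eqr : (\int[mu]_z (q z)%:E = \int[mu]_z (r z)%:E)%E := integral_flow t im cr (fun z => Wge z.1).
pose f z := act z t - (w (Phi t z).1 - w z.1).
have fE z : act z t = f z + (q z - r z) by rewrite /f /q /r; lra.
have f0 z : 0 <= f z by have := subsol_orbit tG hM cM z Sw (ltW t0); rewrite /f; lra.
have cf : continuous f := calibration_continuous Sw.
have caC : continuous (fun z => act z t + C0 * t).
  by move=> z; apply: (@continuous_comp _ _ _ (act^~ t) (fun x => x + C0 * t)); [exact: ca|apply: cvgD; [exact: cvg_id|exact: cvg_cst]].
have a0 z : 0 <= act z t + C0 * t.
  have D s : 0 <= s <= t -> is_derive s (1 : R) (act z) (dens G (Phi s z)) by move=> _; exact: (act_derive tG hM cM z s).
  have := derive_ge_increment (ltW t0) D (fun s _ => HC0 (Phi s z)).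
  by rewrite (act0 tG hM cM) !subr0 mulNr => h; rewrite -lerBlDr sub0r.
have Ct : 0 <= C0 * t by rewrite mulr_ge0// ltW.
have fr : (\int[mu]_z (r z)%:E \is a fin_num)%E.
  rewrite ge0_fin_numE; last by apply: integral_ge0 => z _; rewrite lee_fin; exact: Wge.
  apply: (@le_lt_trans _ _ (\int[mu]_z (cst (W + W)%:E z))%E).
    apply: ge0_le_integral => //.
    - by move=> z _; rewrite lee_fin; exact: Wge.
    - exact: continuous_borel.
    - by move=> z _; rewrite lee_fin lerD2r; exact: le_trans (ler_norm _) (HW _ I).
  by rewrite integral_const ltry.
have key : (\int[mu]_z (act z t + C0 * t)%:E + \int[mu]_z (r z)%:E = \int[mu]_z (f z)%:E + (C0 * t)%:E + \int[mu]_z (r z)%:E)%E.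
  rewrite -[X in _ = (_ + X)%E]eqr -ge0_integralD//; first last.
  - exact: continuous_borel.
  - by move=> z _; rewrite lee_fin; exact: Wge.
  - exact: continuous_borel.
  - by move=> z _; rewrite lee_fin.
  have -> : (C0 * t)%:E = (\int[mu]_z (cst (C0 * t)%:E z))%E by rewrite integral_const.
  rewrite -ge0_integralD//; first last.
  - exact: continuous_borel.
  - by move=> z _; rewrite lee_fin.
  have cfC : continuous (fun z => f z + C0 * t).
    by move=> z; apply: (@continuous_comp _ _ _ f (fun x => x + C0 * t)); [exact: cf|apply: cvgD; [exact: cvg_id|exact: cvg_cst]].
  rewrite -ge0_integralD//; first last.
  - exact: continuous_borel.
  - by move=> z _; rewrite lee_fin; exact: Wge.
  - exact: continuous_borel cfC.
  - by move=> z _; rewrite adde_ge0// lee_fin.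
  by apply: eq_integral => z _; rewrite -!EFinD; congr EFin; rewrite fE; lra.
by move: fat; rewrite -(leeD2rE _ _ fr) key leeD2rE.
Qed.

Lemma invariant_action_ge0 mu w : invariant_measure G mu -> subsolution (A := A) G 0 w -> (0 <= cot_action G mu)%E.
Proof.
move=> im Sw; have := invariant_defect im Sw ltr01; rewrite mul1e mulr1 -shifted_actionE => h.
rewrite -(leeD2rE _ _ (isT : C0%:E \is a fin_num)) add0e; apply: le_trans h; rewrite leeDr//.
by apply: integral_ge0 => z _; rewrite lee_fin; have := subsol_orbit tG hM cM z Sw ler01; lra.
Qed.

(** The defect of calibration of w is continuous and nonnegative, with integral at most 0 by
    [invariant_defect], so it vanishes on the support. *)
Lemma support_aubry mu : invariant_measure G mu -> (cot_action G mu <= 0)%E -> cot_support mu `<=` aubry G.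
Proof.
move=> im a0 z Sz w Sw t t0.
case: (eqVneq t 0) => [->|tn0]; first by rewrite (flow0 tG hM cM) (act0 tG hM cM) subrr.
have tp : 0 < t by rewrite lt_neqAle eq_sym tn0.
pose f y := act y t - (w (Phi t y).1 - w y.1); have cf : continuous f := calibration_continuous Sw.
have f0 y : 0 <= f y by have := subsol_orbit tG hM cM y Sw t0; rewrite /f; lra.
have If : (\int[mu]_y (f y)%:E <= 0)%E.
  have := invariant_defect im Sw tp; rewrite -shifted_actionE => h.
  have h2 : (\int[mu]_y (f y)%:E + (C0 * t)%:E <= 0 + (C0 * t)%:E)%E.
    apply: (le_trans h); rewrite add0e (mulrC C0) EFinM; apply: lee_wpmul2l; first by rewrite lee_fin.
    by rewrite -[leRHS]add0e leeD2rE.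
  by move: h2; rewrite leeD2rE.
have [fz|fz] := leP (f z) 0; first by have /eqP : f z == 0 by [rewrite eq_le fz f0]; rewrite /f; lra.
pose U := [set y : T | f z / 2 < f y]; have c0 : 0 < f z / 2 by exact: divr_gt0.
have oU : open (U : set (cotangent A)).
  by have /continuousP := cf; move=> /(_ _ (interval_open (a := BRight (f z / 2)) (b := +oo%O) isT isT)); congr open; apply/seteqP; split => y /=; rewrite in_itv/= andbT.
have mU : (0 < mu U)%E by apply: Sz => //; rewrite /U /=; lra.
suff : (0 < \int[mu]_y (f y)%:E)%E by rewrite ltNge If.
apply: (@lt_le_trans _ _ ((f z / 2)%:E * mu U)%E); first by rewrite mule_gt0.
rewrite -(integral_cst mu (open_borel oU)).
apply: (@le_trans _ _ (\int[mu]_(y in U) (f y)%:E)%E).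
  apply: ge0_le_integral => //; [exact: open_borel|by move=> y _; rewrite lee_fin ltW| | ].
  - exact: measurable_funTS (continuous_borel cf).
  - by move=> y /= Uy; rewrite lee_fin ltW.
apply: ge0_subset_integral => //; [exact: open_borel|exact: continuous_borel|by move=> y _; rewrite lee_fin].
Qed.

Lemma mather_set_aubry : (forall mu, minimizing_measure G mu -> (cot_action G mu <= 0)%E) -> mather_set G `<=` aubry G.
Proof.
move=> ha z Cz w Sw t t0.
pose f y := act y t - (w (Phi t y).1 - w y.1); have cf : continuous f := calibration_continuous Sw.
have cl : closed (f @^-1` [set 0]) by apply: closed_comp => [y _|]; [exact: cf|exact: closed_eq].
have : (f @^-1` [set 0]) z.
  rewrite ((closure_id _).1 cl); move: z Cz; apply: closure_subset => y [mu [im mm] Sy] /=.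
  by have := support_aubry im (ha mu (conj im mm)) Sy Sw t0; rewrite /f; lra.
by rewrite /= /f; lra.
Qed.

End InvariantMeasures.

Lemma ultra_unit_cvg (R : realType) (U : set_system nat) (f : nat -> R) : UltraFilter U -> (forall N, 0 <= f N <= 1) -> cvg (f N @[N --> U]).
Proof.
move=> UU f01; have UF := ultra_fmap f UU; have FU : ProperFilter U by exact: ultra_proper.
have := @segment_compact R 0 1; rewrite compact_ultra => /(_ _ UF) [|l [_ Ul]]; last by apply/cvg_ex; exists l.
by apply: (@filterS _ U _ setT) => [N _|]; [rewrite /= in_itv/=; exact: f01|exact: filterT].
Qed.

Lemma sum_shift (R : realType) (a : nat -> R) (n k : nat) : (forall j, 0 <= a j <= 1) ->
  `|\sum_(j < n) a (j + k)%N - \sum_(j < n) a j| <= k%:R.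
Proof.
move=> a01; elim: k => [|k IH]; first by under eq_bigr do rewrite addn0; rewrite subrr normr0.
have T m : \sum_(j < m) a (j + k.+1)%N = \sum_(j < m) a (j + k)%N + (a (m + k)%N - a k).
  elim: m => [|m IHm]; first by rewrite !big_ord0 add0n subrr addr0.
  by rewrite !big_ord_recr /= IHm addnS addSn; lra.
rewrite T -natr1; have := a01 (n + k)%N; have := a01 k; move: IH; rewrite !ler_norml.
by move=> /andP[? ?] /andP[? ?] /andP[? ?]; apply/andP; split; lra.
Qed.

(** Layer-cake approximation from below with error e: integrals then depend only on the measures of
    superlevel sets, which are open for a continuous function. *)
Lemma layer_sum (R : realType) (e h : R) (J : nat) : 0 < e -> 0 <= h ->
  let psi := \sum_(j < J) e * (j.+1%:R * e < h)%R%:R in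
  psi <= h /\ (h <= J%:R * e -> h <= psi + e).
Proof.
move=> e0 h0 /=.
suff [H1 H2] : (J%:R * e < h -> \sum_(j < J) e * (j.+1%:R * e < h)%R%:R = J%:R * e) /\
    (h <= J%:R * e -> \sum_(j < J) e * (j.+1%:R * e < h)%R%:R <= h <= \sum_(j < J) e * (j.+1%:R * e < h)%R%:R + e).
  by case: (leP h (J%:R * e)) => hJ; [have /andP[] := H2 hJ|split; [rewrite H1// ltW|]].
elim: J => [|J [H1 H2]]; first by rewrite big_ord0 mul0r add0r; split=> // hz; rewrite h0 (le_trans hz)// ltW.
rewrite big_ord_recr /=; have E : J.+1%:R * e = J%:R * e + e by rewrite -natr1 mulrDl mul1r.
rewrite E; case: ltP => hJ; rewrite ?mulr1 ?mulr0 ?addr0; split=> //.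
- by move=> _; rewrite H1//; apply: le_lt_trans hJ; rewrite lerDl ltW.
- by move=> _; case: (leP h (J%:R * e)) => hJ'; [exact: H2|rewrite H1// hJ ltW].
Qed.

(** * Krylov-Bogoliubov measures *)

Section KrylovBogoliubov.
Variables (R : realType) (n : nat) (M : ptopologicalType) (A : C2atlas R n M).
Variables (g : riemannian A) (G : cotangent A -> R).
Hypothesis tG : tonelli g G.
Hypotheses (hM : hausdorff_space M) (cM : compact [set: M]).
Local Notation Phi := (ham_flow G).
Local Notation act := (act G).
Local Notation T := (cot_borel A).
Variables (z : cotangent A) (U : set_system nat).
Hypotheses (UU : UltraFilter U) (Uoo : \oo `<=` U).
Let FU : ProperFilter U. Proof. exact: ultra_proper. Qed.
#[local] Existing Instance FU.
Implicit Types (B : set (cotangent A)) (f : cotangent A -> R).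

(** At stage N the orbit of z is sampled between the times -(N+1) and 0 with mesh 1/(N+1)!, so that
    the sampled past grows while the mesh shrinks. *)
Definition step N : R := (N.+1`!)%:R^-1.
Definition samples N : nat := (N.+1 * N.+1`!)%N.
Definition sample N j := Phi (j%:R * step N - N.+1%:R) z.
Definition average N f : R := (\sum_(j < samples N) f (sample N j)) / (samples N)%:R.

Lemma samples_gt0 N : 0 < (samples N)%:R :> R. Proof. by rewrite ltr0n muln_gt0 fact_gt0. Qed.

Lemma step_gt0 N : 0 < step N. Proof. by rewrite invr_gt0 ltr0n fact_gt0. Qed.

Lemma samples_step N : (samples N)%:R * step N = N.+1%:R.
Proof. by rewrite natrM mulfK// pnatr_eq0 -lt0n fact_gt0. Qed.

Lemma sample_past N j : (j < samples N)%N -> exists2 s, 0 <= s & sample N j = Phi (- s) z.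
Proof.
move=> jn; exists (N.+1%:R - j%:R * step N); last by rewrite opprB.
by rewrite subr_ge0 -samples_step ler_pM2r ?step_gt0// ler_nat ltnW.
Qed.

Lemma average_le N f f' : (forall j, (j < samples N)%N -> f (sample N j) <= f' (sample N j)) -> average N f <= average N f'.
Proof. by move=> h; rewrite ler_pM2r ?invr_gt0 ?samples_gt0//; apply: ler_sum => j _; exact: h. Qed.

Lemma average_cst N (c : R) : average N (fun=> c) = c.
Proof. by rewrite /average sumr_const card_ord -(mulr_natr c) mulfK// gt_eqF// samples_gt0. Qed.

Lemma average_ind N B : 0 <= average N \1_B <= 1.
Proof.
by apply/andP; split; [rewrite -[leLHS](average_cst N 0)|rewrite -[leRHS](average_cst N 1)]; apply: average_le => j _; rewrite indicE ?ler0n ?lern1 ?leq_b1.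
Qed.

(** The limit along an ultrafilter exists for every set B, at the price of finite additivity only;
    [regular_measure] turns it into a measure. *)
Definition Lam B : R := lim (average N \1_B @[N --> U]).

Lemma Lam_cvg B : average N \1_B @[N --> U] --> Lam B.
Proof. exact: ultra_unit_cvg UU (average_ind^~ B). Qed.

Lemma Lam_le B B' : B `<=` B' -> Lam B <= Lam B'.
Proof.
move=> BB; apply: ler_cvg_to (@Lam_cvg B) (@Lam_cvg B') _; apply: nearW => N; apply: average_le => j _.
by rewrite !indicE ler_nat; case: (boolP (_ \in B)) => // /set_mem/BB/mem_set ->.
Qed.

Lemma LamU B B' : B `&` B' = set0 -> Lam (B `|` B') = Lam B + Lam B'.
Proof.
move=> BB; apply: (@cvg_unique _ _ (average N \1_(B `|` B') @[N --> U])); [exact: norm_hausdorff|exact: Lam_cvg|].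
have -> : (fun N => average N \1_(B `|` B')) = (fun N => average N \1_B + average N \1_B').
  apply/funext => N; rewrite /average -mulrDl -big_split /=; congr (_ / _); apply: eq_bigr => j _.
  rewrite !indicE in_setU; case: (boolP (_ \in B)) => [/set_mem Bx|_]; case: (boolP (_ \in B')) => [/set_mem Bx'|_] //=; rewrite ?addr0 ?add0r//.
  by have : (B `&` B') (sample N j) by []; rewrite BB.
by apply: cvgD; exact: Lam_cvg.
Qed.

Lemma Lam_eventually B (c : R) : (forall N j, (j < samples N)%N -> \1_B (sample N j) = c) -> Lam B = c.
Proof.
move=> h; apply: (@cvg_unique _ _ (average N \1_B @[N --> U])); [exact: norm_hausdorff|exact: Lam_cvg|].
have -> : (fun N => average N \1_B) = (fun=> c); last exact: cvg_cst.
by apply/funext => N; rewrite -[RHS](average_cst N); apply/eqP; rewrite eq_le; apply/andP; split; apply: average_le => j jn; rewrite h.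
Qed.

Definition Lam_preserving (s : R) := forall B, Lam (Phi s @^-1` B) = Lam B.

Lemma Lam_preservingN s : Lam_preserving s -> Lam_preserving (- s).
Proof.
move=> hs B; rewrite -[LHS]hs; congr Lam; apply/seteqP.
by split => x; rewrite /preimage /= (flowK tG hM cM).
Qed.

(* The mesh is the inverse of a factorial: eventually every positive rational is a multiple of it. *)
Lemma Lam_rational (m q : nat) : (0 < q)%N -> Lam_preserving (m%:R / q%:R).
Proof.
move=> q0 B; set s := m%:R / q%:R; have s0 : 0 <= s by rewrite divr_ge0.
apply/eqP; rewrite -subr_eq0 -normr_le0; apply: (@le_of_eps _ _ _ 1) => // e e0; rewrite add0r mul1r.
have cv : `|average N \1_(Phi s @^-1` B) - average N \1_B| @[N --> U] --> `|Lam (Phi s @^-1` B) - Lam B|.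
  by apply: cvg_norm; apply: cvgB; exact: Lam_cvg.
apply: ler_cvg_to cv (@cvg_cst _ e _ U _) _; apply: Uoo.
have [N0 HN0] : exists N0 : nat, s / e <= N0%:R by exists (Num.truncn (s / e)).+1; apply: ltW; exact: truncnS_gt.
exists (maxn N0 q) => // N /=; rewrite geq_max => /andP[N0N qN].
have dq : (q %| N.+1`!)%N by apply: dvdn_fact; rewrite q0 (leq_trans qN).
pose k := (m * (N.+1`! %/ q))%N.
have ks : k%:R * step N = s.
  rewrite /k /step /s -{2}(divnK dq) !natrM invfM mulrA mulfK// pnatr_eq0 -lt0n divn_gt0//.
  by rewrite dvdn_leq// fact_gt0.
pose a j := \1_B (sample N j) : R.
have aE j : \1_(Phi s @^-1` B) (sample N j) = a (j + k)%N.
  have E : Phi s (sample N j) = sample N (j + k).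
    by rewrite /sample -(flowD tG hM cM) natrD mulrDl ks (addrC (j%:R * _) s) addrA.
  by rewrite /a -E !indicE.
have a01 j : 0 <= a j <= 1 by rewrite /a indicE ler0n lern1 leq_b1.
rewrite /average -mulrBl normrM [X in _ * X]ger0_norm ?invr_ge0// ler_pdivrMr ?samples_gt0//.
under eq_bigr do rewrite aE.
apply: le_trans (sum_shift _ _ a01) _; rewrite -(ler_pM2r (step_gt0 N)) ks -mulrA samples_step.
rewrite mulrC -ler_pdivrMr//; apply: le_trans HN0 _; rewrite ler_nat; exact: leq_trans N0N (leqnSn _).
Qed.

Lemma Lam_dense (t d : R) : 0 < d -> exists2 s, `|s - t| <= d & Lam_preserving s.
Proof.
have pos t' d' : 0 <= t' -> 0 < d' -> exists2 s, `|s - t'| <= d' & Lam_preserving s.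
  move=> t0 d0; pose q := (Num.truncn d'^-1).+1; pose m := Num.truncn (t' * q%:R).
  have q0 : 0 < q%:R :> R by rewrite ltr0n.
  exists (m%:R / q%:R); last exact: Lam_rational.
  have /andP[m1 m2] := truncn_itv (mulr_ge0 t0 (ltW q0)).
  have dq : 1 <= d' * q%:R by rewrite mulrC -ler_pdivrMr// mul1r; apply: ltW; exact: truncnS_gt.
  rewrite -(ler_pM2r q0) -[X in _ * X <= _](ger0_norm (ltW q0)) -normrM mulrBl divfK ?gt_eqF//.
  by apply: le_trans dq; move: m1 m2; rewrite -/m -natr1 ler_norml => m1 m2; apply/andP; split; lra.
case: (leP 0 t) => t0 d0; first exact: pos.
have [|s sd ps] := pos (- t) d _ d0; first by rewrite oppr_ge0 ltW.
by exists (- s); [rewrite -opprD normrN -[t]opprK|exact: Lam_preservingN].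
Qed.

(** Lam is known to be invariant only under a dense set of times. A compact set sent by Phi t into
    the open set B is also sent into B by Phi s for all s close to t, and such a time s of
    invariance exists. *)
Lemma inner_flow t B : open B -> (inner_lam Lam (Phi t @^-1` B) <= inner_lam Lam B)%E.
Proof.
move=> oB; apply: ge_ereal_sup => _ [K [cK KB] <-].
pose P (d : R) w := forall s, `|s - t| <= d -> B (Phi s w).
have Pm (a b : R) w : 0 < a -> a <= b -> P b w -> P a w by move=> _ ab h s sa; apply: h; exact: le_trans ab.
have lP w : K w -> exists2 d : R, 0 < d & \forall y \near w, P d y.
  by move=> Kw; apply: (flow_joint tG hM cM); apply: open_nbhs_nbhs; split=> //; exact: KB.
have [d d0 Hd] := compact_unif cK Pm lP.
have [s sd ps] := Lam_dense t d0.
apply: (@le_trans _ _ (Lam (Phi s @` K))%:E); last first.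
  apply: inner_ge; last by move=> _ [w Kw <-]; exact: Hd.
  by apply: continuous_compact => //; apply: continuous_subspaceT; exact: (@flow_continuous _ _ _ _ _ _ tG hM cM s).
by rewrite lee_fin -[leRHS]ps; apply: Lam_le => w Kw; exists w.
Qed.

Lemma outer_flow_le t B : (outer_lam Lam (Phi t @^-1` B) <= outer_lam Lam B)%E.
Proof.
apply: le_ereal_inf_tmp => _ [V [oV BV] <-]; apply: le_trans (inner_flow t oV); apply: ereal_inf_lbound.
exists (Phi t @^-1` V) => //; split; last exact: preimage_subset.
by have /continuousP := @flow_continuous _ _ _ _ _ _ tG hM cM t; apply.
Qed.

Lemma outer_flow t B : outer_lam Lam (Phi t @^-1` B) = outer_lam Lam B.
Proof.
apply/eqP; rewrite eq_le outer_flow_le /=; apply: le_trans (outer_flow_le (- t) _).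
rewrite le_eqVlt; apply/orP; left; apply/eqP; congr outer_lam; apply/seteqP.
by split => x; rewrite /preimage /= (flowNK tG hM cM).
Qed.

Let K0 := [set y | G y <= G z].

Lemma sample_sublevel N j : K0 (sample N j).
Proof. by rewrite /K0 /= (flow_energy tG hM cM). Qed.

Lemma empirical_measure : exists mu : probability T R,
  invariant_measure G mu /\ forall B, open B -> mu B = inner_lam Lam B.
Proof.
have cK0 : compact K0 by exact: (sublevel_compact tG cM).
have L1 : Lam setT = 1 by apply: Lam_eventually => N j _; rewrite indicT.
have L0 : Lam (~` K0) = 0.
  by apply: Lam_eventually => N j _; rewrite indicE memNset// => /(_ (sample_sublevel N j)).
have [mu muE] := regular_measure (cot_hausdorff hM) Lam_le LamU cK0 L1 L0.
exists mu; split=> [t B mB|B oB]; first by rewrite !muE; exact: outer_flow.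
by rewrite muE; exact: outer_open.
Qed.

Lemma empirical_null (mu : probability T R) B : (forall B, open B -> mu B = inner_lam Lam B) -> open B ->
  (forall N j, (j < samples N)%N -> ~ B (sample N j)) -> mu B = 0%E.
Proof.
move=> muE oB nB; apply/eqP; rewrite eq_le measure_ge0 andbT muE//; apply: le_trans (inner_ub Lam_le _) _.
by rewrite (@Lam_eventually B 0)// => N j jn; rewrite indicE memNset//; exact: nB.
Qed.

(** If the support missed B, every point of the compact set B and K0 have in common would have a
    null neighbourhood, so that set would be null; but its complement is null, since all samples lie
    in it. *)
Lemma empirical_support (mu : probability T R) B : (forall B, open B -> mu B = inner_lam Lam B) -> closed B ->
  (forall s, 0 <= s -> B (Phi (- s) z)) -> exists2 q, B q & cot_support mu q.
Proof.
move=> muE cB HB; apply: contrapT => nq; have cK0 : compact K0 by exact: (sublevel_compact tG cM).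
have cK : compact (B `&` K0) by rewrite setIC; exact: compact_closedI.
have clK : closed (B `&` K0) := compact_closed (cot_hausdorff hM) cK.
have nC : mu.-negligible (~` (B `&` K0) : set T).
  apply/negligibleP; first by apply: open_borel; exact: closed_openC.
  apply: empirical_null => // [|N j jn]; first exact: closed_openC.
  by apply; split; [have [s s0 ->] := sample_past jn; exact: HB|exact: sample_sublevel].
have nK : mu.-negligible (B `&` K0 : set T).
  apply: (compact_induct (Q := fun S : set (cotangent A) => mu.-negligible (S : set T)) cK).
  - exact: negligible_set0.
  - by move=> S S' SS'; exact: negligibleS.
  - by move=> S S'; exact: negligibleU.
  - move=> q [Bq _]; apply: contrapT => nN; apply: nq; exists q => // W oW Wq; rewrite lt_neqAle measure_ge0 andbT.
    apply/eqP => e; apply: nN; exists W; first exact: open_nbhs_nbhs.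
    by apply/negligibleP => //; exact: open_borel.
have : mu.-negligible [set: T] by rewrite -(setvU (B `&` K0)); exact: negligibleU.
have := @probability_setT _ T R mu => m1 nT; have m0 : mu [set: T] = 0%E by apply/negligibleP.
by move: m1; rewrite m0 => /eqP; rewrite eq_sym onee_eq0.
Qed.

Variables (u : M -> R) (W : R).
Hypotheses (HW : forall y, `|u y| <= W)
  (cal : forall s, 0 <= s -> u z.1 = u (Phi (- s) z).1 - act z (- s)).

(** By calibration the actions of the small steps add up to u(z) - u(z'), at most W + W in absolute
    value; divided by the elapsed time N + 1 this tends to 0. Replacing each action by mesh times
    density costs e / 2 on average. *)
Lemma average_dens e : 0 < e -> \forall N \near \oo, average N (dens G) <= e.
Proof.
move=> e0; have e2 : 0 < e / 2 by exact: divr_gt0.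
have [d d0 Hd] := act_unif tG hM cM z e2.
have [N0 HN0] : exists N0 : nat, Num.max d^-1 ((W + W) / (e / 2)) <= N0%:R.
  by exists (Num.truncn (Num.max d^-1 ((W + W) / (e / 2)))).+1; apply: ltW; exact: truncnS_gt.
exists N0 => // N /= N0N; have : Num.max d^-1 ((W + W) / (e / 2)) <= N.+1%:R.
  by apply: le_trans HN0 _; rewrite ler_nat (leq_trans N0N).
rewrite ge_max ler_pdivrMr// => /andP[dN WN]; have n0 : 0 < (N.+1%:R : R) by rewrite ltr0n.
have sd : step N <= d.
  rewrite /step invf_ple ?posrE ?ltr0n ?fact_gt0//; apply: le_trans dN _.
  by rewrite ler_nat; exact: fact_geq.
pose z' := Phi (- N.+1%:R) z.
have sE j : sample N j = Phi (j%:R * step N) z' by rewrite /z' -(flowD tG hM cM).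
have az : \sum_(j < samples N) act (sample N j) (step N) = u z.1 - u z'.1.
  transitivity (act z' ((samples N)%:R * step N)).
    by rewrite (act_sum tG hM cM); apply: eq_bigr => j _; rewrite sE.
  by rewrite samples_step (actN tG hM cM) (cal (ltW n0)) /z'; lra.
have b (j : 'I_(samples N)) : step N * dens G (sample N j) <= act (sample N j) (step N) + e / 2 * step N.
  have := Hd (sample N j) (sample_sublevel N j) (step N); rewrite (ltW (step_gt0 N)) sd => /(_ isT).
  by rewrite ler_norml => /andP[]; lra.
have S : average N (dens G) * N.+1%:R = \sum_(j < samples N) step N * dens G (sample N j).
  by rewrite -mulr_sumr -samples_step /average mulrA divfK ?gt_eqF ?samples_gt0// mulrC.
rewrite -(ler_pM2r n0) S; apply: le_trans (ler_sum _ (fun j _ => b j)) _.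
rewrite big_split /= az sumr_const card_ord -(mulr_natr (_ * step N)) -mulrA (mulrC (step N)) samples_step.
by have := HW z.1; have := HW z'.1; rewrite !ler_norml => /andP[? ?] /andP[? ?]; lra.
Qed.

Lemma average_layers (e : R) (B : nat -> set (cotangent A)) J :
  average N (fun y => \sum_(j < J) e * \1_(B j) y) @[N --> U] --> \sum_(j < J) e * Lam (B j).
Proof.
elim: J => [|J IH].
  rewrite big_ord0 (_ : (fun N => _) = (fun=> 0)); first exact: cvg_cst.
  by apply/funext => N; rewrite -[RHS](average_cst N); congr (average N); apply/funext => y; rewrite big_ord0.
rewrite big_ord_recr /=.
rewrite (_ : (fun N => _) = (fun N => average N (fun y => \sum_(j < J) e * \1_(B j) y) + e * average N \1_(B J))).
  by apply: cvgD => //; apply: cvgM; [exact: cvg_cst|exact: Lam_cvg].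
apply/funext => N; rewrite /average mulrA -mulrDl mulr_sumr -big_split /=; congr (_ / _).
by apply: eq_bigr => j _; rewrite big_ord_recr.
Qed.

(** On open sets mu is at most Lam, and the layers B j are open superlevel sets of the shifted
    Lagrangian. Its integral is thus at most a limit of averages of layer sums, plus e; these
    averages are eventually below C0 + e by [average_dens]. *)
Lemma empirical_action (mu : probability T R) (C0 : R) : (forall B, open B -> mu B = inner_lam Lam B) ->
  0 <= C0 -> (forall y, - C0 <= dens G y) -> (shifted_action G C0 mu <= C0%:E)%E.
Proof.
move=> muE C00 HC0; apply/lee_addgt0Pr => e' e'0; pose e := e' / 2; have e0 : 0 < e by exact: divr_gt0.
have cK0 : compact K0 by exact: (sublevel_compact tG cM).
have clK0 : closed K0 := compact_closed (cot_hausdorff hM) cK0.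
pose h y := dens G y + C0; have h0 y : 0 <= h y by have := HC0 y; rewrite /h; lra.
have ch : continuous h by exact: (dens_shift_continuous tG).
have [Bd Bd0 HBd] := continuous_bounded cK0 (fun y _ => ch y).
pose J := (Num.truncn (Bd / e)).+1; have hJ y : K0 y -> h y <= J%:R * e.
  move=> Ky; apply: le_trans (ler_norm _) _; apply: (le_trans (HBd y Ky)).
  by rewrite -ler_pdivrMr//; apply: ltW; exact: truncnS_gt.
pose B (j : nat) : set (cotangent A) := [set y | j.+1%:R * e < h y].
have oB j : open (B j).
  have /continuousP := ch; move=> /(_ _ (interval_open (a := BRight (j.+1%:R * e)) (b := +oo%O) isT isT)).
  by congr open; apply/seteqP; split => y /=; rewrite /B /= in_itv/= andbT.
pose psi y := \sum_(j < J) e * \1_(B j) y.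
have [lo hi] : (forall y, psi y <= h y) /\ (forall y, h y <= J%:R * e -> h y <= psi y + e).
  have E y : psi y = \sum_(j < J) e * (j.+1%:R * e < h y)%R%:R.
    by apply: eq_bigr => j _; rewrite indicE; congr (_ * _%:R); congr nat_of_bool; apply/idP/idP; rewrite inE.
  by split=> y; rewrite E; have [] := layer_sum J e0 (h0 y).
have mB j : measurable (B j : set T) by exact: open_borel.
have mI j : measurable_fun [set: T] (fun y : T => (e * \1_(B j) y)%:E).
  by apply/measurable_EFinP; apply: measurable_funM => //; exact: measurable_indic.
have null : mu (~` K0) = 0%E.
  by apply: empirical_null => // [|N j _]; [exact: closed_openC|apply; exact: sample_sublevel].
have mpsi : measurable_fun [set: T] (fun y : T => (psi y)%:E).
  by rewrite /psi; under eq_fun do rewrite -sumEFin; apply: emeasurable_sum => j; exact: mI.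
have I0 j y : 0 <= e * \1_(B j) y by apply: mulr_ge0; [exact: ltW|rewrite indicE ler0n].
have psi0 y : 0 <= psi y by apply: sumr_ge0 => j _; exact: I0.
have mT := @measurableT _ T; have mK : measurable (~` K0 : set T) by apply: open_borel; exact: closed_openC.
have mps : measurable_fun [set: T] (fun y : T => (psi y)%:E + cst e%:E y)%E by exact: emeasurable_funD.
have step1 : (shifted_action G C0 mu <= \int[mu]_y ((psi y)%:E + cst e%:E y))%E.
  rewrite /shifted_action (ge0_negligible_integral mK mT) //; last 2 first.
  - exact: continuous_borel ch.
  - by move=> y _; rewrite lee_fin; exact: h0.
  rewrite setTD setCK; have mK0 : measurable (K0 : set T) by rewrite -(setCK K0); exact: measurableC.
  apply: (@le_trans _ _ (\int[mu]_(y in K0) ((psi y)%:E + cst e%:E y))%E).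
    apply: ge0_le_integral => //.
    - by move=> y _; rewrite lee_fin; exact: h0.
    - exact: measurable_funTS (continuous_borel ch).
    - exact: measurable_funTS mps.
    - by move=> y Ky; rewrite -EFinD lee_fin; apply: hi; exact: hJ.
  by apply: ge0_subset_integral => // y _; apply: adde_ge0; rewrite lee_fin; [exact: psi0|exact: ltW].
apply: (le_trans step1); rewrite ge0_integralD//; last 2 first.
- by move=> y _; rewrite lee_fin.
- by move=> y _; rewrite lee_fin ltW.
have Ipsi : (\int[mu]_y (psi y)%:E <= (\sum_(j < J) e * Lam (B j))%:E)%E.
  rewrite /psi; under eq_integral do rewrite -sumEFin.
  rewrite ge0_integral_sum//; last by move=> j y _; rewrite lee_fin; exact: I0.
  rewrite -sumEFin; apply: lee_sum => j _; under eq_integral do rewrite EFinM.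
  rewrite ge0_integralZl_EFin//; last 2 first.
  - by apply/measurable_EFinP; exact: measurable_indic.
  - exact: ltW.
  rewrite integral_indic// setIT [leRHS](EFinM e) lee_pmul2l//.
  by have hj := inner_ub Lam_le (B j); rewrite -(muE _ (oB j)) in hj; exact: hj.
have Lpsi : \sum_(j < J) e * Lam (B j) <= C0 + e.
  apply: ler_cvg_to (@average_layers e B J) (@cvg_cst _ (C0 + e) _ U _) _; apply: Uoo.
  apply: filterS (average_dens e0) => N hN; apply: (@le_trans _ _ (average N (dens G) + C0)); last by rewrite addrC lerD2l.
  rewrite -[X in _ <= _ + X](average_cst N) /average -mulrDl -big_split /=.
  exact: (@average_le N psi h (fun j _ => lo _)).
rewrite integral_const; apply: (@le_trans _ _ ((C0 + e)%:E + e%:E)%E); last by rewrite -!EFinD lee_fin /e; lra.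
by apply: leeD => //; apply: le_trans Ipsi _; rewrite lee_fin.
Qed.

End KrylovBogoliubov.

Lemma krylov_bogoliubov (R : realType) (n : nat) (M : ptopologicalType) (A : C2atlas R n M) (g : riemannian A) (G : cotangent A -> R)
  (u : M -> R) (z : cotangent A) (C : set (cotangent A)) : tonelli g G -> hausdorff_space M -> compact [set: M] ->
  subsolution (A := A) G 0 u -> (forall s, 0 <= s -> u z.1 = u (ham_flow G (- s) z).1 - act G z (- s)) ->
  closed C -> (forall s, 0 <= s -> C (ham_flow G (- s) z)) ->
  exists mu : probability (cot_borel A) R,
    [/\ invariant_measure G mu, (cot_action G mu <= 0)%E & exists2 q, C q & cot_support mu q].
Proof.
move=> tG hM cM Su cal cC HC; have cu := subsol_continuous tG hM cM Su.
have [U [UU Uoo]] := ultraFilterLemma (eventually_filter).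
have [W W0 HW] := continuous_bounded cM (fun y _ => cu y).
have [mu [im muE]] := empirical_measure tG hM cM z UU Uoo; exists mu; split=> //.
- have [C0 C00 HC0] := lagrangian_lb tG; have fC : C0%:E \is a fin_num by [].
  have HD y : - C0 <= dens G y by exact: HC0.
  rewrite -(leeD2rE _ _ fC) add0e (shifted_actionE tG C00 HD).
  exact: (empirical_action tG hM cM UU Uoo (fun y => HW y I) cal muE C00 HD).
- exact: (empirical_support tG hM cM UU muE cC HC).
Qed.

(** * The Mather set *)

Section Calibration.
Variables (R : realType) (n : nat) (M : ptopologicalType) (A : C2atlas R n M).
Variables (g : riemannian A) (G : cotangent A -> R).
Hypothesis tG : tonelli g G.
Hypotheses (hM : hausdorff_space M) (cM : compact [set: M]).

(** The measure produced along the orbit has action at most 0, and no invariant measure has negative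
    action, so it is minimizing and its support lies in the Mather set. *)
Lemma calibrated_mather (u : M -> R) (z : cotangent A) (C : set (cotangent A)) : subsolution (A := A) G 0 u ->
  (forall s, 0 <= s -> u z.1 = u (ham_flow G (- s) z).1 - act G z (- s)) -> closed C ->
  (forall s, 0 <= s -> C (ham_flow G (- s) z)) -> exists2 q, C q & mather_set G q.
Proof.
move=> Su cal cC HC; have [C0 C00 HC0] := lagrangian_lb tG.
have [mu [im mu0 [q Cq Sq]]] := krylov_bogoliubov tG hM cM Su cal cC HC.
exists q => //; apply: subset_closure; exists mu => //; split=> // nu inu; apply: (le_trans mu0).
exact: (invariant_action_ge0 tG hM cM C00 (fun y => HC0 _) inu Su).
Qed.

(** A backward calibrated orbit yields an invariant measure of action at most 0; hence all
    minimizing measures have action at most 0, and [mather_set_aubry] applies. *)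
Lemma mather_aubry (u : M -> R) : connected [set: M] -> neg_weak_KAM (A := A) G u -> mather_set G `<=` aubry G.
Proof.
move=> kM hu; have [C0 C00 HC0] := lagrangian_lb tG.
have [z [_ _ cal]] := backward_orbit tG hM cM kM hu point.
have [mu [im mu0 _]] := krylov_bogoliubov tG hM cM (neg_weak_KAM_subsol hu) cal closedT (fun _ _ => I).
apply: (mather_set_aubry tG hM cM C00 (fun y => HC0 _)) => nu [_ mnu]; exact: le_trans (mnu _ im) mu0.
Qed.

Lemma critical_reversed : is_critical_value (A := A) G 0 -> is_critical_value (A := A) (reversed G) 0.
Proof.
move=> [[u Su] minG]; split; first by exists (fun y => - u y); exact: (subsol_reversed tG hM cM Su).
move=> b [v Sv]; apply: minG; exists (fun y => - v y); rewrite -(reversedK G).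
exact: (subsol_reversed (tonelli_reversed tG) hM cM Sv).
Qed.

Lemma pos_weak_KAMP (u : M -> R) : pos_weak_KAM (A := A) G u <-> neg_weak_KAM (A := A) (reversed G) (fun y => - u y).
Proof.
split=> h t x t0; have := h t x t0; rewrite /lax_oleinik_pos => e.
  by rewrite EFinN e oppeK.
by rewrite -e -EFinN opprK.
Qed.

End Calibration.

Theorem theorem4p4 (R : realType) (n : nat) (M : ptopologicalType)
  (A : C2atlas R n M) (g : riemannian A)
  (hM : hausdorff_space M) (cM : compact [set: M]) (kM : connected [set: M])
  (G H : cotangent A -> R)
  (tG : tonelli g G) (tH : tonelli g H) (cGH : poisson_commute G H)
  (critG : is_critical_value G 0) (critH : is_critical_value H 0)
  (um up : M -> R) (hum : neg_weak_KAM G um) (hup : pos_weak_KAM G up) :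
  weak_KAM_pair G um up -> weak_KAM_pair H um up.
Proof.
move=> [u [_ [_ umM] [_ upM]]].
have tG' := tonelli_reversed tG; have tH' := tonelli_reversed tH.
have [C2G _ _ _] := tG; have [C2H _ _ _] := tH.
have cGH' := poisson_reversed C2G C2H cGH; have cHG := poisson_sym cGH.
have critH' := critical_reversed tH hM cM critH.
have hup' := (pos_weak_KAMP G up).1 hup.
have humH : neg_weak_KAM H um := um_neg_weak_KAM tG tH cGH hM cM kM critH hum.
have hupH : pos_weak_KAM H up by apply/pos_weak_KAMP; exact: (um_neg_weak_KAM tG' tH' cGH' hM cM kM critH' hup').
have SumH := neg_weak_KAM_subsol humH; have SumG := neg_weak_KAM_subsol hum.
(* The function - up is a negative solution for the reversed H, hence a subsolution of it; a second
   reversal gives up and H back. *)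
have SupH : subsolution H 0 up.
  have := subsol_reversed tH' hM cM (neg_weak_KAM_subsol ((pos_weak_KAMP H up).1 hupH)).
  by rewrite reversedK; congr subsolution; apply/funext => y; exact: opprK.
have cum := subsol_continuous tG hM cM SumG; have cup := subsol_continuous tH hM cM SupH.
suff key x : projected_mather_set H x -> up x = um x.
  exists um; split; first by exists 0; [exact: critH|exact: SumH].
    by split; [exact: humH|move=> x _; reflexivity].
  by split; [exact: hupH|exact: key].
move=> [z Mz <-].
have Az := mather_aubry tH hM cM kM humH Mz.
have bum s : 0 <= s -> um z.1 = um (ham_flow G (- s) z).1 - act G z (- s).
  exact: (aubry_backward tH tG cHG hM cM kM critG humH Az SumH).
have bup s : 0 <= s -> up z.1 = up (ham_flow G (- s) z).1 - act G z (- s).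
  exact: (aubry_backward tH tG cHG hM cM kM critG humH Az SupH).
pose f (q : cotangent A) := um q.1 - up q.1; have cf : continuous f.
  move=> q; apply: (@continuous_comp _ _ _ (fst : cotangent A -> M) (fun y => um y - up y)); first exact: cot_fst_continuous.
  by apply: cvgB; [exact: cum|exact: cup].
(* The level set of um - up through z is closed and contains the backward orbit of G, so by
   [calibrated_mather] it meets the Mather set of G. *)
have cC : closed (f @^-1` [set f z]) by apply: closed_comp => [y _|]; [exact: cf|exact: closed_eq].
have HC s : 0 <= s -> (f @^-1` [set f z]) (ham_flow G (- s) z).
  by move=> s0; rewrite /= /f (bum s s0) (bup s s0); lra.
have [q /= fq Mq] := calibrated_mather tG hM cM SumG bum cC HC.
have Pq : projected_mather_set G q.1 by exists q.
by move: fq; rewrite /f (umM _ Pq) (upM _ Pq) subrr => /esym/eqP; rewrite subr_eq0 => /eqP.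
Qed.
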